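(* Let $q\in[-1,1]$ and let $\varrho(N)$, $N\in\mathbb{N}$, be probability measures on $\hat U(N)$. Assume there is a function $\Psi$ analytic in a neighborhood of $1$ such that for every fixed $r\in\mathbb{N}$ \[ \lim_{N\to\infty}\frac1N\log S_{\varrho(N)}(u_1,\dots,u_r,1^{N-r})=\sum_{i=1}^r\Psi(u_i) \] uniformly in a neighborhood of $1^r$. Then for every $k\in\mathbb{N}$ the $k$-th moment of $m_{N,PP(q)}[\varrho(N)]$ converges in probability as $N\to\infty$ to \[ \sum_{m=0}^{k-1}\frac{k!}{m!\,(m+1)!\,(k-m)!}\frac{d^m}{du^m}\Big(e_q(u)\Psi'(e_q(u))+\frac{e_q(u)}{e_q(u)-1}-\frac1u\Big)^{k-m}\Big|_{u=0}, \] where $e_q(u)=(1-qu)^{-1/q}$ for $q\ne0$ and $e_0(u)=e^u$. Equivalently, the limiting measure $\mu^{(q)}$ has $R$-transform $R_{\mu^{(q)}}(z)=e_q(z)\Psi'(e_q(z))+\frac{e_q(z)}{e_q(z)-1}-\frac1z$ for $|z|$ small.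
   Context: A signature of length $N$ is a tuple $\lambda=(\lambda_1\ge\dots\ge\lambda_N)\in\mathbb{Z}^N$; $\hat U(N)$ denotes the set of signatures of length $N$. For $\lambda\in\hat U(N)$, $\chi^{\lambda}(u_1,\dots,u_N)=\det(u_i^{\lambda_j+N-j})_{i,j}/\prod_{i<j}(u_i-u_j)$ is the rational Schur function. For a probability measure $\varrho(N)$ on $\hat U(N)$, the Schur generating function is $S_{\varrho(N)}(u_1,\dots,u_N)=\sum_{\lambda\in\hat U(N)}\varrho(N)[\lambda]\,\chi^\lambda(u_1,\dots,u_N)/\chi^\lambda(1^N)$, where $1^N=(1,\dots,1)$; it is assumed that this series converges uniformly in a neighborhood of $1^N$. For $q\in[-1,1]$ and $\lambda\in\hat U(N)$ the $q$-deformed Perelomov–Popov measure is \[ m_{N,PP(q)}[\lambda]=\frac1N\sum_{i=1}^N\Big(\prod_{j\ne i}\frac{(\lambda_i-i)-(\lambda_j-j)-q}{(\lambda_i-i)-(\lambda_j-j)}\Big)\delta\Big(\frac{\lambda_i+N-i}{N}\Big), \] and $m_{N,PP(q)}[\varrho(N)]$ denotes the random measure $m_{N,PP(q)}[\lambda]$ with $\lambda$ distributed according to $\varrho(N)$. For a compactly supported probability measure $\mu$ on $\mathbb{R}$, the free cumulants $\kappa_n(\mu)$ are defined by $\int t^k\mu(dt)=\sum_{\pi\in NC(k)}\prod_{V\in\pi}\kappa_{|V|}(\mu)$ for all $k$, where $NC(k)$ is the set of non-crossing partitions of $\{1,\dots,k\}$; the $R$-transform is $R_\mu(z)=\sum_{n\ge1}\kappa_n(\mu)z^{n-1}$.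 *)

(* Defs.v *)
(* Complex numbers are R[i] (real_closed)
   for R : realType, seen as a numClosedFieldType, hence a normed field
   (normedModType over itself) via numFieldNormedType. *)
From HB Require Import structures.
From mathcomp Require Import all_boot all_order all_algebra.
From mathcomp Require Import complex.
From mathcomp Require Import all_classical all_reals all_analysis.
Import Order.TTheory GRing.Theory Num.Theory.
Import numFieldNormedType.Exports.

Set Implicit Arguments.
Unset Strict Implicit.
Unset Printing Implicit Defensive.

Local Open Scope ring_scope.
Local Open Scope classical_set_scope.

Definition CC (R : realType) : numClosedFieldType := R[i].

Definition ofR {R : realType} (x : R) : CC R := (x +i* 0)%C.
Definition reC {R : realType} (z : CC R) : R := complex.Re (z : R[i]).
Definition imC {R : realType} (z : CC R) : R := complex.Im (z : R[i]).

(* modulus, principal argument in (-pi, pi], principal logarithm,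
   complex exponential *)
Definition modC {R : realType} (z : CC R) : R :=
  Num.sqrt (reC z ^+ 2 + imC z ^+ 2).
Definition argC {R : realType} (z : CC R) : R :=
  if modC z + reC z == 0 then pi
  else 2 * atan (imC z / (modC z + reC z)).
Definition LogC {R : realType} (z : CC R) : CC R :=
  (ln (modC z) +i* argC z)%C.
Definition cexp {R : realType} (z : CC R) : CC R :=
  (expR (reC z) * cos (imC z) +i* (expR (reC z) * sin (imC z)))%C.

Definition e_q {R : realType} (q : R) (u : CC R) : CC R :=
  if q == 0 then cexp u
  else cexp (- (ofR q)^-1 * LogC (1 - ofR q * u)).

Definition analytic_at {R : realType} (f : CC R -> CC R) (z0 : CC R) : Prop :=
  exists r : R, 0 < r /\ exists a : nat -> CC R,
    forall z : CC R, modC (z - z0) < r ->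
      (fun n => \sum_(i < n) a i * (z - z0) ^+ i) @ \oo --> f z.

Definition is_signature (N : nat) (l : {ffun 'I_N -> int}) : bool :=
  [forall i : 'I_N, forall j : 'I_N, (i <= j)%N ==> (l j <= l i)].

(* \hat U(N) ; coordinates are 0-indexed: l i = lambda_{i+1} *)
Definition signature (N : nat) := sig (fun l : {ffun 'I_N -> int} => is_signature l).

Definition sgv {N : nat} (l : signature N) (i : 'I_N) : int := (val l) i.

Definition schur_ratio {R : realType} {N : nat} (l : signature N)
    (u : 'rV[CC R]_N) : CC R :=
  \det (\matrix_(i < N, j < N) (u 0 i) ^ (sgv l j + (N - 1 - j)%N%:Z))
  / \prod_(i < N) \prod_(j < N | (i < j)%N) (u 0 i - u 0 j).

Definition distinct_coords {R : realType} {N : nat} : set 'rV[CC R]_N :=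
  [set v | forall i j : 'I_N, i != j -> v 0 i != v 0 j].

(* the rational Schur function chi^lambda, i.e. the ratio above extended
   by continuity to all of (C\{0})^N (it is a Laurent polynomial) *)
Definition schur {R : realType} {N : nat} (l : signature N)
    (u : 'rV[CC R]_N) : CC R :=
  lim (schur_ratio l @ within distinct_coords (nbhs u)).

Definition ones (R : realType) (N : nat) : 'rV[CC R]_N := const_mx 1.

Definition sums_to {K : numDomainType} {T : eqType} (f : T -> K) (s : K) : Prop :=
  forall e : K, 0 < e -> exists s0 : seq T, forall s1 : seq T,
    uniq s1 -> {subset s0 <= s1} -> `|\sum_(x <- s1) f x - s| < e.

Definition unif_sums_on {K : numDomainType} {T : eqType} {U : Type}
    (A : set U) (f : T -> U -> K) (S : U -> K) : Prop :=
  forall e : K, 0 < e -> exists s0 : seq T, forall s1 : seq T,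
    uniq s1 -> {subset s0 <= s1} ->
    forall u, A u -> `|\sum_(x <- s1) f x u - S u| < e.

Definition is_prob {R : realType} {N : nat} (rho : signature N -> R) : Prop :=
  (forall l, 0 <= rho l) /\ (\esum_(l in [set: signature N]) (rho l)%:E = 1)%E.

Definition sgf_term {R : realType} {N : nat} (rho : signature N -> R)
    (l : signature N) (u : 'rV[CC R]_N) : CC R :=
  ofR (rho l) * schur l u / schur l (ones R N).

Definition sgf_sums {R : realType} {N : nat} (rho : signature N -> R)
    (u : 'rV[CC R]_N) (s : CC R) : Prop :=
  sums_to (fun l => sgf_term rho l u) s.

(* standing assumption: the series converges uniformly near 1^N *)
Definition sgf_unif_near_one {R : realType} {N : nat}
    (rho : signature N -> R) : Prop :=
  exists U : set 'rV[CC R]_N, U \in nbhs (ones R N) /\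
    exists S : 'rV[CC R]_N -> CC R, unif_sums_on U (sgf_term rho) S.

Definition pad {R : realType} (N r : nat) (u : 'rV[CC R]_r) : 'rV[CC R]_N :=
  \row_(i < N) (match (insub (val i) : option 'I_r) with
                | Some j => u 0 j | None => 1 end).

(* lim_N (1/N) log S_rho(N)(u_1..u_r,1^(N-r)) = sum_i Psi(u_i) uniformly in a
   neighbourhood of 1^r; log is the branch continuous in u with log S = 0 at
   u = 1^r (where S = 1). *)
Definition log_sgf_limit {R : realType} (rho : forall N, signature N -> R)
    (Psi : CC R -> CC R) : Prop :=
  forall r : nat, (0 < r)%N ->
  exists delta : CC R, 0 < delta /\
  exists L : nat -> 'rV[CC R]_r -> CC R,
    (\forall N \near \oo,
       {within ball (ones R r) delta, continuous (L N)} /\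
       L N (ones R r) = 0 /\
       forall u, ball (ones R r) delta u ->
         exists s, sgf_sums (rho N) (pad N u) s /\ cexp (L N u) = s) /\
    (forall e : CC R, 0 < e -> \forall N \near \oo,
       forall u, ball (ones R r) delta u ->
         `|(N%:R)^-1 * L N u - \sum_(i < r) Psi (u 0 i)| < e).

Definition pp_weight {R : realType} (q : R) {N : nat} (l : signature N)
    (i : 'I_N) : R :=
  \prod_(j < N | j != i)
     ((((sgv l i - i%:Z) - (sgv l j - j%:Z))%:~R - q)
        / ((sgv l i - i%:Z) - (sgv l j - j%:Z))%:~R).

Definition pp_moment {R : realType} (q : R) (k : nat) {N : nat}
    (l : signature N) : R :=
  (N%:R)^-1 * \sum_(i < N)
     pp_weight q l i * (((sgv l i + (N - 1 - i)%N%:Z)%:~R / N%:R) ^+ k).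

Definition Fq {R : realType} (q : R) (Psi : CC R -> CC R) (u : CC R) : CC R :=
  e_q q u * derive1 Psi (e_q q u) + e_q q u / (e_q q u - 1) - u^-1.

(* F^j, extended at the removable singularity u = 0 *)
Definition Fq_pow_ext {R : realType} (q : R) (Psi : CC R -> CC R) (j : nat)
    (u : CC R) : CC R :=
  if u == 0 then lim ((fun v => Fq q Psi v ^+ j) @ 0^')
  else Fq q Psi u ^+ j.

Definition limit_moment {R : realType} (q : R) (Psi : CC R -> CC R) (k : nat)
    : CC R :=
  \sum_(m < k)
    ((k`!)%:R / ((m`!)%:R * ((m.+1)`!)%:R * ((k - m)`!)%:R)) *
    derive1n m (Fq_pow_ext q Psi (k - m)) 0.

Definition cvg_in_prob {R : realType} (rho : forall N, signature N -> R)
    (X : forall N, signature N -> CC R) (c : CC R) : Prop :=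
  forall e : R, 0 < e ->
    (fun N => \esum_(l in [set l : signature N | ofR e < `|X N l - c|])
                 (rho N l)%:E) @ \oo --> 0%E.

(* Main.v *)
(* Put l_j = lambda_j + N - j and let V be the Vandermonde determinant. The operators
   D_k = V^-1 (sum_i u_i^k d_i^k) V have the Schur functions as eigenfunctions, with
   eigenvalue P_k = sum_j l_j (l_j - 1) ... (l_j - k + 1); hence D_k and D_k^2, applied to
   the Schur generating function S, give the first two moments of P_k at u = 1^N. These
   values only involve Taylor coefficients of log S of bounded degree, and the hypothesis
   makes the coefficients of (log S) / N close to those of sum_i Psi(u_i), so that
   P_k / N^(k+1) has a limit M_k and vanishing variance.
   Comparing prod_i (1 - l_i x) with prod_i (1 - (l_i + q) x) expresses the
   Perelomov-Popov moments recursively in terms of power sums of the l_j; so they converge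
   in probability, to the solution C_k of the limiting recursion. Lagrange inversion along
   x = e_q(y) - 1 identifies C_k with the coefficient of y^k in
   (1 + y F(y))^(k+1) / (k+1), F(y) = e_q Psi'(e_q) + e_q / (e_q - 1) - 1/y, which is the
   announced sum of derivatives of powers of F. *)
Require Import Defs.
From HB Require Import structures.
From mathcomp Require Import all_boot all_order all_algebra.
From mathcomp Require Import fingroup perm.
From mathcomp Require Import complex.
From mathcomp Require Import all_classical all_reals all_analysis.
From mathcomp Require mpoly.
From mathcomp Require Import ring lra zify.
Import -(notations) mpoly.
Import Order.TTheory GRing.Theory Num.Theory.
Import numFieldNormedType.Exports.

Set Implicit Arguments.
Unset Strict Implicit.
Unset Printing Implicit Defensive.

Local Open Scope ring_scope.
Local Open Scope classical_set_scope.

(** * Moduli and limits of complex sequences *)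

(** The hypothesis controls a fixed number of variables, while the operators act on all N of them.
    Symmetry bridges the two: a monomial of degree less than D involves fewer than D variables,
    which a permutation moves to the first D places, so the case r = D bounds all coefficients of
    degree less than D, uniformly in N. Hence the estimates are sup bounds on low-degree
    coefficients at u = 1, with constants depending on degrees and never on N. V vanishes at u =
    1^N, so the operators are rewritten with divided differences, which act on polynomials and lower
    the degree by a known amount; averaging over permutations then leaves only pure powers of one
    variable. The logarithm of S is given as a continuous branch, whereas coefficients of a formal
    logarithm are needed. Only ln |S| = Re log S enters, since the real part on a circle determines
    all coefficients but the constant one. Exchanging the infinite sum over signatures with Taylor
    expansion needs a domination; it comes from the positivity of the monomial coefficients of Schur
    functions. *)

Section ComplexModulus.
Variable R : realType.
Local Notation K := (CC R).
Implicit Types (x y z : K) (r s : R).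

Lemma normE z : `|z| = ofR (modC z).
Proof. exact: normc_def. Qed.

Lemma ofR_inj : injective (@ofR R).
Proof. by move=> r s []. Qed.

Lemma ofRD r s : ofR (r + s) = ofR r + ofR s :> K.
Proof. exact: (rmorphD (real_complex R)). Qed.
Lemma ofRN r : ofR (- r) = - ofR r :> K.
Proof. exact: (rmorphN (real_complex R)). Qed.
Lemma ofRB r s : ofR (r - s) = ofR r - ofR s :> K.
Proof. exact: (rmorphB (real_complex R)). Qed.
Lemma ofRM r s : ofR (r * s) = ofR r * ofR s :> K.
Proof. exact: (rmorphM (real_complex R)). Qed.
Lemma ofR0 : ofR 0 = 0 :> K. Proof. by []. Qed.
Lemma ofR1 : ofR 1 = 1 :> K. Proof. by []. Qed.
Lemma ofR_nat n : ofR n%:R = n%:R :> K.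
Proof. exact: (rmorph_nat (real_complex R)). Qed.
Lemma ofR_int (n : int) : ofR n%:~R = n%:~R :> K.
Proof. exact: (rmorph_int (real_complex R)). Qed.
Lemma ofRV r : ofR r^-1 = (ofR r)^-1 :> K.
Proof. exact: (fmorphV (real_complex R)). Qed.
Lemma ofRX r n : ofR (r ^+ n) = ofR r ^+ n :> K.
Proof. exact: (rmorphXn (real_complex R)). Qed.
Lemma ofR_sum (I : Type) (t : seq I) (P : pred I) (F : I -> R) :
  ofR (\sum_(i <- t | P i) F i) = \sum_(i <- t | P i) ofR (F i) :> K.
Proof. exact: (rmorph_sum (real_complex R)). Qed.
Lemma ofR_prod (I : Type) (t : seq I) (P : pred I) (F : I -> R) :
  ofR (\prod_(i <- t | P i) F i) = \prod_(i <- t | P i) ofR (F i) :> K.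
Proof. exact: (rmorph_prod (real_complex R)). Qed.
Lemma ler_ofR r s : (ofR r <= ofR s :> K) = (r <= s).
Proof. exact: lecR. Qed.
Lemma ltr_ofR r s : (ofR r < ofR s :> K) = (r < s).
Proof. exact: ltcR. Qed.
Lemma ofR_eq0 r : (ofR r == 0 :> K) = (r == 0).
Proof. by rewrite -ofR0 (inj_eq ofR_inj). Qed.

Lemma gt0_ofR (e : K) : 0 < e -> exists2 r, 0 < r & e = ofR r.
Proof.
case: e => a b; rewrite ltcE /= => /andP[/eqP -> a0]; exists a => //.
Qed.

Lemma modC_ge0 z : 0 <= modC z. Proof. exact: sqrtr_ge0. Qed.
Lemma modC_ofR r : modC (ofR r) = `|r|.
Proof. by rewrite /modC /= expr0n addr0 sqrtr_sqr. Qed.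
Lemma modC0 : modC (0 : K) = 0. Proof. by rewrite (modC_ofR 0) normr0. Qed.
Lemma modC1 : modC (1 : K) = 1. Proof. by rewrite (modC_ofR 1) normr1. Qed.
Lemma modC_nat n : modC (n%:R : K) = n%:R.
Proof. by rewrite -ofR_nat modC_ofR ger0_norm. Qed.
Lemma modCD x y : modC (x + y) <= modC x + modC y.
Proof. by rewrite -ler_ofR ofRD -!normE ler_normD. Qed.
Lemma modCM x y : modC (x * y) = modC x * modC y.
Proof. by apply: ofR_inj; rewrite ofRM -!normE normrM. Qed.
Lemma modCN x : modC (- x) = modC x.
Proof. by apply: ofR_inj; rewrite -!normE normrN. Qed.
Lemma modCV x : modC x^-1 = (modC x)^-1.
Proof. by apply: ofR_inj; rewrite ofRV -!normE normfV. Qed.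
Lemma modCX x n : modC (x ^+ n) = modC x ^+ n.
Proof. by apply: ofR_inj; rewrite ofRX -!normE normrX. Qed.
Lemma modCB x y : modC (x - y) = modC (y - x).
Proof. by rewrite -modCN opprB. Qed.
Lemma modCB_le x y : modC (x - y) <= modC x + modC y.
Proof. by rewrite -(modCN y) modCD. Qed.
Lemma modC_eq0 x : (modC x == 0) = (x == 0).
Proof. by rewrite -ofR_eq0 -normE normr_eq0. Qed.
Lemma modC_gt0 x : (0 < modC x) = (x != 0).
Proof. by rewrite lt_def modC_ge0 andbT modC_eq0. Qed.
Lemma modC_sum (I : Type) (t : seq I) (P : pred I) (F : I -> K) :
  modC (\sum_(i <- t | P i) F i) <= \sum_(i <- t | P i) modC (F i).
Proof.
by rewrite -ler_ofR ofR_sum -normE; apply: le_trans (ler_norm_sum _ _ _) _;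
  apply: ler_sum => i _; rewrite normE.
Qed.
Lemma modC_prod (I : Type) (t : seq I) (P : pred I) (F : I -> K) :
  modC (\prod_(i <- t | P i) F i) = \prod_(i <- t | P i) modC (F i).
Proof.
by apply: ofR_inj; rewrite ofR_prod -normE normr_prod; apply: eq_bigr => i _;
  rewrite normE.
Qed.
Lemma reC_le z : `|reC z| <= modC z.
Proof. by rewrite -ler_ofR -normE; exact: normc_ge_Re. Qed.
Lemma imC_le z : `|imC z| <= modC z.
Proof.
rewrite /modC -sqrtr_sqr ler_wsqrtr // lerDr sqr_ge0 //.
Qed.
Lemma reCD x y : reC (x + y) = reC x + reC y.
Proof. by case: x; case: y. Qed.
Lemma reCN x : reC (- x) = - reC x.
Proof. by case: x. Qed.
Lemma reCB x y : reC (x - y) = reC x - reC y.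
Proof. by case: x; case: y. Qed.
Lemma imCD x y : imC (x + y) = imC x + imC y.
Proof. by case: x; case: y. Qed.
Lemma imCB x y : imC (x - y) = imC x - imC y.
Proof. by case: x; case: y. Qed.
Lemma reC_sum (I : Type) (t : seq I) (P : pred I) (F : I -> K) :
  reC (\sum_(i <- t | P i) F i) = \sum_(i <- t | P i) reC (F i).
Proof.
by apply: (big_morph reC) => // x y; rewrite reCD.
Qed.
Lemma imC_sum (I : Type) (t : seq I) (P : pred I) (F : I -> K) :
  imC (\sum_(i <- t | P i) F i) = \sum_(i <- t | P i) imC (F i).
Proof.
by apply: (big_morph imC) => // x y; rewrite imCD.
Qed.
Lemma reC_ofRM r z : reC (ofR r * z) = r * reC z.
Proof. by case: z => a b; rewrite /reC /= mul0r subr0. Qed.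

Lemma eqC_re_im x y : reC x = reC y -> imC x = imC y -> x = y.
Proof. by case: x => a b; case: y => c d /= -> ->. Qed.

(** Convergence phrased with real moduli: the norm of [CC R] takes its values in [CC R] itself, out
    of reach of real linear arithmetic. *)
Definition cvgK (u : nat -> K) (l : K) : Prop :=
  forall e : R, 0 < e -> exists M, forall n, (M <= n)%N -> modC (u n - l) < e.

Lemma cvgKP (u : nat -> K) (l : K) : u @ \oo --> l <-> cvgK u l.
Proof.
split=> [/cvgrPdist_lt ul e e0|ul].
  have := ul (ofR e); rewrite -ofR0 ltr_ofR => /(_ e0) [M _ HM].
  exists M => n Mn; have := HM n Mn.
  by rewrite normE ltr_ofR modCB.
apply/cvgrPdist_lt => e /gt0_ofR [r r0 ->].
have [M HM] := ul r r0; exists M => // n /= Mn.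
by rewrite normE ltr_ofR modCB HM.
Qed.

Lemma modC_small x : (forall e, 0 < e -> modC x < e) -> x = 0.
Proof.
move=> H; apply/eqP; rewrite -modC_eq0; apply/negPn/negP => x0.
have : 0 < modC x by rewrite lt_def x0 modC_ge0.
by move=> /H; rewrite ltxx.
Qed.

Lemma cvgK_unique u x y : cvgK u x -> cvgK u y -> x = y.
Proof.
move=> ux uy; apply/eqP; rewrite -subr_eq0; apply/eqP/modC_small => e e0.
have e2 : 0 < e / 2 by lra.
have [M HM] := ux _ e2; have [M' HM'] := uy _ e2.
have h1 := HM (maxn M M') (leq_maxl _ _).
have h2 := HM' (maxn M M') (leq_maxr _ _).
set v := u _ in h1 h2.
have -> : x - y = (v - y) - (v - x) by ring.
by apply: le_lt_trans (modCB_le _ _) _; lra.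
Qed.

Lemma cvgK_ext u v x : (forall n, u n = v n) -> cvgK u x -> cvgK v x.
Proof. by move=> uv ux e /ux [M HM]; exists M => n /HM; rewrite uv. Qed.

Lemma cvgK_cst x : cvgK (fun=> x) x.
Proof. by move=> e e0; exists 0%N => n _; rewrite subrr modC0. Qed.

Lemma cvgKD u v x y : cvgK u x -> cvgK v y -> cvgK (fun n => u n + v n) (x + y).
Proof.
move=> ux vy e e0; have e2 : 0 < e / 2 by lra.
have [M HM] := ux _ e2; have [M' HM'] := vy _ e2.
exists (maxn M M') => n; rewrite geq_max => /andP[/HM h1 /HM' h2].
have -> : u n + v n - (x + y) = (u n - x) + (v n - y) by ring.
by apply: le_lt_trans (modCD _ _) _; lra.
Qed.

Lemma cvgKMl c u x : cvgK u x -> cvgK (fun n => c * u n) (c * x).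
Proof.
move=> ux e e0.
have c0 : 0 < modC c + 1 by rewrite ltr_wpDl ?modC_ge0.
have [M HM] := ux (e / (modC c + 1)) (divr_gt0 e0 c0).
exists M => n /HM; rewrite -mulrBr modCM => h.
apply: le_lt_trans (_ : (modC c + 1) * modC (u n - x) < _).
  by rewrite ler_wpM2r ?modC_ge0 // lerDl.
by rewrite mulrC -ltr_pdivlMr.
Qed.

Lemma cvgKN u x : cvgK u x -> cvgK (fun n => - u n) (- x).
Proof.
by move=> /(cvgKMl (-1)); rewrite mulN1r; apply: cvgK_ext => n; rewrite mulN1r.
Qed.

Lemma cvgKB u v x y : cvgK u x -> cvgK v y -> cvgK (fun n => u n - v n) (x - y).
Proof. by move=> ux /cvgKN; exact: cvgKD. Qed.

Lemma cvgK_sub0 u x : cvgK u x <-> cvgK (fun n => u n - x) 0.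
Proof. by split=> h e /h [M HM]; exists M => n /HM; rewrite ?subr0. Qed.

Lemma cvgK_sum (I : Type) (t : seq I) (P : pred I) (F : I -> nat -> K) (l : I -> K) :
  (forall i, P i -> cvgK (F i) (l i)) ->
  cvgK (fun n => \sum_(i <- t | P i) F i n) (\sum_(i <- t | P i) l i).
Proof.
move=> H; elim: t => [|a t IH].
  by rewrite big_nil; apply: cvgK_ext (cvgK_cst 0) => n; rewrite big_nil.
rewrite big_cons; case: ifPn => Pa.
  by apply: cvgK_ext (cvgKD (H _ Pa) IH) => n; rewrite big_cons Pa.
by apply: cvgK_ext IH => n; rewrite big_cons (negbTE Pa).
Qed.

Lemma cvgK_bound u x C : (forall n, modC (u n) <= C) -> cvgK u x -> modC x <= C.
Proof.
move=> uC ux; rewrite leNgt; apply/negP => Cx.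
have [M /(_ M (leqnn _))] := ux (modC x - C) ltac:(lra).
have := uC M; have := modCB_le (u M) (u M - x).
by rewrite opprB addrC subrK; lra.
Qed.

Lemma cvgK_real (u : nat -> R) (x : R) :
  u @ \oo --> x -> cvgK (fun n => ofR (u n)) (ofR x).
Proof.
move=> /cvgrPdist_lt ux e e0; have [M _ HM] := ux e e0.
by exists M => n /HM; rewrite -ofRB modC_ofR distrC.
Qed.

Lemma mono_bounded_tail (x : nat -> R) (C : R) :
  (forall i, 0 <= x i) -> (forall n, \sum_(i < n) x i <= C) ->
  forall e, 0 < e -> exists M, forall m n, (M <= m)%N -> (m <= n)%N ->
    \sum_(m <= i < n) x i < e.
Proof.
move=> x0 xC e e0.
pose u n := \sum_(i < n) x i.
have hs : has_sup (range u).
  split; first by exists (u 0%N); exists 0%N.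
  by exists C => _ [n _ <-]; exact: xC.
have [_ [M _ <-] uM] := sup_adherent e0 hs.
have mono : forall m n, (m <= n)%N -> u m + \sum_(m <= i < n) x i = u n.
  by move=> m n mn; rewrite /u -!(big_mkord xpredT) -big_cat_nat.
exists M => m n Mm mn.
have un : u n <= sup (range u).
  by move: hs => [h0 hb]; apply: ub_le_sup => //; exists n.
have um : u M <= u m.
  by rewrite -(mono _ _ Mm) lerDl sumr_ge0.
by have := mono m n mn; lra.
Qed.

(** Dominated convergence for sums whose length grows with n: the domination makes the tail past a
    fixed index small for all n at once, and the head is a finite sum of null sequences. *)
Lemma tannery (x : nat -> R) (C : R) (t : nat -> nat -> K) :
  (forall n, \sum_(i < n) x i <= C) ->
  (forall n i, modC (t n i) <= x i) ->
  (forall i, cvgK (fun n => t n i) 0) ->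
  cvgK (fun n => \sum_(i < n) t n i) 0.
Proof.
move=> xC tx t0 e e0.
have x0 i : 0 <= x i by apply: le_trans (tx 0%N i); rewrite modC_ge0.
have e2 : 0 < e / 2 by lra.
have [I HI] := mono_bounded_tail x0 xC e2.
have := @cvgK_sum _ (index_enum 'I_I) xpredT (fun i n => t n i) (fun=> 0)
  (fun i _ => t0 i).
rewrite big1 // => /(_ _ e2) [M HM].
exists (maxn I M) => n; rewrite geq_max => /andP[In Mn].
rewrite subr0 -(big_mkord xpredT) (@big_cat_nat _ _ _ I) //=.
apply: le_lt_trans (modCD _ _) _.
have := HM n Mn; rewrite subr0 -(big_mkord xpredT (fun i => t n i)) => h1.
have h2 : modC (\sum_(I <= i < n) t n i) <= \sum_(I <= i < n) x i.
  by apply: le_trans (modC_sum _ _ _) _; apply: ler_sum.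
by have := HI I n (leqnn _) In; lra.
Qed.

(** Real and imaginary parts are absolutely summable real series, so completeness is only needed
    over the reals. *)
Lemma abs_summable_cvg (a : nat -> K) (C : R) :
  (forall n, \sum_(i < n) modC (a i) <= C) ->
  exists l, cvgK (fun n => \sum_(i < n) a i) l.
Proof.
move=> aC.
have key (g : K -> R) : (forall z, `|g z| <= modC z) ->
    exists l : R, (fun n => \sum_(i < n) g (a i)) @ \oo --> l.
  move=> gm; pose s := series (fun i => g (a i)).
  have : cvgn (series (fun i => g (a i))).
    apply: normed_cvg.
    apply: nondecreasing_is_cvgn.
      by apply: nondecreasing_series => i _ _ /=.
    exists C => _ [n _ <-] /=; rewrite seriesEord.
    by apply: le_trans (aC n); apply: ler_sum.
  move=> /cvg_ex [l hl]; exists l.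
  by move: hl; rewrite seriesEord.
have [lr hr] := key _ (@reC_le).
have [li hi] := key _ (@imC_le).
exists ((lr +i* li)%C : K).
have hi' := cvgKMl ((0 +i* 1)%C : K) (cvgK_real hi).
have := cvgKD (cvgK_real hr) hi'.
have -> : ofR lr + (0 +i* 1)%C * ofR li = ((lr +i* li)%C : K).
  by apply: eqC_re_im; rewrite /reC /imC /=; ring.
apply: cvgK_ext => n.
rewrite -reC_sum -imC_sum; case: (\sum_(i < n) a i) => x y.
by apply: eqC_re_im; rewrite /reC /imC /=; ring.
Qed.

End ComplexModulus.

(** * Power series *)

Section TruncatedPolynomials.
Variable F : fieldType.
Implicit Types (p q : {poly F}) (n : nat) (a b : nat -> F).

(** Congruence modulo X^n: polynomials stand for truncated formal power series throughout. *)
Definition eqX n p q : Prop := forall i, (i < n)%N -> p`_i = q`_i.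

Lemma eqX_refl n p : eqX n p p. Proof. by []. Qed.
Lemma eqX_sym n p q : eqX n p q -> eqX n q p.
Proof. by move=> pq i /pq. Qed.
Lemma eqX_trans n q p r : eqX n p q -> eqX n q r -> eqX n p r.
Proof. by move=> pq qr i ni; rewrite pq ?qr. Qed.
Lemma eqX_le n m p q : (m <= n)%N -> eqX n p q -> eqX m p q.
Proof. by move=> mn pq i im; apply: pq; apply: leq_trans mn. Qed.
Lemma eqXD n p q p' q' : eqX n p q -> eqX n p' q' -> eqX n (p + p') (q + q').
Proof. by move=> h h' i ni; rewrite !coefD h ?h'. Qed.
Lemma eqXN n p q : eqX n p q -> eqX n (- p) (- q).
Proof. by move=> h i ni; rewrite !coefN h. Qed.
Lemma eqXB n p q p' q' : eqX n p q -> eqX n p' q' -> eqX n (p - p') (q - q').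
Proof. by move=> h /eqXN; exact: eqXD. Qed.
Lemma eqXM n p q p' q' : eqX n p q -> eqX n p' q' -> eqX n (p * p') (q * q').
Proof.
move=> h h' i ni; rewrite !coefM; apply: eq_bigr => j _.
by rewrite h ?h' //; [exact: leq_ltn_trans (leq_subr _ _) ni|
  exact: leq_ltn_trans (leq_ord j) ni].
Qed.
Lemma eqXMl n p q r : eqX n p q -> eqX n (r * p) (r * q).
Proof. exact: eqXM. Qed.
Lemma eqXMr n p q r : eqX n p q -> eqX n (p * r) (q * r).
Proof. by move=> h; apply: eqXM. Qed.
Lemma eqXZ n c p q : eqX n p q -> eqX n (c *: p) (c *: q).
Proof. by move=> h i ni; rewrite !coefZ h. Qed.
Lemma eqXX n p q k : eqX n p q -> eqX n (p ^+ k) (q ^+ k).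
Proof. by move=> h; elim: k => [//|k IH]; rewrite !exprS; apply: eqXM. Qed.
Lemma eqX_sum (I : Type) (t : seq I) (P : pred I) n (f g : I -> {poly F}) :
  (forall i, P i -> eqX n (f i) (g i)) ->
  eqX n (\sum_(i <- t | P i) f i) (\sum_(i <- t | P i) g i).
Proof. by move=> h j nj; rewrite !coef_sum; apply: eq_bigr => i Pi; rewrite h. Qed.
Lemma eqX_deriv n p q : eqX n.+1 p q -> eqX n p^`() q^`().
Proof. by move=> h i ni; rewrite !coef_deriv h. Qed.
Lemma eqX_mulX n p q : eqX n p q -> eqX n.+1 ('X * p) ('X * q).
Proof. by move=> h [|i] ni; rewrite !coefXM //= h. Qed.

Lemma eqX_cancel n p q (r : {poly F}) : r`_0 != 0 -> eqX n (r * p) (r * q) -> eqX n p q.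
Proof.
move=> r0 h i; elim/ltn_ind: i => i IH ni.
have := h i ni; rewrite !coefM !big_ord_recl subn0.
rewrite (eq_bigr (fun j : 'I_i => r`_(lift ord0 j) * q`_(i - lift ord0 j))).
  by move=> /addIr /(mulfI r0).
by move=> j _; rewrite IH //= /bump leq0n; have := ltn_ord j; lia.
Qed.

Lemma coef_exp_lt p n i : p`_0 = 0 -> (i < n)%N -> (p ^+ n)`_i = 0.
Proof.
move=> p0; elim: n i => // n IH i; rewrite ltnS => iln.
rewrite exprS coefM big_ord_recl p0 mul0r add0r big1 // => j _.
by rewrite IH ?mulr0 //= /bump leq0n; have := ltn_ord j; lia.
Qed.

(** Without constant term, the i-th power of the inner polynomial starts in degree i, so outer
    coefficients of index at least n are invisible. Both composites are padded to sums of a common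
    length before being compared. *)
Lemma eqX_comp n p q p' q' : p'`_0 = 0 -> q'`_0 = 0 ->
  eqX n p q -> eqX n p' q' -> eqX n (p \Po p') (q \Po q').
Proof.
move=> p0 q0 h h'.
suff -> : p \Po p' = \sum_(i < maxn n (maxn (size p) (size q))) p`_i *: p' ^+ i.
  have -> : q \Po q' = \sum_(i < maxn n (maxn (size p) (size q))) q`_i *: q' ^+ i.
    rewrite comp_polyE (big_ord_widen (maxn n (maxn (size p) (size q)))
      (fun i => q`_i *: q' ^+ i)) ?leq_max ?leqnn ?orbT //.
    rewrite big_mkcond; apply: eq_bigr => i _; case: ltnP => // hi.
    by rewrite nth_default // scale0r.
  move=> j nj; rewrite !coef_sum; apply: eq_bigr => i _; rewrite !coefZ.
  case: (ltnP i n) => ni; first by rewrite h // (eqXX i h').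
  by rewrite !coef_exp_lt ?mulr0 //; apply: leq_trans ni.
rewrite comp_polyE (big_ord_widen (maxn n (maxn (size p) (size q)))
  (fun i => p`_i *: p' ^+ i)) ?leq_max ?leqnn ?orbT //.
rewrite big_mkcond; apply: eq_bigr => i _; case: ltnP => // hi.
by rewrite nth_default // scale0r.
Qed.

Definition tr n a : {poly F} := \poly_(i < n) a i.

Lemma coef_tr n a i : (i < n)%N -> (tr n a)`_i = a i.
Proof. by move=> h; rewrite coef_poly h. Qed.
Lemma eqX_tr n m a : (n <= m)%N -> eqX n (tr m a) (tr n a).
Proof. by move=> nm i h; rewrite !coef_tr //; apply: leq_trans nm. Qed.
Definition conv a b n : F := \sum_(k < n.+1) a k * b (n - k)%N.
Definition delta0 n : F := (n == 0)%:R.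
Definition pw b k : nat -> F := iter k (conv b) delta0.
(** The sum stops at k = n, so this is the composite series only when [b 0 = 0]. *)
Definition comps a b n : F := \sum_(k < n.+1) a k * pw b k n.
Definition dseq a n : F := n.+1%:R * a n.+1.

Lemma tr_conv n a b : eqX n (tr n (conv a b)) (tr n a * tr n b).
Proof.
move=> i ni; rewrite coef_tr // coefM; apply: eq_bigr => k _.
by rewrite !coef_tr //; [apply: leq_ltn_trans (leq_subr _ _) ni|
  apply: leq_ltn_trans (leq_ord k) ni].
Qed.
Lemma tr_delta0 n : eqX n (tr n delta0) 1.
Proof. by move=> i ni; rewrite coef_tr // coef1. Qed.
Lemma tr_pw n b k : eqX n (tr n (pw b k)) (tr n b ^+ k).
Proof.
elim: k => [|k IH]; first exact: tr_delta0.
rewrite exprS; apply: (eqX_trans (q := tr n b * tr n (pw b k))).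
  exact: tr_conv.
exact: eqXMl.
Qed.
Lemma pw_lt b k n : b 0%N = 0 -> (n < k)%N -> pw b k n = 0.
Proof.
move=> b0 nk; rewrite -(@coef_tr n.+1) // (tr_pw b k (ltnSn n)).
by rewrite coef_exp_lt // coef_tr.
Qed.
Lemma tr_comps n a b : b 0%N = 0 -> eqX n (tr n (comps a b)) (tr n a \Po tr n b).
Proof.
move=> b0 i ni; rewrite coef_tr // comp_polyE coef_sum /comps.
have tn0 : (tr n b)`_0 = 0 by rewrite coef_tr ?b0 //; case: n ni.
have -> : \sum_(j < size (tr n a)) ((tr n a)`_j *: tr n b ^+ j)`_i =
          \sum_(j < n) ((tr n a)`_j *: tr n b ^+ j)`_i.
  rewrite (big_ord_widen n (fun j => ((tr n a)`_j *: tr n b ^+ j)`_i)) ?size_poly //.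
  rewrite big_mkcond; apply: eq_bigr => j _; case: ltnP => // hj.
  by rewrite coefZ nth_default // mul0r.
rewrite (big_ord_widen n (fun k => a k * pw b k i)) // big_mkcond.
apply: eq_bigr => j _; rewrite coefZ coef_tr //.
case: ltnP => hj; last by rewrite coef_exp_lt ?mulr0.
by rewrite -(tr_pw b j ni) coef_tr.
Qed.
End TruncatedPolynomials.

(** * Absolutely convergent power series on closed discs *)

Section PowerSeries.
Variable R : realType.
Local Notation K := (CC R).
Implicit Types (a b : nat -> K) (f g : K -> K) (r s C : R) (z : K).

(** The explicit bound at radius [r], boundary included, is submultiplicative under products and
    dominates the values on the closed disc; this reduces the convergence of a composite to an
    inequality between a bound and a radius. *)
Definition psb r a C : Prop := forall n, \sum_(k < n) modC (a k) * r ^+ k <= C.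
Definition pss a z n : K := \sum_(k < n) a k * z ^+ k.
Definition ps r a f : Prop :=
  (exists C, psb r a C) /\ forall z, modC z <= r -> cvgK (pss a z) (f z).

Lemma psb_ge0 r a C : psb r a C -> 0 <= C.
Proof. by move=> /(_ 0%N); rewrite big_ord0. Qed.

Lemma psb_le r s a C : 0 <= s -> s <= r -> psb r a C -> psb s a C.
Proof.
move=> s0 sr h n; apply: le_trans (h n); apply: ler_sum => i _.
by rewrite ler_wpM2l ?modC_ge0 // lerXn2r ?nnegrE // (le_trans s0).
Qed.

Lemma ps_le r s a f : 0 <= s -> s <= r -> ps r a f -> ps s a f.
Proof.
move=> s0 sr [[C h] hf]; split; first by exists C; exact: psb_le h.
by move=> z zs; apply: hf; apply: le_trans sr.
Qed.

Lemma psb_term r a C z k : modC z <= r -> modC (a k * z ^+ k) <= modC (a k) * r ^+ k.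
Proof.
move=> zr; rewrite modCM modCX ler_wpM2l ?modC_ge0 // lerXn2r ?nnegrE ?modC_ge0 //.
exact: le_trans (modC_ge0 _) zr.
Qed.

Lemma pss_bound r a C z n : psb r a C -> modC z <= r -> modC (pss a z n) <= C.
Proof.
move=> h zr; apply: le_trans (modC_sum _ _ _) _; apply: le_trans (h n).
by apply: ler_sum => i _; exact: psb_term.
Qed.

Lemma ps_bound r a f C z : psb r a C -> ps r a f -> modC z <= r -> modC (f z) <= C.
Proof.
move=> h [_ hf] zr; apply: cvgK_bound (hf _ zr) => n; exact: pss_bound h zr.
Qed.

Lemma psb_ex r a C : psb r a C -> exists f, ps r a f.
Proof.
move=> h.
have H z : modC z <= r -> exists l, cvgK (pss a z) l.
  move=> zr; apply: (@abs_summable_cvg _ (fun k => a k * z ^+ k) C) => n; apply: le_trans (h n).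
  by apply: ler_sum => i _; exact: psb_term.
have [f Hf] : {f : K -> K & forall z, modC z <= r -> cvgK (pss a z) (f z)}.
  apply: (@choice _ _ (fun z l => modC z <= r -> cvgK (pss a z) l)) => z.
  case: (pselect (modC z <= r)) => zr; first by have [l hl] := H z zr; exists l.
  by exists 0.
by exists f; split => //; exists C.
Qed.

Lemma ps_ext r a b f g : (forall n, a n = b n) ->
  (forall z, modC z <= r -> f z = g z) -> ps r a f -> ps r b g.
Proof.
move=> /funext <- fg [hC hf]; split => // z zr; rewrite -fg //; exact: hf.
Qed.

Lemma psb_conv r a b C C' : 0 <= r -> psb r a C -> psb r b C' -> psb r (conv a b) (C * C').
Proof.
move=> r0 ha hb n.
pose A := \poly_(i < n) (modC (a i) * r ^+ i).
pose B := \poly_(i < n) (modC (b i) * r ^+ i).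
apply: le_trans (_ : (\sum_(i < n) modC (a i) * r ^+ i) *
                     (\sum_(i < n) modC (b i) * r ^+ i) <= _); last first.
  by apply: ler_pM => //; apply: sumr_ge0 => i _; rewrite mulr_ge0 ?modC_ge0 ?exprn_ge0.
apply: le_trans (_ : \sum_(i < n) \sum_(k < i.+1)
   (modC (a k) * r ^+ k) * (modC (b (i - k)%N) * r ^+ (i - k)) <= _).
  apply: ler_sum => i _; rewrite /conv.
  apply: le_trans (ler_wpM2r _ (modC_sum _ _ _)) _; first by rewrite exprn_ge0.
  rewrite big_distrl /=; apply: ler_sum => k _.
  rewrite modCM -[X in r ^+ X](subnKC (leq_ord k)) exprD.
  by rewrite (_ : _ * _ * (_ * _) = modC (a k) * r ^+ k * (modC (b (i - k)%N) * r ^+ (i - k))) //; ring.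
rewrite big_distrlr /=.
apply: le_trans (_ : \sum_(k < n) \sum_(i < n | (k <= i)%N)
   (modC (a k) * r ^+ k) * (modC (b (i - k)%N) * r ^+ (i - k)) <= _).
  under eq_bigr => i _.
    rewrite (big_ord_widen n (fun k => (modC (a k) * r ^+ k) *
      (modC (b (i - k)%N) * r ^+ (i - k)))) //.
    over.
  rewrite (exchange_big_dep xpredT) //=.
apply: ler_sum => k _.
have E (f : nat -> R) : \sum_(i < n | (k <= i)%N) f (i - k)%N = \sum_(j < n - k) f j.
  rewrite -(big_mkord (fun i => (k <= i)%N) (fun i => f (i - k)%N)).
  rewrite (@big_cat_nat _ _ _ k) ?leq0n //=; last exact: ltnW.
  rewrite big_nat_cond big_pred0 ?add0r; last by move=> i; apply/negbTE; lia.
  rewrite -{1}[k : nat]add0n big_addn big_mkord.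
  by apply: eq_big => [i|i _]; rewrite ?leq_addl ?addnK.
rewrite (E (fun j => (modC (a k) * r ^+ k) * (modC (b j) * r ^+ j))).
rewrite [leRHS](bigID (fun i : 'I_n => (i < n - k)%N)) /=.
rewrite -(big_ord_widen _ (fun j => (modC (a k) * r ^+ k) * (modC (b j) * r ^+ j)))
  ?leq_subr // lerDl.
by apply: sumr_ge0 => i _; rewrite !mulr_ge0 ?modC_ge0 ?exprn_ge0.
Qed.

Lemma pss_conv a b z n : pss (conv a b) z n =
  \sum_(k < n) a k * z ^+ k * pss b z (n - k).
Proof.
rewrite /pss /conv.
under eq_bigr => i _.
  rewrite big_distrl /= (big_ord_widen n (fun k => a k * b (i - k)%N * z ^+ i)) //.
  over.
rewrite (exchange_big_dep xpredT) //=; apply: eq_bigr => k _.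
have E (f : nat -> K) : \sum_(i < n | (k < i.+1)%N) f (i - k)%N = \sum_(j < n - k) f j.
  rewrite -(big_mkord (fun i => (k <= i)%N) (fun i => f (i - k)%N)).
  rewrite (@big_cat_nat _ _ _ k) ?leq0n //=; last exact: ltnW.
  rewrite big_nat_cond big_pred0 ?add0r; last by move=> i; apply/negbTE; lia.
  rewrite -{1}[k : nat]add0n big_addn big_mkord.
  by apply: eq_big => [i|i _]; rewrite ?leq_addl ?addnK.
rewrite big_distrr /= -(E (fun j => a k * z ^+ k * (b j * z ^+ j))).
apply: eq_bigr => i ki; rewrite -[in LHS](subnKC (ki : (k <= i)%N)) exprD subnKC //; ring.
Qed.

(** A partial sum of the product is the sum over k of a term of [a] times a shorter partial sum of
    [b]; replacing the latter by its limit costs an error that tends to 0 by dominated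
    convergence. *)
Lemma ps_conv r a b f g : 0 <= r -> ps r a f -> ps r b g ->
  ps r (conv a b) (fun z => f z * g z).
Proof.
move=> r0 [[C hC] hf] [[C' hC'] hg]; split.
  by exists (C * C'); exact: psb_conv.
move=> z zr.
have gC : modC (g z) <= C' by apply: (ps_bound hC') => //; split=> //; exists C'.
have T : cvgK (fun n => \sum_(k < n) a k * z ^+ k * (pss b z (n - k) - g z)) 0.
  apply: (@tannery _ (fun k => (modC (a k) * r ^+ k) * (C' + C')) (C * (C' + C'))
    (fun n k => a k * z ^+ k * (pss b z (n - k) - g z)))=> [n|n i|i].
  - rewrite -big_distrl /=; apply: ler_wpM2r (hC n).
    by rewrite addr_ge0 // (psb_ge0 hC').
  - rewrite modCM ler_pM ?modC_ge0 //; first exact: psb_term.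
    by apply: le_trans (modCB_le _ _) _; rewrite lerD // (pss_bound _ hC').
  - rewrite -(mulr0 (a i * z ^+ i)); apply: cvgKMl.
    apply: (proj1 (cvgK_sub0 _ _)) => e /(hg z zr) [M HM]; exists (M + i)%N => n Mn.
    by apply: HM; lia.
have := cvgKD T (cvgKMl (g z) (hf z zr)); rewrite add0r mulrC.
apply: cvgK_ext => n; rewrite pss_conv /pss mulrC big_distrl -big_split /=.
by apply: eq_bigr => k _; ring.
Qed.

Lemma psb_delta0 r : 0 <= r -> psb r (@delta0 K) 1.
Proof.
move=> r0 [|n]; first by rewrite big_ord0.
rewrite big_ord_recl /= /delta0 eqxx modC1 mul1r expr0 big1 ?addr0 // => i _.
by rewrite modC0 mul0r.
Qed.

Lemma pss_delta0 z n : pss (@delta0 K) z n.+1 = 1.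
Proof.
rewrite /pss big_ord_recl /delta0 eqxx mul1r expr0 big1 ?addr0 // => i _.
by rewrite mul0r.
Qed.

Lemma ps_delta0 r : 0 <= r -> ps r (@delta0 K) (fun=> 1).
Proof.
move=> r0; split; first by exists 1; exact: psb_delta0.
move=> z _ e e0; exists 1%N => -[//|n] _.
by rewrite pss_delta0 subrr modC0.
Qed.

Lemma psb_pw r b C k : 0 <= r -> psb r b C -> psb r (pw b k) (C ^+ k).
Proof.
move=> r0 h; elim: k => [|k IH]; first exact: psb_delta0.
by rewrite exprS; exact: psb_conv.
Qed.

Lemma ps_pw r b g k : 0 <= r -> ps r b g -> ps r (pw b k) (fun z => g z ^+ k).
Proof.
move=> r0 h; elim: k => [|k IH]; first exact: ps_delta0.
apply: ps_ext (ps_conv r0 h IH) => // z _; rewrite exprS //.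
Qed.

(** The k-th power of the inner series has bound C^k, at most s^k, so the outer series at radius [s]
    dominates the double sum. This justifies both the exchange of sums and the passage to the limit
    in each power. *)
Lemma ps_comp r s a b f g C : 0 <= r -> b 0%N = 0 -> psb r b C -> C <= s ->
  ps s a f -> ps r b g -> ps r (comps a b) (fun z => f (g z)).
Proof.
move=> r0 b0 hb Cs [[A hA] hf] hg.
have C0 := psb_ge0 hb.
have s0 : 0 <= s by exact: le_trans Cs.
have hk k n : \sum_(i < n) modC (pw b k i) * r ^+ i <= s ^+ k.
  by apply: le_trans (psb_pw k r0 hb n) _; rewrite lerXn2r ?nnegrE.
split.
  exists A => n; apply: le_trans (_ : \sum_(k < n) modC (a k) *
      \sum_(i < n) modC (pw b k i) * r ^+ i <= _); last first.
    apply: le_trans (hA n); apply: ler_sum => k _.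
    by rewrite ler_wpM2l ?modC_ge0.
  apply: le_trans (_ : \sum_(i < n) \sum_(k < n)
      modC (a k) * (modC (pw b k i) * r ^+ i) <= _); last first.
    by rewrite exchange_big /=; apply: ler_sum => k _; rewrite big_distrr.
  apply: ler_sum => i _; rewrite /comps.
  apply: le_trans (ler_wpM2r _ (modC_sum _ _ _)) _; first by rewrite exprn_ge0.
  rewrite big_distrl /= (big_ord_widen n
    (fun k => modC (a k * pw b k i) * r ^+ i)) //.
  rewrite [leRHS](bigID (fun k : 'I_n => (k < i.+1)%N)) /= -[leLHS]addr0 lerD //.
    by apply: ler_sum => k _; rewrite modCM mulrA.
  by apply: sumr_ge0 => k _; rewrite !mulr_ge0 ?modC_ge0 ?exprn_ge0.
move=> z zr.
have gzs : modC (g z) <= s by apply: le_trans Cs; apply: (ps_bound hb hg).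
have T : cvgK (fun n => \sum_(k < n) a k * (pss (pw b k) z n - g z ^+ k)) 0.
  apply: (@tannery _ (fun k => (modC (a k) * s ^+ k) * (1 + 1)) (A * (1 + 1))
    (fun n k => a k * (pss (pw b k) z n - g z ^+ k))).
  - by move=> n; rewrite -big_distrl /=; apply: ler_wpM2r (hA n); lra.
  - move=> n k; rewrite modCM -mulrA ler_wpM2l ?modC_ge0 //.
    apply: le_trans (modCB_le _ _) _; rewrite mulrDr mulr1 lerD //.
      by apply: (pss_bound _ (_ : psb r _ _) zr) => m; exact: hk.
    by rewrite modCX lerXn2r ?nnegrE ?modC_ge0.
  - move=> k; rewrite -(mulr0 (a k)); apply: cvgKMl; apply: (proj1 (cvgK_sub0 _ _)).
    by have [_] := ps_pw k r0 hg; apply.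
have := cvgKD T (hf _ gzs); rewrite add0r.
apply: cvgK_ext => n; rewrite [in X in _ + X]/pss -big_split /=.
transitivity (\sum_(k < n) a k * pss (pw b k) z n).
  by apply: eq_bigr => k _; ring.
rewrite /pss; under eq_bigr do rewrite big_distrr /=.
rewrite exchange_big /=; apply: eq_bigr => i _.
rewrite /comps big_distrl /= (big_ord_widen n (fun k => a k * pw b k i * z ^+ i)) //.
rewrite [LHS](bigID (fun k : 'I_n => (k < i.+1)%N)) /= [X in _ + X]big1 ?addr0.
  by apply: eq_bigr => k _; rewrite mulrA.
by move=> k; rewrite -leqNgt => ik; rewrite pw_lt // mul0r mulr0.
Qed.

Lemma psD r a b f g : 0 <= r -> ps r a f -> ps r b g ->
  ps r (fun n => a n + b n) (fun z => f z + g z).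
Proof.
move=> r0 [[C hC] hf] [[C' hC'] hg].
split; last first.
  move=> z zr; apply: cvgK_ext (cvgKD (hf z zr) (hg z zr)) => n.
  by rewrite /pss -big_split /=; apply: eq_bigr => i _; rewrite mulrDl.
exists (C + C') => n; apply: le_trans (lerD (hC n) (hC' n)).
rewrite -big_split /=; apply: ler_sum => i _.
by rewrite -mulrDl ler_wpM2r ?exprn_ge0 // modCD.
Qed.

Lemma psZ r c a f : ps r a f -> ps r (fun n => c * a n) (fun z => c * f z).
Proof.
move=> [[C hC] hf]; split; last first.
  move=> z zr; apply: cvgK_ext (cvgKMl c (hf z zr)) => n.
  by rewrite /pss big_distrr /=; apply: eq_bigr => i _; rewrite mulrA.
exists (modC c * C) => n; apply: le_trans (ler_wpM2l (modC_ge0 c) (hC n)).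
by rewrite big_distrr /=; apply: ler_sum => i _; rewrite modCM mulrA.
Qed.

Lemma ps_scale r s c a f : modC c * s <= r -> 0 <= s -> ps r a f ->
  ps s (fun n => c ^+ n * a n) (fun z => f (c * z)).
Proof.
move=> csr s0 [[C hC] hf]; split; last first.
  move=> z zs; have czr : modC (c * z) <= r.
    by rewrite modCM; apply: le_trans csr; rewrite ler_wpM2l ?modC_ge0.
  apply: cvgK_ext (hf _ czr) => n.
  by apply: eq_bigr => i _; rewrite exprMn; ring.
exists C => n; apply: le_trans (hC n); apply: ler_sum => i _.
rewrite modCM mulrAC modCX -exprMn mulrC ler_wpM2l ?modC_ge0 //.
by rewrite lerXn2r ?nnegrE ?mulr_ge0 ?modC_ge0 // (le_trans _ csr) // mulr_ge0 ?modC_ge0.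
Qed.

Lemma ps0 r a f : 0 <= r -> ps r a f -> f 0 = a 0%N.
Proof.
move=> r0 [_ hf]; have := hf 0; rewrite modC0 => /(_ r0) h.
apply: cvgK_unique h _ => e e0; exists 1%N => -[//|n] _.
rewrite /pss big_ord_recl expr0 mulr1 big1 ?addr0 ?subrr ?modC0 // => i _.
by rewrite expr0n mulr0.
Qed.

End PowerSeries.

(** * Derivatives, uniqueness and inverses of power series *)

Section PowerSeriesCalculus.
Variable R : realType.
Local Notation K := (CC R).
Implicit Types (a b : nat -> K) (f g : K -> K) (r s C : R) (z h : K).

Lemma le_of_eq (x y : R) : x = y -> x <= y.
Proof. by move=> ->. Qed.

(** Mean value inequality for the power function. It trades the factor n+1 of a differentiated
    series for a loss of radius. *)
Lemma natX_le r s n : 0 <= s -> s < r -> n.+1%:R * s ^+ n * (r - s) <= r ^+ n.+1.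
Proof.
move=> s0 sr; have r0 : 0 < r by exact: le_lt_trans sr.
elim: n => [|n IH]; first by rewrite expr0 expr1; lra.
have sn : 0 <= s ^+ n by rewrite exprn_ge0.
rewrite [r ^+ n.+2]exprS.
have h1 : r * (n.+1%:R * s ^+ n * (r - s)) <= r * r ^+ n.+1 by rewrite ler_pM2l.
have h2 : s ^+ n.+1 <= r ^+ n.+1 by rewrite lerXn2r ?nnegrE ?(ltW r0) ?(ltW sr).
have h3 : s * (n.+1%:R * s ^+ n * (r - s)) <= s * r ^+ n.+1 by rewrite ler_wpM2l.
have h4 : s ^+ n.+1 * (r - s) <= r ^+ n.+1 * (r - s) by rewrite ler_wpM2r // subr_ge0 ltW.
rewrite -[n.+2]addn1 natrD mulrDl mul1r mulrDl.
have -> : n.+1%:R * s ^+ n.+1 * (r - s) = s * (n.+1%:R * s ^+ n * (r - s)) by rewrite exprS; ring.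
lra.
Qed.

Lemma psb_dseq r s a C : 0 <= s -> s < r -> psb r a C -> psb s (dseq a) (C / (r - s)).
Proof.
move=> s0 sr h n; have rs : 0 < r - s by lra.
rewrite ler_pdivlMr //; apply: le_trans (h n.+1).
rewrite big_ord_recl /= big_distrl /= -[leLHS]add0r lerD //.
  by rewrite mulr_ge0 ?modC_ge0 // expr0.
apply: ler_sum => i _; rewrite /dseq modCM modC_nat.
have -> : i.+1%:R * modC (a i.+1) * s ^+ i * (r - s) =
  modC (a i.+1) * (i.+1%:R * s ^+ i * (r - s)) by ring.
by rewrite ler_wpM2l ?modC_ge0 // natX_le.
Qed.

Lemma subX_bound s z w n : modC z <= s -> modC w <= s ->
  modC (z ^+ n - w ^+ n) <= modC (z - w) * (n%:R * s ^+ n.-1).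
Proof.
move=> zs ws; have s0 : 0 <= s by apply: le_trans (modC_ge0 _) zs.
rewrite subrXX modCM ler_wpM2l ?modC_ge0 //.
apply: le_trans (modC_sum _ _ _) _.
apply: le_trans (_ : \sum_(i < n) s ^+ n.-1 <= _); last first.
  by rewrite sumr_const card_ord mulr_natl.
apply: ler_sum => i _; rewrite modCM !modCX.
have -> : s ^+ n.-1 = s ^+ (n.-1 - i) * s ^+ i.
  by rewrite -exprD subnK //; have := ltn_ord i; lia.
by apply: ler_pM; rewrite ?exprn_ge0 ?modC_ge0 // lerXn2r ?nnegrE ?modC_ge0.
Qed.

Lemma sub2X_bound s z w n : modC z <= s -> modC w <= s ->
  modC (z ^+ n.+2 - w ^+ n.+2 - n.+2%:R * w ^+ n.+1 * (z - w)) <=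
  modC (z - w) ^+ 2 * (n.+2%:R * n.+1%:R * s ^+ n).
Proof.
move=> zs ws; have s0 : 0 <= s by apply: le_trans (modC_ge0 _) zs.
have -> : z ^+ n.+2 - w ^+ n.+2 - n.+2%:R * w ^+ n.+1 * (z - w) =
  (z - w) * \sum_(i < n.+2) ((z ^+ (n.+1 - i) - w ^+ (n.+1 - i)) * w ^+ i).
  rewrite subrXX [_ * w ^+ _ * _]mulrC -mulrBr; congr (_ * _).
  rewrite [RHS](eq_bigr (fun i : 'I_n.+2 => z ^+ (n.+1 - i) * w ^+ i - w ^+ n.+1)).
    by rewrite big_split /= sumrN sumr_const card_ord mulr_natl.
  by move=> i _; rewrite mulrBl -exprD subnK //; have := ltn_ord i; lia.
rewrite modCM expr2 -mulrA ler_wpM2l ?modC_ge0 //.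
apply: le_trans (modC_sum _ _ _) _.
apply: le_trans (_ : \sum_(i < n.+2) modC (z - w) * (n.+1%:R * s ^+ n) <= _); last first.
  by rewrite sumr_const card_ord -mulr_natl; apply: le_of_eq; ring.
apply: ler_sum => i _; rewrite modCM modCX.
have [ni|ni] := leqP n.+1 i.
  have -> : (n.+1 - i)%N = 0%N by lia.
  by rewrite subrr modC0 mul0r !mulr_ge0 ?modC_ge0 ?exprn_ge0.
have -> : s ^+ n = s ^+ (n.+1 - i).-1 * s ^+ i.
  by rewrite -exprD; congr (_ ^+ _); lia.
rewrite !mulrA; apply: ler_pM; rewrite ?exprn_ge0 ?modC_ge0 //; last first.
  by rewrite lerXn2r ?nnegrE ?modC_ge0.
apply: le_trans (subX_bound _ zs ws) _; rewrite -!mulrA ler_wpM2l ?modC_ge0 //.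
by rewrite ler_wpM2r ?exprn_ge0 // ler_nat leq_subr.
Qed.

(** Second-order Taylor remainder, uniform on the disc. Two formal derivatives are needed and each
    costs some radius, hence the intermediate radius [t]. *)
Lemma ps_quad r s a f : 0 <= s -> s < r -> ps r a f ->
  exists f' C2, ps s (dseq a) f' /\
    forall z h, modC z <= s -> modC (z + h) <= s ->
      modC (f (z + h) - f z - f' z * h) <= modC h ^+ 2 * C2.
Proof.
move=> s0 sr [[C hC] hf].
pose t := (s + r) / 2.
have st : s < t by rewrite /t; lra.
have tr' : t < r by rewrite /t; lra.
have t0 : 0 <= t by lra.
have h1 := psb_dseq t0 tr' hC.
have h2 := psb_dseq s0 st h1.
have h1' := psb_le s0 (ltW st) h1.
have [f' hf'] := psb_ex h1'.
exists f', (C / (r - t) / (t - s)); split=> // z h zs zhs.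
have zr : modC z <= r by lra.
have zhr : modC (z + h) <= r by lra.
have T := cvgKB (cvgKB (hf _ zhr) (hf _ zr)) (cvgKMl h (hf'.2 _ zs)).
rewrite [f' z * h]mulrC.
have {}T : cvgK (fun n => pss a (z + h) n.+2 - pss a z n.+2 - h * pss (dseq a) z n.+1)
   (f (z + h) - f z - h * f' z).
  apply: cvgKB; first apply: cvgKB.
  - by move=> e /(hf _ zhr) [M HM]; exists M => n Mn; apply: HM; lia.
  - by move=> e /(hf _ zr) [M HM]; exists M => n Mn; apply: HM; lia.
  - apply: cvgKMl => e /(hf'.2 _ zs) [M HM]; exists M => n Mn; apply: HM; lia.
apply: cvgK_bound T => n; rewrite /pss.
have -> : \sum_(k < n.+2) a k * (z + h) ^+ k - \sum_(k < n.+2) a k * z ^+ k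
    - h * \sum_(k < n.+1) dseq a k * z ^+ k =
  \sum_(k < n) a k.+2 * ((z + h) ^+ k.+2 - z ^+ k.+2 - k.+2%:R * z ^+ k.+1 * ((z + h) - z)).
  rewrite !big_ord_recl /= /dseq /bump /= !expr0 !expr1.
  transitivity ((\sum_(i < n) a i.+2 * (z + h) ^+ i.+2) - (\sum_(i < n) a i.+2 * z ^+ i.+2)
     - h * \sum_(i < n) (i.+2%:R * a i.+2) * z ^+ i.+1).
    have e1 : \sum_(i < n) a (1 + (1 + i))%N * (z + h) ^+ (1 + (1 + i)) =
       \sum_(i < n) a i.+2 * (z + h) ^+ i.+2 by apply: eq_bigr => i _; rewrite !add1n.
    have e2 : \sum_(i < n) a (1 + (1 + i))%N * z ^+ (1 + (1 + i)) =
       \sum_(i < n) a i.+2 * z ^+ i.+2 by apply: eq_bigr => i _; rewrite !add1n.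
    have e3 : \sum_(i < n) (1 + i).+1%:R * a (1 + i).+1 * z ^+ (1 + i) =
       \sum_(i < n) i.+2%:R * a i.+2 * z ^+ i.+1 by apply: eq_bigr => i _; rewrite !add1n.
    rewrite ?e1 ?e2 ?e3; ring.
  rewrite big_distrr /= -!sumrB; apply: eq_bigr => i _; ring.
apply: le_trans (modC_sum _ _ _) _.
apply: le_trans (ler_wpM2l _ (h2 n)); last by rewrite exprn_ge0 // modC_ge0.
rewrite big_distrr /=; apply: ler_sum => i _; rewrite modCM /dseq !modCM !modC_nat.
apply: le_trans (ler_wpM2l (modC_ge0 _) (sub2X_bound i zhs zs)) _.
have -> : z + h - z = h by ring.
by apply: le_of_eq; ring.
Qed.

Lemma cvg_dnbhsK g (l : K) :
  (forall e : R, 0 < e -> exists2 d : R, 0 < d &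
     forall h, h != 0 -> modC h < d -> modC (g h - l) < e) ->
  g @ (0 : K)^' --> l.
Proof.
move=> H; apply/cvgrPdist_lt => e /gt0_ofR [e' e0 ->].
have [d d0 hd] := H e' e0.
apply/nbhs_ballP; exists (ofR d); first by rewrite /= -ofR0 ltr_ofR.
move=> h /=; rewrite /ball /= sub0r normrN normE ltr_ofR => hh h0.
by rewrite normE ltr_ofR modCB hd.
Qed.

Lemma dnbhsK_lim g (l : K) :
  (forall e : R, 0 < e -> exists2 d : R, 0 < d &
     forall h, h != 0 -> modC h < d -> modC (g h - l) < e) ->
  lim (g @ (0 : K)^') = l.
Proof. by move=> /cvg_dnbhsK /cvg_lim; apply. Qed.

Lemma ps_derive1 r s a f : 0 < s -> s < r -> ps r a f ->
  exists f', ps s (dseq a) f' /\ forall z, modC z < s -> derive1 f z = f' z.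
Proof.
move=> s0 sr hf; have [f' [C2 [hf' H]]] := ps_quad (ltW s0) sr hf.
exists f'; split=> // z zs; rewrite /derive1; apply: dnbhsK_lim => e e0.
have C20 : 0 < `|C2| + 1 by rewrite ltr_wpDl.
exists (Num.min (s - modC z) (e / (`|C2| + 1))).
  by rewrite lt_min subr_gt0 zs divr_gt0.
move=> h h0; rewrite lt_min => /andP[h1 h2].
have zh : modC (z + h) <= s by apply: le_trans (modCD _ _) _; lra.
have Hh := H z h (ltW zs) zh.
have -> : h^-1 *: (f (h + z) - f z) - f' z = h^-1 * (f (z + h) - f z - f' z * h).
  by rewrite /GRing.scale /= [h + z]addrC; field.
have hm : 0 < modC h by rewrite modC_gt0.
rewrite modCM modCV mulrC ltr_pdivrMr //.
apply: le_lt_trans Hh _; rewrite expr2 -mulrA mulrC ltr_pM2r //.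
apply: le_lt_trans (_ : modC h * (`|C2| + 1) < _).
  rewrite ler_wpM2l ?modC_ge0 //; apply: le_trans (ler_norm _) _; lra.
by rewrite -ltr_pdivlMr.
Qed.

Lemma derive1_near f g d : 0 < d -> (forall z, modC z < d -> f z = g z) ->
  forall z, modC z < d -> derive1 f z = derive1 g z.
Proof.
move=> d0 fg z zd; rewrite /derive1.
have E : {near (0 : K)^', (fun h => h^-1 *: (f (h + z) - f z)) =1
   (fun h => h^-1 *: (g (h + z) - g z))}.
  apply/nbhs_ballP; exists (ofR (d - modC z)).
    by rewrite /= -ofR0 ltr_ofR; lra.
  move=> h /=; rewrite /ball /= sub0r normrN normE ltr_ofR => hh _.
  rewrite !fg //; apply: le_lt_trans (modCD _ _) _; lra.
congr lim; apply/seteqP; split; apply: near_eq_cvg => //.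
by apply: filterS E => h /esym.
Qed.

Lemma derive1n_near n f g d : 0 < d -> (forall z, modC z < d -> f z = g z) ->
  forall z, modC z < d -> derive1n n f z = derive1n n g z.
Proof.
move=> d0; elim: n f g => [|n IH] f g fg z zd; first exact: fg.
by rewrite !derive1Sn; apply: IH zd => w wd; exact: (derive1_near d0 fg).
Qed.

(** The radius is halved at each derivative; this is harmless because [derive1n] at 0 only depends
    on the germ of the function. *)
Lemma ps_derive1n m r a f : 0 < r -> ps r a f -> derive1n m f 0 = (m`!)%:R * a m.
Proof.
move=> r0; elim: m r a f r0 => [|m IH] r a f r0 hf.
  by rewrite derive1n0 (ps0 (ltW r0) hf) mul1r.
have s0 : 0 < r / 2 by lra.
have [f' [hf' H]] := ps_derive1 s0 (ltac:(lra) : r / 2 < r) hf.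
rewrite derive1Sn (derive1n_near m s0 (g := f')) ?modC0 //.
rewrite (IH _ _ _ s0 hf') factS natrM /dseq; ring.
Qed.

(** The analogue of the Schwarz lemma: without constant term the bound decreases linearly with the
    radius. It makes an inner series small enough to be composed. *)
Lemma psb_shrink r s b C : b 0%N = 0 -> 0 <= s -> s <= r -> 0 < r ->
  psb r b C -> psb s b (s / r * C).
Proof.
move=> b0 s0 sr r0 h n.
apply: le_trans (ler_wpM2l _ (h n)); last by rewrite divr_ge0 // ltW.
rewrite big_distrr /=; apply: ler_sum => -[[|i] ni] _ /=.
  by rewrite b0 modC0 !mul0r mulr0.
rewrite mulrCA ler_wpM2l ?modC_ge0 // !exprS mulrA divfK ?gt_eqF //.
by rewrite ler_wpM2l // lerXn2r ?nnegrE // (ltW r0).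
Qed.

Lemma ps_cont0 r a f : 0 < r -> ps r a f ->
  exists2 C, 0 <= C & forall z, modC z <= r -> modC (f z - a 0%N) <= modC z * C.
Proof.
move=> r0 [[C hC] hf]; exists (C / r).
  by rewrite divr_ge0 ?(psb_ge0 hC) // ltW.
move=> z zr.
pose b n := if n is 0%N then 0 else a n.
have hb : psb r b C.
  move=> n; apply: le_trans (hC n); apply: ler_sum => -[[|i] ni] _ //=.
  by rewrite modC0 !mul0r mulr_ge0 ?modC_ge0 // expr0.
have hb' := psb_shrink (erefl : b 0%N = 0) (modC_ge0 z) zr r0 hb.
have -> : modC z * (C / r) = modC z / r * C by ring.
apply: cvgK_bound (_ : cvgK (fun n => pss b z n.+1) _) => [n|].
  by apply: (pss_bound _ hb'); rewrite lexx.
have : cvgK (fun n => pss a z n.+1 - a 0%N) (f z - a 0%N).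
  apply: cvgKB (cvgK_cst _) => e /(hf _ zr) [M HM]; exists M => n Mn.
  by apply: HM; lia.
apply: cvgK_ext => n; rewrite /pss !big_ord_recl /= expr0 mul0r mulr1; ring.
Qed.

Lemma ps_divX r a f : 0 < r -> a 0%N = 0 -> ps r a f ->
  ps r (fun n => a n.+1) (fun z => if z == 0 then a 1%N else f z / z).
Proof.
move=> r0 a0 [[C hC] hf].
have hb : psb r (fun n => a n.+1) (C / r).
  move=> n; rewrite ler_pdivlMr //; apply: le_trans (hC n.+1).
  rewrite big_ord_recl a0 modC0 mul0r add0r big_distrl /=; apply: ler_sum => i _.
  by rewrite -mulrA -exprSr.
split; first by exists (C / r).
move=> z zr; case: eqP => [->|/eqP z0].
  move=> e e0; exists 1%N => -[//|n] _.
  rewrite /pss big_ord_recl expr0 mulr1 big1 ?addr0 ?subrr ?modC0 // => i _.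
  by rewrite expr0n mulr0.
have : cvgK (fun n => z^-1 * pss a z n.+1) (z^-1 * f z).
  apply: cvgKMl => e /(hf _ zr) [M HM]; exists M => n Mn.
  by apply: HM; lia.
rewrite mulrC; apply: cvgK_ext => n.
rewrite /pss big_ord_recl a0 mul0r add0r big_distrr /=; apply: eq_bigr => i _.
by rewrite exprS; field.
Qed.

(** Induction by dividing by z. The quotient is known to vanish only off 0; continuity of its sum at
    0 yields the next coefficient. *)
Lemma ps_zero r a : 0 < r -> ps r a (fun=> 0) -> forall n, a n = 0.
Proof.
move=> r0 h n; elim: n a h => [|n IH] a h; first by rewrite -(ps0 (ltW r0) h).
have a0 : a 0%N = 0 by rewrite -(ps0 (ltW r0) h).
have h1 := ps_divX r0 a0 h.
suff a1 : a 1%N = 0.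
  apply: (IH (fun n => a n.+1)); apply: ps_ext h1 => // z _.
  by case: eqP => _; rewrite ?a1 ?mul0r.
have [C C0 HC] := ps_cont0 r0 h1.
apply: modC_small => e e0.
have C1 : 0 < C + 1 by lra.
pose d := Num.min r (e / (C + 1) / 2).
have d0 : 0 < d by rewrite lt_min r0 !divr_gt0.
have := HC (ofR d); rewrite modC_ofR gtr0_norm // ofR_eq0 gt_eqF //= mul0r sub0r modCN.
move=> /(_ _)/le_lt_trans; apply; first by rewrite /d ge_min lexx.
apply: le_lt_trans (_ : d * (C + 1) < _); first by rewrite ler_wpM2l ?(ltW d0) //; lra.
rewrite -ltr_pdivlMr // /d gt_min; apply/orP; right.
have h2 : 0 < e / (C + 1) by rewrite divr_gt0.
lra.
Qed.

Lemma ps_unique r a b f : 0 < r -> ps r a f -> ps r b f -> forall n, a n = b n.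
Proof.
move=> r0 ha hb n; apply/eqP; rewrite -subr_eq0.
have h := psD (ltW r0) ha (psZ (-1) hb).
have := ps_zero r0 (_ : ps r (fun n => a n + -1 * b n) (fun=> 0)).
move=> /(_ _ n); rewrite mulN1r => -> //.
by apply: ps_ext h => // z _; rewrite mulN1r subrr.
Qed.

Lemma ps_geom r : 0 <= r -> r < 1 -> ps r (fun=> 1 : K) (fun z => (1 - z)^-1).
Proof.
move=> r0 r1; have hb : psb r (fun=> 1 : K) (1 - r)^-1.
  move=> n; under eq_bigr do rewrite modC1 mul1r.
  have r1' : 0 < 1 - r by lra.
  rewrite -div1r ler_pdivlMr // mulrC -opprB mulNr -subrX1 opprB.
  by rewrite gerBl exprn_ge0.
split; first by exists (1 - r)^-1.
move=> z zr.
have [l hl] : exists l, cvgK (pss (fun=> 1) z) l.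
  by have [f [_ hf]] := psb_ex hb; exists (f z); apply: hf.
have z1 : 1 - z != 0.
  apply/eqP => /eqP; rewrite subr_eq0 => /eqP zE; move: zr; rewrite -zE modC1; lra.
suff -> : (1 - z)^-1 = l by [].
have S : cvgK (fun n => pss (fun=> 1) z n.+1) l.
  by move=> e /hl [M HM]; exists M => n Mn; apply: HM; lia.
have S' : cvgK (fun n => pss (fun=> 1) z n.+1) (1 + z * l).
  apply: cvgK_ext (cvgKD (cvgK_cst 1) (cvgKMl z hl)) => n.
  rewrite /pss big_ord_recl /= expr0 mulr1 big_distrr /=; congr (_ + _).
  by apply: eq_bigr => i _; rewrite !mul1r exprS.
have lE := cvgK_unique S S'.
by apply: (mulfI z1); rewrite mulfV // mulrBl mul1r {1}lE; ring.
Qed.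

(** The inverse is the geometric series composed with 1 - f. As 1 - f has no constant term, the
    radius r / (2 (C + 1)) brings its bound down to 1/2. *)
Lemma ps_inv r a f : 0 < r -> a 0%N = 1 -> ps r a f ->
  exists s b, [/\ 0 < s, s <= r, b 0%N = 1, ps s b (fun z => (f z)^-1) &
    forall z, modC z <= s -> f z != 0].
Proof.
move=> r0 a0 hf.
have [[D hD] _] := hf.
pose w n := delta0 K n + -1 * a n.
have hw := psD (ltW r0) (ps_delta0 (ltW r0)) (psZ (-1) hf).
have w0 : w 0%N = 0 by rewrite /w /delta0 eqxx a0 mulN1r subrr.
have [[C hC] _] := hw.
have C0 := psb_ge0 hC.
pose s := Num.min r (r / (2 * (C + 1))).
have C1 : 0 < 2 * (C + 1) by lra.
have s0 : 0 < s by rewrite lt_min r0 divr_gt0.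
have sr : s <= r by rewrite /s ge_min lexx.
have hC' := psb_shrink w0 (ltW s0) sr r0 hC.
have Ch : s / r * C <= 1 / 2.
  apply: le_trans (_ : (2 * (C + 1))^-1 * C <= _).
    rewrite ler_wpM2r // ler_pdivrMr // mulrC /s ge_min lexx orbT //.
  rewrite mulrC ler_pdivrMr //; lra.
have hws := ps_le (ltW s0) sr hw.
have hg := ps_geom (r := 1 / 2) ltac:(lra) ltac:(lra).
have hcomp := ps_comp (ltW s0) w0 hC' Ch hg hws.
exists s, (comps (fun=> 1) w); split=> //.
- by rewrite /comps big_ord_recl big_ord0 addr0 mul1r /pw /= /delta0 eqxx.
- apply: ps_ext hcomp => // z _; congr (_^-1); ring.
- move=> z zs; apply/eqP => fz0.
  have := ps_bound hC' hws zs; rewrite fz0 mulr0 addr0 modC1; lra.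
Qed.

End PowerSeriesCalculus.

(** * Exponential and logarithm *)

Section ExpLog.
Variable R : realType.
Local Notation K := (CC R).
Implicit Types (z w : K) (r s C x y : R).

Definition expc (n : nat) : K := (n`!%:R)^-1.

Lemma expR_psb r : 0 <= r -> psb r expc (expR r).
Proof.
move=> r0 n.
have -> : \sum_(k < n) modC (expc k) * r ^+ k = series (exp_coeff r) n.
  rewrite seriesEord; apply: eq_bigr => k _.
  by rewrite modCV modC_nat /exp_coeff /= mulrC.
rewrite /expR; apply: nondecreasing_cvgn_le; last exact: is_cvg_series_exp_coeff.
by apply: nondecreasing_series => k _ _; rewrite exp_coeff_ge0.
Qed.

Lemma expR_cvgK x : cvgK (pss expc (ofR x)) (ofR (expR x)).
Proof.
have : series (exp_coeff x) @ \oo --> expR x by exact: is_cvg_series_exp_coeff.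
move=> /cvgK_real; apply: cvgK_ext => n; rewrite seriesEord ofR_sum; apply: eq_bigr => k _.
by rewrite /exp_coeff /= ofRM ofRX ofRV ofR_nat mulrC.
Qed.

Lemma imag_cvgK y : cvgK (pss expc (0 +i* y)%C) ((cos y +i* sin y)%C : K).
Proof.
have hc : series (cos_coeff y) @ \oo --> cos y.
  by rewrite cos.unlock; exact: is_cvg_series_cos_coeff.
have hs : series (sin_coeff y) @ \oo --> sin y.
  by rewrite sin.unlock; exact: is_cvg_series_sin_coeff.
have := cvgKD (cvgK_real hc) (cvgKMl ((0 +i* 1)%C : K) (cvgK_real hs)).
have -> : ofR (cos y) + (0 +i* 1)%C * ofR (sin y) = ((cos y +i* sin y)%C : K).
  by apply: eqC_re_im; rewrite /reC /imC /=; ring.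
apply: cvgK_ext => n; rewrite !seriesEord !ofR_sum big_distrr -big_split /=.
apply: eq_bigr => k _.
have -> : ((0 +i* y)%C : K) = (0 +i* 1)%C * ofR y.
  by apply: eqC_re_im; rewrite /reC /imC /=; ring.
have i2 : ((0 +i* 1)%C : K) ^+ 2 = -1.
  by rewrite expr2; apply: eqC_re_im; rewrite /reC /imC /=; ring.
have ik : ((0 +i* 1)%C : K) ^+ k = ofR ((~~ odd k)%:R * (-1) ^+ k./2)
    + (0 +i* 1)%C * ofR ((odd k)%:R * (-1) ^+ k./2).
  rewrite -{1}(odd_double_half k) exprD -muln2 mulnC exprM i2.
  have -> : ((-1 : K) ^+ k./2) = ofR ((-1) ^+ k./2) by rewrite ofRX ofRN ofR1.
  case: (odd k); rewrite /= ?expr0 ?expr1 ?mul0r ?mul1r ?ofR0 ?mulr0 ?addr0 ?add0r //.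
rewrite exprMn ik /cos_coeff /sin_coeff /= /expc !ofRM !ofRX !ofRV !ofR_nat !ofRN ofR1.
case: (boolP (odd k)) => ok /=; rewrite ?ofR_nat ?mul0r ?mul1r ?mulr0 ?addr0 ?add0r.
  have -> : k.-1./2 = k./2 by have := odd_double_half k; rewrite ok; lia.
  by ring.
by ring.
Qed.

Lemma exp_scale_conv z w n :
  conv (fun k => z ^+ k * expc k) (fun k => w ^+ k * expc k) n = (z + w) ^+ n * expc n.
Proof.
rewrite /conv exprDn big_distrl /= /expc.
rewrite (reindex_inj rev_ord_inj) /=; apply: eq_bigr => i _; rewrite subSS.
have iln : (i <= n)%N by rewrite -ltnS.
rewrite subKn // -(bin_fact iln) !natrM -mulr_natr.
have f0 m : (m`!%:R : K) != 0 by rewrite pnatr_eq0 -lt0n fact_gt0.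
have b0 : ('C(n, i)%:R : K) != 0 by rewrite pnatr_eq0 -lt0n bin_gt0.
field; rewrite ?f0 ?b0 //.
Qed.

(** [cexp] is given by its real and imaginary parts; the exponential series of x and of iy are
    multiplied as power series in an auxiliary variable, evaluated at 1. *)
Lemma cexp_cvgK z : cvgK (pss expc z) (cexp z).
Proof.
case: z => x y.
pose X : K := ofR x; pose Y : K := (0 +i* y)%C.
have [f hf] := psb_ex (expR_psb (modC_ge0 X)).
have [g hg] := psb_ex (expR_psb (modC_ge0 Y)).
have h1 := ps_scale (s := 1) (c := X) (_ : modC X * 1 <= _) ler01 hf.
have h2 := ps_scale (s := 1) (c := Y) (_ : modC Y * 1 <= _) ler01 hg.
move: h1 h2; rewrite !mulr1 => /(_ (lexx _)) h1 /(_ (lexx _)) h2.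
have [_ /(_ 1)] := ps_conv ler01 h1 h2; rewrite modC1 lexx !mulr1 => /(_ isT).
have -> : f X = ofR (expR x).
  by apply: cvgK_unique (hf.2 _ (lexx _)) _; exact: expR_cvgK.
have -> : g Y = (cos y +i* sin y)%C.
  by apply: cvgK_unique (hg.2 _ (lexx _)) _; exact: imag_cvgK.
have -> : ofR (expR x) * (cos y +i* sin y)%C = cexp ((x +i* y)%C : K).
  by apply: eqC_re_im; rewrite /reC /imC /=; ring.
have XY : X + Y = (x +i* y)%C.
  by apply: eqC_re_im; rewrite /reC /imC /=; ring.
apply: cvgK_ext => n; rewrite /pss; apply: eq_bigr => k _.
by rewrite exp_scale_conv XY expr1n mulr1 mulrC.
Qed.

Lemma ps_cexp r : 0 <= r -> ps r expc (@cexp R).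
Proof.
by move=> r0; split=> [|z _]; [exists (expR r); exact: expR_psb|exact: cexp_cvgK].
Qed.

Lemma modC_cexp z : modC (cexp z) = expR (reC z).
Proof.
rewrite /modC /cexp /= !exprMn -mulrDr cos2Dsin2 mulr1 sqrtr_sqr ger0_norm //.
Qed.

(** Coefficients of log (1 - z); the convention [0^-1 = 0] provides the constant term. *)
Definition logc (n : nat) : K := - (n%:R)^-1.

Lemma psb_logc r : 0 <= r -> r < 1 -> psb r logc (1 - r)^-1.
Proof.
move=> r0 r1 n.
apply: le_trans (_ : \sum_(k < n) r ^+ k <= _).
  apply: ler_sum => -[[|k] nk] _ /=.
    by rewrite /logc invr0 oppr0 modC0 mul0r expr0.
  rewrite /logc modCN modCV modC_nat ler_piMl ?exprn_ge0 // invf_le1 ?ltr0Sn //.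
  by rewrite ler1n.
have r1' : 0 < 1 - r by lra.
rewrite -div1r ler_pdivlMr // mulrC -opprB mulNr -subrX1 opprB.
by rewrite gerBl exprn_ge0.
Qed.

Definition Lam (z : K) : K := lim (pss logc z @ \oo).

Lemma ps_Lam r : 0 <= r -> r < 1 -> ps r logc Lam.
Proof.
move=> r0 r1; split; first by exists (1 - r)^-1; exact: psb_logc.
move=> z zr; have [f [_ hf]] := psb_ex (psb_logc r0 r1).
have := hf z zr => /cvgKP h.
by rewrite /Lam (cvg_lim _ h) //; apply/cvgKP.
Qed.

(* The coefficients u of exp o log (1 - z) satisfy (1 - z) u' = - u. *)
Lemma cexp_Lam z : modC z < 1 -> cexp (Lam z) = 1 - z.
Proof.
move=> z1; have z0 := modC_ge0 z.
have hL := ps_Lam z0 z1.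
have hb := psb_logc z0 z1.
have C0 := psb_ge0 hb.
have l0 : logc 0 = 0 by rewrite /logc invr0 oppr0.
have [_ /(_ z (lexx _)) h] := ps_comp z0 l0 hb (lexx _) (ps_cexp C0) hL.
pose u := comps expc logc.
have u0 : u 0%N = 1.
  by rewrite /u /comps big_ord_recl big_ord0 addr0 /pw /= /delta0 eqxx mulr1 /expc invr1.
have uS n : n.+1%:R * u n.+1 = n%:R * u n - u n.
  pose E := tr n.+2 expc; pose L := tr n.+2 logc; pose U := tr n.+2 u.
  have L0 : L`_0 = 0 by rewrite coef_tr.
  have hU : eqX n.+2 U (E \Po L) by exact: tr_comps.
  have hE : eqX n.+1 E^`() E.
    move=> i ni; rewrite coef_deriv !coef_tr //; last exact: ltnW.
    rewrite /expc factS natrM invfM -[LHS]mulr_natl mulrA mulfV ?mul1r ?pnatr_eq0 //.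
  have hL' : eqX n.+1 ((1 - 'X) * L^`()) (-1)%:P.
    move=> i ni; rewrite mulrBl mul1r coefB coefXM coefC !coef_deriv.
    have cl j : (j <= n)%N -> L`_j.+1 *+ j.+1 = -1.
      move=> jn; rewrite coef_tr // /logc -[LHS]mulr_natr mulNr mulVf ?pnatr_eq0 //.
    case: i ni => [|i] ni; first by rewrite cl // subr0.
    by rewrite !cl ?subrr //; lia.
  have hU' : eqX n.+1 ((1 - 'X) * U^`()) (- U).
    have d := eqX_deriv hU; rewrite deriv_comp in d.
    apply: (eqX_trans (eqXMl (1 - 'X) d)).
    have -> : (1 - 'X) * ((E^`() \Po L) * L^`()) = (E^`() \Po L) * ((1 - 'X) * L^`()) by ring.
    apply: (eqX_trans (eqXMl _ hL')).
    rewrite polyCN mulrN polyC1 mulr1; apply: eqXN.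
    have hc : eqX n.+1 (E^`() \Po L) (E \Po L) by apply: eqX_comp.
    apply: (eqX_trans hc).
    by apply: eqX_sym; apply: eqX_le hU.
  have := hU' n (ltnSn n).
  rewrite mulrBl mul1r coefB coefXM coefN !coef_deriv !coef_tr //; last by lia.
  case: n {E L U L0 hU hE hL' hU'} => [|n] /=.
    by rewrite subr0 !mulr1n => ->; rewrite mul0r mul1r sub0r.
  rewrite ?coef_tr // => /eqP; rewrite subr_eq => /eqP h'.
  by rewrite mulr_natl h' mulr_natl addrC.
have u1 : u 1%N = -1 by have := uS 0%N; rewrite mul1r u0 => ->; ring.
have u2 n : u n.+2 = 0.
  elim: n => [|n IH].
    have := uS 1%N; rewrite mul1r subrr => /eqP; rewrite mulf_eq0 pnatr_eq0 /= => /eqP //.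
  have := uS n.+2; rewrite IH mulr0 subrr => /eqP; rewrite mulf_eq0 pnatr_eq0 /= => /eqP //.
apply: cvgK_unique h _ => e e0; exists 2%N => -[|[|n]] // _.
rewrite /pss !big_ord_recl big1 ?addr0; last by move=> i _; rewrite -/u !lift0 u2 mul0r.
by rewrite /bump /= -/u u0 u1 expr0 expr1 mulN1r mulr1 subrr modC0.
Qed.

Lemma ln_modC_1B z : modC z < 1 -> ln (modC (1 - z)) = reC (Lam z).
Proof. by move=> z1; rewrite -(cexp_Lam z1) modC_cexp expRK. Qed.

(** Half-angle formula: the quotient inside [argC] is sin y / (1 + cos y) = tan (y / 2), and |y| <
    pi keeps y / 2 in the range where [atan] inverts [tan]. *)
Lemma LogC_cexp z : `|imC z| < pi -> LogC (cexp z) = z.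
Proof.
case: z => x y; rewrite /imC /= ltr_norml => /andP[y1 y2].
rewrite /LogC modC_cexp /= expRK; congr (_ +i* _)%C.
rewrite /argC modC_cexp /= /reC /imC /=.
have e0 := expR_gt0 x.
have -> : expR x + expR x * cos y = expR x * (1 + cos y) by ring.
have yE : y = (y / 2) *+ 2 by rewrite -mulr_natr; field.
have c0 : 0 < cos (y / 2).
  by apply: cos_gt0_pihalf; apply/andP; split; lra.
have cE : 1 + cos y = cos (y / 2) ^+ 2 *+ 2.
  by rewrite {1}yE mulr2n cosD -!expr2 sin2cos2; ring.
have sE : sin y = (sin (y / 2) * cos (y / 2)) *+ 2.
  by rewrite {1}yE mulr2n sinD; ring.
have d0 : 0 < 1 + cos y by rewrite cE pmulrn_lgt0 // exprn_gt0.
rewrite mulf_eq0 !gt_eqF //=.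
have -> : expR x * sin y / (expR x * (1 + cos y)) = tan (y / 2).
  rewrite cE sE /tan; move: (expR x) (cos (y / 2)) (sin (y / 2)) e0 c0 => e c t e0 c0.
  have e1 : e != 0 by rewrite gt_eqF.
  have c1 : c != 0 by rewrite gt_eqF.
  apply: (canLR (mulfK _)); first by rewrite mulf_neq0 // mulrn_eq0 expf_neq0.
  by rewrite !mulr2n -[t in LHS](divfK c1); ring.
rewrite tanK ?in_itv /=; first by field.
by apply/andP; split; lra.
Qed.

(** The series has modulus at most 1 / (1 - |z|), below 2 and hence below pi, so it is the principal
    logarithm of its exponential. *)
Lemma LogC_1B z : modC z <= 1 / 4 -> LogC (1 - z) = Lam z.
Proof.
move=> z2; have z1 : modC z < 1 by lra.
rewrite -cexp_Lam // LogC_cexp //.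
apply: le_lt_trans (imC_le _) _.
have h := ps_bound (psb_logc (modC_ge0 z) z1) (ps_Lam (modC_ge0 z) z1) (lexx _).
apply: le_lt_trans h _; apply: lt_le_trans (pi_ge2 R).
rewrite -[ltRHS]invrK ltf_pV2 ?posrE ?invr_gt0 //; lra.
Qed.

End ExpLog.

(** * Coefficients of the logarithm of a power series *)

(** Logarithmic derivative of a product of factors 1 - w X, each contributing the truncated
    geometric series of - w / (1 - w X). *)
Lemma eqX_prod_linear_deriv (F : fieldType) (ws : seq F) (d : nat) :
  eqX d ((\prod_(w <- ws) (1 - w *: 'X : {poly F})) * - \sum_(w <- ws) \poly_(i < d) (w ^+ i.+1))
    (\prod_(w <- ws) (1 - w *: 'X : {poly F}))^`().
Proof.
elim: ws => [|x t IH].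
  by rewrite !big_nil -[1]polyC1 derivC oppr0 mulr0.
rewrite !big_cons derivM opprD mulrDr; apply: eqXD.
  rewrite mulrAC; apply: eqXMr => i id_.
  rewrite mulrBl mul1r coefB -scalerAl coefZ coefXM !coefN coef_poly id_.
  rewrite derivB derivZ derivX -[1]polyC1 derivC sub0r coefN coefZ coefC.
  case: i id_ => [|i] id_ /=; first by rewrite mulr0 subr0 mulr1 expr1.
  by rewrite coef_poly (ltnW id_) mulr0 mulrN opprK oppr0 exprS addNr.
by rewrite -mulrA; apply: eqXMl.
Qed.

Section TruncatedLog.
Variables (F : fieldType) (A : comAlgType F).
Implicit Types f : A.

(** The Mercator series cut after d terms, in an arbitrary commutative algebra so as to serve both
    one-variable and multivariate polynomials. *)
Definition logT (d : nat) f : A :=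
  \sum_(j < d) ((-1) ^+ j / j.+1%:R : F) *: (f - 1) ^+ j.+1.

Variable D : A -> A.
Hypothesis D0 : D 0 = 0.
Hypothesis DD : forall x y, D (x + y) = D x + D y.
Hypothesis DZ : forall (c : F) x, D (c *: x) = c *: D x.
Hypothesis DM : forall x y, D (x * y) = D x * y + x * D y.
Hypothesis charF : forall n, n.+1%:R != 0 :> F.

Lemma derivation_exp x n : D (x ^+ n.+1) = n.+1%:R * x ^+ n * D x.
Proof.
elim: n => [|n IH]; first by rewrite expr1 expr0 !mul1r.
by rewrite exprS DM IH -[n.+2%:R]natr1 (exprS x n); ring.
Qed.

(** The derivative is a finite geometric sum in 1 - f. The defect (1 - f)^d has order d as soon as f
    has constant term 1, so [logT] is a logarithm up to that order. *)
Lemma derivation_logT d f : f * D (logT d f) = D f * (1 - (1 - f) ^+ d).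
Proof.
have D1 : D 1 = 0.
  have /eqP := DM 1 1; rewrite !mulr1 mul1r -subr_eq subrr => /eqP //.
have DB : D (f - 1) = D f.
  by rewrite DD -scaleN1r DZ D1 scaler0 addr0.
have -> : D (logT d f) = D f * \sum_(j < d) (1 - f) ^+ j.
  rewrite /logT big_distrr /=.
  transitivity (\sum_(j < d) D (((-1) ^+ j / j.+1%:R : F) *: (f - 1) ^+ j.+1)).
    by apply: (big_morph D).
  apply: eq_bigr => j _; rewrite DZ derivation_exp DB.
  have -> : (j.+1%:R : A) = (j.+1%:R : F)%:A by rewrite scaler_nat.
  have -> : 1 - f = (-1 : F) *: (f - 1) by rewrite scaleN1r opprB.
  by rewrite mulr_algl exprZn -scalerAr -scalerAl scalerA divfK // mulrC.
rewrite mulrCA; congr (_ * _).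
have -> : f * \sum_(j < d) (1 - f) ^+ j = - (((1 - f) - 1) * \sum_(j < d) (1 - f) ^+ j).
  by rewrite -mulNr; congr (_ * _); ring.
by rewrite -subrX1 opprB.
Qed.

End TruncatedLog.

(** * Fourier inversion on a circle and coefficients of a logarithm *)

Section Fourier.
Variable R : realType.
Local Notation K := (CC R).
Implicit Types (z w : K) (r eta e : R) (p : {poly K}).

Lemma prim_root_ex n : (0 < n)%N -> exists w : K, n.-primitive_root w.
Proof.
move=> n0; pose p : {poly K} := 'X^n - 1.
have [rs Dp] := closed_field_poly_normal p.
have lp : lead_coef p = 1 by rewrite /p lead_coefDl ?lead_coefXn // size_polyN size_polyXn size_poly1.
rewrite lp scale1r in Dp.
have urs : uniq rs.
  rewrite -separable.separable_prod_XsubC -Dp.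
  by rewrite cyclotomic.separable_Xn_sub_1 // pnatr_eq0 -lt0n.
have srs : size rs = n.
  have := congr1 (size \o polyseq) Dp; rewrite /= size_prod_XsubC => -[].
  by rewrite size_polyDl ?size_polyXn ?size_polyN ?size_poly1 // => -[].
have rrs : all n.-unity_root rs.
  apply/allP => w wrs; rewrite /root_of_unity -/p Dp.
  by rewrite root_prod_XsubC.
have := @cyclic.has_prim_root _ n rs n0 rrs urs; rewrite srs leqnn => /(_ isT).
by move=> /hasP [w _ hw]; exists w.
Qed.

Lemma modC_prim_root n w : (0 < n)%N -> n.-primitive_root w -> modC w = 1.
Proof.
move=> n0 hw; apply/eqP; rewrite -(@pexpr_eq1 _ _ n) ?modC_ge0 -?lt0n //.
by rewrite -modCX (prim_expr_order hw) modC1.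
Qed.

Lemma sum_root_of_unity n (x : K) : x ^+ n = 1 -> x != 1 -> \sum_(k < n) x ^+ k = 0.
Proof.
move=> xn x1; have := subrX1 x n; rewrite xn subrr => /esym/eqP.
by rewrite mulf_eq0 subr_eq0 (negbTE x1) => /eqP.
Qed.

Lemma conjc_modC1 w : modC w = 1 -> (w^*)%C = w^-1.
Proof.
move=> w1; have w0 : w != 0 by rewrite -modC_gt0 w1.
have := sqr_normc w; rewrite [`|_|]normE w1 ofR1 expr1n => h.
by apply: (mulfI w0); rewrite mulfV // -h.
Qed.

Lemma add_conjc z : z + (z^*)%C = ofR (2 * reC z).
Proof. by case: z => a b; apply: eqC_re_im; rewrite /reC /imC /=; ring. Qed.

Lemma conjc_ofR r : ((ofR r : K)^*)%C = ofR r.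
Proof. by apply: eqC_re_im; rewrite /reC /imC /= ?oppr0. Qed.

Lemma conjcM z w : ((z * w)^*)%C = (z^*)%C * (w^*)%C.
Proof. exact: (rmorphM (@conjc R)). Qed.
Lemma conjcX z n : ((z ^+ n)^*)%C = (z^*)%C ^+ n.
Proof. exact: (rmorphXn (@conjc R)). Qed.
Lemma conjc_sum (I : Type) (t : seq I) (P : pred I) (f : I -> K) :
  ((\sum_(i <- t | P i) f i)^*)%C = \sum_(i <- t | P i) ((f i)^*)%C.
Proof. exact: (rmorph_sum (@conjc R)). Qed.

(** Discrete Fourier transform of 2 Re p = p + conj p on the circle: for n > 0 the conjugate part
    only has nonpositive frequencies and contributes nothing to frequency n. *)
Lemma poly_coef_re_bound p r eta n : 0 < r -> (0 < n)%N ->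
  (forall z, modC z = r -> `|reC p.[z]| <= eta) -> modC p`_n * r ^+ n <= 2 * eta.
Proof.
move=> r0 n0 H.
(* With M sample points neither the frequencies i < m of p nor the frequencies - i of its conjugate
   coincide with n modulo M: i and n are both below M, and 0 < n + i < M. *)
pose m := (size p + n.+1)%N; pose M := (m + n)%N.
have M0 : (0 < M)%N by rewrite /M /m; lia.
have [w hw] := prim_root_ex M0.
have wM : w ^+ M = 1 := prim_expr_order hw.
have w1 : modC w = 1 := modC_prim_root M0 hw.
have w0 : w != 0 by rewrite -modC_gt0 w1.
have mk k : modC (ofR r * w ^+ k) = r.
  by rewrite modCM modCX w1 expr1n mulr1 modC_ofR gtr0_norm.
have nm : (n < m)%N by rewrite /m; lia.
pose Q : K := \sum_(k < M) (w ^- n) ^+ k * ofR (2 * reC p.[ofR r * w ^+ k]).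
have pE k : p.[ofR r * w ^+ k] = \sum_(i < m) p`_i * ofR r ^+ i * (w ^+ i) ^+ k.
  rewrite (@horner_coef_wide _ m) ?leq_addr //; apply: eq_bigr => i _.
  by rewrite exprMn -!exprM mulnC mulrA.
have pcE k : ((p.[ofR r * w ^+ k])^*)%C =
    \sum_(i < m) ((p`_i)^*)%C * ofR r ^+ i * (w ^- i) ^+ k.
  rewrite pE conjc_sum; apply: eq_bigr => i _.
  by rewrite !conjcM !conjcX conjc_ofR (conjc_modC1 w1) !exprVn.
have wnM : (w ^- n) ^+ M = 1 by rewrite -exprVn -exprM mulnC exprM exprVn wM invr1 expr1n.
have QE : Q = M%:R * (p`_n * ofR r ^+ n).
  rewrite /Q; under eq_bigr do rewrite -add_conjc mulrDr.
  rewrite big_split /= [X in _ + X](_ : _ = 0) ?addr0.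
    under eq_bigr do rewrite pE big_distrr /=.
    rewrite exchange_big /= (bigD1 (Ordinal nm)) //= [X in _ + X]big1 ?addr0.
      rewrite (eq_bigr (fun=> p`_n * ofR r ^+ n)).
        by rewrite sumr_const card_ord mulr_natl.
      move=> k _; rewrite mulrCA -exprMn mulVf ?expf_neq0 // expr1n mulr1 //.
    move=> i; rewrite -val_eqE /= => ni.
    rewrite (eq_bigr (fun k : 'I_M => p`_i * ofR r ^+ i * (w ^- n * w ^+ i) ^+ k)).
      rewrite -big_distrr /= sum_root_of_unity ?mulr0 //.
        by rewrite exprMn wnM mul1r -exprM mulnC exprM wM expr1n.
      apply: contra ni => /eqP h.
      have : w ^+ i == w ^+ n by rewrite -[w ^+ i](mulVKf (expf_neq0 n w0)) h mulr1.
      have iM : (i < M)%N by have := ltn_ord i; rewrite /M; lia.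
      have nM : (n < M)%N by move: nm; rewrite /M; lia.
      by rewrite (eq_prim_root_expr hw) !modn_small.
    by move=> k _; rewrite exprMn mulrCA.
  under eq_bigr do rewrite pcE big_distrr /=.
  rewrite exchange_big /= big1 // => i _.
  rewrite (eq_bigr (fun k : 'I_M => ((p`_i)^*)%C * ofR r ^+ i * (w ^- n * w ^- i) ^+ k)).
    rewrite -big_distrr /= sum_root_of_unity ?mulr0 //.
      by rewrite exprMn wnM mul1r -exprVn -exprM mulnC exprM exprVn wM invr1 expr1n.
    rewrite -invfM -exprD invr_eq1 addnC -(prim_order_dvd hw).
    by apply/negP => /dvdn_leq; have := ltn_ord i; rewrite /M; lia.
  by move=> k _; rewrite exprMn mulrCA.
have h1 : modC Q <= M%:R * (2 * eta).
  apply: le_trans (modC_sum _ _ _) _.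
  apply: le_trans (_ : \sum_(k < M) (2 * eta) <= _); last first.
    by rewrite sumr_const card_ord -[leLHS]mulr_natl.
  apply: ler_sum => k _.
  rewrite modCM modCX modCV modCX w1 !expr1n invr1 expr1n mul1r modC_ofR normrM.
  by rewrite ger0_norm // ler_pM2l //; exact: H.
move: h1; rewrite QE modCM modC_nat ler_pM2l ?ltr0n // modCM modCX modC_ofR.
by rewrite (gtr0_norm r0).
Qed.


Lemma ps_tail_unif r (a : nat -> K) f : 0 <= r -> ps r a f ->
  forall e, 0 < e -> exists M, forall n, (M <= n)%N -> forall z, modC z <= r ->
    modC (f z - pss a z n) <= e.
Proof.
move=> r0 [[C hC] hf] e e0.
have x0 i : 0 <= modC (a i) * r ^+ i by rewrite mulr_ge0 ?modC_ge0 ?exprn_ge0.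
have [M HM] := mono_bounded_tail x0 hC e0.
exists M => n Mn z zr.
have S : cvgK (fun m => pss a z (n + m) - pss a z n) (f z - pss a z n).
  apply: cvgKB (cvgK_cst _) => d /(hf z zr) [M' HM']; exists M' => m Mm.
  by apply: HM'; lia.
apply: cvgK_bound S => m; rewrite /pss -!(big_mkord xpredT (fun k => a k * z ^+ k)).
rewrite (@big_cat_nat _ _ _ n) ?leq_addr //= addrAC subrr add0r.
apply: le_trans (modC_sum _ _ _) _.
apply: le_trans (ltW (HM n (n + m)%N Mn (leq_addr _ _))).
apply: ler_sum => i _; exact: psb_term.
Qed.

(** Uniform convergence on the circle transfers the bound from the partial sums. *)
Lemma ps_coef_re_bound r (a : nat -> K) f eta n : 0 < r -> (0 < n)%N -> ps r a f ->
  (forall z, modC z = r -> `|reC (f z)| <= eta) -> modC (a n) * r ^+ n <= 2 * eta.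
Proof.
move=> r0 n0 hf H; rewrite leNgt; apply/negP => Hlt.
have [M HM] := ps_tail_unif (ltW r0) hf (ltac:(lra) : 0 < (modC (a n) * r ^+ n - 2 * eta) / 4).
set e : R := (modC (a n) * r ^+ n - 2 * eta) / 4 in HM.
pose m := maxn M n.+1.
have : modC (tr m a)`_n * r ^+ n <= 2 * (eta + e).
  apply: poly_coef_re_bound => // z zr.
  have -> : (tr m a).[z] = pss a z m.
    by rewrite horner_poly.
  have h := HM m (leq_maxl _ _) z ltac:(by rewrite zr).
  have -> : pss a z m = f z - (f z - pss a z m) by ring.
  rewrite reCB; apply: le_trans (ler_normB _ _) _.
  by apply: lerD; [exact: H|apply: le_trans (reC_le _) h].
rewrite coef_tr ?leq_maxr // /e; lra.
Qed.

Lemma poly_one_sub_factor p r : p`_0 = 1 -> 0 < r ->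
  (forall z, modC z <= r -> p.[z] != 0) ->
  exists2 ws : seq K, (forall w, w \in ws -> modC w * r < 1) &
    p = \prod_(w <- ws) (1 - w *: 'X).
Proof.
move=> p0 r0 H; have [rs Dp] := closed_field_poly_normal p.
have pn : p != 0 by apply/eqP => pE; move: p0; rewrite pE coef0 => /eqP; rewrite eq_sym oner_eq0.
have rr w : w \in rs -> r < modC w.
  move=> wrs; rewrite ltNge; apply/negP => /H; rewrite Dp hornerZ.
  have /rootP -> : root (\prod_(z <- rs) ('X - z%:P)) w by rewrite root_prod_XsubC.
  by rewrite mulr0 eqxx.
have rn w : w \in rs -> w != 0 by move=> /rr h; rewrite -modC_gt0; lra.
exists [seq w^-1 | w <- rs].
  move=> _ /mapP [w /rr h ->]; rewrite modCV mulrC ltr_pdivrMr ?mul1r //; lra.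
have E (t : seq K) : {subset t <= rs} -> \prod_(z <- t) ('X - z%:P) =
    (\prod_(z <- t) (- z)) *: \prod_(w <- [seq w^-1 | w <- t]) (1 - w *: 'X).
  elim: t => [|x t IH] ts; first by rewrite !big_nil scale1r.
  have x0 : x != 0 by apply: rn; apply: ts; rewrite inE eqxx.
  rewrite map_cons !big_cons IH; last by move=> y yt; apply: ts; rewrite inE yt orbT.
  have -> : 'X - x%:P = (- x) *: (1 - x^-1 *: 'X).
    by rewrite scalerBr scalerA mulNr mulfV // scaleN1r opprK addrC -mul_polyC mulr1 polyCN.
  by rewrite -scalerAl -scalerAr scalerA.
have {}E := E rs (fun _ h => h).
move: p0; rewrite {1}Dp E scalerA coefZ.
have -> : (\prod_(w <- [seq w^-1 | w <- rs]) (1 - w *: 'X) : {poly K})`_0 = 1.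
  elim: (map _ _) => [|x t IH]; first by rewrite big_nil coef1.
  by rewrite big_cons coefM big_ord_recl big_ord0 addr0 IH mulr1 coefB coef1 coefZ coefX mulr0 subr0.
by rewrite mulr1 => c1; rewrite Dp E scalerA c1 scale1r.
Qed.

(** Newton's identities: the formal and the explicit logarithmic derivative both give f' after
    multiplication by f, and f can be cancelled. *)
Lemma logT_prod (ws : seq K) (d n : nat) : (n < d)%N ->
  n.+1%:R * (logT d (\prod_(w <- ws) (1 - w *: 'X) : {poly K}))`_n.+1 =
  - \sum_(w <- ws) w ^+ n.+1.
Proof.
move=> nd; set f := \prod_(w <- ws) _.
pose G : {poly K} := - \sum_(w <- ws) \poly_(i < d) (w ^+ i.+1).
have f0 : f`_0 = 1.
  rewrite /f; elim: ws {f G} => [|x t IH]; first by rewrite big_nil coef1.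
  by rewrite big_cons coefM big_ord_recl big_ord0 addr0 IH mulr1 coefB coef1 coefZ coefX mulr0 subr0.
have fG : eqX d (f * G) f^`() by exact: eqX_prod_linear_deriv.
have fL : eqX d (f * (logT d f)^`()) f^`().
  rewrite (@derivation_logT _ _ (@deriv K)) //.
  - rewrite -[X in eqX _ _ X]mulr1; apply: eqXMl => i id_.
    rewrite coefB coef_exp_lt ?subr0 //; by rewrite coefB coef1 f0 subrr.
  - exact: deriv0.
  - by move=> x y; rewrite derivD.
  - by move=> c x; rewrite derivZ.
  - by move=> x y; rewrite derivM.
have f00 : f`_0 != 0 by rewrite f0 oner_eq0.
have := eqX_cancel f00 (eqX_trans fL (eqX_sym fG)) nd.
rewrite coef_deriv mulr_natl => ->; rewrite coefN coef_sum; congr (- _).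
by apply: eq_bigr => w _; rewrite coef_poly nd.
Qed.

Lemma eqX_logT d n (p q : {poly K}) : eqX n p q -> eqX n (logT d p) (logT d q).
Proof.
by move=> h; apply: eqX_sum => i _; apply: eqXZ; apply: eqXX; apply: eqXB.
Qed.

(** As the inverse roots satisfy |w| r < 1, the sum of the series log (1 - w z) converges on the
    closed disc and has real part ln |p|; no branch of log p is chosen. The bound on real parts
    applies to its difference with g. *)
Lemma logT_poly_bound p r (c : nat -> K) g eta d n :
  p`_0 = 1 -> 0 < r -> (forall z, modC z <= r -> p.[z] != 0) -> ps r c g ->
  (forall z, modC z = r -> `|ln (modC p.[z]) - reC (g z)| <= eta) ->
  (0 < n)%N -> (n <= d)%N -> modC ((logT d p)`_n - c n) * r ^+ n <= 2 * eta.
Proof.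
move=> p0 r0 pn hg H n0 nd.
have [ws wsr pE] := poly_one_sub_factor p0 r0 pn.
have hL : ps r (fun n => \sum_(w <- ws) w ^+ n * logc R n)
     (fun z => \sum_(w <- ws) Lam (w * z)).
  elim: ws wsr {pE} => [|w ws IH] wsr.
    apply: ps_ext (psZ 0 (ps_delta0 (ltW r0))) => [m|z _]; by rewrite big_nil mul0r.
  have w1 : modC w * r < 1 by apply: wsr; rewrite inE eqxx.
  have h1 := ps_scale (lexx _) (ltW r0) (ps_Lam (mulr_ge0 (modC_ge0 w) (ltW r0)) w1).
  have wsr' x : x \in ws -> modC x * r < 1 by move=> xs; apply: wsr; rewrite inE xs orbT.
  have := psD (ltW r0) h1 (IH wsr').
  by apply: ps_ext => [m|z _]; rewrite big_cons.
have hd := psD (ltW r0) hL (psZ (-1) hg).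
have lnE z : modC z = r -> ln (modC p.[z]) = reC (\sum_(w <- ws) Lam (w * z)).
  move=> zr; rewrite pE horner_prod modC_prod reC_sum.
  elim: ws wsr {pE hL hd} => [|w ws IH] wsr; first by rewrite !big_nil ln1.
  have w1 : modC (w * z) < 1 by rewrite modCM zr; apply: wsr; rewrite inE eqxx.
  have E : (1 - w *: 'X).[z] = 1 - w * z by rewrite !hornerE.
  have pos x : modC (x * z) < 1 -> 0 < modC (1 - x * z).
    move=> x1; rewrite modC_gt0; apply/eqP => /eqP; rewrite subr_eq0 => /eqP xE.
    by move: x1; rewrite -xE modC1 ltxx.
  rewrite !big_cons lnM ?posrE.
  - rewrite E ln_modC_1B // IH // => x xs; apply: wsr; by rewrite inE xs orbT.
  - by rewrite E pos.
  - rewrite -modC_prod modC_gt0 prodf_seq_neq0; apply/allP => x xs /=.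
    have -> : (1 - x *: 'X).[z] = 1 - x * z by rewrite !hornerE.
    by rewrite -modC_gt0 pos // modCM zr; apply: wsr; rewrite inE xs orbT.
have := ps_coef_re_bound r0 n0 hd (eta := eta).
have -> : \sum_(w <- ws) w ^+ n * logc R n + -1 * c n = (logT d p)`_n - c n.
  rewrite mulN1r; congr (_ - _); rewrite -big_distrl /= pE.
  case: n n0 nd => // n _ nd; have := logT_prod ws nd.
  set s := \sum_(w <- ws) _ => h.
  have n1 : (n.+1%:R : K) != 0 by rewrite pnatr_eq0.
  by apply: (mulfI n1); rewrite h /logc; field.
apply=> z zr; rewrite reCD mulN1r reCN -lnE //; exact: H.
Qed.

Lemma ln_near1 (x t : R) : `|x - 1| <= t -> t <= 1 / 2 -> `|ln x| <= 2 * t.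
Proof.
rewrite ler_norml => /andP[h1 h2] t2; have x0 : 0 < x by lra.
have l1 : ln x <= x - 1 by have := @le_ln1Dx R (x - 1) ltac:(lra); rewrite addrC subrK.
have l2 : ln x^-1 <= x^-1 - 1.
  have := @le_ln1Dx R (x^-1 - 1); rewrite [1 + _]addrC subrK; apply.
  by rewrite ltrBDl subrr invr_gt0.
rewrite lnV ?posrE // in l2.
have l3 : x^-1 - 1 <= 2 * t.
  rewrite lerBlDr -div1r ler_pdivrMr //; nra.
rewrite ler_norml; apply/andP; split; lra.
Qed.

(* A truncation of [f] is a product of factors [1 - w z], for each of which the
   logarithm is explicit; discrete Fourier inversion of the real part, as in the
   Borel-Caratheodory theorem, then gives the coefficients. *)
Lemma logT_ps_bound r (a c : nat -> K) f g eta d n D :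
  a 0%N = 1 -> 0 < r -> ps r a f -> ps r c g ->
  (forall z, modC z <= r -> f z != 0 /\ `|ln (modC (f z)) - reC (g z)| <= eta) ->
  (0 < n)%N -> (n <= d)%N -> (n < D)%N ->
  modC ((logT d (tr D a))`_n - c n) * r ^+ n <= 2 * eta.
Proof.
move=> a0 r0 hf hg H n0 nd nD; rewrite leNgt; apply/negP => Hlt.
(* One eighth of the supposed excess: the truncation only weakens the bound to 2 (eta + 2 e), which
   absorbs half of it. *)
pose e := (modC ((logT d (tr D a))`_n - c n) * r ^+ n - 2 * eta) / 8.
have e0 : 0 < e by rewrite /e; lra.
have [[C hC] _] := hg.
(* A lower bound for |f| on the disc, since ln |f| is at least Re g - eta; it converts the absolute
   truncation error into a relative one and keeps the truncation free of zeros. *)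
pose B := expR (- (eta + C)).
have B0 : 0 < B by exact: expR_gt0.
have fB z : modC z <= r -> B <= modC (f z).
  move=> zr; have [fz0 hz] := H z zr.
  have m0 : 0 < modC (f z) by rewrite modC_gt0.
  rewrite -[leRHS]lnK ?posrE // ler_expR.
  have := ps_bound hC hg zr; have := reC_le (g z); move: hz.
  by rewrite !ler_norml => /andP[h1 h2] /andP[h3 h4] h5; lra.
pose t := Num.min e (1 / 4).
have t0 : 0 < t by rewrite lt_min e0; lra.
have te : t <= e by rewrite /t ge_min lexx.
have t4 : t <= 1 / 4 by rewrite /t ge_min lexx orbT.
have [M HM] := ps_tail_unif (ltW r0) hf (mulr_gt0 t0 B0).
pose m := maxn M D.
have hm z : modC z <= r -> `|modC (tr m a).[z] / modC (f z) - 1| <= t.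
  move=> zr; have := HM m (leq_maxl _ _) z zr.
  have -> : pss a z m = (tr m a).[z] by rewrite horner_poly.
  move=> h; have fz := fB z zr.
  have m0 : 0 < modC (f z) by lra.
  have -> : modC (tr m a).[z] / modC (f z) - 1 = (modC (tr m a).[z] - modC (f z)) / modC (f z).
    by rewrite mulrBl mulfV // gt_eqF.
  rewrite normrM normfV (gtr0_norm m0) ler_pdivrMr //.
  apply: le_trans (_ : t * B <= _); last by rewrite ler_pM2l.
  apply: le_trans h.
  have h1 := modCD (f z - (tr m a).[z]) (tr m a).[z]; rewrite subrK in h1.
  have h2 := modCB_le (f z) (f z - (tr m a).[z]).
  rewrite opprB addrC subrK in h2.
  by rewrite ler_norml; apply/andP; split; lra.
have hn z : modC z <= r -> (tr m a).[z] != 0.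
  move=> zr; apply/eqP => h; have := hm z zr; rewrite h modC0 mul0r sub0r normrN1; lra.
have tE : (logT d (tr m a))`_n = (logT d (tr D a))`_n.
  by apply: (eqX_logT d (n := D)) => //; apply: eqX_tr; rewrite leq_maxr.
have T0 : (tr m a)`_0 = 1 by rewrite coef_tr // /m; lia.
have := logT_poly_bound T0 r0 hn hg (eta := eta + 2 * t) (d := d) (n := n).
move=> /(_ _ n0 nd) h.
suff : modC ((logT d (tr m a))`_n - c n) * r ^+ n <= 2 * (eta + 2 * t).
  by rewrite tE => h'; move: te e0; rewrite /e; lra.
apply: h => z zr; have zr' : modC z <= r by rewrite zr.
have [fz0 hz] := H z zr'.
have m0 : 0 < modC (f z) by rewrite modC_gt0.
have m1 : 0 < modC (tr m a).[z] by rewrite modC_gt0 hn.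
have l := ln_near1 (hm z zr') ltac:(lra).
rewrite ln_div ?posrE // in l.
have -> : ln (modC (tr m a).[z]) - reC (g z) =
  (ln (modC (tr m a).[z]) - ln (modC (f z))) + (ln (modC (f z)) - reC (g z)) by ring.
by apply: le_trans (ler_normD _ _) _; lra.
Qed.

End Fourier.

(** * Schur functions as Laurent polynomials *)

Section SchurLaurent.

Definition sdec (N : nat) (l : 'I_N -> int) : Prop :=
  forall i j : 'I_N, (i < j)%N -> l j < l i.

Definition vdm (F : comPzRingType) (N : nat) (u : 'I_N -> F) : F :=
  \prod_(i < N) \prod_(j < N | (i < j)%N) (u i - u j).

(** A Laurent polynomial given by the list of its exponents with repetition. Positivity of the
    coefficients is built in, and one list serves over every field. *)
Definition laur (F : unitRingType) (N : nat) (ns : seq ('I_N -> int)) (u : 'I_N -> F) : F :=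
  \sum_(n <- ns) \prod_(i < N) u i ^ n i.

Lemma vdm_recl (F : comPzRingType) (N : nat) (u : 'I_N.+1 -> F) :
  vdm u = \prod_(j < N) (u ord0 - u (lift ord0 j)) * vdm (fun i => u (lift ord0 i)).
Proof.
rewrite /vdm big_ord_recl; congr (_ * _).
  by rewrite big_mkcond big_ord_recl /= mul1r; apply: eq_bigr.
apply: eq_bigr => i _; rewrite big_mkcond big_ord_recl /= mul1r [RHS]big_mkcond.
by apply: eq_bigr => j _; rewrite /bump !leq0n !add1n ltnS.
Qed.

Lemma vdm_scale (F : comPzRingType) (N : nat) (u : 'I_N -> F) c :
  vdm (fun i => u i * c) = vdm u * c ^+ (\sum_(i < N) \sum_(j < N | (i < j)%N) 1%N).
Proof.
rewrite /vdm -prodrXr -big_split; apply: eq_bigr => i _.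
by rewrite -prodrXr -big_split; apply: eq_bigr => j _; rewrite /= expr1 mulrBl.
Qed.

(** Multiplication by a unitriangular matrix subtracts from each column its successor, which leaves
    a single 1, in the last place of the first row. *)
Lemma det_col_differences (F : comPzRingType) (N : nat) (W : 'M[F]_N.+1) :
  (forall j, W ord0 j = 1) ->
  \det W = (-1) ^+ N *
    \det (\matrix_(i < N, j < N) (W (lift ord0 i) (widen_ord (leqnSn N) j) - W (lift ord0 i) (lift ord0 j))).
Proof.
move=> W0.
pose B : 'M[F]_N.+1 := \matrix_(i, j) ((i == j)%:R - (i == j.+1 :> nat)%:R).
have dB : \det B = 1.
  rewrite det_trig; first by apply: big1 => i _; rewrite mxE eqxx ltn_eqF // subr0.
  apply/is_trig_mxP => i j ij; rewrite mxE -val_eqE /= ltn_eqF // ltn_eqF ?subr0 //.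
  exact: ltnW.
have WB i j : (W *m B) i j = W i j - (if (j.+1 < N.+1)%N then W i (inord j.+1) else 0).
  rewrite mxE (eq_bigr (fun k => W i k * (k == j)%:R - W i k * (k == j.+1 :> nat)%:R)).
    rewrite big_split /= sumrN (bigD1 j) //= eqxx mulr1 big1 ?addr0; last first.
      by move=> k /negbTE ->; rewrite mulr0.
    congr (_ - _); case: ltnP => h.
      rewrite (bigD1 (inord j.+1)) //= inordK // eqxx mulr1 big1 ?addr0 // => k.
      by rewrite -val_eqE /= inordK // => /negbTE ->; rewrite mulr0.
    by rewrite big1 // => k _; rewrite ltn_eqF ?mulr0 //; apply: leq_trans h.
  by move=> k _; rewrite mxE mulrBr.
have -> : \det W = \det (W *m B) by rewrite det_mulmx dB mulr1.
rewrite (expand_det_row _ ord0) (bigD1 ord_max) //= [X in _ + X]big1 ?addr0; last first.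
  move=> j jm; rewrite WB !W0 ifT ?subrr ?mul0r //.
  rewrite ltnS ltn_neqAle -ltnS ltn_ord andbT; apply: contra jm => /eqP jN.
  by apply/eqP/val_inj.
rewrite WB /= ltnn subr0 W0 mul1r /cofactor add0n; congr (_ * \det _).
apply/matrixP => i j; rewrite [RHS]mxE [LHS]mxE [LHS]mxE.
have -> : lift ord_max j = widen_ord (leqnSn N) j.
  by apply: val_inj; rewrite /= /bump leqNgt ltn_ord.
rewrite WB /= ltnS ltn_ord; congr (_ - W _ _).
by apply: val_inj; rewrite /= inordK ?ltnS.
Qed.

Lemma det_sum_cols (F : comPzRingType) (N M : nat) (Q : 'I_N -> pred 'I_M)
    (S : 'I_N -> 'I_N -> 'I_M -> F) :
  \det (\matrix_(i, j) \sum_(k < M | Q j k) S i j k) =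
  \sum_(f in family Q) \det (\matrix_(i, j) S i j (f j)).
Proof.
rewrite -det_tr; under [RHS]eq_bigr do rewrite -det_tr.
rewrite /determinant exchange_big /=; apply: eq_bigr => s _.
rewrite -big_distrr /=; congr (_ * _).
transitivity (\prod_i \sum_(k < M | Q i k) S (s i) i k).
  by apply: eq_bigr => i _; rewrite !mxE.
rewrite bigA_distr_big_dep; apply: eq_bigr => f _.
by apply: eq_bigr => i _; rewrite !mxE.
Qed.

Lemma geom_expz (F : fieldType) (x : F) (a b : int) : x != 0 -> b <= a ->
  x ^ a - x ^ b = (x - 1) * \sum_(k < `|a - b|%N) x ^ (b + k%:Z).
Proof.
move=> x0 ba.
have -> : x ^ a = x ^ b * x ^+ `|a - b|%N.
  rewrite exprnP -expfzDr //; congr (_ ^ _); lia.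
rewrite -[X in _ - X]mulr1 -mulrBr subrX1 mulrCA; congr (_ * _).
by rewrite big_distrr; apply: eq_bigr => k _; rewrite expfzDr // -exprnP.
Qed.

(* Branching: normalising u_0 = 1 and subtracting adjacent columns of det (u_i ^ l_j) leaves
   a sum of determinants over interlacing exponents in one variable fewer. *)
Lemma alternant_laurent (N : nat) (l : 'I_N -> int) : sdec l ->
  exists2 ns : seq ('I_N -> int), (0 < size ns)%N &
    forall (F : fieldType) (u : 'I_N -> F), (forall i, u i != 0) ->
      \det (\matrix_(i < N, j < N) u i ^ l j) = vdm u * laur ns u.
Proof.
elim: N l => [|N IH] l hl.
  exists [:: fun=> 0] => // F u _.
  by rewrite det_mx00 /vdm /laur big_seq1 !big_ord0 mulr1.
pose l1 (j : 'I_N) := l (widen_ord (leqnSn N) j).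
pose l2 (j : 'I_N) := l (lift ord0 j).
have l21 j : l2 j < l1 j by apply: hl; rewrite /= /bump add1n.
pose D (j : 'I_N) := `|l1 j - l2 j|%N.
pose M := (\max_j D j)%N.
pose Q (j : 'I_N) : pred 'I_M := fun k => (k < D j)%N.
pose mm (f : {ffun 'I_N -> 'I_M}) (j : 'I_N) : int := l2 j + (f j : nat)%:Z.
have hmm (f : {ffun 'I_N -> 'I_M}) : f \in family Q -> sdec (mm f).
  move=> /familyP hf i j ij; rewrite /mm.
  have fj : (f j < D j)%N := hf j.
  have h1 : l1 j <= l2 i.
    rewrite /l1 /l2; case: (ltngtP j i.+1) => [|ji|ji]; first by lia.
      by apply/ltW/hl; rewrite /= /bump add1n.
    by rewrite le_eqVlt; apply/orP; left; apply/eqP; congr l; apply: val_inj; rewrite /= /bump add1n.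
  by have := l21 j; move: fj; rewrite /D; lia.
have [nsf Hns] : {nsf : {ffun 'I_N -> 'I_M} -> seq ('I_N -> int) & forall f, f \in family Q ->
    (0 < size (nsf f))%N /\ forall (F : fieldType) (u : 'I_N -> F), (forall i, u i != 0) ->
      \det (\matrix_(i < N, j < N) u i ^ mm f j) = vdm u * laur (nsf f) u}.
  apply: (@choice _ _ (fun f ns => f \in family Q ->
    (0 < size ns)%N /\ forall (F : fieldType) (u : 'I_N -> F), (forall i, u i != 0) ->
      \det (\matrix_(i < N, j < N) u i ^ mm f j) = vdm u * laur ns u)) => f.
  case: (boolP (f \in family Q)) => hf; last by exists [::].
  by have [ns h1 h2] := IH _ (hmm f hf); exists ns.
pose cN := (\sum_(i < N) \sum_(j < N | (i < j)%N) 1)%N.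
(* The exponent of u_0 restores homogeneity after the normalisation u_0 = 1: N comes from the
   factors u_i / u_0 - 1, cN from the smaller Vandermonde product, and the sum of the [n j] from the
   monomial itself. *)
pose g (n : 'I_N -> int) (i : 'I_N.+1) : int :=
  if unlift ord0 i is Some j then n j
  else \sum_(j < N.+1) l j - N%:Z - cN%:Z - \sum_(j < N) n j.
exists (flatten [seq map g (nsf f) | f <- enum (family Q)]).
  have [f0 hf0] : exists f, f \in family Q.
    have hD (j : 'I_N) : (0 < M)%N.
      by apply: leq_trans (leq_bigmax j); rewrite /D; have := l21 j; lia.
    exists [ffun j => Ordinal (hD j)]; apply/familyP => j.
    by rewrite ffunE; change (0 < D j)%N; rewrite /D; have := l21 j; lia.
  rewrite size_flatten /shape -map_comp sumnE big_map.
  rewrite (bigD1_seq f0) ?mem_enum ?enum_uniq //= size_map.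
  by have [h _] := Hns f0 hf0; rewrite ltn_addr.
move=> F u u0.
pose c := u ord0; have c0 : c != 0 := u0 ord0.
pose w (i : 'I_N) := u (lift ord0 i) * c^-1.
have w0 i : w i != 0 by rewrite mulf_neq0 ?invr_eq0.
have -> : \matrix_(i, j) u i ^ l j =
    (\matrix_(i, j) (u i * c^-1) ^ l j) *m diag_mx (\row_j c ^ l j).
  apply/matrixP => i j; rewrite mul_mx_diag !mxE -expfzMl -mulrA mulVf ?mulr1 //.
rewrite det_mulmx det_diag det_col_differences; last first.
  by move=> j; rewrite mxE mulfV // exp1rz.
have -> : (\matrix_(i < N, j < N)
    ((\matrix_(i0, j0) (u i0 * c^-1) ^ l j0) (lift ord0 i) (widen_ord (leqnSn N) j) -
     (\matrix_(i0, j0) (u i0 * c^-1) ^ l j0) (lift ord0 i) (lift ord0 j))) =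
   diag_mx (\row_i (w i - 1)) *m (\matrix_(i, j) \sum_(k < M | Q j k) w i ^ (l2 j + (k : nat)%:Z)).
  apply/matrixP => i j; rewrite mul_diag_mx !mxE (geom_expz (w0 i) (ltW (l21 j))).
  congr (_ * _); rewrite (big_ord_widen M (fun k => w i ^ (l2 j + k%:Z))) //.
  exact: (leq_bigmax j).
rewrite det_mulmx det_diag det_sum_cols.
rewrite (eq_bigr (fun f => vdm w * laur (nsf f) w)); last first.
  by move=> f hf; have [_ h] := Hns f hf; rewrite -h.
rewrite -big_distrr /= vdm_recl.
have -> : vdm w = vdm (fun i => u (lift ord0 i)) * c ^- cN.
  by rewrite /w vdm_scale exprVn.
have -> : \prod_i (\row_i0 (w i0 - 1)) 0 i =
   (-1) ^+ N * c ^- N * \prod_(j < N) (u ord0 - u (lift ord0 j)).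
  rewrite -exprVn -exprMn.
  have -> : (-1 * c^-1) ^+ N = \prod_(j < N) (-1 * c^-1) by rewrite prodr_const card_ord.
  rewrite -big_split /=.
  by apply: eq_bigr => j _; rewrite mxE /w -/c; field.
have -> : \prod_i (\row_j c ^ l j) 0 i = c ^ (\sum_(j < N.+1) l j).
  rewrite (eq_bigr (fun i => c ^ l i)); last by move=> i _; rewrite mxE.
  by elim/big_rec2: _ => [|i x y _ ->]; rewrite ?expr0z // expfzDr.
have s1 : (-1 : F) ^+ N * (-1) ^+ N = 1 by rewrite -exprMn mulrNN mulr1 expr1n.
set V := \prod_(j < N) _; set V' := vdm _; set S := \sum_(f in _) _.
set L := \sum_(j < N.+1) l j.
have -> : (-1) ^+ N * ((-1) ^+ N * c ^- N * V * (V' * c ^- cN * S)) * c ^ L =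
  ((-1) ^+ N * (-1) ^+ N) * (V * V' * (c ^ L * c ^- N * c ^- cN * S)) by ring.
rewrite s1 mul1r; congr (_ * _).
rewrite /laur big_flatten big_map big_enum /= /S big_distrr /=; apply: eq_bigr => f hf.
rewrite big_map /laur big_distrr /=; apply: eq_bigr => n _.
rewrite big_ord_recl /g unlift_none.
rewrite [X in _ = _ * X](eq_bigr (fun i => u (lift ord0 i) ^ n i)); last first.
  by move=> i _; rewrite liftK.
have -> : \prod_(i < N) w i ^ n i = c ^ (- \sum_(j < N) n j) * \prod_(i < N) u (lift ord0 i) ^ n i.
  have -> : c ^ (- \sum_(j < N) n j) = \prod_(j < N) c ^ (- n j).
    rewrite -sumrN; elim/big_rec2: _ => [|i x y _ <-]; rewrite ?expr0z // expfzDr //.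
  rewrite -big_split; apply: eq_bigr => i _.
  by rewrite /w expfzMl mulrC exprz_inv.
rewrite !expfzDr // -!exprnN; ring.
Qed.

End SchurLaurent.

(** * Schur functions off and on the diagonals *)

Section SchurLimit.
Variable R : realType.
Local Notation K := (CC R).

Definition lexp (N : nat) (l : signature N) (j : 'I_N) : int :=
  sgv l j + (N - 1 - j)%N%:Z.

Lemma sdec_lexp N (l : signature N) : sdec (lexp l).
Proof.
move=> i j ij; rewrite /lexp.
have := valP l => /forallP /(_ i) /forallP /(_ j) /implyP /(_ (ltnW ij)).
by rewrite -/(sgv l i) -/(sgv l j); have := ltn_ord j; move: ij; lia.
Qed.

Section Cvg.
Context (T : Type) (F : set_system T) {FF : Filter F}.
Implicit Types f g : T -> K.

Lemma mulK_cvg f g (a b : K) :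
  f @ F --> a -> g @ F --> b -> (fun x => f x * g x) @ F --> a * b.
Proof. by move=> fa gb; exact: (@cvgM K T F FF f g a b fa gb). Qed.

Lemma eqK_cvg f g (a b : K) : f @ F --> a -> (forall x, f x = g x) -> a = b -> g @ F --> b.
Proof. by move=> fa /funext <- <-. Qed.

Lemma exprz_cvg f (a : K) (n : int) :
  a != 0 -> f @ F --> a -> (fun x => f x ^ n) @ F --> a ^ n.
Proof.
move=> a0 fa; have P k : (fun x => f x ^+ k) @ F --> a ^+ k.
  elim: k => [|k IH].
    apply: (@eqK_cvg (fun=> 1) _ 1 _ (cvg_cst (1 : K))) => [x|]; by rewrite expr0.
  by apply: (eqK_cvg (mulK_cvg fa IH)) => [x|]; rewrite exprS.
case: n => n; first exact: P.
have an0 : a ^+ n.+1 != 0 by rewrite expf_neq0.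
exact: (@cvgV K T F FF (fun x => f x ^+ n.+1) (a ^+ n.+1) an0 (P n.+1)).
Qed.

Lemma prodK_cvg (I : Type) (t : seq I) (f : I -> T -> K) (a : I -> K) :
  (forall i, f i @ F --> a i) ->
  (fun x => \prod_(i <- t) f i x) @ F --> \prod_(i <- t) a i.
Proof.
move=> H; elim: t => [|i t IH].
  apply: (@eqK_cvg (fun=> 1) _ 1 _ (cvg_cst (1 : K))) => [x|]; by rewrite big_nil.
by apply: (eqK_cvg (mulK_cvg (H i) IH)) => [x|]; rewrite big_cons.
Qed.

Lemma sumK_cvg (I : Type) (t : seq I) (f : I -> T -> K) (a : I -> K) :
  (forall i, f i @ F --> a i) ->
  (fun x => \sum_(i <- t) f i x) @ F --> \sum_(i <- t) a i.
Proof.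
move=> H; elim: t => [|i t IH].
  apply: (@eqK_cvg (fun=> 0) _ 0 _ (cvg_cst (0 : K))) => [x|]; by rewrite big_nil.
have h := @cvgD K K T F FF (f i) (fun x => \sum_(i <- t) f i x) _ _ (H i) IH.
by apply: (eqK_cvg h) => [x|]; rewrite big_cons.
Qed.

End Cvg.

Lemma laur_cvg (N : nat) (ns : seq ('I_N -> int)) (u : 'rV[K]_N) :
  (forall i, u 0 i != 0) ->
  (fun v : 'rV[K]_N => laur ns (fun i => v 0 i)) @ u --> laur ns (fun i => u 0 i).
Proof.
move=> u0; have FF : Filter (nbhs u) by exact: nbhs_filter.
apply: (@sumK_cvg _ (nbhs u) FF) => n; apply: (@prodK_cvg _ (nbhs u) FF) => i.
apply: (@exprz_cvg _ (nbhs u) FF) => //.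
exact: coord_continuous.
Qed.

(** Move u along the direction (0, 1, 2, ...). Two coordinates collide only at the roots of a
    nonzero polynomial in the step, and more small steps are tried than it can have roots. *)
Lemma closure_distinct (N : nat) (u : 'rV[K]_N) : closure distinct_coords u.
Proof.
move=> B /nbhs_ballP [e /= /gt0_ofR [r r0 ->]] HB.
pose p : {poly K} := \prod_(i < N) \prod_(j < N | i != j)
   ((u 0 i - u 0 j)%:P + ((i : nat)%:R - (j : nat)%:R) *: 'X).
have p0 : p != 0.
  rewrite /p; apply/prodf_neq0 => i _; apply/prodf_neq0 => j ij.
  apply/eqP => /(congr1 (fun q : {poly K} => q`_1)).
  rewrite coefD coefC coefZ coefX coef0 /= add0r mulr1 => /eqP.
  by rewrite subr_eq0 eqr_nat => /eqP /val_inj ijE; move: ij; rewrite ijE eqxx.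
pose t (k : nat) : R := r / (N.+1%:R * k.+1%:R).
have N0 : 0 < N.+1%:R :> R by rewrite ltr0Sn.
have k0 k : 0 < k.+1%:R :> R by rewrite ltr0Sn.
pose ts := [seq (ofR (t k) : K) | k <- iota 0 (size p)].
have uts : uniq ts.
  rewrite map_inj_uniq ?iota_uniq // => a b /ofR_inj /eqP.
  rewrite /t !invfM !mulrA; have rN : r / N.+1%:R != 0 by rewrite mulf_neq0 ?invr_eq0 ?gt_eqF.
  by rewrite (inj_eq (mulfI rN)) (inj_eq invr_inj) eqr_nat eqSS => /eqP.
have [k hk] : exists k, ~~ root p (ofR (t k)).
  apply: contrapT => /forallNP H.
  have := @max_poly_roots _ p ts p0; rewrite uts => /(_ _ isT).
  rewrite size_map size_iota ltnn => H'; suff : false by []; apply: H'.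
  by apply/allP => _ /mapP [k _ ->]; apply/negPn/negP; exact: H.
exists (\row_i (u 0 i + ofR (t k) * (i : nat)%:R)); split.
  move=> i j ij; rewrite !mxE; apply/eqP => E.
  move: hk; rewrite /root /p horner_prod => /negP; apply.
  rewrite (bigD1 i) //= horner_prod (bigD1 j) //= hornerD hornerC hornerZ hornerX.
  have -> : u 0 i - u 0 j + ((i : nat)%:R - (j : nat)%:R) * ofR (t k) =
     (u 0 i + ofR (t k) * (i : nat)%:R) - (u 0 j + ofR (t k) * (j : nat)%:R) by ring.
  by rewrite E subrr !mul0r.
apply: HB; split=> [|a b]; first by rewrite -ofR0 ltr_ofR.
rewrite (ord1 a) mxE /ball /= opprD addrA subrr sub0r normrN.
rewrite normE ltr_ofR modCM modC_nat modC_ofR ger0_norm; last first.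
  by rewrite divr_ge0 ?mulr_ge0 ?ltW.
rewrite /t mulrAC ltr_pdivrMr ?mulr_gt0 // ltr_pM2l //.
apply: lt_le_trans (_ : N.+1%:R <= _); first by rewrite ltr_nat ltnS ltnW.
by rewrite -natrM ler_nat leq_pmulr.
Qed.

(** The defining ratio agrees near u with a continuous Laurent polynomial wherever the coordinates
    are distinct, and such points accumulate at u, so the limit is its value. *)
Lemma schur_laurent (N : nat) (l : signature N) :
  exists ns : seq ('I_N -> int), [/\ (0 < size ns)%N,
    forall (F : fieldType) (u : 'I_N -> F), (forall i, u i != 0) ->
      \det (\matrix_(i < N, j < N) u i ^ lexp l j) = vdm u * laur ns u &
    forall u : 'rV[K]_N, (forall i, u 0 i != 0) ->
      schur l u = laur ns (fun i => u 0 i)].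
Proof.
have [ns ns0 H] := alternant_laurent (sdec_lexp l).
exists ns; split=> // u u0; rewrite /schur.
have PF : ProperFilter (within distinct_coords (nbhs u)).
  by apply: within_nbhs_proper; exact: closure_distinct.
apply: cvg_lim => //.
have nz : \forall v \near u, forall i : 'I_N, (v : 'rV[K]_N) 0 i != 0.
  have FF : Filter (nbhs u) by exact: nbhs_filter.
  apply: (@filter_forall _ _ (fun (i : 'I_N) (v : 'rV[K]_N) => v 0 i != 0) _ FF) => i.
  have : (fun v : 'rV[K]_N => v 0 i) @ u --> u 0 i by exact: coord_continuous.
  by move=> /cvgr_neq0 /(_ (u0 i)).
move=> A /(laur_cvg u0) hA.
have hA' : nbhs u [set v : 'rV[K]_N | A (laur ns (fun i => v 0 i))] := hA.
change (nbhs u [set v : 'rV[K]_N | distinct_coords v -> A (schur_ratio l v)]).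
have FF : Filter (nbhs u) by exact: nbhs_filter.
have nz' : nbhs u [set v : 'rV[K]_N | forall i, v 0 i != 0] := nz.
apply: (@filterS _ (nbhs u) FF _ _ _ (@filterI _ (nbhs u) FF _ _ nz' hA')) => v [v0 Av] vd.
rewrite /schur_ratio.
have := H _ (fun i => v 0 i) v0; rewrite /vdm => ->.
rewrite mulrC mulKf; first exact: Av.
apply/prodf_neq0 => i _; apply/prodf_neq0 => j ij; rewrite subr_eq0; apply: vd.
by rewrite -val_eqE /= neq_ltn ij.
Qed.

End SchurLimit.

(** * Divided differences of multivariate polynomials *)

Section Mpoly.
Variables (N : nat) (F : fieldType).
Local Notation MP := (mpoly N F).
Local Notation Xv i := (mpolyX F (mnm1 i) : MP).
Implicit Types (f g h p q : MP) (i j k : 'I_N) (a b m : multinom N) (s : 'S_N).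

Lemma msym_var s i : msym s (Xv i) = Xv (s i).
Proof.
rewrite msymX; congr (mpolyX _ _); apply/mnmP => k.
rewrite mnmE !mnm1E; congr (nat_of_bool _).
by apply/eqP/eqP => [->|<-]; rewrite ?permKV ?permK.
Qed.

Lemma mpoly_ring_ind (P : MP -> Prop) :
  P 0 -> P 1 -> (forall p q, P p -> P q -> P (p + q)) ->
  (forall c p, P p -> P (c *: p)) -> (forall p q, P p -> P q -> P (p * q)) ->
  (forall i, P (Xv i)) -> forall p, P p.
Proof.
move=> P0 P1 HD HZ HM HX p; rewrite (mpolyE p).
elim/big_rec: _ => [//|m x _ Px]; apply: (HD) => //; apply: (HZ).
rewrite mpolyXE_id; elim/big_rec: _ => [//|i y _ Py]; apply: (HM) => //.
by elim: (m i) => [|e IH]; rewrite ?expr0 // exprS; apply: (HM).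
Qed.

Lemma meval_msym s p (v : 'I_N -> F) : meval v (msym s p) = meval (v \o s) p.
Proof.
elim/mpoly_ring_ind: p => [||p q hp hq|c p hp|p q hp hq|i].
- by rewrite msym0 !meval0.
- by rewrite msym1 !meval1.
- by rewrite msymD !mevalD hp hq.
- by rewrite msymZ !mevalZ hp.
- by rewrite msymM !mevalM hp hq.
- by rewrite msym_var !mevalXU.
Qed.

Lemma mderiv_msym s k p : mderiv (s k) (msym s p) = msym s (mderiv k p).
Proof.
have dX i j : mderiv i (Xv j) = (i == j)%:R.
  rewrite mderivX mnm1E eq_sym; case: eqP => [->|_]; rewrite ?scale0r //.
  have -> : mnm_sub (mnm1 j) (mnm1 j) = mnm0 by apply/mnmP => l; rewrite mnmBE subnn mnm0E.
  by rewrite scale1r mpolyX0.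
elim/mpoly_ring_ind: p => [||p q hp hq|c p hp|p q hp hq|i].
- by rewrite !(msym0, mderiv0).
- by rewrite msym1 -mpolyC1 !mderivC msym0.
- by rewrite !(msymD, mderivD) hp hq.
- by rewrite !(msymZ, mderivZ) hp.
- by rewrite !(msymM, mderivM, msymD) hp hq.
- rewrite msym_var !dX (inj_eq perm_inj); case: (k == i); by rewrite ?msym1 ?msym0.
Qed.

Lemma subX_neq0 i j : i != j -> Xv i - Xv j != 0.
Proof.
move=> ij; apply/eqP => /(congr1 (mcoeff (mnm1 i))).
have ne : (mnm1 j == mnm1 i) = false.
  by apply/eqP => /mnmP /(_ i); rewrite !mnm1E eqxx eq_sym (negbTE ij).
rewrite mcoeffB !mcoeffX mcoeff0 eqxx ne subr0.
by move/eqP; rewrite oner_eq0.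
Qed.

(** The twisted Leibniz rule for p q propagates divisibility from the variables to the whole
    ring. *)
Lemma divdiff_ex i j p : exists g, (Xv i - Xv j) * g = p - msym (tperm i j) p.
Proof.
elim/mpoly_ring_ind: p => [||p q [g hg] [h hh]|c p [g hg]|p q [g hg] [h hh]|k].
- by exists 0; rewrite msym0 subrr mulr0.
- by exists 0; rewrite msym1 subrr mulr0.
- by exists (g + h); rewrite mulrDr hg hh msymD; ring.
- by exists (c *: g); rewrite -scalerAr hg msymZ scalerBr.
- exists (p * h + g * msym (tperm i j) q).
  rewrite mulrDr mulrCA hh mulrA hg msymM; ring.
- rewrite msym_var; case: tpermP => [->|->|_ _].
  + by exists 1; rewrite mulr1.
  + by exists (-1); ring.
  + by exists 0; rewrite subrr mulr0.
Qed.

Definition Nd i j p : MP := projT1 (cid (divdiff_ex i j p)).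

Lemma NdP i j p : (Xv i - Xv j) * Nd i j p = p - msym (tperm i j) p.
Proof. by rewrite /Nd; case: cid. Qed.

Lemma Nd_unique i j p g : i != j -> (Xv i - Xv j) * g = p - msym (tperm i j) p -> g = Nd i j p.
Proof. by move=> /subX_neq0 ij; rewrite -NdP => /(mulfI ij). Qed.

Lemma NdD i j p q : i != j -> Nd i j (p + q) = Nd i j p + Nd i j q.
Proof. by move=> ij; apply/esym/Nd_unique => //; rewrite mulrDr !NdP msymD; ring. Qed.

Lemma NdZ i j c p : i != j -> Nd i j (c *: p) = c *: Nd i j p.
Proof. by move=> ij; apply/esym/Nd_unique => //; rewrite -scalerAr NdP msymZ scalerBr. Qed.

Lemma Nd_sym i j p q : i != j -> msym (tperm i j) p = p -> Nd i j (p * q) = p * Nd i j q.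
Proof.
move=> ij ps; apply/esym/Nd_unique => //; rewrite mulrCA NdP msymM ps; ring.
Qed.

Lemma Nd_eval i j p (v : 'I_N -> F) :
  (v i - v j) * meval v (Nd i j p) = meval v p - meval (v \o tperm i j) p.
Proof.
by rewrite -(meval_msym (tperm i j) p) -mevalB -NdP mevalM mevalB !mevalXU.
Qed.

Lemma mcoeff_varM i p m : mcoeff (mnm_add m (mnm1 i)) (Xv i * p) = mcoeff m p.
Proof. by rewrite mulrC addmC mcoeffMX. Qed.

Lemma mcoeff_varM0 i p m : m i = 0%N -> mcoeff m (Xv i * p) = 0.
Proof.
move=> mi; rewrite mcoeffM big1 // => -[k1 k2] /= /eqP /mnmP /(_ i).
rewrite mi mnmDE mcoeffX; case: eqP => [<-|_ _]; last by rewrite mul0r.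
by rewrite mnm1E eqxx.
Qed.

(** The monomial [m] times x_i (x_i / x_j)^e. *)
Definition mshift i j m (e : nat) : multinom N :=
  mnm_add (mnm_sub m (mnm_muln (mnm1 j) e)) (mnm_muln (mnm1 i) e.+1).

Lemma mshiftE i j m e k : i != j -> (e <= m j)%N ->
  mshift i j m e k = if k == i then (m i + e.+1)%N else if k == j then (m j - e)%N else m k.
Proof.
move=> ij ej; rewrite mnmDE mnmBE !mulmnE !mnm1E.
rewrite ![_ == k]eq_sym; case: (altP (k =P i)) => [->|ki].
  by rewrite (negbTE ij) mul0n subn0 mul1n.
case: (altP (k =P j)) => [->|kj]; by rewrite ?mul1n ?mul0n ?subn0 addn0.
Qed.

Lemma mdeg_mshift i j m e : i != j -> (e <= m j)%N -> mdeg (mshift i j m e) = (mdeg m).+1.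
Proof.
move=> ij ej.
have le : lem (mnm_muln (mnm1 j) e) m.
  apply/mnm_lepP => k; rewrite mulmnE mnm1E; case: eqP => [<-|_]; by rewrite ?mul1n ?mul0n.
have := mdegD (mnm_sub m (mnm_muln (mnm1 j) e)) (mnm_muln (mnm1 j) e).
rewrite submK // mdegMn mdeg1 mul1n => ->.
rewrite /mshift mdegD mdegMn mdeg1 mul1n; lia.
Qed.

(** Long division by x_i - x_j: a coefficient of the quotient is one of the dividend plus the
    quotient coefficient with one factor x_j turned into x_i; iterate until x_j is exhausted. All
    coefficients used have degree one more than [m], and their number depends on the exponent of x_j
    only. *)
Lemma Nd_coef i j p m : i != j -> mcoeff m (Nd i j p) =
  \sum_(e < (m j).+1) mcoeff (mshift i j m e) (p - msym (tperm i j) p).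
Proof.
move=> ij; move: {2}(m j) (erefl (m j)) => c; elim: c m => [|c IH] m mj.
  rewrite mj big_ord_recl big_ord0 addr0 -NdP mulrBl mcoeffB.
  rewrite (@mcoeff_varM0 j); last by rewrite mshiftE ?mj // eq_sym (negbTE ij) eqxx.
  rewrite subr0 -(mcoeff_varM i); congr mcoeff; apply/mnmP => k.
  rewrite mshiftE ?mj // mnmDE mnm1E subn0 [i == k]eq_sym.
  case: (altP (k =P i)) => [->|_]; first by rewrite addn1.
  by case: (altP (k =P j)) => [->|_]; rewrite ?mj addn0.
rewrite mj big_ord_recl.
pose m' : multinom N := mnm_add (mnm_sub m (mnm1 j)) (mnm1 i).
have m'E k : m' k = if k == i then (m i).+1 else if k == j then c else m k.
  rewrite mnmDE mnmBE !mnm1E ![_ == k]eq_sym; case: (altP (k =P i)) => [->|ki].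
    by rewrite (negbTE ij) subn0 addn1.
  by case: (altP (k =P j)) => [->|kj]; rewrite ?mj ?subn0 ?subn1 addn0.
have m'j : m' j = c by rewrite m'E eq_sym (negbTE ij) eqxx.
have -> : \sum_(e < c.+1) mcoeff (mshift i j m (lift ord0 e)) (p - msym (tperm i j) p) =
    mcoeff m' (Nd i j p).
  rewrite (IH _ m'j) m'j; apply: eq_bigr => e _; congr mcoeff; apply/mnmP => k.
  have ec : (e <= c)%N by rewrite -ltnS.
  rewrite !mshiftE ?m'j ?mj ?lift0 // !m'E eqxx.
  case: (altP (k =P i)) => [_|ki]; first by lia.
  case: (altP (k =P j)) => [kj|kj]; first by rewrite subSS.
  by [].
rewrite -NdP mulrBl mcoeffB.
have -> : mshift i j m (ord0 : 'I_c.+2) = mnm_add m (mnm1 i).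
  apply/mnmP => k; rewrite mshiftE ?mj // mnmDE mnm1E subn0 [i == k]eq_sym.
  case: (altP (k =P i)) => [->|_]; first by rewrite addn1.
  by case: (altP (k =P j)) => [->|_]; rewrite ?mj addn0.
rewrite mcoeff_varM.
clearbody m'.
have -> : mnm_add m (mnm1 i) = mnm_add m' (mnm1 j).
  apply/mnmP => k; rewrite !mnmDE m'E !mnm1E ![_ == k]eq_sym.
  case: (altP (k =P i)) => [->|ki]; first by rewrite (negbTE ij) addn0 addn1.
  by case: (altP (k =P j)) => [->|kj]; rewrite ?mj ?addn0 ?addn1.
by rewrite mcoeff_varM subrK.
Qed.

End Mpoly.

(** * Iterated divided differences and their Lagrange formula *)

Section IteratedDifferences.
Variables (n : nat) (F : fieldType).
Local Notation MP := (mpoly n.+1 F).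
Local Notation Xv i := (mpolyX F (mnm1 i) : MP).
Implicit Types (f g p q : MP) (s : 'S_n.+1) (v w : 'I_n.+1 -> F).

Fixpoint Dl (m : nat) g : MP :=
  if m is m'.+1 then Nd ord0 (inord m) (Dl m' g) else g.

Lemma ord0_inord m : (m < n)%N -> (ord0 : 'I_n.+1) != inord m.+1.
Proof. by move=> mn; rewrite -val_eqE /= inordK. Qed.

Lemma DlD m p q : (m <= n)%N -> Dl m (p + q) = Dl m p + Dl m q.
Proof. by elim: m => [//|m IH] mn; rewrite /= IH ?NdD ?ord0_inord // ltnW. Qed.
Lemma DlZ m c p : (m <= n)%N -> Dl m (c *: p) = c *: Dl m p.
Proof. by elim: m => [//|m IH] mn; rewrite /= IH ?NdZ ?ord0_inord // ltnW. Qed.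
Lemma Dl_sym m p q : (m <= n)%N -> (forall s, msym s p = p) -> Dl m (p * q) = p * Dl m q.
Proof. by move=> + ps; elim: m => [//|m IH] mn; rewrite /= IH ?Nd_sym ?ord0_inord // ltnW. Qed.

Definition stab0 g : Prop := forall s, s ord0 = ord0 -> msym s g = g.

(** A function symmetric in all variables but x_0 only sees which variable is put in place of
    x_0. *)
Lemma stab0_eval g v s : stab0 g -> meval (v \o s) g = meval (v \o tperm ord0 (s ord0)) g.
Proof.
move=> hg; pose t := (s * tperm ord0 (s ord0))%g.
have t0 : t ord0 = ord0 by rewrite permM tpermR.
have := hg t t0 => /(congr1 (meval (v \o tperm ord0 (s ord0)))); rewrite meval_msym => <-.
by apply: meval_eq => i /=; rewrite /t permM tpermK.
Qed.

Definition injv v := forall i j, i != j -> v i != v j.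

Lemma injv_perm v s : injv v -> injv (v \o s).
Proof. by move=> hv i j ij; apply: hv; rewrite (inj_eq perm_inj). Qed.

(** The denominator at node a of the Lagrange form of a divided difference over the nodes 0, ...,
    m. *)
Definition dden (x : nat -> F) (m a : nat) : F :=
  \prod_(0 <= b < m.+1 | b != a) (x a - x b).

Lemma dden_head x m : dden x m 0 = \prod_(0 <= b < m) (x 0%N - x b.+1).
Proof. by rewrite /dden big_mkcond big_nat_recl //= mul1r. Qed.

Lemma dden_lift x m a : dden x m a.+1 =
  (x a.+1 - x 0%N) * \prod_(0 <= b < m | b != a) (x a.+1 - x b.+1).
Proof.
rewrite /dden big_mkcond big_nat_recl //=; congr (_ * _); rewrite [RHS]big_mkcond.
by apply: eq_bigr => b _; rewrite eqSS.
Qed.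

Lemma dden_last x m a : (a <= m)%N -> dden x m.+1 a = dden x m a * (x a - x m.+1).
Proof.
by move=> am; rewrite /dden big_mkcond big_nat_recr //= -big_mkcond ifT // gtn_eqF.
Qed.

Lemma dden_neq0 x m a : (forall b c, (b <= m)%N -> (c <= m)%N -> b != c -> x b != x c) ->
  (a <= m)%N -> dden x m a != 0.
Proof.
move=> hx am; rewrite /dden prodf_seq_neq0; apply/allP => b.
rewrite mem_index_iota /= => bm; apply/implyP => ba.
by rewrite subr_eq0; apply: hx => //; rewrite eq_sym.
Qed.

(** The recursion of divided differences in Lagrange form; [y] is the node sequence in which x_(m+1)
    replaces x_0. Term by term it is 1/(t - x_0) and 1/(t - x_(m+1)) being combined over a common
    denominator. *)
Lemma divdiff_step (x y G : nat -> F) m :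
  (forall b c, (b <= m.+1)%N -> (c <= m.+1)%N -> b != c -> x b != x c) ->
  y 0%N = x m.+1 -> (forall b, (b < m)%N -> y b.+1 = x b.+1) ->
  \sum_(0 <= a < m.+1) G a / dden x m a -
  (G m.+1 / dden y m 0 + \sum_(0 <= a < m) G a.+1 / dden y m a.+1) =
  (x 0%N - x m.+1) * \sum_(0 <= a < m.+2) G a / dden x m.+1 a.
Proof.
move=> hx y0 yb.
have x0m : x 0%N - x m.+1 != 0 by rewrite subr_eq0; apply: hx.
rewrite big_nat_recl // [in RHS]big_nat_recr //= [in RHS]big_nat_recl //.
have A0 : dden x m 0 != 0 by apply: dden_neq0 => // b c bm cm; apply: hx; lia.
rewrite dden_last // dden_lift.
have -> : dden y m 0 = \prod_(0 <= b < m) (x m.+1 - x b.+1).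
  rewrite dden_head y0; apply: eq_big_nat => b /andP[_ bm]; by rewrite yb.
have -> : \prod_(0 <= b < m.+1 | b != m) (x m.+1 - x b.+1) = \prod_(0 <= b < m) (x m.+1 - x b.+1).
  rewrite big_mkcond big_nat_recr //= eqxx mulr1; apply: eq_big_nat => b /andP[_ bm].
  by rewrite ltn_eqF.
set B := \prod_(0 <= b < m) (x m.+1 - x b.+1).
have B0 : B != 0.
  rewrite /B prodf_seq_neq0; apply/allP => b; rewrite mem_index_iota /= => bm.
  by rewrite subr_eq0; apply: hx; lia.
have S : \sum_(0 <= a < m) G a.+1 / dden x m a.+1 - \sum_(0 <= a < m) G a.+1 / dden y m a.+1 =
  (x 0%N - x m.+1) * \sum_(0 <= a < m) G a.+1 / dden x m.+1 a.+1.
  rewrite -sumrB big_distrr /=; apply: eq_big_nat => a /andP[_ am].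
  rewrite dden_last // !dden_lift y0 yb //.
  have -> : \prod_(0 <= b < m | b != a) (x a.+1 - y b.+1) =
            \prod_(0 <= b < m | b != a) (x a.+1 - x b.+1).
    by rewrite big_nat_cond [RHS]big_nat_cond; apply: eq_bigr => b /andP[/andP[_ bm] _]; rewrite yb.
  set Q := \prod_(0 <= b < m | b != a) (x a.+1 - x b.+1).
  have Q0 : Q != 0.
    rewrite /Q prodf_seq_neq0; apply/allP => b; rewrite mem_index_iota /= => bm.
    apply/implyP => ba; rewrite subr_eq0; apply: hx; [lia|lia|by rewrite eqSS eq_sym].
  have h1 : x a.+1 - x 0%N != 0 by rewrite subr_eq0; apply: hx; lia.
  have h2 : x a.+1 - x m.+1 != 0 by rewrite subr_eq0; apply: hx; lia.
  by field; rewrite Q0 h1 h2.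
rewrite mulrDr mulrDr -S.
have -> : (x 0%N - x m.+1) * (G 0%N / (dden x m 0 * (x 0%N - x m.+1))) = G 0%N / dden x m 0.
  by field; rewrite A0 x0m.
have -> : (x 0%N - x m.+1) * (G m.+1 / ((x m.+1 - x 0%N) * B)) = - (G m.+1 / B).
  have h : x m.+1 - x 0%N != 0 by rewrite -opprB oppr_eq0.
  by field; rewrite B0 h.
ring.
Qed.

Lemma inord0_ord0 : inord 0 = ord0 :> 'I_n.+1.
Proof. by apply: val_inj; rewrite /= inordK. Qed.

Lemma Dl_eval m g v : (m <= n)%N -> stab0 g -> injv v ->
  meval v (Dl m g) = \sum_(0 <= a < m.+1)
    meval (v \o tperm ord0 (inord a)) g / dden (fun b => v (inord b)) m a.
Proof.
elim: m v => [|m IH] v mn hg hv.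
  rewrite big_nat1 inord0_ord0 tperm1 dden_head big_geq // divr1.
  by apply: meval_eq => i /=; rewrite perm1.
pose G a := meval (v \o tperm ord0 (inord a)) g.
pose v' := v \o tperm ord0 (inord m.+1).
have v'0 : v' (inord 0) = v (inord m.+1) by rewrite /v' /= inord0_ord0 tpermL.
have v'b b : (b < m)%N -> v' (inord b.+1) = v (inord b.+1).
  move=> bm; rewrite /v' /= tpermD //; rewrite -val_eqE /= !inordK //; lia.
have v0m : v ord0 - v (inord m.+1) != 0 by rewrite subr_eq0; apply: hv; exact: ord0_inord.
apply: (mulfI v0m); rewrite /= Nd_eval.
rewrite (IH v (ltnW mn) hg hv) (IH v' (ltnW mn) hg (injv_perm _ hv)).
rewrite [X in _ - X]big_nat_recl //.
have -> : meval (v' \o tperm ord0 (inord 0)) g = G m.+1.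
  rewrite /G inord0_ord0 tperm1; apply: meval_eq => i /=; by rewrite perm1.
have Ga a : (a < m)%N -> meval (v' \o tperm ord0 (inord a.+1)) g = G a.+1.
  move=> am; have -> : meval (v' \o tperm ord0 (inord a.+1)) g =
      meval (v \o (tperm ord0 (inord a.+1) * tperm ord0 (inord m.+1))%g) g.
    by apply: meval_eq => i /=; rewrite permM.
  rewrite stab0_eval // permM tpermL tpermD //; last by rewrite -val_eqE /= !inordK //; lia.
  by rewrite -val_eqE /= !inordK //; lia.
rewrite [X in _ - (_ + X)](eq_big_nat _ _ (F2 := fun a => G a.+1 / dden (fun b => v' (inord b)) m a.+1)); last first.
  by move=> a /andP[_ am]; rewrite Ga.
have -> : v ord0 = v (inord 0) by rewrite inord0_ord0.
apply: (@divdiff_step (fun b => v (inord b)) (fun b => v' (inord b)) G) => // b c bm cm bc.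
by apply: hv; rewrite -val_eqE /= !inordK //; lia.
Qed.


End IteratedDifferences.

(** * Differential operators with Schur eigenfunctions *)

Section MpolyPoints.
Variable R : realType.
Local Notation K := (CC R).

(** Cauchy's estimate by averaging over roots of unity whose order exceeds all exponents of p and of
    [al], so that no two are confused. Coordinates outside J are set to 0, which loses nothing as
    [al] does not involve them. *)
Lemma mpoly_coef_bound (N : nat) (p : mpoly N K) (al : multinom N) (J : pred 'I_N) (eta : R) :
  (forall i, ~~ J i -> al i = 0%N) ->
  (forall v : 'I_N -> K, (forall i, if J i then modC (v i) = 1 else v i = 0) ->
     modC (meval v p) <= eta) ->
  modC (mcoeff al p) <= eta.
Proof.
move=> alJ H.
pose M := (maxn (msize p) (mdeg al).+1).+1.
have [w hw] := prim_root_ex R (ltn0Sn (maxn (msize p) (mdeg al).+1)).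
have M0 : (0 < M)%N by [].
have wM : w ^+ M = 1 := prim_expr_order hw.
have w1 : modC w = 1 := modC_prim_root M0 hw.
have w0 : w != 0 by rewrite -modC_gt0 w1.
pose vf (f : {ffun 'I_N -> 'I_M}) (i : 'I_N) : K := if J i then w ^+ f i else 0.
pose wt (f : {ffun 'I_N -> 'I_M}) : K := \prod_(i < N) (w ^- al i) ^+ f i.
pose S := \sum_(f : {ffun 'I_N -> 'I_M}) wt f * meval (vf f) p.
have le_mdeg (m : multinom N) i : (m i <= mdeg m)%N.
  by rewrite mdegE (bigD1 i) //= leq_addr.
have ip (m : multinom N) : m \in msupp p ->
    \sum_(f : {ffun 'I_N -> 'I_M}) wt f * \prod_(i < N) vf f i ^+ m i =
    (m == al)%:R * M%:R ^+ N.
  move=> mp.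
  transitivity (\prod_(i < N) \sum_(k < M) (w ^- al i) ^+ k * (if J i then w ^+ k else 0) ^+ m i).
    rewrite bigA_distr_bigA /=; apply: eq_bigr => f _.
    by rewrite /wt -big_split.
  case: (altP (m =P al)) => [->|mal].
    rewrite mul1r.
    have -> : (M%:R : K) ^+ N = \prod_(i < N) M%:R by rewrite prodr_const card_ord.
    apply: eq_bigr => i _.
    rewrite (eq_bigr (fun=> 1)) ?sumr_const ?card_ord // => k _.
    case: (boolP (J i)) => Ji.
      by rewrite -exprM mulnC exprM -exprMn mulVf ?expf_neq0 // expr1n.
    by rewrite alJ // !expr0 invr1 expr1n mulr1.
  rewrite mul0r.
  have /existsP [i hi] : [exists i, m i != al i].
    apply: contraR mal; rewrite negb_exists => /forallP h.
    by apply/eqP/mnmP => i; have := h i; rewrite negbK => /eqP.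
  rewrite (bigD1 i) //= [X in X * _](_ : _ = 0) ?mul0r //.
  case: (boolP (J i)) => Ji.
    rewrite (eq_bigr (fun k : 'I_M => (w ^- al i * w ^+ m i) ^+ k)); last first.
      by move=> k _; rewrite exprMn -!exprM [(k * _)%N]mulnC.
    apply: sum_root_of_unity.
      rewrite exprMn -exprVn -!exprM [(al i * M)%N]mulnC [(m i * M)%N]mulnC !exprM.
      by rewrite exprVn wM invr1 !expr1n mulr1.
    apply: contra hi => /eqP h.
    have mM : (m i < M)%N.
      rewrite /M ltnS; apply: leq_trans (leq_maxl _ _); apply: leq_trans (le_mdeg m i) _.
      by apply/ltnW/msize_mdeg_lt.
    have aM : (al i < M)%N.
      by rewrite /M ltnS; apply: leq_trans (leq_maxr _ _); apply: leq_trans (le_mdeg al i) _.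
    have : w ^+ m i == w ^+ al i by rewrite -[w ^+ m i](mulVKf (expf_neq0 (al i) w0)) h mulr1.
    by rewrite (eq_prim_root_expr hw) !modn_small.
  rewrite big1 // => k _; move: hi; rewrite alJ // => hi.
  by rewrite expr0n (negbTE hi) mulr0.
have SE : S = mcoeff al p * M%:R ^+ N.
  rewrite /S; under eq_bigr do rewrite mevalE big_distrr /=.
  rewrite exchange_big /=.
  rewrite (eq_big_seq (fun m => mcoeff m p * ((m == al)%:R * M%:R ^+ N))); last first.
    move=> m mp /=; rewrite -(ip m mp) big_distrr /=; apply: eq_bigr => f _; ring.
  case: (boolP (al \in msupp p)) => ap.
    rewrite (bigD1_seq al) ?msupp_uniq //= eqxx mul1r big1 ?addr0 // => m /negbTE ->.
    by rewrite mul0r mulr0.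
  rewrite memN_msupp_eq0 // mul0r big1_seq // => m /andP[_ mp].
  case: eqP mp ap => [-> ->//|_ _ _]; by rewrite mul0r mulr0.
have MN0 : 0 < (M%:R : R) ^+ N by rewrite exprn_gt0 // ltr0n.
have : modC S <= (M%:R ^+ N) * eta.
  apply: le_trans (modC_sum _ _ _) _.
  apply: le_trans (_ : \sum_(f : {ffun 'I_N -> 'I_M}) eta <= _).
    apply: ler_sum => f _; rewrite modCM.
    have -> : modC (wt f) = 1.
      rewrite /wt modC_prod big1 // => i _.
      by rewrite modCX modCV modCX w1 !expr1n invr1 expr1n.
    rewrite mul1r; apply: H => i; rewrite /vf; case: (J i) => //.
    by rewrite modCX w1 expr1n.
  by rewrite sumr_const card_ffun !card_ord -[leLHS]mulr_natl natrX.
by rewrite SE modCM modCX modC_nat mulrC ler_pM2l.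
Qed.

Lemma mpoly_eq0_points (N : nat) (p : mpoly N K) : (forall v, meval v p = 0) -> p = 0.
Proof.
move=> H; apply/mpolyP => al; rewrite mcoeff0; apply/eqP; rewrite -modC_eq0.
rewrite eq_le modC_ge0 andbT; apply: (@mpoly_coef_bound N p al xpredT) => // v _.
by rewrite H modC0.
Qed.

End MpolyPoints.

(** * Derivatives of the Vandermonde product *)

Section VandermondeDerivatives.
Variables (n : nat) (F : fieldType).
Local Notation MP := (mpoly n.+1 F).
Local Notation Xv i := (mpolyX F (mnm1 i) : MP).
Implicit Types (s t : 'S_n.+1) (v w : 'I_n.+1 -> F).

Lemma vdm_perm (A : comPzRingType) (N : nat) (u : 'I_N -> A) (s : 'S_N) :
  vdm (u \o s) = (-1) ^+ s * vdm u.
Proof.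
pose c : A := (-1) ^+ (\sum_(i < N) \sum_(j < N | (i < j)%N) 1%N).
have E (x : 'I_N -> A) : vdm x = c * \det (Vandermonde N (\row_j x j)).
  rewrite det_Vandermonde /c.
  have -> : \prod_(i < N) \prod_(j < N | (i < j)%N) ((\row_j0 x j0) 0 j - (\row_j0 x j0) 0 i)
     = vdm (fun i => x i * -1).
    apply: eq_bigr => i _; apply: eq_bigr => j _; rewrite !mxE; ring.
  rewrite vdm_scale mulrCA -exprMn mulrNN mulr1 expr1n mulr1 //.
rewrite !E mulrCA; congr (_ * _).
have -> : Vandermonde N (\row_j (u \o s) j) = col_perm s (Vandermonde N (\row_j u j)).
  by apply/matrixP => i j; rewrite !mxE.
by rewrite col_permE det_mulmx det_perm odd_permV mulrC.
Qed.

Definition Vp : MP := vdm (fun i => Xv i).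

Lemma meval_Vp v : meval v Vp = vdm v.
Proof.
rewrite /Vp /vdm rmorph_prod; apply: eq_bigr => i _; rewrite rmorph_prod.
by apply: eq_bigr => j _; rewrite /= mevalB !mevalXU.
Qed.

Lemma vdm_neq0 v : injv v -> vdm v != 0.
Proof.
move=> hv; apply/prodf_neq0 => i _; apply/prodf_neq0 => j ij; rewrite subr_eq0; apply: hv.
by rewrite -val_eqE /= neq_ltn ij.
Qed.

Lemma msym_Vp s : msym s Vp = (-1) ^+ s * Vp.
Proof.
rewrite /Vp -(vdm_perm _ s) /vdm rmorph_prod; apply: eq_bigr => i _; rewrite rmorph_prod.
by apply: eq_bigr => j _; rewrite /= msymB !msym_var.
Qed.

(** Deleting factor c amounts to deleting factor m after the m-th one has been moved into slot c.
    This normalises the products left by a differentiation. *)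
Lemma prod_remove_swap (A : comPzRingType) (f g : nat -> A) (m N c : nat) :
  (m <= c)%N -> (c < N)%N -> (m < c -> g c = f m)%N ->
  (forall b, (m < b)%N -> (b < N)%N -> b != c -> g b = f b) ->
  \prod_(m <= b < N | b != c) f b = \prod_(m.+1 <= b < N) g b.
Proof.
move=> mc cN gc gb; have mN := leq_ltn_trans mc cN.
rewrite big_mkcond (big_ltn mN).
move: mc; rewrite leq_eqVlt => /orP[/eqP mcE|mc].
  rewrite mcE eqxx /= mul1r; apply: eq_big_nat => b /andP[mb bN].
  by rewrite gtn_eqF //= gb ?mcE // gtn_eqF.
rewrite ltn_eqF //= -(gc mc) -big_mkcond.
rewrite [RHS](bigD1_seq c) ?iota_uniq ?mem_index_iota ?mc //=; congr (_ * _).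
rewrite big_nat_cond [RHS]big_nat_cond; apply: eq_bigr => b /andP[/andP[mb bN] bc].
by rewrite gb.
Qed.

Lemma mderiv_prod_linear (i : 'I_n.+1) (y : nat -> MP) (m N : nat) :
  (forall b, mderiv i (y b) = 1) ->
  mderiv i (\prod_(m <= b < N) y b) = \sum_(m <= c < N) \prod_(m <= b < N | b != c) y b.
Proof.
move=> hy; elim: N => [|N IH].
  by rewrite !big_geq // -mpolyC1 mderivC.
case: (leqP m N) => mN; last by rewrite !big_geq // -mpolyC1 mderivC.
rewrite !big_nat_recr //= mderivM hy mulr1 IH; congr (_ + _).
  rewrite big_distrl; apply: eq_big_nat => c /andP[_ cN].
  by rewrite big_mkcond [in RHS]big_mkcond big_nat_recr //= gtn_eqF.
rewrite big_mkcond [in RHS]big_mkcond big_nat_recr //= eqxx mulr1.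
apply: eq_big_nat => c /andP[_ cN].
by rewrite ltn_eqF.
Qed.

Lemma mderiv_X (i j : 'I_n.+1) : mderiv i (Xv j) = (i == j)%:R.
Proof.
rewrite mderivX mnm1E eq_sym; case: eqP => [->|_]; rewrite ?scale0r //.
have -> : mnm_sub (mnm1 j) (mnm1 j) = mnm0 by apply/mnmP => l; rewrite mnmBE subnn mnm0E.
by rewrite scale1r mpolyX0.
Qed.

Lemma iter_mderivZ (i : 'I_n.+1) k c (p : MP) :
  iter k (mderiv i) (c *: p) = c *: iter k (mderiv i) p.
Proof. by elim: k => [//|k IH]; rewrite !iterS IH mderivZ. Qed.

Lemma iter_mderiv_sum (i : 'I_n.+1) k (I : Type) (r : seq I) (P : pred I) (f : I -> MP) :
  iter k (mderiv i) (\sum_(x <- r | P x) f x) = \sum_(x <- r | P x) iter k (mderiv i) (f x).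
Proof.
elim: k => [//|k IH]; rewrite iterS IH (big_morph _ (mderivD i) (mderiv0 _ i)).
by [].
Qed.

Lemma iter_mderiv_leibniz (i : 'I_n.+1) k (p q : MP) :
  iter k (mderiv i) (p * q) = \sum_(m < k.+1) ('C(k, m)%:R : F) *:
    (iter m (mderiv i) p * iter (k - m) (mderiv i) q).
Proof.
elim: k => [|k IH]; first by rewrite big_ord_recl big_ord0 addr0 /= bin0 scale1r.
rewrite iterS IH (big_morph _ (mderivD i) (mderiv0 _ i)).
rewrite (eq_bigr (fun m : 'I_k.+1 =>
   ('C(k, m)%:R : F) *: (iter m.+1 (mderiv i) p * iter (k - m) (mderiv i) q) +
   ('C(k, m)%:R : F) *: (iter m (mderiv i) p * iter (k.+1 - m) (mderiv i) q))); last first.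
  move=> m _; rewrite mderivZ mderivM scalerDr -!iterS -subSn // -ltnS //.
have re (a b c d : MP) : (a + b) + (c + d) = c + ((a + d) + b) by ring.
rewrite big_split /= [X in X + _ = _]big_ord_recr [X in _ + X = _]big_ord_recl re.
rewrite [RHS]big_ord_recl [X in _ = _ + X]big_ord_recr.
congr (_ + (_ + _)).
- by rewrite /= !bin0.
- rewrite -big_split; apply: eq_bigr => m _.
  by rewrite !lift0 /= subSS -scalerDl -natrD binS addnC.
- by rewrite !lift0 /= !binn !subnn.
Qed.

Lemma iter_mderiv_const_mulr (i : 'I_n.+1) k (p q : MP) : mderiv i q = 0 ->
  iter k (mderiv i) (p * q) = iter k (mderiv i) p * q.
Proof. by move=> q0; elim: k => [//|k IH]; rewrite !iterS IH mderivM q0 mulr0 addr0. Qed.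

Lemma iter_mderiv_msym s i k (p : MP) :
  iter k (mderiv (s i)) (msym s p) = msym s (iter k (mderiv i) p).
Proof. by elim: k => [//|k IH]; rewrite !iterS IH mderiv_msym. Qed.

Lemma prod_neq_ord0 (A : comPzRingType) (f : 'I_n.+1 -> A) :
  \prod_(0 <= b < n) f (inord b.+1) = \prod_(i | i != ord0) f i.
Proof.
rewrite [RHS]big_mkcond [RHS]big_ord_recl /= mul1r big_mkord; apply: eq_bigr => b _.
by congr f; apply: val_inj; rewrite /= inordK ?ltnS.
Qed.

Lemma card_stab0 : #|[pred s : 'S_n.+1 | s ord0 == ord0]| = (n`!)%N.
Proof.
have -> : #|[pred s : 'S_n.+1 | s ord0 == ord0]| = #|perm_on [set~ (ord0 : 'I_n.+1)]|.
  apply: eq_card => s; rewrite !inE; apply/eqP/fintype.subsetP => [s0 i|h].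
    rewrite !inE; apply: contra => /eqP ->; by rewrite s0.
  apply/eqP; apply: contraT => s0; have := h ord0; rewrite !inE => /(_ s0).
  by rewrite eqxx.
by rewrite card_perm cardsC1 card_ord.
Qed.

(** A multiple of the elementary symmetric polynomial of degree n - m in the differences x_0 - x_i,
    written as a sum over permutations so that a derivative acts by dropping one factor. *)
Definition Zp (m : nat) : MP :=
  \sum_(s : 'S_n.+1 | s ord0 == ord0) \prod_(m <= b < n) (Xv ord0 - Xv (s (inord b.+1))).

Definition V0p : MP := \prod_(i | i != ord0) (Xv ord0 - Xv i).

Lemma Zp0 : Zp 0 = (n`!)%:R *: V0p.
Proof.
rewrite /Zp (eq_bigr (fun=> V0p)).
  by rewrite sumr_const card_stab0 scaler_nat.
move=> s /eqP s0; rewrite (prod_neq_ord0 (fun i => Xv ord0 - Xv (s i))).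
rewrite /V0p [RHS](reindex_inj (@perm_inj _ s)) /=; apply: eq_bigl => i.
by rewrite -{2}s0 (inj_eq perm_inj).
Qed.

(** Whichever of the n - m factors is dropped, a transposition of the indices brings the sum over
    permutations to the same form. *)
Lemma mderiv_Zp m : (m < n)%N -> mderiv ord0 (Zp m) = (n - m)%:R *: Zp m.+1.
Proof.
move=> mn; rewrite /Zp (big_morph _ (mderivD _) (mderiv0 _ _)).
rewrite (eq_bigr (fun s : 'S_n.+1 => \sum_(m <= c < n)
   \prod_(m <= b < n | b != c) (Xv ord0 - Xv (s (inord b.+1))))); last first.
  move=> s /eqP s0.
  pose y b : MP := if (b < n)%N then Xv ord0 - Xv (s (inord b.+1)) else Xv ord0.
  have yE b : (b < n)%N -> y b = Xv ord0 - Xv (s (inord b.+1)) by rewrite /y => ->.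
  rewrite (eq_big_nat _ _ (F2 := y)); last by move=> b /andP[_ bn]; rewrite yE.
  rewrite mderiv_prod_linear.
    apply: eq_big_nat => c _; rewrite big_nat_cond [RHS]big_nat_cond.
    by apply: eq_bigr => b /andP[/andP[_ bn] _]; rewrite yE.
  move=> b; rewrite /y; case: ltnP => bn; rewrite ?mderivB !mderiv_X eqxx //.
  rewrite -{1}s0 (inj_eq perm_inj) -val_eqE /= inordK ?ltnS // subr0 //.
rewrite exchange_big /=.
rewrite (eq_big_nat _ _ (F2 := fun=> \sum_(s : 'S_n.+1 | s ord0 == ord0)
   \prod_(m.+1 <= b < n) (Xv ord0 - Xv (s (inord b.+1))))).
  by rewrite sumr_const_nat scaler_nat.
move=> c /andP[mc cn].
pose t : 'S_n.+1 := tperm (inord m.+1) (inord c.+1).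
have t0 : t ord0 = ord0 by rewrite tpermD // -val_eqE /= inordK ?ltnS.
rewrite [RHS](reindex_inj (mulgI t)) /=; apply: eq_big => s; first by rewrite permM t0.
move=> _; apply: prod_remove_swap => //.
  by move=> _; rewrite permM tpermR.
move=> b mb bn bc; rewrite permM tpermD //; rewrite -val_eqE /= !inordK ?ltnS //; lia.
Qed.


End VandermondeDerivatives.

(** * The operators in divided-difference form and their eigenfunctions *)

Section DkOperator.
Variables (n : nat) (K : fieldType).
Hypothesis charK : forall m, m.+1%:R != 0 :> K.
Local Notation MP := (mpoly n.+1 K).
Local Notation Xv i := (mpolyX K (mnm1 i) : MP).
Local Notation Zp := (Zp n K).
Local Notation V0p := (V0p n K).
Local Notation Vp := (Vp n K).
Implicit Types (s t : 'S_n.+1) (v w : 'I_n.+1 -> K).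

Lemma factK_neq0 m : (m`!%:R : K) != 0.
Proof. by rewrite -(prednK (fact_gt0 m)) charK. Qed.

Lemma iter_mderiv_V0p m : (m <= n)%N ->
  iter m (mderiv ord0) V0p = ((n - m)`!%:R : K)^-1 *: Zp m.
Proof.
elim: m => [|m IH] mn.
  by rewrite subn0 Zp0 scalerA mulVf ?scale1r // factK_neq0.
rewrite iterS (IH (ltnW mn)).
rewrite mderivZ.
rewrite (mderiv_Zp K mn).
rewrite scalerA.
congr (_ *: _).
have -> : (n - m = (n - m.+1).+1)%N by lia.
by rewrite factS natrM invfM mulrAC mulVf ?mul1r.
Qed.

(** Only the factors x_0 - x_i of the Vandermonde product feel derivatives in x_0. *)
Lemma Vp_V0p : exists2 V' : MP, mderiv ord0 V' = 0 & Vp = V0p * V'.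
Proof.
exists (vdm (fun i : 'I_n => Xv (lift ord0 i))); last first.
  rewrite /Vp vdm_recl; congr (_ * _).
  by rewrite /V0p [RHS]big_mkcond [RHS]big_ord_recl /= mul1r.
have D1 (I : Type) (r : seq I) (P : pred I) (f : I -> MP) : (forall i, P i -> mderiv ord0 (f i) = 0) ->
    mderiv ord0 (\prod_(i <- r | P i) f i) = 0.
  move=> h; elim/big_rec: _ => [|i x Pi x0]; first by rewrite -mpolyC1 mderivC.
  by rewrite mderivM x0 h // mul0r mulr0 addr0.
apply: (D1) => i _; apply: (D1) => j _; by rewrite mderivB !mderiv_X /= subrr.
Qed.

Lemma meval_sum (I : Type) (r : seq I) (P : pred I) (f : I -> MP) v :
  meval v (\sum_(i <- r | P i) f i) = \sum_(i <- r | P i) meval v (f i).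
Proof. exact: rmorph_sum. Qed.
Lemma meval_prod (I : Type) (r : seq I) (P : pred I) (f : I -> MP) v :
  meval v (\prod_(i <- r | P i) f i) = \prod_(i <- r | P i) meval v (f i).
Proof. exact: rmorph_prod. Qed.
Lemma meval_exp (f : MP) v k : meval v (f ^+ k) = meval v f ^+ k.
Proof. exact: rmorphXn. Qed.

Lemma Vp_iter_ratio0 m v : (m <= n)%N -> injv v ->
  meval v (iter m (mderiv ord0) Vp) / vdm v =
  ((n - m)`!%:R : K)^-1 * \sum_(s : 'S_n.+1 | s ord0 == ord0)
     (dden (fun b => v (s (inord b))) m 0)^-1.
Proof.
move=> mn hv; have [V' V'0 VE] := Vp_V0p.
have hV := vdm_neq0 hv; rewrite -(meval_Vp v) in hV.
rewrite -(meval_Vp v) [in LHS]VE iter_mderiv_const_mulr //.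
move: hV; rewrite VE !mevalM mulf_eq0 negb_or => /andP[h0 h1].
rewrite -mulf_div mulfV // mulr1 iter_mderiv_V0p // mevalZ -mulrA; congr (_ * _).
rewrite /Zp meval_sum big_distrl /=; apply: eq_bigr => s /eqP s0.
have E : meval v V0p = \prod_(0 <= b < n) (v ord0 - v (s (inord b.+1))).
  rewrite (prod_neq_ord0 (fun i => v ord0 - v (s i))) /V0p meval_prod.
  rewrite [LHS](reindex_inj (@perm_inj _ s)) /=; apply: eq_big => i.
    by rewrite -[in LHS]s0 (inj_eq perm_inj).
  by move=> _; rewrite mevalB !mevalXU.
rewrite meval_prod E dden_head inord0_ord0 s0.
rewrite (eq_bigr (fun b => v ord0 - v (s (inord b.+1)))); last first.
  by move=> b _; rewrite mevalB !mevalXU.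
have C : \prod_(0 <= b < n) (v ord0 - v (s (inord b.+1))) =
  (\prod_(0 <= b < m) (v ord0 - v (s (inord b.+1)))) *
  (\prod_(m <= b < n) (v ord0 - v (s (inord b.+1)))) by rewrite -big_cat_nat.
move: h0; rewrite E C mulf_eq0 negb_or => /andP[hA hB].
by rewrite invfM mulrCA mulfV // mulr1.
Qed.

(** Transported from the index 0 by a transposition; the sign it produces in the numerator also
    appears in the denominator. *)
Lemma Vp_iter_ratio m v (i : 'I_n.+1) : (m <= n)%N -> injv v ->
  meval v (iter m (mderiv i) Vp) / vdm v =
  ((n - m)`!%:R : K)^-1 * \sum_(s : 'S_n.+1 | s ord0 == i)
     (dden (fun b => v (s (inord b))) m 0)^-1.
Proof.
move=> mn hv; pose t : 'S_n.+1 := tperm ord0 i.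
have ti : t ord0 = i by rewrite tpermL.
have sg : (-1 : MP) ^+ t * (-1) ^+ t = 1 by rewrite -signr_addb addbb.
have sgC : (-1 : K) ^+ t * (-1) ^+ t = 1 by rewrite -signr_addb addbb.
have VE : Vp = msym t ((-1) ^+ t *: Vp).
  rewrite msymZ msym_Vp -mul_mpolyC mulrA.
  have -> : mpolyC n.+1 ((-1) ^+ t) = (-1) ^+ t :> MP by rewrite rmorphXn rmorphN1.
  by rewrite sg mul1r.
have -> : iter m (mderiv i) Vp = msym t ((-1) ^+ t *: iter m (mderiv ord0) Vp).
  have E := iter_mderiv_msym t ord0 m ((-1) ^+ t *: Vp).
  rewrite ti -VE in E; rewrite E.
  by rewrite iter_mderivZ.
rewrite meval_msym mevalZ.
have -> : vdm v = (-1) ^+ t * vdm (v \o t) by rewrite vdm_perm mulrA sgC mul1r.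
have s0 : (-1 : K) ^+ t != 0 by rewrite signr_eq0.
rewrite -mulf_div mulfV // mul1r Vp_iter_ratio0 //; last exact: injv_perm.
congr (_ * _); rewrite [RHS](reindex_inj (mulIg t)) /=; apply: eq_big => s.
  by rewrite permM -[in RHS]ti (inj_eq perm_inj).
by move=> _; congr (_^-1); apply: eq_bigr => b _; rewrite !permM.
Qed.

Lemma dden_swap (x y : nat -> K) m a : (a <= m)%N -> y 0%N = x a ->
  (0 < a -> y a = x 0)%N -> (forall b, (0 < b)%N -> (b <= m)%N -> b != a -> y b = x b) ->
  dden x m a = dden y m 0.
Proof.
move=> am y0 ya yb; rewrite dden_head /dden y0.
rewrite (@prod_remove_swap K (fun b => x a - x b) (fun b => x a - y b)) //.
- by rewrite big_add1.
- by move=> a0; rewrite ya.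
- by move=> b b0 bm ba; rewrite yb.
Qed.

(** After summation over all permutations the m+1 terms of the Lagrange formula coincide, a
    transposition exchanging node a with node 0. *)
Lemma sum_perm_Dl m (g : MP) v : (m <= n)%N -> stab0 g -> injv v ->
  \sum_(s : 'S_n.+1) meval (v \o s) (Dl m g) =
  m.+1%:R * \sum_(s : 'S_n.+1) meval (v \o s) g / dden (fun b => v (s (inord b))) m 0.
Proof.
move=> mn hg hv.
rewrite (eq_bigr (fun s : 'S_n.+1 => \sum_(0 <= a < m.+1)
    meval ((v \o s) \o tperm ord0 (inord a)) g / dden (fun b => v (s (inord b))) m a)); last first.
  by move=> s _; rewrite Dl_eval //; exact: injv_perm.
rewrite exchange_big /=.
rewrite (eq_big_nat _ _ (F2 := fun=> \sum_(s : 'S_n.+1)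
   meval (v \o s) g / dden (fun b => v (s (inord b))) m 0)).
  by rewrite sumr_const_nat subn0 mulr_natl.
move=> a /andP[_ am]; pose t : 'S_n.+1 := tperm ord0 (inord a).
rewrite [RHS](reindex_inj (mulgI t)) /=; apply: eq_bigr => s _; congr (_ / _).
  by apply: meval_eq => i /=; rewrite permM.
have an : (a < n.+1)%N by apply: leq_trans am _; rewrite ltnS.
apply: dden_swap; first by rewrite -ltnS.
- by rewrite permM inord0_ord0 tpermL.
- by move=> _; rewrite permM tpermR inord0_ord0.
- move=> b b0 bm ba; have bn : (b < n.+1)%N by rewrite ltnS; apply: leq_trans bm _.
  by rewrite permM tpermD // -val_eqE /= !inordK //; lia.
Qed.

(** The binomial comes from the Leibniz rule, [m.+1] from the equal Lagrange terms of [sum_perm_Dl],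
    and the factorial from the normalisation in [iter_mderiv_V0p]. *)
Definition cst (k m : nat) : K := 'C(k, m)%:R / (m.+1%:R * (n - m)`!%:R).

(** The derivative in x_0 conjugated by exp L, written without the exponential. *)
Definition TL (L w : MP) : MP := mderiv ord0 w + mderiv ord0 L * w.

(* With [x_i = u_i - 1] and [V] the Vandermonde determinant, [Dop k 0] is
   [V^-1 (sum_i u_i^k (d/du_i)^k) V], the derivatives of [V] being expanded into
   iterated divided differences, and [Dop k L] is its conjugate by [exp L]. *)
Definition Dop (k : nat) (L f : MP) : MP :=
  \sum_(m < k.+1) cst k m *: \sum_(s : 'S_n.+1)
    msym s (Dl m ((1 + Xv ord0) ^+ k * iter (k - m) (TL L) f)).

Definition msymmetric (f : MP) : Prop := forall s, msym s f = f.

Lemma stab0_iter_TL k L f : msymmetric L -> msymmetric f -> stab0 (iter k (TL L) f).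
Proof.
move=> hL hf s s0; elim: k => [|k IH]; first exact: hf.
rewrite iterS; move: IH; set g := iter k _ _ => IH.
by rewrite /TL msymD msymM -!mderiv_msym IH hL s0.
Qed.

Lemma stab0_symbol k m L f : msymmetric L -> msymmetric f ->
  stab0 ((1 + Xv ord0) ^+ k * iter m (TL L) f).
Proof.
move=> hL hf s s0; rewrite msymM (stab0_iter_TL _ hL hf s0); congr (_ * _).
by rewrite rmorphXn /= msymD msym1 msym_var s0.
Qed.

Lemma TL0_iter m f : iter m (TL 0) f = iter m (mderiv ord0) f.
Proof. by elim: m => [//|m IH]; rewrite !iterS IH /TL mderiv0 mul0r addr0. Qed.

Lemma msymmetric0 : msymmetric 0.
Proof. by move=> s; rewrite msym0. Qed.

(** Leibniz rule on V f: the logarithm-free ratios of derivatives of V to V are sums of inverse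
    Lagrange denominators, and these are what a symmetrised iterated divided difference produces.
    Distinct coordinates allow the division by V. *)
Lemma meval_Dop0 k f v : (k <= n)%N -> msymmetric f -> injv v ->
  vdm v * meval v (Dop k 0 f) =
  \sum_(i < n.+1) (1 + v i) ^+ k * meval v (iter k (mderiv i) (Vp * f)).
Proof.
move=> kn hf hv; have V0 := vdm_neq0 hv.
pose T (i : 'I_n.+1) (m : nat) : K := 'C(k, m)%:R * ((1 + v i) ^+ k *
  meval v (iter (k - m) (mderiv i) f)) / (n - m)`!%:R.
have E1 : meval v (Dop k 0 f) = \sum_(m < k.+1) \sum_(s : 'S_n.+1)
    T (s ord0) m / dden (fun b => v (s (inord b))) m 0.
  rewrite /Dop meval_sum; apply: eq_bigr => m _.
  have mn : (m <= n)%N by apply: leq_trans kn; rewrite -ltnS.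
  rewrite mevalZ meval_sum.
  rewrite (eq_bigr (fun s : 'S_n.+1 => meval (v \o s)
     (Dl m ((1 + Xv ord0) ^+ k * iter (k - m) (TL 0) f)))); last first.
    by move=> s _; rewrite meval_msym.
  rewrite sum_perm_Dl //; last exact: stab0_symbol msymmetric0 hf.
  rewrite mulrA big_distrr /=; apply: eq_bigr => s _.
  rewrite mevalM meval_exp mevalD meval1 mevalXU TL0_iter.
  have -> : meval (v \o s) (iter (k - m) (mderiv ord0) f) =
            meval v (iter (k - m) (mderiv (s ord0)) f).
    by rewrite -meval_msym -iter_mderiv_msym hf.
  rewrite /cst /T /=; have h1 := charK m; have h2 := factK_neq0 (n - m).
  move: (dden _ _ _)^-1 => D.
  move: (m.+1%:R : K) ((n - m)`!%:R : K) h1 h2 => a b h1 h2.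
  by field; rewrite h1 h2.
have E2 (i : 'I_n.+1) : (1 + v i) ^+ k * meval v (iter k (mderiv i) (Vp * f)) =
    vdm v * \sum_(m < k.+1) \sum_(s : 'S_n.+1 | s ord0 == i)
      T (s ord0) m / dden (fun b => v (s (inord b))) m 0.
  rewrite iter_mderiv_leibniz meval_sum !big_distrr /=; apply: eq_bigr => m _.
  have mn : (m <= n)%N by apply: leq_trans kn; rewrite -ltnS.
  rewrite mevalZ mevalM.
  rewrite (eq_bigr (fun s : 'S_n.+1 => T i m * (dden (fun b => v (s (inord b))) m 0)^-1)); last first.
    by move=> s /eqP ->.
  rewrite -big_distrr /=.
  have h := Vp_iter_ratio i mn hv.
  have -> : meval v (iter m (mderiv i) Vp) = vdm v * (((n - m)`!%:R : K)^-1 *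
     \sum_(s : 'S_n.+1 | s ord0 == i) (dden (fun b => v (s (inord b))) m 0)^-1).
    by rewrite -h mulrC divfK.
  by rewrite /T; ring.
rewrite E1 (eq_bigr _ (fun i _ => E2 i)) -big_distrr /=; congr (_ * _).
rewrite [RHS]exchange_big /=; apply: eq_bigr => m _.
by rewrite (partition_big (fun s : 'S_n.+1 => s ord0) xpredT).
Qed.

Definition altM (l : 'I_n.+1 -> nat) : 'M[MP]_n.+1 := \matrix_(i, j) (1 + Xv i) ^+ l j.

Lemma mderiv_det_const (N : nat) (A : 'M[MP]_N) i :
  (forall a b, mderiv i (A a b) = 0) -> mderiv i (\det A) = 0.
Proof.
move=> h; rewrite /determinant (big_morph _ (mderivD i) (mderiv0 _ i)) big1 // => s _.
rewrite mderivM.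
have -> : mderiv i ((-1) ^+ s : MP) = 0.
  by case: (odd_perm s); rewrite ?expr1 ?expr0 ?mderivN -mpolyC1 mderivC ?oppr0.
rewrite mul0r add0r.
have -> : mderiv i (\prod_j A j (s j)) = 0.
  elim/big_rec: _ => [|j x _ x0]; first by rewrite -mpolyC1 mderivC.
  by rewrite mderivM x0 h mul0r mulr0 addr0.
by rewrite mulr0.
Qed.

Lemma iter_mderiv_pow i k l :
  (1 + Xv i) ^+ k * iter k (mderiv i) ((1 + Xv i) ^+ l) = ((l ^_ k)%:R : K) *: (1 + Xv i) ^+ l.
Proof.
have d1 m : mderiv i ((1 + Xv i) ^+ m) = (m%:R : K) *: (1 + Xv i) ^+ m.-1.
  elim: m => [|m IH]; first by rewrite expr0 -mpolyC1 mderivC scale0r.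
  rewrite exprS mderivM IH mderivD mderiv_X eqxx -{1}mpolyC1 mderivC add0r mul1r /=.
  case: m {IH} => [|m]; first by rewrite scale0r mulr0 addr0 scale1r.
  by rewrite /= -scalerAr -exprS -{1}[(1 + Xv i) ^+ m.+1]scale1r -scalerDl nat1r.
have dk m : iter m (mderiv i) ((1 + Xv i) ^+ l) = ((l ^_ m)%:R : K) *: (1 + Xv i) ^+ (l - m).
  elim: m => [|m IH]; first by rewrite subn0 scale1r.
  by rewrite iterS IH mderivZ d1 scalerA -natrM ffactnSr subnS.
rewrite dk -scalerAr -exprD; case: (leqP k l) => kl; first by rewrite subnKC.
by rewrite ffact_small // !scale0r.
Qed.

(** In the expansion along row i the cofactors are free of x_i, and u^k d^k multiplies u^l by a
    falling factorial. Regrouping by columns turns the cofactor sums back into determinants. *)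
Lemma sum_iter_mderiv_altM k (l : 'I_n.+1 -> nat) :
  \sum_i (1 + Xv i) ^+ k * iter k (mderiv i) (\det (altM l)) =
  ((\sum_j (l j ^_ k))%:R : K) *: \det (altM l).
Proof.
transitivity (\sum_i \sum_j ((l j ^_ k)%:R : K) *: (altM l i j * cofactor (altM l) i j)).
  apply: eq_bigr => i _; rewrite [X in iter k _ X](expand_det_row _ i) iter_mderiv_sum big_distrr /=.
  apply: eq_bigr => j _; rewrite iter_mderiv_const_mulr.
    by rewrite mulrA /altM mxE iter_mderiv_pow scalerAl.
  rewrite /cofactor mderivM (mderiv_det_const (i := i)).
    have -> : mderiv i ((-1) ^+ (i + j) : MP) = 0.
      by rewrite -signr_odd; case: (odd _); rewrite ?expr1 ?expr0 ?mderivN -mpolyC1 mderivC ?oppr0.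
    by rewrite mul0r mulr0 addr0.
  move=> a b; rewrite !mxE; elim: (l _) => [|e IH]; first by rewrite expr0 -mpolyC1 mderivC.
  rewrite exprS mderivM IH mulr0 addr0 mderivD mderiv_X -mpolyC1 mderivC add0r.
  by rewrite (negbTE (neq_lift i a)) mul0r.
rewrite exchange_big natr_sum scaler_suml; apply: eq_bigr => j _.
by rewrite -scaler_sumr -expand_det_col.
Qed.

Lemma Dop0_eigen_points k (l : 'I_n.+1 -> nat) f v : (k <= n)%N -> msymmetric f -> injv v ->
  Vp * f = \det (altM l) ->
  meval v (Dop k 0 f) = meval v (((\sum_j (l j ^_ k))%:R : K) *: f).
Proof.
move=> kn hf hv E; have V0 := vdm_neq0 hv; apply: (mulfI V0).
rewrite meval_Dop0 // E.
have := sum_iter_mderiv_altM k l => /(congr1 (meval v)).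
rewrite meval_sum -E mevalZ mevalM meval_Vp mevalZ mulrCA => <-.
by apply: eq_bigr => i _; rewrite mevalM meval_exp mevalD meval1 mevalXU.
Qed.


End DkOperator.

(** * Asymptotics of low-degree coefficients *)

Section LowDegree.
Variables (N : nat) (F : fieldType).
Local Notation MP := (mpoly N F).
Implicit Types (f g p q : MP) (i j : 'I_N) (m : multinom N) (s : 'S_N) (d : nat).

Definition eqd d p q : Prop := forall m, (mdeg m < d)%N -> mcoeff m p = mcoeff m q.

Lemma eqd_refl d p : eqd d p p. Proof. by []. Qed.
Lemma eqd_trans d q p r : eqd d p q -> eqd d q r -> eqd d p r.
Proof. by move=> h h' m md; rewrite h ?h'. Qed.
Lemma eqd_le d d' p q : (d' <= d)%N -> eqd d p q -> eqd d' p q.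
Proof. by move=> dd h m md; apply: h; apply: leq_trans dd. Qed.
Lemma eqdD d p q p' q' : eqd d p q -> eqd d p' q' -> eqd d (p + p') (q + q').
Proof. by move=> h h' m md; rewrite !mcoeffD h ?h'. Qed.
Lemma eqdB d p q p' q' : eqd d p q -> eqd d p' q' -> eqd d (p - p') (q - q').
Proof. by move=> h h' m md; rewrite !mcoeffB h ?h'. Qed.
Lemma eqdZ d c p q : eqd d p q -> eqd d (c *: p) (c *: q).
Proof. by move=> h m md; rewrite !mcoeffZ h. Qed.
Lemma eqd_sum (I : Type) (r : seq I) (P : pred I) (f g : I -> MP) d :
  (forall x : I, P x -> eqd d (f x) (g x)) ->
  eqd d (\sum_(x <- r | P x) f x) (\sum_(x <- r | P x) g x).
Proof.
move=> h; elim: r => [|x r IH]; first by rewrite !big_nil.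
by rewrite !big_cons; case: ifPn => // Px; apply: eqdD; [exact: h|].
Qed.
Lemma eqdM d p q p' q' : eqd d p q -> eqd d p' q' -> eqd d (p * p') (q * q').
Proof.
move=> h h' m md; rewrite !mcoeffM; apply: eq_bigr => -[k1 k2] /= /eqP mE.
have := congr1 mdeg mE; rewrite mdegD => dE.
rewrite h ?h' //; lia.
Qed.

Definition mpermute (s : 'S_N) m : multinom N := Multinom [tuple m (s i) | i < N].

Lemma mcoeff_msym s p m : mcoeff m (msym s p) = mcoeff (mpermute s m) p.
Proof. by rewrite mcoeff_sym. Qed.

Lemma mpermuteE s m i : mpermute s m i = m (s i).
Proof. by rewrite mnmE. Qed.

Lemma mdeg_mpermute s m : mdeg (mpermute s m) = mdeg m.
Proof.
rewrite !mdegE [RHS](reindex_inj (@perm_inj _ s)) /=; apply: eq_bigr => i _.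
by rewrite mpermuteE.
Qed.

Lemma eqd_msym d s p q : eqd d p q -> eqd d (msym s p) (msym s q).
Proof. by move=> h m md; rewrite !mcoeff_msym h ?mdeg_mpermute. Qed.

Lemma eqd_mderiv d i p q : eqd d.+1 p q -> eqd d (mderiv i p) (mderiv i q).
Proof. by move=> h m md; rewrite !mcoeff_deriv h // mdegD mdeg1 addn1. Qed.

(** A divided difference, like a derivative, costs one degree of precision. *)
Lemma eqd_Nd d i j p q : i != j -> eqd d.+1 p q -> eqd d (Nd i j p) (Nd i j q).
Proof.
move=> ij h m md; rewrite !Nd_coef //; apply: eq_bigr => e _.
apply: (eqdB h (eqd_msym _ h)); rewrite mdeg_mshift //; by rewrite -ltnS.
Qed.

Lemma le_mdeg m i : (m i <= mdeg m)%N.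
Proof. by rewrite mdegE (bigD1 i) //= leq_addr. Qed.

(** The divisors of a monomial spelled as a word of variables, with repetitions; there are 2 to the
    degree of them, whatever the number of variables. *)
Fixpoint subm (t : seq 'I_N) : seq (multinom N) :=
  if t is i :: t' then subm t' ++ [seq mnm_add m (mnm1 i) | m <- subm t'] else [:: mnm0].

Lemma size_subm t : size (subm t) = (2 ^ size t)%N.
Proof. by elim: t => [//|i t IH] /=; rewrite size_cat size_map IH expnS mul2n addnn. Qed.

Lemma mem_subm t m : (forall i, (m i <= count_mem i t)%N) -> m \in subm t.
Proof.
elim: t m => [|i t IH] m h /=.
  rewrite inE; apply/eqP/mnmP => i; rewrite mnm0E; apply/eqP; rewrite -leqn0.
  exact: h.
rewrite mem_cat; apply/orP.
case: (leqP (m i) (count_mem i t)) => mi.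
  by left; apply: IH => j; have := h j; rewrite /=; case: eqP => [<-|_] //=; rewrite ?add0n.
right; apply/mapP; exists (mnm_sub m (mnm1 i)).
  apply: IH => j; rewrite mnmBE mnm1E; have := h j; rewrite /=.
  by case: eqP => _ /=; lia.
by apply/mnmP => j; rewrite mnmDE mnmBE mnm1E; case: eqP => [<-|_] /=; lia.
Qed.

End LowDegree.

Section Small.
Variables (R : realType) (F : fieldType) (nm : F -> R).
Hypothesis nm0 : nm 0 = 0.
Hypothesis nm_ge0 : forall x, 0 <= nm x.
Hypothesis nmD : forall x y, nm (x + y) <= nm x + nm y.
Hypothesis nmM : forall x y, nm (x * y) = nm x * nm y.
Hypothesis nmN : forall x, nm (- x) = nm x.
Hypothesis nm_nat : forall n, nm n%:R = n%:R.

Lemma nm_sum (I : Type) (r : seq I) (P : pred I) (f : I -> F) :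
  nm (\sum_(i <- r | P i) f i) <= \sum_(i <- r | P i) nm (f i).
Proof.
elim: r => [|x r IH]; first by rewrite !big_nil nm0.
rewrite !big_cons; case: ifP => // _; apply: le_trans (nmD _ _) _; exact: lerD.
Qed.

Section FixedDim.
Variable N : nat.
Local Notation MP := (mpoly N F).
Implicit Types (f g p q : MP) (i j : 'I_N) (m : multinom N) (s : 'S_N) (d : nat) (e : R).

(** A sup bound on low-degree coefficients. Derivatives, divided differences and products preserve
    such bounds up to factors depending on [d] but not on the number of variables. *)
Definition small d e f : Prop := forall m, (mdeg m < d)%N -> nm (mcoeff m f) <= e.

Lemma small_le d e e' f : e <= e' -> small d e f -> small d e' f.
Proof. by move=> ee h m md; apply: le_trans ee; apply: h. Qed.
Lemma small_deg d d' e f : (d' <= d)%N -> small d e f -> small d' e f.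
Proof. by move=> dd h m md; apply: h; apply: leq_trans dd. Qed.
Lemma small_eqd d e f g : eqd d f g -> small d e f -> small d e g.
Proof. by move=> fg h m md; rewrite -fg // h. Qed.
Lemma smallD d e e' f g : small d e f -> small d e' g -> small d (e + e') (f + g).
Proof. by move=> h h' m md; rewrite mcoeffD; apply: le_trans (nmD _ _) _; apply: lerD; auto. Qed.
Lemma smallN d e f : small d e f -> small d e (- f).
Proof. by move=> h m md; rewrite mcoeffN nmN h. Qed.
Lemma smallZ d e c f : small d e f -> small d (nm c * e) (c *: f).
Proof. by move=> h m md; rewrite mcoeffZ nmM ler_wpM2l // h. Qed.
Lemma small0 d e : 0 <= e -> small d e 0.
Proof. by move=> e0 m _; rewrite mcoeff0 nm0. Qed.
Lemma small_msym d e s f : small d e f -> small d e (msym s f).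
Proof. by move=> h m md; rewrite mcoeff_msym h ?mdeg_mpermute. Qed.

Lemma nmMn x c : nm (x *+ c) = c%:R * nm x.
Proof. by rewrite -(mulr_natl x c) nmM nm_nat. Qed.

Lemma small_mderiv d e i f : 0 <= e -> small d.+1 e f -> small d (d%:R * e) (mderiv i f).
Proof.
move=> e0 h m md; rewrite mcoeff_deriv nmMn.
apply: ler_pM => //; last by apply: h; rewrite mdegD mdeg1 addn1.
by rewrite ler_nat; apply: leq_ltn_trans (le_mdeg m i) md.
Qed.

Lemma small_Nd d e i j f : 0 <= e -> i != j -> small d.+1 e f ->
  small d (2 * d%:R * e) (Nd i j f).
Proof.
move=> e0 ij h m md; rewrite Nd_coef //.
apply: le_trans (nm_sum _ _ _) _.
apply: le_trans (_ : \sum_(k < (m j).+1) (e + e) <= _).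
  apply: ler_sum => k _.
  apply: (smallD h (smallN (small_msym _ h))).
  by rewrite mdeg_mshift // -ltnS.
have mj : (m j < d)%N := leq_ltn_trans (le_mdeg m j) md.
have : (m j).+1%:R <= d%:R :> R by rewrite ler_nat.
rewrite sumr_const card_ord -[X in X <= _]mulr_natl; nra.
Qed.

Lemma ex_count m : exists2 t : seq 'I_N, size t = mdeg m & forall i, count_mem i t = m i.
Proof.
exists (flatten [seq nseq (m i) i | i <- enum 'I_N]).
  rewrite size_flatten /shape -map_comp mdegE sumnE big_map big_enum /=.
  by apply: eq_bigr => i _; rewrite size_nseq.
move=> i; rewrite count_flatten sumnE -map_comp big_map big_enum /=.
rewrite (bigD1 i) //= count_nseq /= eqxx mul1n big1 ?addn0 // => j ji.
by rewrite count_nseq /= (negbTE ji) mul0n.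
Qed.

(** A coefficient of the product has one term per divisor of its monomial, hence at most 2^d
    terms. *)
Lemma smallM d e e' f g : 0 <= e -> 0 <= e' -> small d e f -> small d e' g ->
  small d ((2 ^ d)%:R * (e * e')) (f * g).
Proof.
move=> e0 e0' h h' m md; rewrite mcoeffM.
apply: le_trans (nm_sum _ _ _) _.
pose P (k : bmultinom N (mdeg m).+1 * bmultinom N (mdeg m).+1) := m == mnm_add k.1 k.2.
apply: le_trans (_ : \sum_(k | P k) e * e' <= _).
  apply: ler_sum => -[k1 k2] /eqP /= mE; rewrite nmM.
  have := congr1 mdeg mE; rewrite mdegD => dE.
  by apply: ler_pM => //; [apply: h|apply: h']; lia.
rewrite sumr_const -[X in X <= _]mulr_natl; apply: ler_wpM2r; first exact: mulr_ge0.
rewrite ler_nat; have [t tm tc] := ex_count m.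
apply: (@leq_trans (2 ^ size t)); last by rewrite leq_exp2l // tm ltnW.
rewrite -size_subm cardE -(size_map (fun k => bmnm k.1)).
apply: uniq_leq_size.
  rewrite map_inj_in_uniq ?enum_uniq // => -[k1 k2] [l1 l2].
  rewrite !mem_enum => hk hl /= kl.
  have mk := elimT (@eqP _ m (mnm_add k1 k2)) hk.
  have ml := elimT (@eqP _ m (mnm_add l1 l2)) hl.
  have k1l1 : k1 = l1 by apply: val_inj.
  congr pair => //; apply: val_inj; apply/mnmP => i.
  have := congr1 (fun m => fun_of_multinom m i) mk; have := congr1 (fun m => fun_of_multinom m i) ml.
  by rewrite !mnmDE k1l1 => -> /addnI.
move=> x /mapP[[k1 k2]]; rewrite mem_enum => hk xE; rewrite xE /=.
have mk := elimT (@eqP _ m (mnm_add k1 k2)) hk.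
apply: mem_subm => i; rewrite tc.
by have := congr1 (fun m => fun_of_multinom m i) mk; rewrite mnmDE; lia.
Qed.

End FixedDim.
End Small.

(** * Conjugation by the generating function *)

Section Conjugation.
Variables (n : nat) (K : fieldType).
Local Notation MP := (mpoly n.+1 K).
Local Notation Xv i := (mpolyX K (mnm1 i) : MP).
Implicit Types (f g p q B L w : MP) (m k d : nat).

(** B plays the part of exp L; only the relation B L' = B' is used, and only up to degree D. Each
    derivative costs one degree. *)
Lemma eqd_iter_conj D B L d j w w' : eqd D (B * mderiv ord0 L) (mderiv ord0 B) ->
  (d + j <= D)%N -> eqd (d + j) w' (B * w) ->
  eqd d (iter j (TL 0) w') (B * iter j (TL L) w).
Proof.
move=> hL; elim: j d => [|j IH] d dD h; first by rewrite addn0 in h.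
rewrite !iterS; have := IH d.+1; rewrite addSnnS => /(_ dD h).
move: (iter j _ w') (iter j _ w) => x g xg.
rewrite /TL mderiv0 mul0r addr0.
refine (eqd_trans (eqd_mderiv ord0 xg) _); rewrite mderivM mulrDr addrC mulrA.
apply: eqdD; first exact: eqd_refl.
apply: eqdM; last exact: eqd_refl.
by move=> al ald; rewrite hL //; apply: leq_trans ald _; apply: leq_trans dD; exact: leq_addr.
Qed.

Lemma eqd_Dl m d p q : (m <= n)%N -> eqd (d + m) p q -> eqd d (Dl m p) (Dl m q).
Proof.
elim: m d => [|m IH] d mn h; first by rewrite addn0 in h.
rewrite /=; apply: eqd_Nd; first exact: ord0_inord.
by apply: (IH _ (ltnW mn)); rewrite addSnnS.
Qed.

(** A symmetric factor passes through divided differences and permutations, so conjugation only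
    affects the derivatives. The m divided differences and k - m derivatives of a term cost k
    degrees altogether. *)
Lemma eqd_Dop D B L k d f f' : (k <= n)%N -> msymmetric B ->
  eqd D (B * mderiv ord0 L) (mderiv ord0 B) -> (d + k <= D)%N ->
  eqd (d + k) f' (B * f) -> eqd d (Dop k 0 f') (B * Dop k L f).
Proof.
move=> kn sB hL dD h; rewrite /Dop big_distrr /=; apply: eqd_sum => m _.
have mk : (m <= k)%N by rewrite -ltnS.
have mn := leq_trans mk kn.
rewrite -scalerAr; apply: eqdZ; rewrite big_distrr /=; apply: eqd_sum => s _.
rewrite -[X in X * msym s _](sB s) -msymM; apply: eqd_msym.
rewrite -Dl_sym //; apply: eqd_Dl => //; rewrite mulrCA; apply: eqdM; first exact: eqd_refl.
by apply: eqd_iter_conj hL _ _; rewrite -addnA subnKC.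
Qed.

Lemma eqd0M a b f g : eqd a f 0 -> eqd b g 0 -> eqd (a + b) (f * g) 0.
Proof.
move=> hf hg m md; rewrite mcoeff0 mcoeffM big1 // => -[k1 k2] /= /eqP mE.
have := congr1 mdeg mE; rewrite mdegD => dE.
case: (ltnP (mdeg k1) a) => h; first by rewrite hf // mcoeff0 mul0r.
by rewrite hg ?mcoeff0 ?mulr0 //; lia.
Qed.

Lemma eqd0X a f : eqd 1 f 0 -> eqd a (f ^+ a) 0.
Proof.
move=> hf; elim: a => [|a IH] => //.
by rewrite exprS; apply: (@eqd0M 1 a).
Qed.

Hypothesis charK : forall m, m.+1%:R != 0 :> K.

Lemma eqd_logT D B : mcoeff mnm0 B = 1 ->
  eqd D (B * mderiv ord0 (logT D B)) (mderiv ord0 B).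
Proof.
move=> B0; rewrite (@derivation_logT _ _ (mderiv ord0)) //; last 4 first.
- exact: mderiv0.
- exact: mderivD.
- by move=> c x; rewrite mderivZ.
- exact: mderivM.
rewrite -[X in eqd _ _ X]mulr1; apply: eqdM; first exact: eqd_refl.
rewrite -[X in eqd _ _ X]subr0; apply: eqdB; first exact: eqd_refl.
apply: eqd0X => m; rewrite ltnS leqn0 mdeg_eq0 => /eqP ->.
by rewrite mcoeffB mcoeff1 eqxx B0 subrr mcoeff0.
Qed.

Lemma msymmetric_logT D B : msymmetric B -> msymmetric (logT D B).
Proof.
move=> sB s; rewrite /logT linear_sum /=; apply: eq_bigr => j _.
by rewrite msymZ rmorphXn /= msymB msym1 sB.
Qed.

End Conjugation.

(** * Divided differences of functions of one variable *)

Section DividedDifferenceCoefficients.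
Variables (n : nat) (K : fieldType).
Local Notation MP := (mpoly n.+1 K).
Local Notation Xv i := (mpolyX K (mnm1 i) : MP).
Implicit Types (f g p : MP) (q : {poly K}) (i j k : 'I_n.+1) (a : multinom n.+1).

Definition indep k p : Prop := forall a, (0 < a k)%N -> mcoeff a p = 0.

Lemma indep_Nd i j k p : i != j -> k != i -> k != j -> indep k p -> indep k (Nd i j p).
Proof.
move=> ij ki kj hp a ak; rewrite Nd_coef // big1 // => e _.
have ej : (e <= a j)%N by rewrite -ltnS.
have sk : (mshift i j a e) k = a k by rewrite mshiftE // (negbTE ki) (negbTE kj).
rewrite mcoeffB mcoeff_msym !hp ?subrr // ?sk //.
by rewrite mpermuteE tpermD 1?eq_sym // sk.
Qed.

(** For a pure power of x_i the division has a single step, and the swapped polynomial does not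
    contribute since its monomials would need x_j in p. *)
Lemma Nd_coef_pure i j p e : i != j -> indep j p ->
  mcoeff (mnm_muln (mnm1 i) e) (Nd i j p) = mcoeff (mnm_muln (mnm1 i) e.+1) p.
Proof.
move=> ij hp; rewrite Nd_coef //.
have aj : (mnm_muln (mnm1 i) e) j = 0%N by rewrite mulmnE mnm1E (negbTE ij).
rewrite aj big_ord_recl big_ord0 addr0 mcoeffB mcoeff_msym.
have sE : mshift i j (mnm_muln (mnm1 i) e) (ord0 : 'I_1) = mnm_muln (mnm1 i) e.+1.
  apply/mnmP => k; rewrite mshiftE ?aj // !mulmnE !mnm1E eqxx [i == k]eq_sym.
  case: (altP (k =P i)) => [_|ki]; first by rewrite !mul1n addn1.
  by case: (altP (k =P j)).
rewrite sE (hp (mpermute _ _)) ?subr0 //.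
by rewrite mpermuteE tpermR mulmnE mnm1E eqxx mul1n.
Qed.

Definition emb i q : MP := horner_alg (Xv i) q.

Lemma embE i q : emb i q = \sum_(e < size q) q`_e *: Xv i ^+ e.
Proof.
rewrite -{1}(coefK q) poly_def /emb linear_sum /=; apply: eq_bigr => e _.
by rewrite -mul_polyC rmorphM /= horner_algC rmorphXn /= horner_algX mulr_algl.
Qed.

Lemma embM i (q1 q2 : {poly K}) : emb i (q1 * q2) = emb i q1 * emb i q2. 
Proof.
exact: rmorphM.
Qed.
Lemma embD i (q1 q2 : {poly K}) : emb i (q1 + q2) = emb i q1 + emb i q2. 
Proof.
exact: rmorphD.
Qed.
Lemma emb1 i : emb i 1 = 1. 
Proof.
exact: rmorph1.
Qed.
Lemma embX i q e : emb i (q ^+ e) = emb i q ^+ e. 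
Proof.
exact: rmorphXn.
Qed.
Lemma emb_var i : emb i 'X = Xv i. 
Proof.
exact: horner_algX.
Qed.

Lemma mcoeff_varX i e a : mcoeff a (Xv i ^+ e) = (mnm_muln (mnm1 i) e == a)%:R.

Proof.
by rewrite mpolyXn mcoeffX.
Qed.

Lemma mcoeff_emb_pure i q e : mcoeff (mnm_muln (mnm1 i) e) (emb i q) = q`_e.
Proof.
have inj e' : (mnm_muln (mnm1 i) e' == mnm_muln (mnm1 i) e) = (e' == e).
  apply/eqP/eqP => [/mnmP /(_ i)|->//]; by rewrite !mulmnE mnm1E eqxx !mul1n.
rewrite embE linear_sum /= -[in RHS](coefK q) coef_poly.
under eq_bigr => e' _ do rewrite mcoeffZ mcoeff_varX inj.
case: ltnP => eq.
  rewrite (bigD1 (Ordinal eq)) //= eqxx mulr1 big1 ?addr0 // => e' e'e.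
  by rewrite (negbTE (_ : val e' != e)) ?mulr0.
rewrite big1 // => e' _; rewrite (_ : (val e' == e) = false) ?mulr0 //.
by apply/negbTE; rewrite neq_ltn (leq_trans (ltn_ord e') eq).
Qed.

Lemma indep_emb i j q : j != i -> indep j (emb i q).
Proof.
move=> ji a aj; rewrite embE linear_sum big1 //= => e _.
rewrite mcoeffZ mcoeff_varX; case: eqP => [aE|]; last by rewrite mulr0.
by move: aj; rewrite -aE mulmnE mnm1E eq_sym (negbTE ji).
Qed.

Lemma mderiv_emb i q : mderiv i (emb i q) = emb i q^`().
Proof.
elim/poly_ind: q => [|p c IH]; first by rewrite deriv0 /emb !linear0.
rewrite derivD derivC addr0 derivM derivX mulr1.
rewrite !embD !embM emb_var mderivD mderivM mderiv_X eqxx mulr1 IH.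
rewrite /emb horner_algC mderivZ -mpolyC1 mderivC scaler0 addr0; ring.
Qed.

Lemma mderiv_emb0 i j q : i != j -> mderiv i (emb j q) = 0.
Proof.
move=> ij; apply/mpolyP => a; rewrite mcoeff_deriv mcoeff0 (@indep_emb j i q ij) ?mul0rn //.
by rewrite mnmDE mnm1E eqxx addn1.
Qed.

Lemma indep_Dl m q j : (m <= n)%N -> (m < j)%N -> indep j (Dl m (emb ord0 q)).
Proof.
elim: m => [|m IH] mn mj /=.
  by apply: indep_emb; rewrite -val_eqE /= -lt0n.
apply: indep_Nd.
- exact: ord0_inord.
- by rewrite -val_eqE /= -lt0n; lia.
- by rewrite -val_eqE /= inordK //; lia.
- by apply: IH; lia.
Qed.

(** The m-th divided difference of x^(m+e) is the complete homogeneous polynomial of degree e in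
    x_0, ..., x_m, where x_0^e has coefficient 1. *)
Lemma Dl_emb_pure m q e : (m <= n)%N ->
  mcoeff (mnm_muln (mnm1 ord0) e) (Dl m (emb ord0 q)) = q`_(m + e).
Proof.
elim: m e => [|m IH] e mn /=; first exact: mcoeff_emb_pure.
rewrite Nd_coef_pure ?ord0_inord //; first by rewrite IH 1?ltnW // addSnnS.
by apply: indep_Dl; rewrite ?inordK //; lia.
Qed.

End DividedDifferenceCoefficients.

Lemma ffact_le_exp a m : (a ^_ m <= a ^ m)%N.
Proof.
elim: m => [//|m IH]; rewrite ffactnSr expnSr.
by apply: leq_mul IH _; exact: leq_subr.
Qed.

(** The falling factorial is a^m up to relative error m^2 / a; the inequality is multiplied by a to
    stay among natural numbers. *)
Lemma exp_le_ffact a m : (a ^ m.+1 <= a ^_ m * a + m ^ 2 * a ^ m)%N.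
Proof.
elim: m => [|m IH]; first by rewrite expn1 ffactn0 mul1n leq_addr.
have h := ffact_le_exp a m.
have hs : (a <= (a - m) + m)%N by lia.
rewrite ffactnSr; move: IH h hs; rewrite !expnS !expn0 !muln1.
move: (a ^_ m)%N (a ^ m)%N (a - m)%N => x y z IH h hs.
have h1 : (x * a <= x * z + m * y)%N by nia.
have h2 : (a * (a * y) <= a * (x * z + m * y + m * m * y))%N by rewrite leq_mul2l; apply/orP; right; lia.
nia.
Qed.

Lemma card_perm_at (n : nat) (i j : 'I_n.+1) :
  #|[pred s : 'S_n.+1 | s j == i]| = (n`!)%N.
Proof.
rewrite -card_stab0 -!sum1_card.
rewrite [LHS](reindex_inj (mulgI (tperm ord0 j))) /=.
rewrite [LHS](reindex_inj (mulIg (tperm ord0 i))) /=.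
apply: eq_bigl => s; rewrite !inE !permM tpermR.
by rewrite -{2}(tpermL ord0 i) (inj_eq perm_inj).
Qed.

(** * Limits as the number of variables grows *)

Section Asymptotics.
Variables (R : realType) (F : fieldType) (nm : F -> R).
Hypothesis nm0 : nm 0 = 0.
Hypothesis nm_ge0 : forall x, 0 <= nm x.
Hypothesis nmD : forall x y, nm (x + y) <= nm x + nm y.
Hypothesis nmM : forall x y, nm (x * y) = nm x * nm y.
Hypothesis nmN : forall x, nm (- x) = nm x.
Hypothesis nm_nat : forall n, nm n%:R = n%:R.

Local Notation small := (small nm).
Local Notation MP n := (mpoly n.+1 F).
Local Notation emb0 n q := (emb (ord0 : 'I_n.+1) q).
Local Notation sq := (forall n, MP n).
Local Notation op := (forall n, MP n -> MP n).
Implicit Types (f g h l : sq) (Ph Qh : op) (m k d : nat) (q : {poly F}).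

Lemma charF m : m.+1%:R != 0 :> F.
Proof.
apply/eqP => /(congr1 nm); rewrite nm_nat nm0 => /eqP.
by rewrite pnatr_eq0.
Qed.

Lemma nmV c : nm (c.+1%:R^-1) = c.+1%:R^-1.
Proof.
have c0 : c.+1%:R != 0 :> R by rewrite pnatr_eq0.
apply: (mulfI c0); rewrite divff // -(nm_nat c.+1) -nmM divff ?charF //.
exact: (nm_nat 1).
Qed.

(* [asm], [bnd] and [ubd]: [o(1)], [O(1)], and uniformly bounded operators, all in
   terms of the coefficients of total degree less than [d] *)
Definition asm d f : Prop := forall e : R, 0 < e -> \forall n \near \oo, small d e (f n).
Definition bnd d f : Prop := exists2 C : R, 0 <= C & \forall n \near \oo, small d C (f n).
Definition ubd d' d Ph : Prop := exists2 C : R, 0 <= C &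
  \forall n \near \oo, forall e (p : MP n), 0 <= e -> small d' e p -> small d (C * e) (Ph n p).

Lemma asm_deg d d' f : (d' <= d)%N -> asm d f -> asm d' f.
Proof. by move=> dd h e /h; apply: filterS => n; apply: small_deg. Qed.
Lemma bnd_deg d d' f : (d' <= d)%N -> bnd d f -> bnd d' f.
Proof. by move=> dd [C C0 h]; exists C => //; apply: filterS h => n; apply: small_deg. Qed.
Lemma asm_ext d f g : (\forall n \near \oo, eqd d (f n) (g n)) -> asm d f -> asm d g.
Proof. by move=> fg h e /h; apply: filterS2 fg => n; apply: small_eqd. Qed.
Lemma bnd_ext d f g : (\forall n \near \oo, eqd d (f n) (g n)) -> bnd d f -> bnd d g.
Proof. by move=> fg [C C0 h]; exists C => //; apply: filterS2 fg h => n; apply: small_eqd. Qed.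
Lemma asm_bnd d f : asm d f -> bnd d f.
Proof. by move=> h; exists 1 => //; apply: h. Qed.
Lemma asmD d f g : asm d f -> asm d g -> asm d (fun n => f n + g n).
Proof.
move=> hf hg e e0; have e2 : 0 < e / 2 by lra.
apply: filterS2 (hf _ e2) (hg _ e2) => n a b.
by have := smallD nmD a b; rewrite -splitr.
Qed.
Lemma bndD d f g : bnd d f -> bnd d g -> bnd d (fun n => f n + g n).
Proof.
move=> [C C0 hf] [C' C0' hg]; exists (C + C'); first exact: addr_ge0.
by apply: filterS2 hf hg => n a b; exact: smallD.
Qed.
Lemma ubd_asm d' d Ph f : ubd d' d Ph -> asm d' f -> asm d (fun n => Ph n (f n)).
Proof.
move=> [C C0 hP] hf e e0; have e1 : 0 < e / (C + 1) by rewrite divr_gt0 //; lra.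
apply: filterS2 hP (hf _ e1) => n hP hfn.
apply: small_le (hP _ _ (ltW e1) hfn).
have C1 : 0 < C + 1 by lra.
by rewrite mulrA ler_pdivrMr //; nra.
Qed.
Lemma ubd_bnd d' d Ph f : ubd d' d Ph -> bnd d' f -> bnd d (fun n => Ph n (f n)).
Proof.
move=> [C C0 hP] [C' C0' hf]; exists (C * C'); first exact: mulr_ge0.
by apply: filterS2 hP hf => n hP hfn; apply: hP.
Qed.
Lemma ubd_comp d'' d' d Ph Qh : ubd d'' d' Qh -> ubd d' d Ph ->
  ubd d'' d (fun n p => Ph n (Qh n p)).
Proof.
move=> [C C0 hQ] [C' C0' hP]; exists (C' * C); first exact: mulr_ge0.
apply: filterS2 hQ hP => n hQ hP e p e0 hp; rewrite -mulrA.
by apply: hP; [exact: mulr_ge0|exact: hQ].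
Qed.
Lemma ubd_id d : ubd d d (fun n p => p).
Proof. by exists 1 => //; near=> n => e p _; rewrite mul1r. Unshelve. all: by end_near. Qed.
Lemma ubd_D d' d Ph Qh : ubd d' d Ph -> ubd d' d Qh -> ubd d' d (fun n p => Ph n p + Qh n p).
Proof.
move=> [C C0 hP] [C' C0' hQ]; exists (C + C'); first exact: addr_ge0.
apply: filterS2 hP hQ => n hP hQ e p e0 hp; rewrite mulrDl.
by apply: smallD => //; [exact: hP|exact: hQ].
Qed.
Lemma ubd_0 d' d : ubd d' d (fun n p => 0).
Proof.
by exists 0 => //; near=> n => e p e0 _; apply: small0; rewrite ?mul0r.
Unshelve. all: by end_near. Qed.
Lemma ubd_sum d' d (J : Type) (r : seq J) (P : pred J) (Ph : J -> op) :
  (forall j : J, P j -> ubd d' d (Ph j)) -> ubd d' d (fun n p => \sum_(j <- r | P j) Ph j n p).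
Proof.
move=> h; elim: r => [|x r IH].
  have [C C0 hC] := ubd_0 d' d; exists C => //.
  by apply: filterS hC => n hC e p e0 hp; rewrite big_nil; apply: hC hp.
case Px : (P x); last first.
  have [C C0 hC] := IH; exists C => //.
  by apply: filterS hC => n hC e p e0 hp; rewrite big_cons Px; apply: hC.
have [C C0 hC] := ubd_D (h x Px) IH; exists C => //.
by apply: filterS hC => n hC e p e0 hp; rewrite big_cons Px; apply: hC.
Qed.
Lemma ubd_Z d' d c Ph : ubd d' d Ph -> ubd d' d (fun n p => c *: Ph n p).
Proof.
move=> [C C0 hP]; exists (nm c * C); first exact: mulr_ge0.
by apply: filterS hP => n hP e p e0 hp; rewrite -mulrA; apply: smallZ => //; apply: hP.
Qed.
Lemma ubd_mul d l : bnd d l -> ubd d d (fun n p => l n * p).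
Proof.
move=> [C C0 hl]; exists ((2 ^ d)%:R * C); first by rewrite mulr_ge0.
by apply: filterS hl => n hl e p e0 hp; rewrite -mulrA; apply: smallM.
Qed.
Lemma ubd_mderiv d : ubd d.+1 d (fun n => mderiv ord0).
Proof.
by exists d%:R => //; near=> n => e p e0 hp; apply: small_mderiv.
Unshelve. all: by end_near. Qed.
Lemma ubd_Dl d m : ubd (d + m) d (fun n => Dl m).
Proof.
elim: m d => [|m IH] d; first by rewrite addn0; exact: ubd_id.
have [C C0 hC] := IH d.+1.
exists (2 * d%:R * C); first by rewrite !mulr_ge0.
apply: filterS2 hC (nbhs_infty_ge m.+1) => n hC mn e p e0 hp; rewrite -mulrA /=.
apply: small_Nd => //; [exact: mulr_ge0|exact: ord0_inord|].
by apply: hC => //; rewrite addSnnS.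
Qed.

(** The average over permutations times N! / (N^(m+1) (n - m)!), with N = n+1; this factor is at
    most 1 and tends to 1. *)
Definition avg m : op := fun n p =>
  ((n.+1 ^ m.+1 * (n - m)`!)%:R)^-1 *: \sum_(s : 'S_n.+1) msym s p.

Lemma avg_cstE m n : exists c, (n.+1 ^ m.+1 * (n - m)`!)%N = c.+1.
Proof. by exists (n.+1 ^ m.+1 * (n - m)`!).-1; rewrite prednK // muln_gt0 expn_gt0 fact_gt0. Qed.

Lemma ubd_avg d m : ubd d d (avg m).
Proof.
exists 1 => //; apply: filterS (nbhs_infty_ge m) => n mn e p e0 hp al ald.
have [c cE] := avg_cstE m n.
rewrite /avg mcoeffZ nmM cE nmV mul1r linear_sum /=.
rewrite mulrC ler_pdivrMr ?ltr0n //.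
apply: le_trans (nm_sum nm0 nmD _ _ _) _.
apply: le_trans (_ : \sum_(s : 'S_n.+1) e <= _).
  by apply: ler_sum => s _; exact: (@small_msym _ _ nm _ d e s p hp al ald).
rewrite sumr_const -(mulr_natl e) mulrC; apply: ler_wpM2l => //; rewrite ler_nat -cE.
rewrite (_ : #|_| = (n.+1)`!)%N; last by rewrite -card_Sn; apply: eq_card.
rewrite -(@ffact_fact n.+1 m.+1) // subSS.
by rewrite leq_mul2r ffact_le_exp orbT.
Qed.

Arguments avg m n p : clear implicits.
(** [TL] for the exponent N l, divided by N = n+1: a multiplication operator up to O(1/N). *)
Definition Uop l : op := fun n w => (n.+1%:R)^-1 *: mderiv ord0 w + mderiv ord0 (l n) * w.

Arguments Uop l n w : clear implicits.

Lemma ubd_invN d' d Ph : ubd d' d Ph -> ubd d' d (fun n p => (n.+1%:R)^-1 *: Ph n p).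
Proof.
move=> [C C0 hP]; exists C => //; apply: filterS hP => n hP e p e0 hp.
apply: (small_le _ (smallZ nm_ge0 nmM _ (hP e p e0 hp))).
by rewrite nmV ler_piMl ?mulr_ge0 // invf_le1 ?ler1n ?ltr0n.
Qed.

Local Notation d0 l := (fun n => mderiv ord0 (l n)).

Lemma ubd_Uop d l : bnd d (d0 l) -> ubd d.+1 d (Uop l).
Proof.
move=> hl; apply: ubd_D; first exact: ubd_invN (ubd_mderiv d).
have [C C0 hC] := ubd_mul hl; exists C => //.
by apply: filterS hC => n hC e p e0 hp; apply: hC => //; apply: small_deg hp.
Qed.

Lemma ubd_iterU d j l : bnd (d + j) (d0 l) -> ubd (d + j) d (fun n => iter j (Uop l n)).
Proof.
elim: j d => [|j IH] d hl; first by rewrite addn0; exact: ubd_id.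
rewrite -addSnnS in hl *.
by apply: (ubd_comp (IH d.+1 hl)); apply: ubd_Uop; apply: bnd_deg hl; rewrite addSn leqW // leq_addr.
Qed.

Lemma bnd_emb d q : bnd d (fun n => emb0 n q).
Proof.
exists (\sum_(e < size q) nm q`_e); first exact: sumr_ge0.
near=> n => al _; rewrite embE linear_sum /=.
apply: le_trans (nm_sum nm0 nmD _ _ _) _; apply: ler_sum => e _.
rewrite mcoeffZ mcoeff_varX nmM nm_nat ler_piMr //.
by case: (_ == _).
Unshelve. all: by end_near. Qed.

(* [Dop k (n.+1 *: l n)] divided by [n.+1 ^ k.+1] *)
Definition calD k l : op := fun n p => \sum_(m < k.+1) ('C(k, m)%:R / m.+1%:R : F) *:
  avg m n (Dl m (emb0 n ((1 + 'X) ^+ k) * iter (k - m) (Uop l n) p)).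

Arguments calD k l n p : clear implicits.

Lemma ubd_calD d k l : bnd (d + k) (d0 l) -> ubd (d + k) d (calD k l).
Proof.
move=> hl; apply: ubd_sum => m _; apply: ubd_Z.
have mk : (m <= k)%N by rewrite -ltnS.
apply: (ubd_comp (Ph := avg m) (d' := d)); last exact: ubd_avg.
apply: (ubd_comp (Ph := fun n => Dl m) (d' := d + m)); last exact: ubd_Dl.
apply: (ubd_comp (Ph := fun n p => emb0 n ((1 + 'X) ^+ k) * p) (d' := d + m)); last first.
  exact: ubd_mul (bnd_emb _ _).
have {1}-> : (d + k = d + m + (k - m))%N by rewrite -addnA subnKC.
by apply: ubd_iterU; rewrite -addnA subnKC.
Qed.

Lemma iter_TL_U n (L : MP n) l j w : l n = (n.+1%:R)^-1 *: L ->
  iter j (TL L) w = (n.+1%:R ^+ j : F) *: iter j (Uop l n) w.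
Proof.
move=> lE; elim: j => [|j IH]; first by rewrite expr0 scale1r.
rewrite !iterS IH; move: (iter j _ w) => x.
rewrite /TL /Uop lE !mderivZ exprS scalerDr !scalerA -!scalerAl -!scalerAr scalerA.
have e : (n.+1%:R * n.+1%:R ^+ j / n.+1%:R : F) = n.+1%:R ^+ j by rewrite mulrC mulKf ?charF.
by rewrite e.
Qed.

Lemma calD_Dop k n (L f : MP n) l : (k <= n)%N -> l n = (n.+1%:R)^-1 *: L ->
  calD k l n f = (n.+1%:R ^+ k.+1)^-1 *: Dop k L f.
Proof.
move=> kn lE; rewrite /calD /Dop scaler_sumr; apply: eq_bigr => m _.
have mk : (m <= k)%N by rewrite -ltnS.
have mn := leq_trans mk kn.
rewrite (iter_TL_U _ _ lE) -scalerAr.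
under [in RHS]eq_bigr => s _ do rewrite DlZ // msymZ.
rewrite -scaler_sumr /avg /cst !scalerA embX embD emb1 emb_var; congr (_ *: _).
have h1 := charF m; have h2 := factK_neq0 charF (n - m).
have h3 : (n.+1%:R ^+ m.+1 : F) != 0 by rewrite expf_neq0 ?charF.
have h4 : (n.+1%:R ^+ (k - m) : F) != 0 by rewrite expf_neq0 ?charF.
have -> : (n.+1%:R ^+ k.+1 : F) = n.+1%:R ^+ m.+1 * n.+1%:R ^+ (k - m).
  by rewrite -exprD addSn subnKC.
rewrite natrM natrX.
move: (m.+1%:R : F) ((n - m)`!%:R : F) (n.+1%:R ^+ m.+1 : F) (n.+1%:R ^+ (k - m) : F) h1 h2 h3 h4.
by move=> a b c d h1 h2 h3 h4; field; rewrite h1 h2 h3 h4.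
Qed.

Lemma asm_invN d f (C : R) : (\forall n \near \oo, small d (C / n.+1%:R) (f n)) -> asm d f.
Proof.
move=> h e e0.
have := nbhs_infty_ge (Num.truncn (C / e)).+1; apply: filterS2 h => n hn nC.
apply: small_le hn; rewrite ler_pdivrMr ?ltr0n // mulrC -ler_pdivrMr //.
apply/ltW/(lt_le_trans (truncnS_gt _)); rewrite ler_nat; exact: leqW.
Qed.

Lemma avg_Dl_emb d m q :
  asm d (fun n => avg m n (Dl m (emb0 n q)) - (q`_m)%:A).
Proof.
have [C C0 hC] : bnd d (fun n => Dl m (emb0 n q)).
  exact: ubd_bnd (ubd_Dl d m) (bnd_emb _ q).
pose C' := m.+1%:R * C + (m.+1 ^ 2)%:R * nm q`_m.
have C'1 : m.+1%:R * C <= C' by rewrite lerDl mulr_ge0.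
have C'2 : (m.+1 ^ 2)%:R * nm q`_m <= C' by rewrite lerDr mulr_ge0.
apply: (@asm_invN d _ C').
apply: filterS2 hC (nbhs_infty_ge m) => n hC mn al ald.
have [c cE] := avg_cstE m n.
have n0 : (0 : R) < n.+1%:R by rewrite ltr0n.
have c0 : (0 : R) < c.+1%:R by rewrite ltr0n.
have cle : ((n.+1)`! <= c.+1)%N.
  rewrite -cE -(@ffact_fact n.+1 m.+1) // subSS leq_mul2r; apply/orP; right.
  exact: ffact_le_exp.
rewrite mcoeffB /avg !mcoeffZ cE linear_sum /= mcoeff1.
have [al0|al0] := eqVneq al mnm0.
  rewrite (eq_bigr (fun _ => q`_m)); last first.
    move=> s _; rewrite mcoeff_msym.
    have -> : mpermute s al = mnm_muln (mnm1 ord0) 0.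
      by apply/mnmP => i; rewrite mpermuteE al0 !mnmE.
    by rewrite Dl_emb_pure // addn0.
  rewrite sumr_const mulr1.
  rewrite (_ : #|_| = (n.+1)`!)%N; last by rewrite -card_Sn; apply: eq_card.
  have -> : c.+1%:R^-1 * (q`_m *+ (n.+1)`!) - q`_m = - (((c.+1 - (n.+1)`!)%:R / c.+1%:R) * q`_m).
    rewrite natrB // -(mulr_natl q`_m); have h := charF c.
    by move: (c.+1%:R : F) ((n.+1)`!%:R : F) h => a b h; field.
  rewrite nmN !nmM nmV nm_nat; apply: le_trans (_ : (m.+1 ^ 2)%:R * nm q`_m / n.+1%:R <= _); last first.
    by rewrite ler_pM2r ?invr_gt0.
  rewrite [X in _ <= X]mulrAC; apply: ler_wpM2r => //.
  rewrite ler_pdivrMr // mulrAC ler_pdivlMr // -!natrM ler_nat.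
  have := exp_le_ffact n.+1 m.+1; rewrite -cE.
  rewrite -(@ffact_fact n.+1 m.+1) // subSS.
  have := ffact_le_exp n.+1 m.+1; rewrite !expnS.
  move: (m.+1 * _)%N n.+1 ((n - m)`!)%N (n.+1 ^ m)%N (n.+1 ^_ m.+1)%N => M N f b a h1 h2.
  have : (N * (N * b) * f <= (a * N + M * (N * b)) * f)%N by rewrite leq_mul2r h2 orbT.
  by rewrite -mulnBl; nia.
have [i ai] : exists i, (0 < al i)%N.
  apply/existsP; apply: contraNT al0 => /existsPn h; apply/eqP/mnmP => i.
  by have := h i; rewrite -leqNgt leqn0 mnm0E => /eqP.
rewrite mulr0 subr0 nmM nmV.
apply: le_trans (_ : m.+1%:R * C / n.+1%:R <= _); last by rewrite ler_pM2r ?invr_gt0.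
rewrite mulrC ler_pdivrMr //.
apply: le_trans (nm_sum nm0 nmD _ _ _) _.
apply: le_trans (_ : \sum_(s : 'S_n.+1) \sum_(j < m.+1 | s (inord j) == i) C <= _).
  apply: ler_sum => s _; rewrite mcoeff_msym.
  pose j := (s^-1)%g i; have sj : s j = i by rewrite /j permKV.
  case: (leqP j m) => jm.
    have jm1 : (j < m.+1)%N by [].
    rewrite (bigD1 (Ordinal jm1)) /=; last by rewrite inord_val sj.
    rewrite -[X in X <= _]addr0; apply: lerD; first by apply: hC; rewrite mdeg_mpermute.
    exact: sumr_ge0.
  rewrite (@indep_Dl _ _ m q j mn jm) ?nm0 ?sumr_ge0 //.
  by rewrite mpermuteE sj.
under eq_bigr => s _ do rewrite big_mkcond.
rewrite exchange_big /=.
rewrite (eq_bigr (fun _ => C *+ n`!)) => [|j _]; last first.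
  by rewrite -big_mkcond sumr_const; congr (_ *+ _); exact: card_perm_at.
rewrite sumr_const card_ord -mulrnA -(mulr_natl C).
rewrite mulrAC ler_pdivlMr // mulrAC [X in _ <= X]mulrAC -!natrM.
apply: ler_wpM2r => //; rewrite ler_nat.
by move: cle; rewrite factS; nia.
Qed.


Definition sumemb q : sq := fun n => \sum_(i < n.+1) emb i q.

Lemma mderiv_sumemb q n : mderiv ord0 (sumemb q n) = emb0 n q^`().
Proof.
rewrite /sumemb linear_sum /= (bigD1 ord0) //= mderiv_emb big1 ?addr0 // => i i0.
by rewrite mderiv_emb0 // eq_sym.
Qed.

Section Limit.
Variables (D : nat) (psi : {poly F}) (l : sq).
Hypothesis hl : asm D (fun n => l n - sumemb psi n).
Local Notation psi' := (deriv psi).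

Lemma asm_dl d : (d < D)%N -> asm d (fun n => mderiv ord0 (l n) - emb0 n psi').
Proof.
move=> dD; have h := ubd_asm (ubd_mderiv d) (asm_deg dD hl).
by apply: asm_ext h; near=> n; rewrite mderivB mderiv_sumemb.
Unshelve. all: by end_near. Qed.

Lemma bnd_dl d : (d < D)%N -> bnd d (d0 l).
Proof.
move=> dD; have h := bndD (asm_bnd (asm_dl dD)) (bnd_emb d psi').
by apply: bnd_ext h; near=> n; rewrite subrK.
Unshelve. all: by end_near. Qed.

(** At each step the derivative term carries 1/N and disappears, and multiplication by the
    derivative of [l n] becomes multiplication by psi'. *)
Lemma asm_iterU j d : (d + j < D)%N -> asm d (fun n => iter j (Uop l n) 1 - emb0 n (psi' ^+ j)).
Proof.
elim: j d => [|j IH] d dD.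
  move=> e e0; near=> n; rewrite expr0 emb1 subrr; apply: small0 => //; exact: ltW.
pose w n := iter j (Uop l n) (1 : MP n).
have hw : bnd d.+1 w.
  have h1 : bnd (d.+1 + j) (fun n => 1 : MP n).
    apply: bnd_ext (bnd_emb _ 1); near=> n; by rewrite emb1.
  by apply: (ubd_bnd (ubd_iterU _) h1); apply: bnd_dl; rewrite addSnnS.
have h1 : asm d (fun n => (n.+1%:R)^-1 *: mderiv ord0 (w n)).
  have [C C0 hC] := ubd_bnd (ubd_mderiv d) hw.
  apply: (@asm_invN _ _ C); apply: filterS hC => n hC.
  by rewrite mulrC -nmV; apply: smallZ.
have h2 : asm d (fun n => mderiv ord0 (l n) * (w n - emb0 n (psi' ^+ j))).
  apply: (ubd_asm (ubd_mul (bnd_dl _))); first by lia.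
  by apply: asm_deg (IH d.+1 _); [exact: leqnSn|rewrite addSnnS].
have h3 : asm d (fun n => emb0 n (psi' ^+ j) * (mderiv ord0 (l n) - emb0 n psi')).
  by apply: (ubd_asm (ubd_mul (bnd_emb _ _))); apply: asm_dl; lia.
apply: asm_ext (asmD h1 (asmD h2 h3)); near=> n.
rewrite iterS -/(w n) /Uop exprS embM.
have -> : forall a b c d e : MP n, a + (b * (c - d) + d * (b - e)) = a + b * c - e * d.
  by move=> a b c d0 e; ring.
exact: eqd_refl.
Unshelve. all: by end_near. Qed.

(** The limit of P_k / N^(k+1). *)
Definition Mlim k : F := \sum_(m < k.+1) 'C(k, m)%:R / m.+1%:R * ((1 + 'X) ^+ k * psi' ^+ (k - m))`_m.

Lemma asm_sum d (J : Type) (r : seq J) (P : pred J) (f : J -> sq) :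
  (forall j : J, P j -> asm d (f j)) -> asm d (fun n => \sum_(j <- r | P j) f j n).
Proof.
move=> h; elim: r => [|x r IH].
  by move=> e e0; near=> n; rewrite big_nil; apply: small0 => //; exact: ltW.
case Px : (P x); last by apply: asm_ext IH; near=> n; rewrite big_cons Px.
by apply: asm_ext (asmD (h x Px) IH); near=> n; rewrite big_cons Px.
Unshelve. all: by end_near. Qed.

Lemma asm_calD1 d k : (d + k < D)%N -> asm d (fun n => calD k l n 1 - (Mlim k)%:A).
Proof.
move=> dD.
pose fm (m : nat) n : MP n := avg m n (Dl m (emb0 n ((1 + 'X) ^+ k) *
  (iter (k - m) (Uop l n) 1 - emb0 n (psi' ^+ (k - m))))) +
  (avg m n (Dl m (emb0 n ((1 + 'X) ^+ k * psi' ^+ (k - m)))) -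
   (((1 + 'X) ^+ k * psi' ^+ (k - m))`_m)%:A).
have h : asm d (fun n => \sum_(m < k.+1) ('C(k, m)%:R / m.+1%:R : F) *: fm m n).
  apply: asm_sum => m _; apply: (ubd_asm (ubd_Z _ (ubd_id _))).
  have mk : (m <= k)%N by rewrite -ltnS.
  apply: asmD; last exact: avg_Dl_emb.
  apply: (ubd_asm (ubd_avg d m)); apply: (ubd_asm (ubd_Dl d m)).
  by apply: (ubd_asm (ubd_mul (bnd_emb _ _))); apply: asm_iterU; rewrite -addnA subnKC.
apply: asm_ext h; apply: filterS (nbhs_infty_ge k) => n kn.
rewrite /calD /Mlim scaler_suml -sumrB.
rewrite (eq_bigr (fun m : 'I_k.+1 => ('C(k, m)%:R / m.+1%:R : F) *: avg m n
   (Dl m (emb0 n ((1 + 'X) ^+ k) * iter (k - m) (Uop l n) 1)) -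
   ('C(k, m)%:R / m.+1%:R * ((1 + 'X) ^+ k * psi' ^+ (k - m))`_m)%:A)) => [|m _].
  exact: eqd_refl.
have mk : (m <= k)%N by rewrite -ltnS.
rewrite -scalerA -scalerBr; congr (_ *: _); rewrite /fm addrA; congr (_ - _).
rewrite /avg -scalerDr -big_split /=; congr (_ *: _); apply: eq_bigr => s _.
rewrite -msymD; congr (msym _ _); rewrite -DlD ?(leq_trans mk) // embM; congr (Dl _ _).
by rewrite mulrBr subrK.
Qed.

Lemma iterU_lin j n c (p r : MP n) :
  iter j (Uop l n) (c *: p + r) = c *: iter j (Uop l n) p + iter j (Uop l n) r.
Proof.
elim: j => [//|j IH]; rewrite !iterS IH; move: (iter j _ p) (iter j _ r) => x y.
rewrite /Uop mderivD mderivZ mulrDr !scalerDr !scalerA -scalerAr [c * _]mulrC -!scalerA.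
by rewrite -!addrA; congr (_ + _); rewrite addrCA.
Qed.

Lemma calD_lin k n c (p r : MP n) : (k <= n)%N ->
  calD k l n (c *: p + r) = c *: calD k l n p + calD k l n r.
Proof.
move=> kn; rewrite /calD scaler_sumr -big_split /=; apply: eq_bigr => m _.
have mk : (m <= k)%N by rewrite -ltnS.
have sc (a : F) (x y : MP n) : c *: (a *: x) + a *: y = a *: (c *: x + y).
  by rewrite scalerDr !scalerA mulrC.
rewrite sc; congr (_ *: _); rewrite iterU_lin mulrDr -scalerAr DlD ?DlZ ?(leq_trans mk) //.
rewrite /avg sc; congr (_ *: _).
rewrite scaler_sumr -big_split /=; apply: eq_bigr => s _.
by rewrite msymD msymZ.
Qed.

(** The first application yields a constant plus an error. On the constant, linearity reduces to the
    previous lemma; on the error, the operator is bounded uniformly in N. The second moment is thus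
    asymptotically the square of the first. *)
Lemma asm_calD2 d k : (d + k + k < D)%N ->
  asm d (fun n => calD k l n (calD k l n 1) - (Mlim k ^+ 2)%:A).
Proof.
move=> dD.
have h1 : asm (d + k) (fun n => calD k l n 1 - (Mlim k)%:A) by exact: asm_calD1.
have h2 := ubd_asm (ubd_calD (bnd_dl (d := d + k) _)) h1.
have h3 : asm d (fun n => Mlim k *: (calD k l n 1 - (Mlim k)%:A)).
  by apply: (ubd_asm (ubd_Z _ (ubd_id _))); apply: asm_calD1; lia.
apply: asm_ext (asmD (h2 _) h3); last by lia.
apply: filterS (nbhs_infty_ge k) => n kn.
have E : calD k l n (calD k l n 1) = Mlim k *: calD k l n 1 + calD k l n (calD k l n 1 - (Mlim k)%:A).
  by rewrite -calD_lin //; congr (calD _ _ _ _); rewrite addrC subrK.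
rewrite E scalerBr scalerA -expr2 addrCA addrA; exact: eqd_refl.
Qed.

End Limit.

Lemma nm_coef0_cvg d f c : asm d.+1 (fun n => f n - c%:A) ->
  (fun n => nm (mcoeff mnm0 (f n) - c)) @ \oo --> (0 : R).
Proof.
move=> h; apply/cvgrPdist_le => e e0; apply: filterS (h _ e0) => n hn.
rewrite sub0r normrN ger0_norm //; have := hn mnm0.
by rewrite mdeg0 mcoeffB mcoeffZ mcoeff1 eqxx mulr1; apply.
Qed.

(* The two moments of the eigenvalue of [Dop k 0], read off the generating
   function [B]: conjugation by [B] turns [Dop k 0] into [Dop k (log B)]. *)
Lemma moments_limit (D k : nat) (psi : {poly F}) (B : sq) :
  (k + k + 2 <= D)%N -> (forall n, msymmetric (B n)) ->
  (\forall n \near \oo, mcoeff mnm0 (B n) = 1) ->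
  asm D (fun n => (n.+1%:R)^-1 *: logT D (B n) - sumemb psi n) ->
  let M := Mlim psi k in
  ((fun n => nm ((n.+1%:R ^+ k.+1)^-1 * mcoeff mnm0 (Dop k 0 (B n)) - M)) @ \oo --> (0 : R)) /\
  ((fun n => nm ((n.+1%:R ^+ k.+1)^-1 ^+ 2 * mcoeff mnm0 (Dop k 0 (Dop k 0 (B n))) - M ^+ 2)) @ \oo --> (0 : R)).
Proof.
move=> kD sB B0 hl /=; set M := Mlim psi k.
pose l n := (n.+1%:R)^-1 *: logT D (B n).
have key n : (k <= n)%N -> mcoeff mnm0 (B n) = 1 ->
  ((n.+1%:R ^+ k.+1)^-1 * mcoeff mnm0 (Dop k 0 (B n)) = mcoeff mnm0 (calD k l n 1)) *
  ((n.+1%:R ^+ k.+1)^-1 ^+ 2 * mcoeff mnm0 (Dop k 0 (Dop k 0 (B n))) =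
    mcoeff mnm0 (calD k l n (calD k l n 1))).
  move=> kn Bn; have hL := @eqd_logT _ _ charF D (B n) Bn.
  have h1 : eqd k.+1 (Dop k 0 (B n)) (B n * Dop k (logT D (B n)) 1).
    apply: (eqd_Dop kn (sB n) hL); first by lia.
    by rewrite mulr1; exact: eqd_refl.
  have h2 : eqd 1 (Dop k 0 (Dop k 0 (B n))) (B n * Dop k (logT D (B n)) (Dop k (logT D (B n)) 1)).
    by apply: (eqd_Dop kn (sB n) hL); first by lia.
  have c0 (p : MP n) : mcoeff mnm0 (B n * p) = mcoeff mnm0 p.
    by rewrite (rmorphM (mcoeff mnm0)) /= Bn mul1r.
  have lE : l n = (n.+1%:R)^-1 *: logT D (B n) by [].
  have e1 : calD k l n 1 = (n.+1%:R ^+ k.+1)^-1 *: Dop k (logT D (B n)) 1.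
    exact: calD_Dop.
  have e2 : calD k l n (calD k l n 1) =
      ((n.+1%:R ^+ k.+1)^-1 ^+ 2) *: Dop k (logT D (B n)) (Dop k (logT D (B n)) 1).
    have := calD_lin l (n.+1%:R ^+ k.+1)^-1 (Dop k (logT D (B n)) 1) 0 kn.
    rewrite addr0 -e1 => ->.
    have -> : calD k l n 0 = 0.
      have := calD_lin l 1 0 0 kn; rewrite scaler0 addr0 scale1r => /eqP.
      by rewrite -subr_eq0 opprD addNKr oppr_eq0 => /eqP.
    by rewrite addr0 (calD_Dop _ kn lE) scalerA -expr2.
  have g1 := h1 mnm0; have g2 := h2 mnm0; rewrite mdeg0 in g1 g2.
  split; first by rewrite (g1 isT) c0 e1 mcoeffZ.
  by rewrite (g2 isT) c0 e2 mcoeffZ.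
have P (u v : nat -> R) : (\forall n \near \oo, u n = v n) -> u @ \oo --> (0 : R) -> v @ \oo --> (0 : R).
  by move=> uv; apply: cvg_trans; exact: near_eq_cvg.
split.
  apply: P (nm_coef0_cvg (asm_calD1 (D := D) (psi := psi) (l := l) (d := 1) (k := k) hl _)); last by lia.
  apply: filterS2 B0 (nbhs_infty_ge k) => n Bn kn.
  by rewrite (key n kn Bn).1.
apply: P (nm_coef0_cvg (asm_calD2 (D := D) (psi := psi) (l := l) (d := 1) (k := k) hl _)); last by lia.
apply: filterS2 B0 (nbhs_infty_ge k) => n Bn kn.
by rewrite (key n kn Bn).2.
Qed.

End Asymptotics.

(** * Taylor expansion of characters at 1 *)

Section FallingFactorial.
Variable K : fieldType.
Hypothesis charK : forall m, m.+1%:R != 0 :> K.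
Implicit Types (x t : K) (a k m c : nat).

(** Falling factorials at field elements, because the shifted parts of a signature may be negative;
    [gb] below is the generalised binomial coefficient. *)
Definition fallK x k : K := \prod_(j < k) (x - j%:R).
Definition gb x a : K := fallK x a / a`!%:R.

Lemma fallK_nat m k : fallK m%:R k = (m ^_ k)%:R.
Proof.
elim: k => [|k IH]; first by rewrite /fallK big_ord0.
rewrite /fallK big_ord_recr /= -/(fallK m%:R k) IH ffactnSr natrM.
case: (leqP k m) => km; first by rewrite natrB.
by rewrite ffact_small // !mul0r.
Qed.

Lemma gb_nat m a : gb m%:R a = 'C(m, a)%:R.
Proof.
rewrite /gb fallK_nat -bin_ffact natrM mulfK //.
exact: factK_neq0.
Qed.

(** The falling factorial of x + t as a polynomial in the shift t. *)
Definition fallp x k : {poly K} := \prod_(j < k) ('X + (x - j%:R)%:P).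
Definition gbp x a : {poly K} := (a`!%:R)^-1 *: fallp x a.

Lemma horner_fallp x k t : (fallp x k).[t] = fallK (x + t) k.
Proof.
by rewrite horner_prod; apply: eq_bigr => j _; rewrite hornerD hornerX hornerC; ring.
Qed.

Lemma horner_gbp x a t : (gbp x a).[t] = gb (x + t) a.
Proof. by rewrite hornerZ horner_fallp mulrC. Qed.

Lemma natK_inj : injective (fun m => m%:R : K).
Proof.
move=> a b /eqP; wlog ab : a b / (a <= b)%N.
  move=> H; case: (leqP a b) => [ab|/ltnW ba] h; first exact: H.
  by apply/esym/H; rewrite // eq_sym.
rewrite eq_sym -subr_eq0 -natrB // => h; apply/eqP; rewrite eqn_leq ab /=.
by rewrite -subn_eq0; case: (b - a)%N h => [//|c]; rewrite (negbTE (charK c)).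
Qed.

Lemma poly_eq0_large_nat (p : {poly K}) c0 :
  (forall c, (c0 <= c)%N -> p.[c%:R] = 0) -> p = 0.
Proof.
move=> h; apply: (@roots_geq_poly_eq0 _ p [seq (c%:R : K) | c <- iota c0 (size p)]).
- by apply/allP => x /mapP[c]; rewrite mem_iota => /andP[cc _] ->; apply/eqP/h.
- by rewrite map_inj_uniq ?iota_uniq //; exact: natK_inj.
- by rewrite size_map size_iota.
Qed.

End FallingFactorial.

(** * Normalised characters expanded at 1 *)

Section CharacterTaylor.
Variables (n : nat) (K : fieldType).
Hypothesis charK : forall m, m.+1%:R != 0 :> K.
Hypothesis pointsK : forall p : mpoly n.+1 K, (forall v, meval v p = 0) -> p = 0.
Local Notation MP := (mpoly n.+1 K).
Local Notation Xv i := (mpolyX K (mnm1 i) : MP).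
Local Notation Vp := (Vp n K).
Implicit Types (f g p : MP) (v : 'I_n.+1 -> K) (al : multinom n.+1) (k c D : nat) (t : K).

Lemma TL_lin (b : K) (L p r : MP) : TL L (b *: p + r) = b *: TL L p + TL L r.
Proof.
by rewrite /TL mderivD mderivZ mulrDr -scalerAr scalerDr -!addrA; congr (_ + _); rewrite addrCA.
Qed.

Lemma iter_TL_lin j (b : K) (L p r : MP) : iter j (TL L) (b *: p + r) = b *: iter j (TL L) p + iter j (TL L) r.
Proof. by elim: j => [//|j IH]; rewrite !iterS IH TL_lin. Qed.

Lemma Dop_lin k (b : K) (L p r : MP) : (k <= n)%N -> Dop k L (b *: p + r) = b *: Dop k L p + Dop k L r.
Proof.
move=> kn; rewrite /Dop scaler_sumr -big_split /=; apply: eq_bigr => m _.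
have mn : (m <= n)%N by apply: leq_trans kn; rewrite -ltnS.
have sc (a : K) (x y : MP) : b *: (a *: x) + a *: y = a *: (b *: x + y).
  by rewrite scalerDr !scalerA mulrC.
rewrite sc; congr (_ *: _); rewrite scaler_sumr -big_split /=; apply: eq_bigr => s _.
by rewrite iter_TL_lin mulrDr -scalerAr DlD // DlZ // msymD msymZ.
Qed.

Lemma mcoeff_prod_emb (q : 'I_n.+1 -> {poly K}) al :
  mcoeff al (\prod_i emb i (q i)) = \prod_i (q i)`_(al i).
Proof.
pose S := (\max_i size (q i) + mdeg al).+1.
have sq i : (size (q i) <= S)%N.
  by apply: leq_trans (_ : \max_i size (q i) <= _)%N; [exact: leq_bigmax|rewrite /S; lia].
have sa i : (al i < S)%N by have := le_mdeg al i; rewrite /S; lia.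
have eE i : emb i (q i) = \sum_(e < S) (q i)`_e *: Xv i ^+ e.
  rewrite embE (big_ord_widen S (fun e => (q i)`_e *: Xv i ^+ e)) //.
  rewrite big_mkcond; apply: eq_bigr => e _; case: ltnP => // h.
  by rewrite nth_default // scale0r.
rewrite (eq_bigr _ (fun i _ => eE i)) bigA_distr_bigA /= linear_sum /=.
pose f0 : {ffun 'I_n.+1 -> 'I_S} := [ffun i => Ordinal (sa i)].
have coefE (f : {ffun 'I_n.+1 -> 'I_S}) :
  mcoeff al (\prod_i ((q i)`_(f i) *: Xv i ^+ f i)) = (\prod_i (q i)`_(f i)) * (f == f0)%:R.
  rewrite scaler_prod mcoeffZ; congr (_ * _).
  pose m : multinom n.+1 := Multinom [tuple (f i : nat) | i < n.+1].
  have mE i : m i = f i by rewrite /m mnmE.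
  have -> : \prod_i (Xv i ^+ f i) = mpolyX K m.
    by rewrite mpolyXE_id; apply: eq_bigr => i _; rewrite mE.
  rewrite mcoeffX; congr (nat_of_bool _)%:R; apply/eqP/eqP => [ma|fE].
    by apply/ffunP => i; apply: val_inj; rewrite ffunE /= -mE ma.
  by apply/mnmP => i; rewrite mE fE ffunE.
rewrite (bigD1 f0) //= coefE eqxx mulr1 [X in _ + X]big1 ?addr0.
  by apply: eq_bigr => i _; rewrite ffunE.
by move=> f ff0; rewrite coefE (negbTE ff0) mulr0.
Qed.

Lemma coef_1DX_exp e a : ((1 + 'X) ^+ e : {poly K})`_a = 'C(e, a)%:R.
Proof.
rewrite exprDn coef_sum; under eq_bigr => i _ do rewrite expr1n mul1r coefMn coefXn.
case: (ltnP a e.+1) => ae.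
  rewrite (bigD1 (Ordinal ae)) //= eqxx big1 ?addr0 // => i /negbTE ia.
  have -> : (a == i) = false by rewrite eq_sym; exact: ia.
  by rewrite mul0rn.
rewrite bin_small // big1 // => i _.
by rewrite (_ : (a == i) = false) ?mul0rn //; apply/negbTE; have := ltn_ord i; lia.
Qed.

Lemma vdm_not_injv v : ~ injv v -> vdm v = 0.
Proof.
move=> nv; have [i [j [ij vij]]] : exists i, exists j, i != j /\ v i = v j.
  apply: contrapT => h; apply: nv => i j ij; apply/eqP => e; apply: h.
  by exists i, j.
wlog ltij : i j ij vij / (i < j)%N.
  move=> H; have := ij; rewrite neq_ltn => /orP[lt|lt]; first exact: (H i j).
  by apply: (H j i) => //; rewrite eq_sym.
by rewrite /vdm (bigD1 i) //= (bigD1 j) //= vij subrr !mul0r.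
Qed.

Lemma Vp_neq0 : Vp != 0.
Proof.
apply/eqP => V0; have iv : injv (fun i : 'I_n.+1 => (i : nat)%:R : K).
  by move=> i j; apply: contraNneq => /(natK_inj charK) /ord_inj ->.
by have := vdm_neq0 iv; rewrite -meval_Vp V0 meval0 eqxx.
Qed.

Lemma meval_altM l v : meval v (\det (altM K l)) = \det (\matrix_(i, j) (1 + v i) ^+ l j).
Proof.
rewrite -(det_map_mx (meval v)); congr (\det _); apply/matrixP => i j.
by rewrite /altM !mxE /= meval_exp mevalD meval1 mevalXU.
Qed.

Lemma msym_det_altM l (s : 'S_n.+1) : msym s (\det (altM K l)) = (-1) ^+ s * \det (altM K l).
Proof.
rewrite -(det_map_mx (msym s)).
have -> : map_mx (msym s) (altM K l) = row_perm s (altM K l).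
  by apply/matrixP => i j; rewrite /altM !mxE rmorphXn /= msymD msym1 msym_var.
by rewrite row_permE det_mulmx det_perm.
Qed.

Section Eigen.
Variables (l : 'I_n.+1 -> nat) (f : MP).
Hypothesis Vf : Vp * f = \det (altM K l).

Lemma msymmetric_alternant_quotient : msymmetric f.
Proof.
move=> s; apply: (mulfI Vp_neq0); rewrite Vf.
have := congr1 (msym s) Vf; rewrite msymM msym_Vp msym_det_altM -mulrA => /eqP.
by rewrite (inj_eq (mulfI _)) ?signr_eq0 // => /eqP.
Qed.

Lemma Dop0_eigen k : (k <= n)%N -> Dop k 0 f = (\sum_j fallK ((l j)%:R : K) k) *: f.
Proof.
move=> kn; apply/eqP; rewrite -subr_eq0; apply/eqP.
apply: (mulfI Vp_neq0); rewrite mulr0; apply: pointsK => v.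
rewrite mevalM meval_Vp; have [iv|niv] := pselect (injv v); last first.
  by rewrite vdm_not_injv // mul0r.
rewrite mevalB (Dop0_eigen_points charK kn msymmetric_alternant_quotient iv Vf).
under [X in _ - meval v (X *: _)]eq_bigr do rewrite fallK_nat.
by rewrite -natr_sum subrr mulr0.
Qed.

End Eigen.

Variables (ns : seq ('I_n.+1 -> int)) (l : 'I_n.+1 -> int).
Hypothesis ns0 : (0 < size ns)%N.
Hypothesis alt_ns : forall u : 'I_n.+1 -> K, (forall i, u i != 0) ->
  \det (\matrix_(i < n.+1, j < n.+1) u i ^ l j) = vdm u * laur ns u.

(** The Taylor coefficient at u = 1 of the Laurent polynomial with all exponents raised by t, as a
    polynomial in t. Division by [size ns], the value at 1, makes the constant coefficient 1. *)
Definition gam al : {poly K} :=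
  ((size ns)%:R)^-1 *: \sum_(m <- ns) \prod_i gbp ((m i)%:~R) (al i).

(* The shift [t] of all the exponents is a device: for large natural [t] the
   quotient is a genuine polynomial, and the identities for its coefficients,
   being polynomial in [t], extend to [t = 0]. *)
Definition Tay D t : MP := \sum_(al : bmultinom n.+1 D) (gam al).[t] *: mpolyX K al.

Lemma mcoeff_Tay D t al : (mdeg al < D)%N -> mcoeff al (Tay D t) = (gam al).[t].
Proof.
move=> ald; rewrite /Tay linear_sum /= (bigD1 (BMultinom ald)) //= mcoeffZ mcoeffX eqxx mulr1.
rewrite big1 ?addr0 // => be; rewrite mcoeffZ mcoeffX.
have [e|ne] := eqVneq (bmnm be) al; last by rewrite mulr0.
by move=> /eqP h; exfalso; apply: h; apply: val_inj.
Qed.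

Definition nonneg_shift c : Prop :=
  (forall j, l j + c%:Z = Posz (absz (l j + c%:Z))) /\
  all (fun m : 'I_n.+1 -> int => [forall i, m i + c%:Z == Posz (absz (m i + c%:Z))]) ns.

Lemma nonneg_shift_ex : exists c0, forall c, (c0 <= c)%N -> nonneg_shift c.
Proof.
have abs (x : int) c : (absz x <= c)%N -> x + c%:Z = Posz (absz (x + c%:Z)) by lia.
have ex (m : 'I_n.+1 -> int) : exists c0, forall c, (c0 <= c)%N -> forall i, m i + c%:Z = Posz (absz (m i + c%:Z)).
  exists (\sum_i absz (m i))%N => c hc i; apply: abs; apply: leq_trans hc.
  by rewrite (bigD1 i) //= leq_addr.
have [c1 h1] := ex l.
have [c2 h2] : exists c0, forall c, (c0 <= c)%N ->
    all (fun m : 'I_n.+1 -> int => [forall i, m i + c%:Z == Posz (absz (m i + c%:Z))]) ns.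
  elim: (ns) => [|m s [c2 h2]]; first by exists 0%N.
  have [c3 h3] := ex m; exists (maxn c2 c3) => c; rewrite geq_max => /andP[cc2 cc3] /=.
  by rewrite h2 // andbT; apply/forallP => i; apply/eqP/h3.
exists (maxn c1 c2) => c; rewrite geq_max => /andP[cc1 cc2].
by split; [exact: h1|exact: h2].
Qed.

Lemma eq_bigr_all (V : nmodType) (T : Type) (P : pred T) (s : seq T) (F G : T -> V) :
  all P s -> (forall x, P x -> F x = G x) -> \sum_(x <- s) F x = \sum_(x <- s) G x.
Proof.
move=> + FG; elim: s => [|x s IH] /=; first by rewrite !big_nil.
by move=> /andP[Px Ps]; rewrite !big_cons FG // IH.
Qed.

Definition Qp c : MP := \sum_(m <- ns) \prod_i (1 + Xv i) ^+ absz (m i + c%:Z).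

Lemma mcoeff_Qp c al : nonneg_shift c ->
  mcoeff al (((size ns)%:R)^-1 *: Qp c) = (gam al).[c%:R].
Proof.
move=> [_ hc]; rewrite mcoeffZ /gam hornerZ; congr (_ * _).
rewrite /Qp linear_sum /= horner_sum.
apply: (eq_bigr_all hc) => m /forallP hm.
rewrite (eq_bigr (fun i => emb i ((1 + 'X) ^+ absz (m i + c%:Z)))); last first.
  by move=> i _; rewrite embX embD emb1 emb_var.
rewrite mcoeff_prod_emb horner_prod; apply: eq_bigr => i _.
rewrite coef_1DX_exp horner_gbp -gb_nat //; congr gb.
by rewrite -[c%:R]/((c%:Z)%:~R) -intrD (eqP (hm i)).
Qed.

Lemma alternant_Qp c : nonneg_shift c -> Vp * Qp c = \det (altM K (fun j => absz (l j + c%:Z))).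
Proof.
move=> [hl hc].
(* The factor W disposes of the points where some u_i = 1 + x_i vanishes, at which negative powers
   are meaningless; being nonzero it is cancelled. *)
pose W : MP := \prod_i (1 + Xv i).
have W0 : W != 0.
  apply/prodf_neq0 => i _; apply/eqP => /(congr1 (mcoeff mnm0)).
  rewrite mcoeffD mcoeff1 eqxx mcoeffX mcoeff0 (_ : (mnm1 i == mnm0) = false) ?addr0; last first.
    by apply/eqP => /mnmP /(_ i); rewrite mnm1E mnm0E eqxx.
  by move/eqP; rewrite oner_eq0.
apply/eqP; rewrite -subr_eq0; apply/eqP; apply: (mulfI W0); rewrite mulr0.
apply: pointsK => v; rewrite mevalM mevalB mevalM meval_Vp meval_altM.
have WE : meval v W = \prod_i (1 + v i).
  by rewrite meval_prod; apply: eq_bigr => i _; rewrite mevalD meval1 mevalXU.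
have [h0|/existsNP[i /negP]] := pselect (forall i, 1 + v i != 0); last first.
  by rewrite negbK => /eqP h; rewrite WE (bigD1 i) //= h !mul0r.
have vdmE : vdm (fun i => 1 + v i) = vdm v.
  by apply: eq_bigr => i _; apply: eq_bigr => j _; ring.
have P : \prod_i (1 + v i) ^+ c != 0 by apply/prodf_neq0 => i _; rewrite expf_neq0.
have powE (i : 'I_n.+1) (z : int) : z + c%:Z = Posz (absz (z + c%:Z)) ->
    (1 + v i) ^+ absz (z + c%:Z) = (1 + v i) ^+ c * (1 + v i) ^ z.
  by move=> zE; rewrite exprnP -zE expfzDr // mulrC.
have -> : \det (\matrix_(i, j) (1 + v i) ^+ absz (l j + c%:Z)) =
    (\prod_i (1 + v i) ^+ c) * \det (\matrix_(i < n.+1, j < n.+1) (1 + v i) ^ l j).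
  have -> : (\matrix_(i, j) (1 + v i) ^+ absz (l j + c%:Z)) =
    diag_mx (\row_i (1 + v i) ^+ c) *m (\matrix_(i < n.+1, j < n.+1) (1 + v i) ^ l j).
    by rewrite mul_diag_mx; apply/matrixP => i j; rewrite !mxE powE.
  by rewrite det_mulmx det_diag; congr (_ * _); apply: eq_bigr => i _; rewrite mxE.
rewrite alt_ns // vdmE.
have -> : meval v (Qp c) = (\prod_i (1 + v i) ^+ c) * laur ns (fun i => 1 + v i).
  rewrite /Qp meval_sum /laur big_distrr /=; apply: (eq_bigr_all hc) => m /forallP hm.
  rewrite meval_prod -big_split /=; apply: eq_bigr => i _.
  by rewrite meval_exp mevalD meval1 mevalXU powE //; apply/eqP/hm.
by rewrite mulrCA subrr mulr0.
Qed.

Lemma gam_mnm0 t : (gam mnm0).[t] = 1.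
Proof.
rewrite /gam hornerZ horner_sum (eq_bigr (fun _ => 1)) => [|m _]; last first.
  rewrite (eq_bigr (fun _ => 1)) => [|i _]; first by rewrite big1 ?hornerC.
  by rewrite mnm0E /gbp /fallp big_ord0 fact0 invr1 scale1r.
rewrite big_const_seq count_predT iter_addr_0 mulVf //.
by case: (size ns) ns0 => [//|a _]; exact: charK.
Qed.

(** A linear functional of [Tay D t] is polynomial in t, so an identity valid for all large natural
    shifts holds at t = 0. *)
Lemma Tay_shift_trick D (phi : MP -> K) (p : {poly K}) :
  (forall (b : K) f g, phi (b *: f + g) = b * phi f + phi g) ->
  (exists c0, forall c, (c0 <= c)%N -> phi (Tay D c%:R) = p.[c%:R]) ->
  phi (Tay D 0) = p.[0].
Proof.
move=> phi_lin [c0 h].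
have phi0 : phi 0 = 0.
  have /eqP := phi_lin 1 0 0; rewrite scaler0 addr0 mul1r -subr_eq0 opprD addNKr oppr_eq0.
  by move/eqP.
pose q : {poly K} := \sum_(al : bmultinom n.+1 D) phi (mpolyX K al) *: gam al.
have phiT t : phi (Tay D t) = q.[t].
  rewrite /Tay /q horner_sum.
  have phi_sum (r : seq (bmultinom n.+1 D)) : phi (\sum_(al <- r) (gam al).[t] *: mpolyX K al) =
     \sum_(al <- r) (phi (mpolyX K al) *: gam al).[t].
    elim: r => [|al r IH]; first by rewrite !big_nil.
    by rewrite !big_cons phi_lin IH [(_ *: gam al).[t]]hornerZ [X in X + _]mulrC.
  exact: phi_sum.
have qp : q - p = 0.
  by apply: (poly_eq0_large_nat charK (c0 := c0)) => c hc; rewrite hornerD hornerN -phiT h // subrr.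
by rewrite phiT; move/eqP: qp; rewrite subr_eq0 => /eqP ->.
Qed.

Lemma eqd_Tay_Qp D c : nonneg_shift c -> eqd D (Tay D c%:R) (((size ns)%:R)^-1 *: Qp c).
Proof. by move=> hc al ald; rewrite mcoeff_Tay // mcoeff_Qp. Qed.

Lemma Qp_facts c : nonneg_shift c -> let f := ((size ns)%:R)^-1 *: Qp c in
  [/\ msymmetric f, mcoeff mnm0 f = 1 & forall k, (k <= n)%N ->
    Dop k 0 f = (\sum_j fallK ((l j)%:~R + c%:R : K) k) *: f].
Proof.
move=> hc /=; have sQ := msymmetric_alternant_quotient (alternant_Qp hc).
split=> [s||k kn].
- by rewrite msymZ sQ.
- by rewrite mcoeff_Qp // gam_mnm0.
rewrite -[X in Dop k 0 X]addr0 Dop_lin // (Dop0_eigen (alternant_Qp hc) kn).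
have -> : Dop k 0 (0 : MP) = 0.
  have := Dop_lin 1 0 0 0 kn; rewrite scaler0 addr0 scale1r => /eqP.
  by rewrite -subr_eq0 opprD addNKr oppr_eq0 => /eqP.
rewrite addr0 scalerA mulrC -scalerA; congr (_ *: _); apply: eq_bigr => j _.
by congr fallK; rewrite -[c%:R]/((c%:Z)%:~R) -intrD (hc.1 j).
Qed.

Lemma eqd_Dop0 k d f g : (k <= n)%N -> eqd (d + k) f g -> eqd d (Dop k 0 f) (Dop k 0 g).
Proof.
move=> kn fg; have h := @eqd_Dop n K (d + k) 1 0 k d g f kn.
rewrite !mul1r mderiv0 -mpolyC1 mderivC in h.
apply: h => //; first by move=> s; rewrite mpolyC1 msym1.
Qed.

(** For large shifts the Taylor polynomial agrees below degree D with an eigenfunction of constant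
    term 1, so the constant term of its image is the eigenvalue, polynomial in the shift. *)
Lemma Tay_eigen1 D k : (k <= n)%N -> (k < D)%N ->
  mcoeff mnm0 (Dop k 0 (Tay D 0)) = \sum_j fallK ((l j)%:~R : K) k.
Proof.
move=> kn kD.
rewrite (@Tay_shift_trick D (fun p => mcoeff mnm0 (Dop k 0 p)) (\sum_j fallp (l j)%:~R k)).
- by rewrite horner_sum; apply: eq_bigr => j _; rewrite horner_fallp addr0.
- by move=> b f g; rewrite Dop_lin // mcoeffD mcoeffZ.
have [c0 hc0] := nonneg_shift_ex; exists c0 => c /hc0 hc.
have [sf f0 ff] := Qp_facts hc.
have h : eqd 1 (Dop k 0 (Tay D c%:R)) (Dop k 0 (((size ns)%:R)^-1 *: Qp c)).
  apply: eqd_Dop0 => //; refine (eqd_le _ (@eqd_Tay_Qp D c hc)); by rewrite add1n.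
rewrite h ?mdeg0 // ff // mcoeffZ f0 mulr1 horner_sum.
by apply: eq_bigr => j _; rewrite horner_fallp.
Qed.

Lemma Tay_eigen2 D k : (k <= n)%N -> (k + k < D)%N ->
  mcoeff mnm0 (Dop k 0 (Dop k 0 (Tay D 0))) = (\sum_j fallK ((l j)%:~R : K) k) ^+ 2.
Proof.
move=> kn kD.
rewrite (@Tay_shift_trick D (fun p => mcoeff mnm0 (Dop k 0 (Dop k 0 p)))
  ((\sum_j fallp (l j)%:~R k) ^+ 2)).
- rewrite horner_exp horner_sum; congr (_ ^+ 2).
  by apply: eq_bigr => j _; rewrite horner_fallp addr0.
- by move=> b f g; rewrite !Dop_lin // mcoeffD mcoeffZ.
have [c0 hc0] := nonneg_shift_ex; exists c0 => c /hc0 hc.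
have [sf f0 ff] := Qp_facts hc.
have h : eqd 1 (Dop k 0 (Dop k 0 (Tay D c%:R))) (Dop k 0 (Dop k 0 (((size ns)%:R)^-1 *: Qp c))).
  do 2!apply: eqd_Dop0 => //; refine (eqd_le _ (@eqd_Tay_Qp D c hc)); by rewrite add1n addSn.
have Dop_scale (b : K) (f : MP) : Dop k 0 (b *: f) = b *: Dop k 0 f.
  have h0 : Dop k 0 (0 : MP) = 0.
    have := Dop_lin 1 0 0 0 kn; rewrite scaler0 addr0 scale1r => /eqP.
    by rewrite -subr_eq0 opprD addNKr oppr_eq0 => /eqP.
  by rewrite -[b *: f]addr0 Dop_lin // h0 addr0.
rewrite h ?mdeg0 // ff // Dop_scale ff // mcoeffZ mcoeffZ f0 mulr1 horner_exp horner_sum -expr2.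
by congr (_ ^+ 2); apply: eq_bigr => j _; rewrite horner_fallp.
Qed.

Lemma mcoeff_Tay0 D t al : (D <= mdeg al)%N -> mcoeff al (Tay D t) = 0.
Proof.
move=> Dal; rewrite /Tay linear_sum big1 //= => be _; rewrite mcoeffZ mcoeffX.
have [e|ne] := eqVneq (bmnm be) al; last by rewrite mulr0.
by have := bmdeg be; rewrite e ltnNge Dal.
Qed.

Lemma msymmetric_Tay D : msymmetric (Tay D 0).
Proof.
move=> s; apply/mpolyP => al; rewrite mcoeff_msym.
have [Dal|alD] := leqP D (mdeg al); first by rewrite !mcoeff_Tay0 ?mdeg_mpermute.
apply/eqP; rewrite -subr_eq0; apply/eqP.
rewrite (@Tay_shift_trick D (fun p => mcoeff (mpermute s al) p - mcoeff al p) 0) ?horner0 //.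
  by move=> b f g; rewrite !mcoeffD !mcoeffZ; ring.
have [c0 hc0] := nonneg_shift_ex; exists c0 => c /hc0 hc.
have [sf _ _] := Qp_facts hc.
rewrite !(eqd_Tay_Qp hc) ?mdeg_mpermute // -(mcoeff_msym s) sf subrr horner0 //.
Qed.

End CharacterTaylor.

(** * Restriction of polynomials to lines *)

Section Specialization.
Variables (N : nat) (K : fieldType).
Local Notation MP := (mpoly N K).
Local Notation Xv i := (mpolyX K (mnm1 i) : MP).
Implicit Types (p q : MP) (v : 'I_N -> K) (m d D : nat) (al : multinom N).

(** Restriction to the line through 0 with direction v. Its coefficients are the values at v of the
    homogeneous parts, which reduces multivariate estimates to power series in one variable. *)
Definition spec v p : {poly K} := mmap (@polyC K) (fun i => v i *: 'X) p.

Definition hpart d p : MP := \sum_(al <- msupp p | mdeg al == d) mcoeff al p *: mpolyX K al.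

Lemma mcoeff_hpart d p al : mcoeff al (hpart d p) = if mdeg al == d then mcoeff al p else 0.
Proof.
rewrite /hpart linear_sum /=.
have [alp|alp] := boolP (al \in msupp p); last first.
  rewrite (memN_msupp_eq0 alp) if_same big_seq_cond big1 // => be /andP[bep _].
  rewrite mcoeffZ mcoeffX; have [e|ne] := eqVneq be al; last by rewrite mulr0.
  by move: alp; rewrite -e bep.
have other (be : multinom N) : be != al -> mcoeff al (mcoeff be p *: mpolyX K be) = 0.
  by move=> ne; rewrite mcoeffZ mcoeffX (negbTE ne) mulr0.
rewrite big_mkcond (bigD1_seq al) //= big1 ?addr0 => [|be ne].
  by case: ifP => // _; rewrite mcoeffZ mcoeffX eqxx mulr1.
by case: ifP => // _; exact: other.
Qed.

Lemma coef_spec v p d : (spec v p)`_d = meval v (hpart d p).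
Proof.
rewrite /spec /mmap coef_sum /hpart (big_morph _ (mevalD v) (meval0 v)) [RHS]big_mkcond /=.
apply: eq_bigr => al _; rewrite coefCM /mmap1.
have -> : \prod_(i < N) (v i *: 'X : {poly K}) ^+ al i = (\prod_i v i ^+ al i) *: 'X^(mdeg al).
  rewrite (eq_bigr (fun i => (v i ^+ al i) *: 'X^(al i))) => [|i _]; last by rewrite exprZn.
  by rewrite scaler_prod mdegE; congr (_ *: _); rewrite -expr_sum.
rewrite coefZ coefXn eq_sym; case: ifP => _; last by rewrite mulr0n !mulr0.
by rewrite mulr1 mevalZ mevalX.
Qed.

Lemma eqX_spec v D p q : eqd D p q -> eqX D (spec v p) (spec v q).
Proof.
move=> pq d dD; rewrite !coef_spec; congr (meval v _); apply/mpolyP => al.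
by rewrite !mcoeff_hpart; case: eqP => // ad; rewrite pq // ad.
Qed.

Lemma specD v p q : spec v (p + q) = spec v p + spec v q. Proof. exact: raddfD. Qed.
Lemma specB v p q : spec v (p - q) = spec v p - spec v q. Proof. exact: raddfB. Qed.
Lemma spec1 v : spec v 1 = 1. Proof. exact: rmorph1. Qed.
Lemma specZ v (c : K) p : spec v (c *: p) = c *: spec v p.
Proof. by rewrite /spec mmapZ mul_polyC. Qed.
Lemma spec_sum v (I : Type) (r : seq I) (P : pred I) (f : I -> MP) :
  spec v (\sum_(x <- r | P x) f x) = \sum_(x <- r | P x) spec v (f x).
Proof. exact: raddf_sum. Qed.
Lemma spec_exp v p e : spec v (p ^+ e) = spec v p ^+ e. Proof. exact: rmorphXn. Qed.
Lemma spec_prod v (I : Type) (r : seq I) (P : pred I) (f : I -> MP) :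
  spec v (\prod_(x <- r | P x) f x) = \prod_(x <- r | P x) spec v (f x).
Proof. exact: rmorph_prod. Qed.
Lemma spec_var v i : spec v (Xv i) = v i *: 'X.
Proof. by rewrite /spec mmapX mmap1U. Qed.

Lemma spec_logT v d p : spec v (logT d p) = logT d (spec v p).
Proof.
rewrite /logT spec_sum; apply: eq_bigr => j _.
by rewrite specZ spec_exp specB spec1.
Qed.

End Specialization.

(** * Binomial series with integer exponents *)

Section BinomialSeries.
Variable R : realType.
Local Notation K := (CC R).
Implicit Types (v z : K) (r : R) (a m : nat).

Lemma charCC m : m.+1%:R != 0 :> K.
Proof. by rewrite pnatr_eq0. Qed.

(** Coefficients in z of (1 + v z)^c, and below those of 1 + v z. *)
Definition bz (c : int) v a : K := gb c%:~R a * v ^+ a.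
Definition lin v a : K := if a is a'.+1 then (if a' is 0 then v else 0) else 1.

Lemma gb0 (x : K) : gb x 0 = 1.
Proof. by rewrite /gb /fallK big_ord0 fact0 divr1. Qed.

Lemma gb_pascal (x : K) a : gb (x + 1) a.+1 = gb x a.+1 + gb x a.
Proof.
rewrite /gb.
have -> : fallK (x + 1) a.+1 = (x + 1) * fallK x a.
  rewrite /fallK big_ord_recl /= subr0; congr (_ * _); apply: eq_bigr => i _.
  by rewrite /bump /= -natr1; ring.
rewrite /fallK big_ord_recr /= factS natrM -natr1.
have h1 := charCC a; have h2 := factK_neq0 charCC a.
rewrite -natr1 in h1.
move: (a%:R : K) (a`!%:R : K) (\prod_(i < a) (x - i%:R)) h1 h2 => b f p h1 h2.
by field; rewrite h1 h2.
Qed.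

Lemma conv_lin (b : nat -> K) v m : conv b (lin v) m.+1 = b m.+1 + b m * v.
Proof.
rewrite /conv big_ord_recr /= subnn mulr1 addrC; congr (_ + _).
rewrite big_ord_recr /= subSnn big1 ?add0r // => i _.
by rewrite (_ : (m.+1 - i)%N = (m - i).-1.+2) /= ?mulr0 //; have := ltn_ord i; lia.
Qed.

Lemma bz_up c v : bz (c + 1) v = conv (bz c v) (lin v).
Proof.
apply/funext => -[|m].
  by rewrite /conv big_ord_recl big_ord0 /= /bz !gb0 !expr0 addr0 !mulr1.
by rewrite conv_lin /bz intrD gb_pascal exprSr; ring.
Qed.

Lemma conv_geom (b : nat -> K) v m : conv b (fun e => (- v) ^+ e) m.+1 =
  b m.+1 - v * conv b (fun e => (- v) ^+ e) m.
Proof.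
rewrite /conv big_ord_recr /= subnn expr0 mulr1 addrC; congr (_ + _).
rewrite big_distrr -sumrN; apply: eq_bigr => i _ /=.
by rewrite subSn ?exprS; [ring|have := ltn_ord i; lia].
Qed.

Lemma bz_down c v : bz (c - 1) v = conv (bz c v) (fun e => (- v) ^+ e).
Proof.
apply/funext; elim=> [|m IH].
  by rewrite /conv big_ord_recl big_ord0 /= /bz !gb0 !expr0 addr0 !mulr1.
rewrite conv_geom -IH /bz.
have := gb_pascal ((c - 1)%:~R) m; rewrite -intrD1 subrK => ->.
by rewrite exprS; ring.
Qed.

Section Bounds.
Variables (v : K) (r : R).
Hypotheses (v1 : modC v <= 1) (r0 : 0 <= r) (r1 : r < 1).
Local Notation q := (1 - r)^-1.

Lemma one_le_q : 1 <= q.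
Proof. by move: (r0) (r1) => h0 h1; rewrite invf_ge1; lra. Qed.

Lemma psb_lin : psb r (lin v) q.
Proof.
move: (r0) (r1) (v1) => h0 h1 h2.
have h : 1 + r <= q by rewrite -div1r ler_pdivlMr; nra.
have vr : modC v * r <= r by rewrite ler_piMl.
move=> [|[|m]].
- by rewrite big_ord0; have := one_le_q; lra.
- by rewrite big_ord_recl big_ord0 /= modC1 expr0 mulr1 addr0 one_le_q.
- rewrite 2!big_ord_recl /= modC1 expr0 mulr1 /bump /= expr1 big1 ?addr0 //.
    by apply: le_trans h; lra.
  by move=> i _; rewrite modC0 mul0r.
Qed.

Lemma ps_lin : ps r (lin v) (fun z => 1 + z * v).
Proof.
split; first by exists q; exact: psb_lin.
move=> z _ e e0; exists 2%N => -[//|[//|m]] _.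
rewrite /pss 2!big_ord_recl /= expr0 mulr1 /bump /= expr1 big1 ?addr0.
  by rewrite [v * z]mulrC subrr modC0.
by move=> i _; rewrite mul0r.
Qed.

Lemma one_add_neq0 z : modC z <= r -> 1 + z * v != 0.
Proof.
move=> zr; rewrite addr_eq0; apply/eqP => e.
have : modC (z * v) = 1 by rewrite -modCN -e modC1.
move: (r0) (r1) (v1) => h0 h1 h2; rewrite modCM; have := modC_ge0 v; have := modC_ge0 z; nra.
Qed.

Lemma psb_geomN : psb r (fun e => (- v) ^+ e) q.
Proof.
have rr : 0 < 1 - r by move: (r1); lra.
move=> m; apply: le_trans (_ : \sum_(k < m) r ^+ k <= _).
  apply: ler_sum => i _; rewrite modCX modCN ler_piMl ?exprn_ge0 //.
  by rewrite exprn_ile1 ?modC_ge0.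
rewrite -div1r ler_pdivlMr // mulrC -opprB mulNr -subrX1 opprB.
by rewrite gerBl exprn_ge0.
Qed.

Lemma ps_geomN : ps r (fun e => (- v) ^+ e) (fun z => (1 + z * v)^-1).
Proof.
have h := ps_scale (r := r) (s := r) (c := - v) _ r0 (ps_geom r0 r1).
apply: ps_ext (h _) => [m|z _|]; first by rewrite mulr1.
  by rewrite mulNr opprK mulrC.
by rewrite modCN ler_piMl.
Qed.

Lemma bz_bound c : psb r (bz c v) (q ^+ absz c) /\ ps r (bz c v) (fun z => (1 + z * v) ^ c).
Proof.
have bz0 : bz 0 v = @delta0 K.
  apply/funext => -[|m]; first by rewrite /bz gb0 mul1r.
  by rewrite /bz /gb /fallK big_ord_recl /= subrr !mul0r.
have pos (m : nat) : psb r (bz m v) (q ^+ m) /\ ps r (bz m v) (fun z => (1 + z * v) ^ (Posz m)).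
  elim: m => [|m [IH1 IH2]].
    by rewrite bz0; split; [exact: psb_delta0|apply: ps_delta0].
  have -> : Posz m.+1 = Posz m + 1 by lia.
  rewrite bz_up; split; first by rewrite exprSr; exact: psb_conv psb_lin.
  apply: ps_ext (ps_conv r0 IH2 ps_lin) => // z zr.
  by rewrite expfzDr ?one_add_neq0.
have neg (m : nat) : psb r (bz (- Posz m) v) (q ^+ m) /\ ps r (bz (- Posz m) v) (fun z => (1 + z * v) ^ (- Posz m)).
  elim: m => [|m [IH1 IH2]]; first by rewrite oppr0; exact: (pos 0%N).
  have -> : - Posz m.+1 = - Posz m - 1 by lia.
  rewrite bz_down; split; first by rewrite exprSr; exact: psb_conv psb_geomN.
  apply: ps_ext (ps_conv r0 IH2 ps_geomN) => // z zr.
  by rewrite expfzDr ?one_add_neq0.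
by case: c => m; [exact: pos|rewrite NegzE; exact: neg].
Qed.

Lemma gb_bound (c : int) a : modC v = 1 -> modC (gb c%:~R a) * r ^+ a <= q ^+ absz c.
Proof.
move=> vE; have [h _] := bz_bound c; apply: le_trans (h a.+1).
rewrite big_ord_recr /= (_ : bz c v a = gb c%:~R a * v ^+ a) // (modCM (gb _ _)) modCX vE expr1n mulr1 lerDr.
by apply: sumr_ge0 => i _; rewrite mulr_ge0 ?modC_ge0 ?exprn_ge0.
Qed.

End Bounds.
End BinomialSeries.

Section SeriesProduct.
Variable R : realType.
Local Notation K := (CC R).

Definition cprod (I : Type) (s : seq I) (a : I -> nat -> K) : nat -> K :=
  foldr (fun i b => conv (a i) b) (@delta0 K) s.

Lemma tr_cprod (I : Type) (s : seq I) (a : I -> nat -> K) D :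
  eqX D (tr D (cprod s a)) (\prod_(i <- s) tr D (a i)).
Proof.
elim: s => [|i s IH] /=; first by rewrite big_nil; exact: tr_delta0.
rewrite big_cons; refine (eqX_trans (@tr_conv _ D (a i) (cprod s a)) _).
exact: eqXMl.
Qed.

Lemma psb_cprod (I : Type) (s : seq I) (a : I -> nat -> K) r (C : I -> R) : 0 <= r ->
  (forall i, psb r (a i) (C i)) -> psb r (cprod s a) (\prod_(i <- s) C i).
Proof.
move=> r0 h; elim: s => [|i s IH] /=; first by rewrite big_nil; exact: psb_delta0.
by rewrite big_cons; exact: psb_conv.
Qed.

Lemma ps_cprod (I : Type) (s : seq I) (a : I -> nat -> K) r (f : I -> K -> K) : 0 <= r ->
  (forall i, ps r (a i) (f i)) -> ps r (cprod s a) (fun z => \prod_(i <- s) f i z).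
Proof.
move=> r0 h; elim: s => [|i s IH] /=.
  by apply: ps_ext (ps_delta0 r0) => // z _; rewrite big_nil.
by apply: ps_ext (ps_conv r0 (h i) IH) => // z _; rewrite big_cons.
Qed.

Definition csum (I : Type) (s : seq I) (a : I -> nat -> K) : nat -> K :=
  fun m => \sum_(i <- s) a i m.

Lemma psb_csum (I : Type) (s : seq I) (a : I -> nat -> K) r (C : I -> R) : 0 <= r ->
  (forall i, psb r (a i) (C i)) -> psb r (csum s a) (\sum_(i <- s) C i).
Proof.
move=> r0 h m; apply: le_trans (_ : \sum_(k < m) \sum_(i <- s) modC (a i k) * r ^+ k <= _).
  apply: ler_sum => k _; rewrite -big_distrl /=; apply: ler_wpM2r; first exact: exprn_ge0.
  exact: modC_sum.
by rewrite exchange_big /=; apply: ler_sum => i _; exact: h.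
Qed.

Lemma ps_csum (I : Type) (s : seq I) (a : I -> nat -> K) r (f : I -> K -> K) : 0 <= r ->
  (forall i, ps r (a i) (f i)) -> ps r (csum s a) (fun z => \sum_(i <- s) f i z).
Proof.
move=> r0 h; elim: s => [|i s IH].
  apply: ps_ext (psZ 0 (ps_delta0 r0)) => [m|z _]; rewrite ?mul0r ?big_nil //.
  by rewrite /csum big_nil.
apply: ps_ext (psD r0 (h i) IH) => [m|z _]; rewrite ?big_cons //.
by rewrite /csum big_cons.
Qed.

End SeriesProduct.

(** * Expectation over signatures *)

Section Enumeration.
Variables (T : countType) (V : nmodType).
Implicit Types (g : T -> V) (m : nat).

(** Outcomes are listed through their codes, with zero at the numbers that code nothing, so that
    unordered sums become ordinary series. *)
Definition oS g (i : nat) : V := if @pickle_inv T i is Some x then g x else 0.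
Definition enum_upto m : seq T := pmap (@pickle_inv T) (iota 0 m).

Lemma sum_oS g m : \sum_(i < m) oS g i = \sum_(x <- enum_upto m) g x.
Proof.
rewrite -(big_mkord xpredT (oS g)) /enum_upto /index_iota subn0.
elim: (iota 0 m) => [|i s IH]; first by rewrite !big_nil.
by rewrite big_cons IH /oS /=; case: pickle_inv => [x|]; rewrite ?big_cons ?add0r.
Qed.

Lemma uniq_enum_upto m : uniq (enum_upto m).
Proof.
rewrite /enum_upto; apply: (pmap_uniq (g := pickle)) (iota_uniq 0 m).
exact: pickle_invK.
Qed.

Lemma enum_upto_cover (s : seq T) : exists m0, forall m, (m0 <= m)%N -> {subset s <= enum_upto m}.
Proof.
exists (\max_(x <- s) (pickle x).+1)%N => m hm x xs.
rewrite /enum_upto mem_pmap; apply/mapP; exists (pickle x); last by rewrite pickleK_inv.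
rewrite mem_iota add0n /=; apply: leq_trans hm.
exact: (@leq_bigmax_seq T s xpredT (fun x => (pickle x).+1) x xs isT).
Qed.

End Enumeration.

(** * Exchanging sums over outcomes with Taylor expansion *)

Section SeriesOfSeries.
Variable R : realType.
Local Notation K := (CC R).

Lemma sums_to_enum (T : countType) (f : T -> K) (s : K) : sums_to f s ->
  cvgK (fun m => \sum_(i < m) oS f i) s.
Proof.
move=> h e e0; have e0' : 0 < ofR e :> K by rewrite -ofR0 ltr_ofR.
have [s0 hs0] := h _ e0'; have [m0 hm0] := enum_upto_cover s0.
exists m0 => m mm; have := hs0 _ (uniq_enum_upto T m) (hm0 _ mm).
by rewrite normE ltr_ofR sum_oS.
Qed.

(** With nonnegative terms a finite sum only grows when the set that ensures distance less than 1 to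
    the limit is added to it. *)
Lemma sums_to_bounded (T : countType) (f : T -> K) (s : K) : sums_to f s ->
  (forall x, f x = ofR (reC (f x)) /\ 0 <= reC (f x)) ->
  forall s1 : seq T, uniq s1 -> \sum_(x <- s1) reC (f x) <= modC s + 1.
Proof.
move=> h f0 s1 us1.
have e0' : 0 < ofR 1 :> K by rewrite -ofR0 ltr_ofR.
have [s0 hs0] := h _ e0'.
have := hs0 (s1 ++ [seq x <- undup s0 | x \notin s1]).
have -> : uniq (s1 ++ [seq x <- undup s0 | x \notin s1]).
  rewrite cat_uniq us1 filter_uniq ?undup_uniq // andbT /=.
  by apply/hasPn => x; rewrite mem_filter => /andP[].
have sub : {subset s0 <= s1 ++ [seq x <- undup s0 | x \notin s1]}.
  move=> x xs; rewrite mem_cat mem_filter mem_undup xs andbT.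
  by case: (x \in s1).
move=> /(_ isT sub); rewrite normE ltr_ofR big_cat /= => hlt.
have le1 : \sum_(x <- s1) reC (f x) <= reC (\sum_(x <- s1) f x + \sum_(x <- [seq x <- undup s0 | x \notin s1]) f x).
  rewrite reCD !reC_sum lerDl; apply: sumr_ge0 => x _; exact: (f0 x).2.
move: hlt le1; move: (\sum_(x <- s1) f x + _) => z hlt le1; apply: le_trans le1 _.
have := reC_le z; have := modCD (z - s) s; rewrite subrK.
by have := ler_norm (reC z); lra.
Qed.

Lemma sum_psb_lim (b : nat -> nat -> K) (A : nat -> K) (x : nat -> R) r C :
  0 <= r -> (forall i, psb r (b i) (x i)) -> (forall m, \sum_(i < m) x i <= C) ->
  (forall n, cvgK (fun m => \sum_(i < m) b i n) (A n)) -> psb r A C.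
Proof.
move=> r0 hb hx hA M.
have h m : \sum_(n < M) modC (\sum_(i < m) b i n) * r ^+ n <= C.
  apply: le_trans (hx m).
  apply: le_trans (_ : \sum_(n < M) \sum_(i < m) modC (b i n) * r ^+ n <= _).
    apply: ler_sum => n _; rewrite -big_distrl /=; apply: ler_wpM2r; first exact: exprn_ge0.
    exact: modC_sum.
  by rewrite exchange_big /=; apply: ler_sum => i _; exact: hb.
apply/ler_addgt0Pr => e e0.
pose S := \sum_(n < M) r ^+ n + 1.
have S0 : 0 < S by rewrite ltr_wpDl // sumr_ge0 // => n _; exact: exprn_ge0.
have eS : 0 < e / S by rewrite divr_gt0.
have [m hm] : exists m, forall n : 'I_M, modC (\sum_(i < m) b i n - A n) < e / S.
  have : forall M', exists m0, forall m, (m0 <= m)%N -> forall n, (n < M')%N -> modC (\sum_(i < m) b i n - A n) < e / S.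
    elim=> [|M' [m0 IH]]; first by exists 0%N.
    have [m1 h1] := hA M' _ eS; exists (maxn m0 m1) => m; rewrite geq_max => /andP[mm0 mm1] n.
    by rewrite ltnS leq_eqVlt => /orP[/eqP ->|nM]; [exact: h1|exact: IH].
  by move=> /(_ M) [m0 hm0]; exists m0 => n; exact: hm0.
apply: le_trans (_ : \sum_(n < M) (modC (\sum_(i < m) b i n) + e / S) * r ^+ n <= _).
  apply: ler_sum => n _; apply: ler_wpM2r; first exact: exprn_ge0.
  have := modCD (\sum_(i < m) b i n) (A n - \sum_(i < m) b i n).
  by rewrite addrC subrK modCB; have := hm n; lra.
under eq_bigr do rewrite mulrDl.
rewrite big_split /= -big_distrr /=; apply: lerD (h m) _.
rewrite mulrAC ler_pdivrMr //; apply: ler_wpM2l; first exact: ltW.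
by rewrite /S lerDl.
Qed.

(** The bounds [x i] are summable: past a finite number of outcomes, both the sums and their partial
    Taylor sums are negligible, uniformly in the truncation order; for the remaining outcomes each
    Taylor series converges. *)
Lemma sum_ps_lim (b : nat -> nat -> K) (A : nat -> K) (x : nat -> R) (g : nat -> K -> K) f r C :
  0 <= r -> (forall i, psb r (b i) (x i)) -> (forall m, \sum_(i < m) x i <= C) ->
  (forall n, cvgK (fun m => \sum_(i < m) b i n) (A n)) ->
  (forall i, ps r (b i) (g i)) ->
  (forall z, modC z <= r -> cvgK (fun m => \sum_(i < m) g i z) (f z)) -> ps r A f.
Proof.
move=> r0 hb hx hA hg hf; split; first by exists C; exact: sum_psb_lim hb hx hA.
move=> z zr e e0.
have x0 i : 0 <= x i by exact: psb_ge0 (hb i).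
have e4 : 0 < e / 4 by lra.
have [i0 hi0] := mono_bounded_tail x0 hx e4.
pose d i M := g i z - pss (b i) z M.
have d2 i M : modC (d i M) <= 2 * x i.
  apply: le_trans (modCB_le _ _) _.
  have h1 := ps_bound (hb i) (hg i) zr; have h2 := pss_bound M (hb i) zr; lra.
have [M hM] : exists M0, forall M, (M0 <= M)%N -> \sum_(i < i0) modC (d i M) < e / 4.
  have : cvgK (fun M => \sum_(i < i0) ofR (modC (d i M))) (\sum_(i < i0) 0).
    apply: cvgK_sum => i _ e' e'0; have [M hM] := (hg i).2 z zr e' e'0.
    exists M => M' /hM; rewrite subr0 modC_ofR ger0_norm ?modC_ge0 //.
    by rewrite /d modCB.
  rewrite big1 // => /(_ _ e4) [M hM]; exists M => M' /hM.
  rewrite subr0 -ofR_sum modC_ofR ger0_norm ?sumr_ge0 // => i _; exact: modC_ge0.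
exists M => M' MM'.
have lim : cvgK (fun m => \sum_(i < m) d i M') (f z - pss A z M').
  have h1 : cvgK (fun m => \sum_(i < m) pss (b i) z M') (pss A z M').
    have := @cvgK_sum _ _ (index_enum 'I_M') xpredT (fun (n : 'I_M') m => z ^+ n * \sum_(i < m) b i n) (fun n => z ^+ n * A n).
    move=> /(_ (fun n _ => cvgKMl _ (hA n))) h.
    rewrite /pss (eq_bigr (fun n : 'I_M' => z ^+ n * A n)); last by move=> n _; rewrite mulrC.
    apply: cvgK_ext h => m; rewrite exchange_big /=; apply: eq_bigr => n _.
    by rewrite big_distrr /=; apply: eq_bigr => i _; rewrite mulrC.
  apply: cvgK_ext (cvgKB (hf z zr) h1) => m.
  by rewrite -sumrB.
rewrite modCB; apply: le_lt_trans (_ : 3 * (e / 4) < e); last by lra.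
pose u m := \sum_(i < m + i0) d i M'.
have lim' : cvgK u (f z - pss A z M').
  by move=> e' /lim [m0 hm0]; exists m0 => m hm; apply: hm0; rewrite (leq_trans hm) ?leq_addr.
apply: cvgK_bound lim' => m; rewrite /u.
rewrite -(big_mkord xpredT (fun i => d i M')) (@big_cat_nat _ _ _ i0) ?leq_addl //=.
apply: le_trans (modCD _ _) _.
have -> : 3 * (e / 4) = e / 4 + 2 * (e / 4) by ring.
apply: lerD.
  rewrite big_mkord; apply: le_trans (modC_sum _ _ _) _; exact/ltW/hM.
apply: le_trans (modC_sum _ _ _) _.
apply: le_trans (_ : \sum_(i0 <= i < m + i0) 2 * x i <= _); first exact: ler_sum.
rewrite -big_distrr /=; apply: ler_wpM2l => //; apply/ltW/hi0 => //; exact: leq_addl.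
Qed.

End SeriesOfSeries.

Lemma coef_spec_emb (n : nat) (K : fieldType) (v : 'I_n.+1 -> K) i (q : {poly K}) a :
  (spec v (emb i q))`_a = q`_a * v i ^+ a.
Proof.
rewrite embE spec_sum coef_sum.
rewrite (eq_bigr (fun e : 'I_(size q) => (q`_e * v i ^+ e) * (a == e)%:R)) => [|e _]; last first.
  by rewrite specZ spec_exp spec_var exprZn !coefZ coefXn mulrA.
case: (ltnP a (size q)) => aq.
  rewrite (bigD1 (Ordinal aq)) //= eqxx mulr1 [X in _ + X]big1 ?addr0 // => e /eqP ne.
  case: eqP => [ae|]; last by rewrite mulr0.
  by case: ne; apply: val_inj.
rewrite nth_default // mul0r big1 // => e _.
by rewrite (_ : (a == e) = false) ?mulr0 //; apply/negbTE; have := ltn_ord e; lia.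
Qed.

(** * Expected Taylor coefficients of characters *)

Section CharacterExpectation.
Variables (R : realType) (n : nat).
Local Notation K := (CC R).
Local Notation N := n.+1.
Local Notation sigN := (signature N).
Local Notation MP := (mpoly N K).
Implicit Types (l : sigN) (v : 'I_N -> K) (r : R) (J : pred 'I_N) (D : nat) (al : multinom N).

Definition nsl l : seq ('I_N -> int) := projT1 (cid (schur_laurent R l)).

Lemma nsl0 l : (0 < size (nsl l))%N.
Proof. by rewrite /nsl; case: cid => ns []. Qed.

Lemma nsl_alt l (F : fieldType) (u : 'I_N -> F) : (forall i, u i != 0) ->
  \det (\matrix_(i < N, j < N) u i ^ lexp l j) = vdm u * laur (nsl l) u.
Proof. by rewrite /nsl; case: cid => ns [] /= _ H _; exact: H. Qed.

Lemma nsl_schur l (u : 'rV[K]_N) : (forall i, u 0 i != 0) ->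
  schur l u = laur (nsl l) (fun i => u 0 i).
Proof. by rewrite /nsl; case: cid => ns [] /= _ _ H; exact: H. Qed.

Definition mval v l : K := ((size (nsl l))%:R)^-1 * laur (nsl l) v.

Lemma sizeV_ge0 l : 0 <= ((size (nsl l))%:R)^-1 :> R.
Proof. by rewrite invr_ge0. Qed.

Lemma size_neq0 l : (size (nsl l))%:R != 0 :> K.
Proof. by rewrite pnatr_eq0 -lt0n nsl0. Qed.

Lemma laur_ones l : laur (nsl l) (fun i => (ones R N) 0 i) = (size (nsl l))%:R.
Proof.
rewrite /laur (eq_bigr (fun _ => 1)) => [|m _].
  by rewrite big_const_seq count_predT iter_addr_0.
by rewrite big1 // => i _; rewrite mxE exp1rz.
Qed.

Lemma sgf_termE (rho : sigN -> R) l (u : 'rV[K]_N) : (forall i, u 0 i != 0) ->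
  sgf_term rho l u = ofR (rho l) * mval (fun i => u 0 i) l.
Proof.
move=> u0; rewrite /sgf_term !nsl_schur //; last by move=> i; rewrite mxE oner_neq0.
by rewrite laur_ones /mval -mulrA [_ / _]mulrC.
Qed.

(* Dominates the Taylor coefficients of [mval] at 1, while being bounded by a sum of
   values of [mval] at the points [uE] near 1, where the expectation converges. *)
Definition wJ r J l : R := ((size (nsl l))%:R)^-1 *
  \sum_(m <- nsl l) \prod_i (if J i then (1 - r)^-1 ^+ absz (m i) else 1).

(** The Taylor coefficients in z of the normalised character at the points 1 + z v. *)
Definition aL v l : nat -> K := fun d => ((size (nsl l))%:R)^-1 *
  csum (nsl l) (fun m => cprod (index_enum 'I_N) (fun i => bz (m i) (v i))) d.

Definition TayL D l : MP := Tay (nsl l) D 0.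

Section Bounds.
Variables (r : R) (J : pred 'I_N).
Hypotheses (r0 : 0 < r) (r1 : r < 1).

Lemma aL_bound v l : (forall i, modC (v i) <= 1) -> (forall i, ~~ J i -> v i = 0) ->
  psb r (aL v l) (wJ r J l) /\ ps r (aL v l) (fun z => mval (fun i => 1 + z * v i) l).
Proof.
move=> v1 vJ; have r0' := ltW r0.
have psbZ (c : K) (a : nat -> K) C : psb r a C -> psb r (fun d => c * a d) (modC c * C).
  move=> h m; apply: le_trans (ler_wpM2l (modC_ge0 c) (h m)).
  by rewrite big_distrr /=; apply: ler_sum => i _; rewrite modCM mulrA.
split.
  have -> : wJ r J l = modC ((size (nsl l))%:R^-1 : K) *
      \sum_(m <- nsl l) \prod_i (if J i then (1 - r)^-1 ^+ absz (m i) else 1).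
    by rewrite modCV modC_nat.
  apply: psbZ; apply: psb_csum => // m; apply: psb_cprod => // i.
  case: ifPn => Ji; first by have [] := bz_bound (v1 i) r0' r1 (m i).
  have -> : bz (m i) (v i) = @delta0 K.
    apply/funext => -[|a]; first by rewrite /bz gb0 mul1r.
    by rewrite /bz vJ // exprS mul0r mulr0.
  exact: psb_delta0.
apply: psZ; apply: ps_csum => // m; apply: ps_cprod => // i.
by have [] := bz_bound (v1 i) r0' r1 (m i).
Qed.

(** Links the analytic expansion along a line with the multivariate Taylor polynomial on which the
    operators act. *)
Lemma aL_spec v l D d : (d < D)%N -> aL v l d = (spec v (TayL D l))`_d.
Proof.
move=> dD.
pose q (m : 'I_N -> int) i : {poly K} := \poly_(a < D) gb ((m i)%:~R) a.
have E : eqd D (TayL D l) (((size (nsl l))%:R)^-1 *: \sum_(m <- nsl l) \prod_i emb i (q m i)).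
  move=> al ald; rewrite mcoeff_Tay // mcoeffZ /gam hornerZ; congr (_ * _).
  rewrite linear_sum /= horner_sum; apply: eq_bigr => m _.
  rewrite mcoeff_prod_emb horner_prod; apply: eq_bigr => i _.
  by rewrite horner_gbp addr0 coef_poly (leq_ltn_trans (le_mdeg al i) ald).
rewrite (eqX_spec v E dD) specZ coefZ /aL; congr (_ * _).
rewrite spec_sum coef_sum /csum; apply: eq_bigr => m _.
rewrite spec_prod -(@coef_tr _ D) //.
rewrite (@tr_cprod _ _ _ _ D d dD).
rewrite [in RHS](eq_bigr (fun i => tr D (bz (m i) (v i)))) // => i _.
apply/polyP => a; rewrite coef_spec_emb /q !coef_poly; case: ifP => // _.
by rewrite mul0r.
Qed.

End Bounds.

Lemma wJ_ge0 r J l : r < 1 -> 0 <= wJ r J l.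
Proof.
move=> r1; rewrite mulr_ge0 ?sizeV_ge0 // sumr_ge0 // => m _; apply: prodr_ge0 => i _.
by case: ifP => // _; rewrite exprn_ge0 // invr_ge0; lra.
Qed.

Lemma Tay_coef_bound r D l al : 0 < r -> r < 1 ->
  modC (mcoeff al (TayL D l)) * r ^+ mdeg al <= wJ r xpredT l.
Proof.
move=> r0 r1; have r0' := ltW r0.
have [Dal|alD] := leqP D (mdeg al).
  by rewrite mcoeff_Tay0 // modC0 mul0r wJ_ge0.
rewrite mcoeff_Tay // /gam hornerZ modCM modCV modC_nat /wJ -mulrA.
apply: ler_wpM2l; first exact: sizeV_ge0.
rewrite horner_sum; apply: le_trans (ler_wpM2r _ (modC_sum _ _ _)) _; first exact: exprn_ge0.
rewrite big_distrl /=; apply: ler_sum => m _.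
rewrite horner_prod modC_prod mdegE -prodrXr -big_split /=.
apply: ler_prod => i _; rewrite mulr_ge0 ?modC_ge0 ?exprn_ge0 //=.
rewrite horner_gbp addr0.
have h1 : modC (1 : K) <= 1 by rewrite modC1.
exact: (@gb_bound R 1 r h1 r0' r1 (m i) (al i) (@modC1 R)).
Qed.

(** Positive real test points: each coordinate in J lies on one side of 1 or the other, according to
    [ep]. *)
Definition uE r J (ep : {ffun 'I_N -> bool}) : 'rV[K]_N :=
  \row_i (if J i then ofR (if ep i then 1 - r else (1 - r)^-1) else 1).

Lemma uE_neq0 r J ep i : r < 1 -> uE r J ep 0 i != 0.
Proof.
move=> r1; rewrite mxE; case: (J i); last exact: oner_neq0.
rewrite ofR_eq0; case: (ep i); last rewrite invr_eq0; by apply/eqP => h; lra.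
Qed.

Lemma mval_uE r J ep l : mval (fun i => uE r J ep 0 i) l =
  ofR (((size (nsl l))%:R)^-1 * \sum_(m <- nsl l) \prod_i
    (if J i then (if ep i then 1 - r else (1 - r)^-1) ^ m i else 1)).
Proof.
rewrite /mval /laur ofRM ofRV ofR_nat ofR_sum; congr (_ * _); apply: eq_bigr => m _.
rewrite ofR_prod; apply: eq_bigr => i _; rewrite mxE; case: (J i); last by rewrite exp1rz.
have ofRz (x : R) (z : int) : ofR (x ^ z) = (ofR x : K) ^ z.
  by case: z => e; rewrite ?NegzE -?exprnP ?exprnN ?ofRV ofRX.
by rewrite ofRz.
Qed.

(** For each monomial, choosing the side of every coordinate by the sign of its exponent turns the
    value at the test point into the product of (1 - r)^(-|m_i|). The right choice depends on the
    monomial, but all values are positive, so the sum over all choices is an upper bound. *)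
Lemma wJ_le_sum r J l : 0 < r -> r < 1 ->
  wJ r J l <= \sum_(ep : {ffun 'I_N -> bool}) reC (mval (fun i => uE r J ep 0 i) l).
Proof.
move=> r0 r1; have rr : 0 < 1 - r by lra.
under eq_bigr => ep _ do rewrite mval_uE.
rewrite /= -big_distrr /=; apply: ler_wpM2l; first exact: sizeV_ge0.
rewrite exchange_big /=; apply: ler_sum => m _.
pose e0 : {ffun 'I_N -> bool} := [ffun i => m i < 0].
rewrite (bigD1 e0) //=; apply: le_trans (_ : \prod_i (if J i then (if e0 i then 1 - r else (1 - r)^-1) ^ m i else 1) <= _); last first.
  rewrite lerDl sumr_ge0 // => ep _; apply: prodr_ge0 => i _.
  by case: (J i) => //; rewrite exprz_ge0 //; case: (ep i); rewrite ?invr_ge0 ltW.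
apply: ler_prod => i _; case: (J i); last by rewrite ler01 lexx.
rewrite exprn_ge0 ?invr_ge0 ?(ltW rr) //= ffunE.
case: (m i) => a /=; first exact: lexx.
by rewrite NegzE -exprnN exprVn.
Qed.

Section Rho.
Variable rho : sigN -> R.
Hypothesis rho0 : forall l, 0 <= rho l.

Lemma wJ_bounded r J : 0 < r -> r < 1 ->
  (forall ep, exists s, sgf_sums rho (uE r J ep) s) ->
  exists C, forall s : seq sigN, uniq s -> \sum_(l <- s) rho l * wJ r J l <= C.
Proof.
move=> r0 r1 hs.
have h ep : exists C, forall s : seq sigN, uniq s ->
    \sum_(l <- s) rho l * reC (mval (fun i => uE r J ep 0 i) l) <= C.
  have [s hsum] := hs ep; exists (modC s + 1) => s1 us1.
  have E l : reC (sgf_term rho l (uE r J ep)) = rho l * reC (mval (fun i => uE r J ep 0 i) l).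
    by rewrite sgf_termE ?reC_ofRM // => i; exact: uE_neq0.
  rewrite (eq_bigr _ (fun l _ => esym (E l))).
  apply: (sums_to_bounded hsum) => // l; split.
    rewrite sgf_termE; last by move=> i; exact: uE_neq0.
    by rewrite mval_uE -ofRM.
  rewrite E mulr_ge0 ?rho0 // mval_uE mulr_ge0 ?sizeV_ge0 // sumr_ge0 // => m _.
  apply: prodr_ge0 => i _; case: (J i) => //.
  have rr : 0 < 1 - r by lra.
  by rewrite exprz_ge0 //; case: (ep i); rewrite ?invr_ge0 ltW.
have [C hC] := choice h.
exists (\sum_ep C ep) => s us.
apply: le_trans (_ : \sum_(l <- s) \sum_(ep : {ffun 'I_N -> bool}) rho l * reC (mval (fun i => uE r J ep 0 i) l) <= _).
  apply: ler_sum => l _; rewrite -big_distrr /=; apply: ler_wpM2l; first exact: rho0.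
  exact: wJ_le_sum.
by rewrite exchange_big /=; apply: ler_sum => ep _; exact: hC.
Qed.

Definition Esum (g : sigN -> K) (m : nat) : K := \sum_(i < m) oS (fun l => ofR (rho l) * g l) i.

Lemma Esum_enum g m : Esum g m = \sum_(l <- enum_upto sigN m) ofR (rho l) * g l.
Proof. exact: sum_oS. Qed.

Definition Wbound r J C : Prop := forall s : seq sigN, uniq s -> \sum_(l <- s) rho l * wJ r J l <= C.

Lemma Esum_cvg r J C c (g : sigN -> K) : Wbound r J C ->
  (forall l, modC (g l) <= c * wJ r J l) -> 0 <= c -> exists s, cvgK (Esum g) s.
Proof.
move=> hW hg c0; apply: (@abs_summable_cvg _ _ (c * C)) => m.
have -> : \sum_(i < m) modC (oS (fun l => ofR (rho l) * g l) i) =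
          \sum_(i < m) oS (fun l => rho l * modC (g l)) i.
  apply: eq_bigr => i _; rewrite /oS; case: pickle_inv => [l|]; last by rewrite modC0.
  by rewrite modCM modC_ofR ger0_norm.
rewrite sum_oS; apply: le_trans (_ : c * (\sum_(l <- enum_upto sigN m) rho l * wJ r J l) <= _).
  rewrite big_distrr /=; apply: ler_sum => l _; rewrite mulrCA; apply: ler_wpM2l => //.
by apply: ler_wpM2l => //; apply: hW; exact: uniq_enum_upto.
Qed.

(** Along a line whose direction is supported in J, the generating function is a power series whose
    coefficients are the expected Taylor coefficients. Restricting to J allows a radius independent
    of N when J is the set of the first D variables. *)
Lemma expect_series r J C v (f : K -> K) : 0 < r -> r < 1 -> Wbound r J C ->
  (forall i, modC (v i) <= 1) -> (forall i, ~~ J i -> v i = 0) ->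
  (forall z, modC z <= r -> sgf_sums rho (\row_i (1 + z * v i)) (f z)) ->
  exists A, ps r A f /\ forall d, cvgK (Esum (fun l => aL v l d)) (A d).
Proof.
move=> r0 r1 hW v1 vJ hf; have r0' := ltW r0.
have bnd l := aL_bound r0 r1 l v1 vJ.
have term l d : modC (aL v l d) <= (r ^+ d)^-1 * wJ r J l.
  rewrite mulrC ler_pdivlMr ?exprn_gt0 //.
  have [h _] := bnd l; apply: le_trans (h d.+1); rewrite big_ord_recr /= lerDr.
  by apply: sumr_ge0 => k _; rewrite mulr_ge0 ?modC_ge0 ?exprn_ge0.
have hA d : exists s, cvgK (Esum (fun l => aL v l d)) s.
  apply: Esum_cvg hW (term ^~ d) _; by rewrite invr_ge0 exprn_ge0.
have [A hA'] := choice hA; exists A; split=> //.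
pose b (i d : nat) : K := oS (fun l => ofR (rho l) * aL v l d) i.
pose x (i : nat) : R := oS (fun l => rho l * wJ r J l) i.
pose g (i : nat) (z : K) : K := oS (fun l => ofR (rho l) * mval (fun i => 1 + z * v i) l) i.
have bx i : psb r (b i) (x i).
  rewrite /b /x /oS => m; case: pickle_inv => [l|]; last first.
    by rewrite big1 // => k _; rewrite modC0 mul0r.
  rewrite (eq_bigr (fun k : 'I_m => rho l * (modC (aL v l k) * r ^+ k))) => [|k _]; last first.
    by rewrite modCM modC_ofR ger0_norm // mulrA.
  by rewrite -big_distrr /=; apply: ler_wpM2l => //; exact: (bnd l).1.
have bg i : ps r (b i) (g i).
  rewrite /b /g /oS; case: pickle_inv => [l|]; first exact: psZ (bnd l).2.
  by apply: ps_ext (psZ 0 (ps_delta0 r0')) => [k|z _]; rewrite mul0r.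
apply: (@sum_ps_lim _ b A x g f r C r0' bx) => // [m|z zr].
  rewrite /x sum_oS; apply: hW; exact: uniq_enum_upto.
have h := sums_to_enum (hf z zr).
apply: cvgK_ext h => m; apply: eq_bigr => i _; rewrite /g /oS; case: pickle_inv => // l.
rewrite sgf_termE; last by move=> j; rewrite mxE (one_add_neq0 (v1 j) r0' r1).
by congr (_ * _); rewrite /mval /laur; congr (_ * _); apply: eq_bigr => mm _; apply: eq_bigr => j _; rewrite mxE.
Qed.

Section ExpectedTaylor.
Variables (r C : R) (D : nat).
Hypotheses (r0 : 0 < r) (r1 : r < 1) (hW : Wbound r xpredT C).

Lemma Etay_ex al : exists s, cvgK (Esum (fun l => mcoeff al (TayL D l))) s.
Proof.
apply: (Esum_cvg (c := (r ^+ mdeg al)^-1) hW); last by rewrite invr_ge0 exprn_ge0 ?ltW.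
by move=> l; rewrite mulrC ler_pdivlMr ?exprn_gt0 //; exact: Tay_coef_bound.
Qed.

(** The Taylor polynomial at 1 of the generating function in all N variables. The radius behind its
    existence may depend on N, as only its coefficients are used. *)
Definition Etay : MP := \sum_(al : bmultinom N D) projT1 (cid (Etay_ex al)) *: mpolyX K al.

Lemma Etay_lin (phi : MP -> K) : (forall (b : K) (f g : MP), phi (b *: f + g) = b * phi f + phi g) ->
  cvgK (Esum (fun l => phi (TayL D l))) (phi Etay).
Proof.
move=> phi_lin.
have phi0 : phi 0 = 0.
  have /eqP := phi_lin 1 0 0; rewrite scaler0 addr0 mul1r -subr_eq0 opprD addNKr oppr_eq0.
  by move/eqP.
have phi_sum (c : bmultinom N D -> K) : phi (\sum_(al : bmultinom N D) c al *: mpolyX K al) =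
    \sum_(al : bmultinom N D) phi (mpolyX K al) * c al.
  elim: (index_enum _) => [|al s IH]; first by rewrite !big_nil.
  by rewrite !big_cons phi_lin IH mulrC.
have TE l : phi (TayL D l) = \sum_(al : bmultinom N D) phi (mpolyX K al) * mcoeff al (TayL D l).
  rewrite {1}/TayL /Tay phi_sum; apply: eq_bigr => al _; rewrite mcoeff_Tay //.
  exact: bmdeg.
rewrite /Etay phi_sum.
have h := @cvgK_sum R _ (index_enum (bmultinom N D)) xpredT
  (fun (al : bmultinom N D) m => phi (mpolyX K al) * Esum (fun l => mcoeff al (TayL D l)) m)
  (fun (al : bmultinom N D) => phi (mpolyX K al) * projT1 (cid (Etay_ex al)))
  (fun (al : bmultinom N D) _ => cvgKMl _ (projT2 (cid (Etay_ex al)))).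
apply: cvgK_ext h => m; rewrite Esum_enum.
rewrite (eq_bigr (fun al : bmultinom N D => \sum_(l <- enum_upto sigN m)
   phi (mpolyX K al) * (ofR (rho l) * mcoeff al (TayL D l)))) => [|al _]; last first.
  by rewrite Esum_enum big_distrr.
rewrite exchange_big /=; apply: eq_bigr => l _; rewrite TE big_distrr /=.
by apply: eq_bigr => al _; rewrite mulrCA.
Qed.

End ExpectedTaylor.
End Rho.
End CharacterExpectation.

(** * From analytic germs and neighbourhoods to discs *)

Section Neighbourhoods.
Variable R : realType.
Local Notation K := (CC R).
Implicit Types (r : R).

(** Convergence at one point t between r and ra bounds the terms there, and the ratio r / t gives
    geometric domination. *)
Lemma ps_of_analytic (a : nat -> K) (g : K -> K) (ra r : R) : 0 < r -> r < ra ->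
  (forall z, modC z < ra -> cvgK (pss a z) (g z)) -> ps r a g.
Proof.
move=> r0 rra h; split; last by move=> z zr; apply: h; apply: le_lt_trans rra.
pose t := (r + ra) / 2; have rt : r < t by rewrite /t; lra.
have t0 : 0 < t by lra.
have tra : modC (ofR t : K) < ra by rewrite modC_ofR ger0_norm ?ltW // /t; lra.
have [M hM] := h _ tra 1 ltr01.
have bnd k : modC (a k) * t ^+ k <= 2 + \sum_(j < M) modC (a j) * t ^+ j.
  case: (ltnP k M) => kM.
    rewrite (bigD1 (Ordinal kM)) //= addrCA lerDl addr_ge0 // sumr_ge0 // => j _.
    by rewrite mulr_ge0 ?modC_ge0 ?exprn_ge0 ?ltW.
  have s0 : 0 <= \sum_(j < M) modC (a j) * t ^+ j.
    by apply: sumr_ge0 => j _; rewrite mulr_ge0 ?modC_ge0 ?exprn_ge0 ?ltW.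
  have h1 := hM k kM; have h2 := hM k.+1 (leqW kM).
  have -> : modC (a k) * t ^+ k = modC ((pss a (ofR t) k.+1 - g (ofR t)) - (pss a (ofR t) k - g (ofR t))).
    rewrite opprB addrA subrK /pss big_ord_recr /= addrAC subrr add0r.
    by rewrite modCM modCX modC_ofR ger0_norm ?ltW.
  have := modCB_le (pss a (ofR t) k.+1 - g (ofR t)) (pss a (ofR t) k - g (ofR t)); lra.
set B := 2 + _ in bnd.
have B0 : 0 <= B by apply: le_trans (bnd 0%N); rewrite mulr_ge0 ?modC_ge0 ?exprn_ge0 ?ltW.
pose x := r / t; have x0 : 0 <= x by rewrite divr_ge0 ?ltW.
have x1 : x < 1 by rewrite /x ltr_pdivrMr // mul1r.
exists (B * (1 - x)^-1) => m.
apply: le_trans (_ : \sum_(k < m) B * x ^+ k <= _).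
  apply: ler_sum => k _; have {1}-> : r = t * x by rewrite /x mulrC divfK ?gt_eqF.
  by rewrite exprMn mulrA; apply: ler_wpM2r; [exact: exprn_ge0|exact: bnd].
rewrite -big_distrr /=; apply: ler_wpM2l => //.
have x1' : 0 < 1 - x by lra.
rewrite -div1r ler_pdivlMr // mulrC -opprB mulNr -subrX1 opprB.
by rewrite gerBl exprn_ge0.
Qed.

Lemma exists_perm_avoid (n D : nat) (A : pred 'I_n.+1) : (#|A| <= D)%N ->
  exists s : 'S_n.+1, forall i : 'I_n.+1, (D <= i)%N -> ~~ A (s i).
Proof.
move=> AD; pose e := enum A ++ enum [predC A].
have se : size e = n.+1 by rewrite size_cat -!cardE cardC card_ord.
have ue : uniq e.
  rewrite cat_uniq !enum_uniq andbT /=; apply/hasPn => x; rewrite !mem_enum !inE.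
  by move=> /negbTE h; rewrite [x \in A]h.
have inj : injective (fun i : 'I_n.+1 => nth ord0 e i).
  by move=> i j /eqP; rewrite nth_uniq ?se // => /eqP /val_inj.
exists (perm inj) => i Di; rewrite permE nth_cat -cardE ltnNge (leq_trans AD Di) /=.
have : nth ord0 (enum [predC A]) (i - #|A|) \in enum [predC A].
  rewrite mem_nth // -cardE; have := cardC A; rewrite card_ord.
  have := leq_trans AD Di => Ai h; rewrite ltn_subLR // h; exact: ltn_ord.
by rewrite mem_enum.
Qed.

Lemma ball_rowP (N : nat) (u v : 'rV[K]_N) r : 0 < r ->
  (forall i, modC (u 0 i - v 0 i) < r) -> ball u (ofR r) v.
Proof.
move=> r0 h; split=> [|a b]; first by rewrite -ofR0 ltr_ofR.
by rewrite (ord1 a) /ball /= normE ltr_ofR.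
Qed.

Lemma mcoeff_logT0 (N : nat) (F : fieldType) D (B : mpoly N F) : mcoeff mnm0 B = 1 -> mcoeff mnm0 (logT D B) = 0.
Proof.
move=> B0; rewrite /logT linear_sum big1 //= => j _.
rewrite mcoeffZ exprS (rmorphM (mcoeff mnm0)) /= mcoeffB mcoeff1 eqxx B0 subrr mul0r mulr0 //.
Qed.

End Neighbourhoods.

Section SmallSymmetric.
Variables (R : realType) (n : nat).
Local Notation K := (CC R).

(** A monomial of degree less than D is moved by symmetry onto the first D variables, and Cauchy's
    estimate on their torus is applied to its homogeneous part, whose values are coefficients along
    lines. The number of variables no longer matters. *)
Lemma small_of_spec D (P : mpoly n.+1 K) (e : R) : msymmetric P -> (D <= n.+1)%N -> 0 <= e ->
  mcoeff mnm0 P = 0 ->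
  (forall d (v : 'I_n.+1 -> K), (0 < d)%N -> (d < D)%N ->
     (forall i : 'I_n.+1, if (i < D)%N then modC (v i) = 1 else v i = 0) -> modC ((spec v P)`_d) <= e) ->
  small (@modC R) D e P.
Proof.
move=> sP Dn e0 P0 h al ald.
have [al0|al0] := posnP (mdeg al).
  by have /eqP := al0; rewrite mdeg_eq0 => /eqP ->; rewrite P0 modC0.
have [s hs] : exists s : 'S_n.+1, forall i : 'I_n.+1, (D <= i)%N -> ~~ (0 < al (s i))%N.
  apply: (@exists_perm_avoid n D (fun i => 0 < al i)%N).
  apply: leq_trans (ltnW ald); rewrite mdegE -sum1_card big_mkcond /=.
  by apply: leq_sum => i _; rewrite unfold_in; case: (al i).
rewrite -(sP s) mcoeff_msym.
set be := mpermute s al; have beE : mdeg be = mdeg al by rewrite mdeg_mpermute.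
have -> : mcoeff be P = mcoeff be (hpart (mdeg al) P) by rewrite mcoeff_hpart beE eqxx.
apply: (@mpoly_coef_bound R n.+1 _ be (fun i => i < D)%N e).
  move=> i; rewrite -leqNgt => /hs; rewrite -leqNgt leqn0 => /eqP.
  by rewrite /be mpermuteE.
move=> v hv; rewrite -coef_spec; exact: h.
Qed.

End SmallSymmetric.

(** * Variance of the factorial moments *)

Lemma near_infty_S (P : nat -> Prop) : (\forall m \near \oo, P m) -> \forall m \near \oo, P m.+1.
Proof. by case=> M _ h; exists M => // m Mm; apply: h; exact: leqW. Qed.

Section Assembly.
Variables (R : realType) (rho : forall N, signature N -> R) (Psi : CC R -> CC R).
Local Notation K := (CC R).
Hypothesis rho0 : forall N (l : signature N), 0 <= rho l.
Hypothesis unif : forall N, sgf_unif_near_one (@rho N).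
Hypothesis loglim : log_sgf_limit rho Psi.

Lemma uE_close n (r : R) J ep (i : 'I_n.+1) : 0 < r -> r <= 1 / 2 ->
  modC (1 - uE r J ep 0 i) <= 2 * r.
Proof.
move=> r0 r2; rewrite mxE; case: (J i); last by rewrite subrr modC0; lra.
rewrite -ofR1 -ofRB modC_ofR; case: (ep i).
  by rewrite opprB addrC subrK ger0_norm; lra.
have rr : 0 < 1 - r by lra.
have -> : 1 - (1 - r)^-1 = - (r / (1 - r)).
  have h : 1 - r != 0 by rewrite gt_eqF.
  by field.
rewrite normrN ger0_norm; last by rewrite divr_ge0 ?ltW.
rewrite ler_pdivrMr //; nra.
Qed.

(** The test points lie within 2 r of 1, inside the neighbourhood on which the generating function
    converges for this N. *)
Lemma Wbound_near_one n : exists r C, [/\ 0 < r, r < 1 & Wbound (@rho n.+1) r xpredT C].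
Proof.
have [U [Un [S hS]]] := unif n.+1; rewrite inE in Un.
have /nbhs_ballP [e /= /gt0_ofR [e' e'0 ->] hU] := Un.
pose r := Num.min (1 / 2) (e' / 4).
have r0 : 0 < r by rewrite lt_min; apply/andP; split; lra.
have r2 : r <= 1 / 2 by rewrite ge_min lexx.
have re : r <= e' / 4 by rewrite ge_min lexx orbT.
have r1 : r < 1 by lra.
have [C hC] : exists C, forall s : seq (signature n.+1), uniq s -> \sum_(l <- s) rho l * wJ r xpredT l <= C.
  apply: wJ_bounded => // ep; exists (S (uE r xpredT ep)).
  have uU : U (uE r xpredT ep).
    apply: hU; apply: ball_rowP => // i; rewrite [ones _ _ _ _]mxE.
    by apply: le_lt_trans (uE_close _ _ _ r0 r2) _; lra.
  move=> e2 /hS [s0 hs0]; exists s0 => s1 us1 ss; exact: hs0.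
by exists r, C; split.
Qed.

Lemma Etay_exists D n : exists B : mpoly n.+1 K, forall phi : mpoly n.+1 K -> K,
  (forall (b : K) f g, phi (b *: f + g) = b * phi f + phi g) ->
  cvgK (Esum (@rho n.+1) (fun l => phi (TayL R D l))) (phi B).
Proof.
have [r [C [r0 r1 hW]]] := Wbound_near_one n.
by exists (Etay (@rho0 n.+1) D r0 r1 hW) => phi hphi; exact: Etay_lin.
Qed.

Lemma Esum_ext n (g h : signature n.+1 -> K) : (forall l, g l = h l) -> Esum (@rho n.+1) g = Esum (@rho n.+1) h.
Proof. by move=> /funext ->. Qed.

Lemma sgf_sums_Esum n (u : 'rV[K]_n.+1) s : (forall i, u 0 i != 0) -> sgf_sums (@rho n.+1) u s ->
  cvgK (Esum (@rho n.+1) (mval (fun i => u 0 i))) s.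
Proof.
move=> u0 /sums_to_enum; apply: cvgK_ext => m; apply: eq_bigr => i _; rewrite /oS.
by case: pickle_inv => // l; rewrite sgf_termE.
Qed.

Lemma Esum1 : \forall n \near \oo, cvgK (Esum (@rho n.+1) (fun=> 1)) 1.
Proof.
have [de [de0 [L [hL _]]]] := loglim (ltn0Sn 0).
have := near_infty_S hL; apply: filterS => n [_ [L0 hS]].
have bones : ball (ones R 1) de (ones R 1) by exact: ballxx.
have [s [hs]] := hS _ bones; rewrite L0.
have -> : cexp (0 : K) = 1 by rewrite /cexp /= expR0 cos0 sin0 mulr1 mulr0.
move=> sE; rewrite -sE in hs.
have pE : pad n.+1 (ones R 1) = ones R n.+1.
  by apply/rowP => i; rewrite !mxE; case: insub => [j|] //; rewrite mxE.
rewrite pE in hs.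
have h1 i : (ones R n.+1) 0 i != 0 by rewrite mxE oner_neq0.
have := sgf_sums_Esum h1 hs.
rewrite (Esum_ext (h := fun=> 1)) // => l.
by rewrite /mval laur_ones mulVf // size_neq0.
Qed.

Lemma TayL_sym D n (l : signature n.+1) : msymmetric (TayL R D l).
Proof.
apply: (@msymmetric_Tay n K (@charCC R) (@mpoly_eq0_points R n.+1) (nsl R l) (lexp l) (nsl0 R l)).
by move=> u u0; exact: nsl_alt.
Qed.

Section Expansion.
Variables (D : nat) (a : nat -> K) (ra : R).
Hypotheses (D0 : (0 < D)%N) (ra0 : 0 < ra).
Hypothesis ha : forall z, modC z < ra -> cvgK (pss a z) (Psi (1 + z)).
Variable B : forall n, mpoly n.+1 K.
Hypothesis hB : forall n (phi : mpoly n.+1 K -> K),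
  (forall (b : K) f g, phi (b *: f + g) = b * phi f + phi g) ->
  cvgK (Esum (@rho n.+1) (fun l => phi (TayL R D l))) (phi (B n)).

(** The Taylor polynomial of Psi at 1. Its constant coefficient is set to 0, like that of the
    logarithm of a series with constant term 1. *)
Definition psiD : {poly K} := \poly_(e < D) (if e == 0%N then 0 else a e).

Lemma msymmetric_B n : msymmetric (B n).
Proof.
move=> s; apply/mpolyP => al; apply/eqP; rewrite -subr_eq0; apply/eqP.
have h := @hB n (fun p => mcoeff al (msym s p) - mcoeff al p) _.
apply: cvgK_unique (h _) _ => [b f g|].
  by rewrite msymD msymZ !mcoeffD !mcoeffZ mulrBr opprD addrACA.
apply: cvgK_ext (cvgK_cst 0) => m; rewrite Esum_enum big1 // => l _.
by rewrite TayL_sym subrr mulr0.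
Qed.

Lemma coef0_B : \forall n \near \oo, mcoeff mnm0 (B n) = 1.
Proof.
have := Esum1; apply: filterS => n h1.
apply: cvgK_unique h1.
have := @hB n (mcoeff mnm0); rewrite (Esum_ext (h := fun=> 1)) => [|l].
  by apply=> b f g; rewrite mcoeffD mcoeffZ.
rewrite /TayL mcoeff_Tay ?mdeg0 //; apply: gam_mnm0; [exact: charCC|exact: nsl0].
Qed.

(** Along a line moving the first D coordinates the generating function is exp L, so the logarithm
    of its modulus is Re L, within N e of the real part of N times the sum of the Psi. The
    coefficient bound for formal logarithms then applies, and the factor N cancels against the
    normalisation. *)
Lemma spec_logB n (v : 'I_n.+1 -> K) (q dr e : R) (L : 'rV[K]_D -> K) d : (D <= n.+1)%N ->
  0 < q -> q <= 1 / 4 -> 2 * q < dr -> q < ra ->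
  L (ones R D) = 0 ->
  (forall u, ball (ones R D) (ofR dr) u ->
    exists s, sgf_sums (@rho n.+1) (pad n.+1 u) s /\ cexp (L u) = s) ->
  (forall u, ball (ones R D) (ofR dr) u ->
    `|(n.+1%:R)^-1 * L u - \sum_(i < D) Psi (u 0 i)| < ofR e) ->
  (0 < d)%N -> (d < D)%N ->
  (forall i : 'I_n.+1, if (i < D)%N then modC (v i) = 1 else v i = 0) ->
  modC ((spec v ((n.+1%:R)^-1 *: logT D (B n) - sumemb psiD n))`_d) * q ^+ d <= 2 * e.
Proof.
move=> Dn q0 q4 qdr qra L0 hS hE d0 dD hv.
have q1 : q < 1 by lra.
have N0 : (0 : R) < n.+1%:R by rewrite ltr0n.
have v1 i : modC (v i) <= 1.
  by have := hv i; case: ifP => [_ ->|_ ->] //; rewrite modC0.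
pose w (j : 'I_D) := widen_ord Dn j.
pose u (z : K) : 'rV[K]_D := \row_j (1 + z * v (w j)).
pose J (i : 'I_n.+1) := (i < D)%N.
have vJ i : ~~ J i -> v i = 0 by have := hv i; rewrite /J; case: ifP.
have padE (x : 'I_n.+1 -> K) : (forall i, ~~ J i -> x i = 1) ->
    pad n.+1 (\row_(j < D) x (w j)) = \row_i x i.
  move=> xJ; apply/rowP => i; rewrite !mxE; case: insubP => [j _ ji|].
    by rewrite mxE; congr (x _); apply: val_inj; rewrite /= ji.
  by move=> /xJ ->.
have bu z : modC z <= q -> ball (ones R D) (ofR dr) (u z).
  move=> zq; apply: ball_rowP => [|j]; first by lra.
  rewrite !mxE opprD addrA subrr sub0r modCN modCM.
  have := v1 (w j); have := modC_ge0 (v (w j)); have := modC_ge0 z; nra.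
have pu z : pad n.+1 (u z) = \row_i (1 + z * v i).
  by apply: padE => i /vJ ->; rewrite mulr0 addr0.
have [C hC] : exists C, Wbound (@rho n.+1) q J C.
  apply: wJ_bounded => // ep.
  have [s [hs _]] : exists s, sgf_sums (@rho n.+1) (pad n.+1 (\row_(j < D) uE q J ep 0 (w j))) s /\
      cexp (L (\row_(j < D) uE q J ep 0 (w j))) = s.
    apply: hS; apply: ball_rowP => [|j]; first by lra.
    rewrite [ones _ _ _ _]mxE [in X in _ - X]mxE.
    by apply: le_lt_trans (uE_close _ _ _ q0 _) qdr; lra.
  have uEE : \row_i uE q J ep 0 i = uE q J ep by apply/rowP => i; rewrite mxE.
  exists s; move: hs; rewrite padE => [|i /negbTE Ji]; last by rewrite mxE Ji.
  by rewrite uEE.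
have [A [hA hAl]] := @expect_series R n (@rho n.+1) (@rho0 n.+1) q J C v (fun z => cexp (L (u z))) q0 q1 hC v1 vJ
  (fun z zq => let: ex_intro s (conj hs e) := hS (u z) (bu z zq) in
     eq_ind_r (fun x => sgf_sums (@rho n.+1) (\row_i (1 + z * v i)) x) (eq_ind _ (fun x => sgf_sums _ x s) hs _ (pu z)) e).
have A0 : A 0%N = 1.
  rewrite -(ps0 (ltW q0) hA).
  have -> : u 0 = ones R D by apply/rowP => j; rewrite !mxE mul0r addr0.
  by rewrite L0 /cexp /= expR0 cos0 sin0 mulr1 mulr0.
have trA : eqX D (tr D A) (spec v (B n)).
  move=> k kD; rewrite coef_tr //; apply: cvgK_unique (hAl k) _.
  have := @hB n (fun p => (spec v p)`_k).
  rewrite (Esum_ext (h := fun l => aL v l k)) => [|l]; last by rewrite (@aL_spec R n v l D k kD).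
  by apply=> b f g; rewrite specD specZ coefD coefZ.
pose c k := n.+1%:R * csum (index_enum 'I_D) (fun j k => v (w j) ^+ k * a k) k.
have hc : ps q c (fun z => n.+1%:R * \sum_(j < D) Psi (1 + z * v (w j))).
  apply: psZ; apply: ps_csum => [|j]; first exact: ltW.
  have h := ps_of_analytic q0 qra ha.
  apply: ps_ext (ps_scale (c := v (w j)) _ (ltW q0) h) => // [z _|].
    by rewrite mulrC.
  by rewrite ler_piMl // ltW.
have hcmp z : modC z <= q -> cexp (L (u z)) != 0 /\
   `|ln (modC (cexp (L (u z)))) - reC (n.+1%:R * \sum_(j < D) Psi (1 + z * v (w j)))| <= n.+1%:R * e.
  move=> zq; split; first by rewrite -modC_gt0 modC_cexp expR_gt0.
  rewrite modC_cexp expRK -reCB; apply: le_trans (reC_le _) _.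
  have := hE _ (bu z zq); rewrite normE ltr_ofR.
  have -> : \sum_(i < D) Psi (u z 0 i) = \sum_(j < D) Psi (1 + z * v (w j)).
    by apply: eq_bigr => j _; rewrite mxE.
  move: (\sum_(j < D) _) (L _) => S x h.
  have -> : x - n.+1%:R * S = n.+1%:R * (n.+1%:R^-1 * x - S).
    by rewrite mulrBr mulrA divff ?mul1r // charCC.
  by rewrite modCM modC_nat ler_pM2l // ltW.
have main := logT_ps_bound A0 q0 hA hc hcmp d0 (ltnW dD) dD.
have e1 : (spec v ((n.+1%:R)^-1 *: logT D (B n) - sumemb psiD n))`_d =
    (n.+1%:R)^-1 * ((logT D (tr D A))`_d - c d).
  rewrite specB specZ coefB coefZ spec_logT mulrBr; congr (_ - _).
    by congr (_ * _); apply/esym; exact: (eqX_logT D trA).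
  rewrite /c mulrA mulVf ?charCC // mul1r /sumemb spec_sum coef_sum /csum.
  rewrite (bigID (fun i : 'I_n.+1 => (i < D)%N)) /= [X in _ + X]big1 ?addr0; last first.
    by move=> i iD; rewrite coef_spec_emb vJ // expr0n gtn_eqF // mulr0.
  rewrite (big_ord_narrow Dn); apply: eq_bigr => j _.
  by rewrite coef_spec_emb coef_poly dD gtn_eqF // mulrC.
rewrite e1 modCM modCV modC_nat -mulrA mulrC ler_pdivrMr //.
by apply: le_trans main _; apply: le_of_eq; ring.
Qed.

Lemma asm_logB : asm (@modC R) D (fun n => (n.+1%:R)^-1 *: logT D (B n) - sumemb psiD n).
Proof.
have [de [de0 [L [hL hE]]]] := loglim D0.
have [dr [dr0 deE]] : exists x : R, 0 < x /\ de = ofR x by have [x] := gt0_ofR de0; exists x.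
rewrite deE in hL hE.
have ra0' := ra0.
(* The test points of radius q are within 2 q of 1, which must stay below [dr]; [ra / 2] keeps the
   disc inside the domain of Psi. *)
pose q := Num.min (1 / 4) (Num.min (dr / 4) (ra / 2)).
have q0 : 0 < q by rewrite !lt_min; apply/and3P; move: dr0 ra0'; split; lra.
have q4 : q <= 1 / 4 by rewrite ge_min lexx.
have qd : q <= dr / 4 by rewrite !ge_min lexx !orbT.
have qa : q <= ra / 2 by rewrite !ge_min lexx !orbT.
have qdr : 2 * q < dr by move: dr0 qd; lra.
have qra : q < ra by move: ra0' qa; lra.
have q1 : q <= 1 by move: q4; lra.
(* Compensates the factor q^d in front of the d-th coefficient for all d < D, as well as the factor
   2 of the coefficient bound. *)
move=> e' e'0; pose e := e' * q ^+ D / 2.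
have qD : 0 < q ^+ D by rewrite exprn_gt0.
have e0 : 0 < e by rewrite /e divr_gt0 // mulr_gt0.
have e0' : 0 < ofR e :> K by rewrite -ofR0 ltr_ofR.
have hn : \forall n \near \oo, (D <= n)%N /\ mcoeff mnm0 (B n) = 1.
  by apply: filterS2 (nbhs_infty_ge D) coef0_B => n.
apply: filterS3 hn (near_infty_S hL) (near_infty_S (hE _ e0')) => n [Dn B0] [_ [L0 hS]] hEn.
apply: small_of_spec; rewrite ?(ltW e'0) ?leqW //.
- move=> s; rewrite msymB msymZ msymmetric_logT; last exact: msymmetric_B.
  congr (_ - _); rewrite /sumemb linear_sum /= [RHS](reindex_inj (@perm_inj _ s)) /=.
  apply: eq_bigr => i _; rewrite !embE linear_sum; apply: eq_bigr => k _.
  by rewrite -[LHS]/(msym s _) msymZ rmorphXn /= msym_var.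
- rewrite mcoeffB mcoeffZ mcoeff_logT0 // mulr0 sub0r /sumemb linear_sum big1 ?oppr0 //= => i _.
  have -> : (mnm0 : multinom n.+1) = mnm_muln (mnm1 i) 0 by apply/mnmP => k; rewrite !mnmE.
  by rewrite mcoeff_emb_pure coef_poly D0.
move=> d v d0 dD hv.
have := spec_logB (leqW Dn) q0 q4 qdr qra L0 hS hEn d0 dD hv.
move: (modC _) => x hx.
have qdD : q ^+ D <= q ^+ d by apply: ler_wiXn2l => //; [exact: ltW|exact: ltnW].
have qdp : 0 < q ^+ d by rewrite exprn_gt0.
have : x * q ^+ d <= e' * q ^+ d.
  apply: le_trans hx _; rewrite /e mulrC divfK ?pnatr_eq0 //.
  by apply: ler_wpM2l => //; exact: ltW.
by rewrite ler_pM2r.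
Qed.

End Expansion.

Lemma sum_subset_le (T : eqType) (F : T -> R) (s t : seq T) : uniq s -> uniq t ->
  {subset s <= t} -> (forall x, 0 <= F x) -> \sum_(x <- s) F x <= \sum_(x <- t) F x.
Proof.
move=> us ut st F0; rewrite [leRHS](bigID (mem s)) /= -[leLHS]addr0; apply: lerD; last exact: sumr_ge0.
rewrite -[leRHS]big_filter; have P : perm_eq s [seq x <- t | x \in s]; last by rewrite (perm_big _ P).
apply: uniq_perm => //; first exact: filter_uniq.
by move=> x; rewrite mem_filter; case xs : (x \in s) => //=; rewrite st.
Qed.

Definition facsum k n (l : signature n.+1) : K := \sum_j fallK ((lexp l j)%:~R : K) k.

Lemma facsum_real k n (l : signature n.+1) : facsum k l = ofR (reC (facsum k l)).
Proof.
have -> : facsum k l = ofR (\sum_j \prod_(i < k) ((lexp l j)%:~R - i%:R)).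
  rewrite ofR_sum; apply: eq_bigr => j _; rewrite ofR_prod; apply: eq_bigr => i _.
  by rewrite ofRB ofR_int ofR_nat.
by [].
Qed.

Lemma facsum_Tay1 k D n (l : signature n.+1) : (k <= n)%N -> (k < D)%N ->
  mcoeff mnm0 (Dop k 0 (TayL R D l)) = facsum k l.
Proof.
move=> kn kD.
apply: (@Tay_eigen1 n K (@charCC R) (@mpoly_eq0_points R n.+1) (nsl R l) (lexp l) (nsl0 R l)) => //.
by move=> u u0; exact: nsl_alt.
Qed.

Lemma facsum_Tay2 k D n (l : signature n.+1) : (k <= n)%N -> (k + k < D)%N ->
  mcoeff mnm0 (Dop k 0 (Dop k 0 (TayL R D l))) = facsum k l ^+ 2.
Proof.
move=> kn kD.
apply: (@Tay_eigen2 n K (@charCC R) (@mpoly_eq0_points R n.+1) (nsl R l) (lexp l) (nsl0 R l)) => //.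
by move=> u u0; exact: nsl_alt.
Qed.

Lemma imC_lim0 (u : nat -> K) x : cvgK u x -> (forall m, imC (u m) = 0) -> imC x = 0.
Proof.
move=> h u0; apply/eqP; rewrite -normr_eq0; apply/eqP/le_anti; rewrite normr_ge0 andbT.
apply/ler_addgt0Pr => e e0; rewrite add0r; have [M /(_ M (leqnn _)) hM] := h _ e0.
apply: le_trans (ltW hM); apply: le_trans (imC_le _).
by rewrite imCB u0 sub0r normrN.
Qed.

(** The first two moments tend to M and M^2, whence E (X - M)^2 = (E X^2 - M^2) - 2 M (E X - M)
    tends to 0. The statement is about finite sets of outcomes, whose sums are bounded by partial
    sums of the expectation because the terms are nonnegative. *)
Lemma facsum_variance k (a : nat -> K) (ra : R) : 0 < ra ->
  (forall z, modC z < ra -> cvgK (pss a z) (Psi (1 + z))) ->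
  forall e : R, 0 < e -> \forall n \near \oo, forall s : seq (signature n.+1), uniq s ->
  \sum_(l <- s) rho l * modC (facsum k l / n.+1%:R ^+ k.+1 - Mlim (psiD (k + k + 2) a) k) ^+ 2 <= e.
Proof.
(* Two applications of the operator cost k degrees each and the derivative of the logarithm one
   more; one degree must remain for the constant term. *)
move=> ra0 ha; set D := (k + k + 2)%N; set M := Mlim _ k.
pose B n := projT1 (cid (Etay_exists D n)).
have hB n := projT2 (cid (Etay_exists D n)).
rewrite -/(B _) in hB.
have D0 : (0 < D)%N by rewrite /D; lia.
have [lim1 lim2] := @moments_limit R K (@modC R) (@modC0 R) (@modC_ge0 R) (@modCD R) (@modCM R) (@modCN R) (@modC_nat R)
  D k (psiD D a) B (leqnn _) (msymmetric_B hB) (coef0_B D0 hB) (asm_logB D0 ra0 ha hB).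
pose x1 n : K := (n.+1%:R ^+ k.+1)^-1 * mcoeff mnm0 (Dop k 0 (B n)).
pose x2 n : K := (n.+1%:R ^+ k.+1)^-1 ^+ 2 * mcoeff mnm0 (Dop k 0 (Dop k 0 (B n))).
pose X n (l : signature n.+1) : K := facsum k l / n.+1%:R ^+ k.+1.
have EX n : (k <= n)%N -> cvgK (Esum (@rho n.+1) (@X n)) (x1 n).
  move=> kn; have := @hB n (fun p => (n.+1%:R ^+ k.+1)^-1 * mcoeff mnm0 (Dop k 0 p)).
  rewrite (Esum_ext (h := @X n)) => [|l].
    by apply=> b f g; rewrite Dop_lin // mcoeffD mcoeffZ mulrDr mulrCA.
  have kD : (k < D)%N by rewrite /D; lia.
  by rewrite (facsum_Tay1 _ kn kD) mulrC.
have EX2 n : (k <= n)%N -> cvgK (Esum (@rho n.+1) (fun l => X n l ^+ 2)) (x2 n).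
  move=> kn; have := @hB n (fun p => (n.+1%:R ^+ k.+1)^-1 ^+ 2 * mcoeff mnm0 (Dop k 0 (Dop k 0 p))).
  rewrite (Esum_ext (h := fun l => X n l ^+ 2)) => [|l].
    by apply=> b f g; rewrite !Dop_lin // mcoeffD mcoeffZ mulrDr mulrCA.
  have kD : (k + k < D)%N by rewrite /D; lia.
  by rewrite (facsum_Tay2 _ kn kD) mulrC -exprMn.
have Xreal n (l : signature n.+1) : imC (X n l) = 0.
  by rewrite /X facsum_real -ofR_nat -ofRX -ofRV -ofRM.
(* A limit of expectations of real variables. Reality makes |X - M|^2 equal to (X - M)^2, which is
   what the moments compute. *)
have Mreal : imC M = 0.
  have h : cvgK (fun n => x1 (n + k)%N) M.
    move=> e e0; move/cvgrPdist_lt : lim1 => /(_ _ e0) [m0 _ hm0]; exists m0 => m mm.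
    have := hm0 (m + k)%N; rewrite /= sub0r normrN ger0_norm ?modC_ge0 //; apply.
    by rewrite (leq_trans mm) ?leq_addr.
  apply: imC_lim0 h _ => m; apply: imC_lim0 (EX _ (leq_addl _ _)) _ => m'.
  rewrite Esum_enum imC_sum big1 // => l _.
  have -> : X (m + k)%N l = ofR (reC (X (m + k)%N l)) by apply: eqC_re_im => //; rewrite Xreal.
  by rewrite -ofRM.
move=> e e0; have e2 : 0 < e / (4 * (modC M + 1)).
  by rewrite divr_gt0 // mulr_gt0 // ltr_wpDl ?modC_ge0.
have e2' : 0 < e / 2 by rewrite divr_gt0.
move/cvgrPdist_lt : lim1 => /(_ _ e2) n1; move/cvgrPdist_lt : lim2 => /(_ _ e2') n2.
have n3 : \forall n \near \oo, (k <= n)%N /\ cvgK (Esum (@rho n.+1) (fun=> 1)) 1.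
  by apply: filterS2 (nbhs_infty_ge k) Esum1 => n.
apply: filterS3 n1 n2 n3 => n; rewrite !sub0r !normrN !ger0_norm ?modC_ge0 // => h1 h2 [kn E1].
rewrite -/(x1 n) in h1; rewrite -/(x2 n) in h2.
pose y := x2 n - 2 * M * x1 n + M ^+ 2 * 1.
have Ey : cvgK (Esum (@rho n.+1) (fun l => (X n l - M) ^+ 2)) y.
  apply: cvgK_ext (cvgKD (cvgKB (EX2 n kn) (cvgKMl (2 * M) (EX n kn))) (cvgKMl (M ^+ 2) E1)) => m.
  rewrite !Esum_enum [2 * M * _]big_distrr [M ^+ 2 * _]big_distrr -sumrB -big_split /=; apply: eq_bigr => l _.
  by move: (X n l) (ofR _) => x t; ring.
have ye : modC y <= e.
  have -> : y = (x2 n - M ^+ 2) - (2 * M) * (x1 n - M) by rewrite /y; ring.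
  apply: le_trans (modCB_le _ _) _; rewrite !modCM modC_nat.
  have M1 : 0 < modC M + 1 by rewrite ltr_wpDl ?modC_ge0.
  have : 2 * modC M * modC (x1 n - M) <= e / 2.
    move: h1; rewrite ltr_pdivlMr ?mulr_gt0 //.
    have := modC_ge0 (x1 n - M); have := modC_ge0 M; move: (modC M) (modC (x1 n - M)) => p t; nra.
  by move: h2; lra.
move=> s us; apply/ler_addgt0Pr => e' e'0.
have [m0 hm0] := enum_upto_cover s; have [m1 hm1] := Ey _ e'0.
pose m := maxn m0 m1.
have hm : modC (Esum (@rho n.+1) (fun l => (X n l - M) ^+ 2) m - y) < e' by apply: hm1; rewrite leq_maxr.
have sm := hm0 m (leq_maxl _ _).
apply: le_trans (sum_subset_le us (uniq_enum_upto _ m) sm _) _ => [l|].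
  by rewrite mulr_ge0 ?exprn_ge0 ?modC_ge0.
have -> : \sum_(l <- enum_upto (signature n.+1) m) rho l * modC (facsum k l / n.+1%:R ^+ k.+1 - M) ^+ 2 =
    reC (Esum (@rho n.+1) (fun l => (X n l - M) ^+ 2) m).
  rewrite Esum_enum reC_sum; apply: eq_bigr => l _; rewrite -/(X n l) reC_ofRM; congr (_ * _).
  have -> : X n l - M = ofR (reC (X n l - M)) by apply: eqC_re_im => //; rewrite imCB Xreal Mreal subrr.
  by rewrite modC_ofR -ofRX /= real_normK ?num_real.
have := modCD (Esum (@rho n.+1) (fun l => (X n l - M) ^+ 2) m - y) y; rewrite subrK.
have := reC_le (Esum (@rho n.+1) (fun l => (X n l - M) ^+ 2) m).
have := ler_norm (reC (Esum (@rho n.+1) (fun l => (X n l - M) ^+ 2) m)).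
move: hm ye; lra.
Qed.

End Assembly.

(** * The recursion for Perelomov-Popov moments *)

Section PerelomovPopov.
Variables (K : fieldType) (N : nat).
Hypothesis charK : forall m, m.+1%:R != 0 :> K.
Variables (x : 'I_N -> K) (q : K).
Hypothesis x_inj : forall i j, i != j -> x i != x j.

Definition ppw i : K := \prod_(j < N | j != i) ((x i - x j - q) / (x i - x j)).
Definition ppc k : K := \sum_i ppw i * x i ^+ k.
(** The quotient ((t + q)^m - t^m) / q, expanded so as to make sense at q = 0. *)
Definition dpow (m : nat) (t : K) : K := \sum_(a < m) 'C(m, a)%:R * q ^+ (m.-1 - a) * t ^+ a.
Definition dsum m : K := \sum_i dpow m (x i).

Lemma dpowE m t : q * dpow m t = (t + q) ^+ m - t ^+ m.
Proof.
rewrite [t + q]addrC exprDn big_ord_recr /= subnn expr0 mul1r binn mulr1n addrK.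
rewrite big_distrr /=; apply: eq_bigr => a _; have am := ltn_ord a.
have -> : (m - a)%N = (m.-1 - a).+1 by lia.
by rewrite exprS -[RHS]mulr_natl; ring.
Qed.

(** Both sides have degree less than N, the leading terms on the left cancelling, and they agree at
    the N distinct nodes x_i by definition of the weights. *)
Lemma lagrange_PP : \prod_i ('X - (x i)%:P) - \prod_i ('X - (x i + q)%:P) =
  q *: \sum_i ppw i *: \prod_(j | j != i) ('X - (x j)%:P).
Proof.
apply/eqP; rewrite -subr_eq0; apply/eqP.
set p := \prod_i ('X - (x i)%:P); set p' := \prod_i _; set w := q *: _.
have sp (y : 'I_N -> K) : size (\prod_i ('X - (y i)%:P)) = N.+1.
  by rewrite size_prod_XsubC /index_enum -enumT size_enum_ord.
apply: (@roots_geq_poly_eq0 _ _ [seq x i | i <- enum 'I_N]).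
- apply/allP => y /mapP[i _ ->]; rewrite rootE !(hornerD, hornerN) /w hornerZ horner_sum.
  have pr (z : 'I_N -> K) (P : pred 'I_N) (t : K) : (\prod_(j | P j) ('X - (z j)%:P)).[t] = \prod_(j | P j) (t - z j).
    by rewrite horner_prod; apply: eq_bigr => j _; rewrite hornerXsubC.
  rewrite (bigD1 i) //= [X in _ * (_ + X)]big1 ?addr0 => [|k ki]; last first.
    by rewrite hornerZ pr (bigD1 i) 1?eq_sym //= subrr mul0r mulr0.
  rewrite hornerZ !pr (bigD1 i) //= subrr mul0r sub0r.
  rewrite (bigD1 i) //= opprD addrA subrr sub0r mulNr opprK.
  have -> : ppw i * \prod_(j | j != i) (x i - x j) = \prod_(j | j != i) (x i - (x j + q)).
    rewrite /ppw -big_split /=; apply: eq_bigr => j ji.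
    by rewrite divfK ?opprD ?addrA // subr_eq0 x_inj // eq_sym.
  by rewrite subrr.
- rewrite map_inj_in_uniq ?enum_uniq // => i j _ _; apply: contra_eq => ij; exact: x_inj.
rewrite size_map size_enum_ord; apply/leq_sizeP => k Nk.
rewrite !coefB /w coefZ coef_sum [X in _ - _ * X]big1 ?mulr0 ?subr0 => [|i _]; last first.
  rewrite coefZ nth_default ?mulr0 // -big_filter size_prod_XsubC size_filter.
  have -> : count (fun j => j != i) (index_enum 'I_N) = #|predC1 i| by rewrite -sum1_count -sum1_card.
  rewrite (cardC1 i) card_ord prednK //; exact: leq_ltn_trans (ltn_ord i).
move: Nk; rewrite leq_eqVlt => /orP[/eqP <-|Nk].
  have lc (y : 'I_N -> K) : (\prod_i ('X - (y i)%:P))`_N = 1.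
    have /monicP := monic_prod_XsubC (index_enum 'I_N) xpredT y.
    by rewrite lead_coefE sp.
  by rewrite /p /p' !lc subrr.
by rewrite !nth_default ?subrr // ?sp.
Qed.

Local Notation lin t := (1 - t *: 'X : {poly K}).

(** The previous identity at 1 / y, multiplied by y^N; checking it at all positive integers y
    suffices. *)
Lemma reversed_PP : \prod_i lin (x i) - \prod_i lin (x i + q) =
  (q *: 'X) * \sum_i ppw i *: \prod_(j | j != i) lin (x j).
Proof.
apply/eqP; rewrite -subr_eq0; apply/eqP; apply: (poly_eq0_large_nat charK (c0 := 1)) => c c1.
have c0 : c%:R != 0 :> K by case: c c1.
set y : K := c%:R in c0 *.
have prE (z : 'I_N -> K) (P : pred 'I_N) : (\prod_(j | P j) lin (z j)).[y] =
    y ^+ #|P| * (\prod_(j | P j) ('X - (z j)%:P)).[y^-1].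
  rewrite !horner_prod -prodr_const -big_split /=; apply: eq_bigr => j _.
  by rewrite hornerXsubC mulrBr mulfV // !hornerE mulrC.
have := congr1 (fun p : {poly K} => y ^+ N * p.[y^-1]) lagrange_PP.
rewrite !(hornerD, hornerN, hornerM) mulrBr hornerZ !horner_sum => h.
rewrite !prE (_ : #|_| = N) ?h ; last by rewrite -[RHS]card_ord; apply: eq_card.
rewrite hornerZ hornerX !big_distrr -sumrB big1 //= => i _.
rewrite !hornerZ prE.
have -> : y ^+ N = y * y ^+ #|[pred j : 'I_N | j != i]|.
  by rewrite -exprS (cardC1 i) card_ord prednK //; exact: leq_ltn_trans (ltn_ord i).
by move: (_.[_]) => v; ring.
Qed.

Lemma coef0_prod_lin (P : pred 'I_N) (y : 'I_N -> K) : (\prod_(i | P i) lin (y i))`_0 = 1.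
Proof.
elim/big_rec: _ => [|i p _ IH]; first by rewrite coef1.
by rewrite coefM big_ord_recl big_ord0 addr0 subn0 IH mulr1 coefB coef1 coefZ coefX mulr0 subr0.
Qed.

(** With C the generating series of the [ppc k], the reversed products satisfy Q = P (1 - q X C).
    Comparing logarithmic derivatives, the power sums of the x_i cancel and (1 - q X C) S = (X C)'
    remains, with S the generating series of the [dsum m.+1]. *)
Lemma ppc_rec k : k.+1%:R * ppc k = dsum k.+1 - q * \sum_(m < k) ppc (k - m.+1) * dsum m.+1.
Proof.
(* For q = 0 all weights are 1 and the claim is direct; the general argument ends with a division by
   q. *)
have [q0|q0] := eqVneq q 0.
  have d0 m t : dpow m.+1 t = m.+1%:R * t ^+ m.
    rewrite /dpow big_ord_recr /= subnn expr0 mulr1 binSn [X in X + _]big1 ?add0r // => a _.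
    by rewrite q0 expr0n subn_eq0 leqNgt ltn_ord mulr0 mul0r.
  rewrite q0 mul0r subr0 /ppc /dsum big_distrr; apply: eq_bigr => i _.
  rewrite d0 /ppw big1 ?mul1r // => j ji.
  by rewrite q0 subr0 divff // subr_eq0 x_inj // eq_sym.
pose M := k.+2.
pose P := \prod_i lin (x i); pose Q := \prod_i lin (x i + q).
pose C : {poly K} := \poly_(m < M) ppc m.
pose W := \sum_i ppw i *: \prod_(j | j != i) lin (x j).
pose E (t : K) : {poly K} := \poly_(m < M) t ^+ m.+1.
have P0 : P`_0 != 0 by rewrite coef0_prod_lin oner_neq0.
have WC : eqX M W (P * C).
  have -> : C = \sum_i ppw i *: \poly_(m < M) x i ^+ m.
    apply/polyP => m; rewrite coef_poly coef_sum; case: ifP => mM; last first.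
      by rewrite big1 // => i _; rewrite coefZ coef_poly mM mulr0.
    by apply: eq_bigr => i _; rewrite coefZ coef_poly mM.
  rewrite big_distrr; apply: eqX_sum => i _ /=.
  have PE : P = lin (x i) * \prod_(j | j != i) lin (x j) by rewrite /P (bigD1 i).
  rewrite -scalerAr; apply: eqXZ; rewrite PE mulrAC mulrC -[X in eqX _ X _]mulr1.
  apply: eqXMl => m mM; apply/esym.
  rewrite mulrBl mul1r coefB -scalerAl coefZ coefXM !coef_poly mM coef1.
  by case: m mM => [|m] mM /=; rewrite ?mulr0 ?subr0 // (ltnW mM) exprS subrr.
have QE : eqX M Q (P * (1 - (q *: 'X) * C)).
  have -> : Q = P - (q *: 'X) * W by rewrite -reversed_PP opprB addrC subrK.
  rewrite mulrBr mulr1; apply: eqXB; first exact: eqX_refl.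
  by rewrite [P * _]mulrCA; apply: eqXMl.
have dP : eqX M (P * - \sum_i E (x i)) (deriv P).
  have := @eqX_prod_linear_deriv K [seq x i | i <- index_enum 'I_N] M.
  by rewrite !big_map.
have dQ : eqX M (Q * - \sum_i E (x i + q)) (deriv Q).
  have := @eqX_prod_linear_deriv K [seq x i + q | i <- index_enum 'I_N] M.
  by rewrite !big_map.
pose S : {poly K} := \poly_(m < M) dsum m.+1.
have ES : \sum_i E (x i + q) = \sum_i E (x i) + q *: S.
  apply/polyP => m; rewrite coefD coefZ !coef_sum coef_poly.
  under eq_bigr do rewrite coef_poly; under [in RHS]eq_bigr do rewrite coef_poly.
  case: ifP => mM; last by rewrite mulr0 addr0.
  rewrite /dsum big_distrr -big_split /=; apply: eq_bigr => i _.
  by rewrite dpowE addrC subrK.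
pose T : {poly K} := 1 - (q *: 'X) * C.
have key : eqX k.+1 (P * (T * S)) (P * deriv ('X * C)).
  have h1 : eqX k.+1 (deriv Q) (deriv P * T + P * deriv T).
    by rewrite -derivM; exact: eqX_deriv QE.
  have h2 : eqX k.+1 (Q * - \sum_i E (x i + q)) (deriv P * T + P * deriv T).
    by apply: eqX_trans h1; apply: eqX_le dQ; rewrite /M.
  have h3 : eqX k.+1 (P * T * - \sum_i E (x i + q)) (P * - (\sum_i E (x i)) * T + P * deriv T).
    apply: eqX_trans (_ : eqX k.+1 _ (Q * - \sum_i E (x i + q))) _.
      by apply: eqXMr; apply: eqX_sym; apply: eqX_le QE; rewrite /M.
    apply: eqX_trans h2 _; apply: eqXD; last exact: eqX_refl.
    by apply: eqXMr; apply: eqX_sym; apply: eqX_le dP; rewrite /M.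
  have dT : deriv T = - (q *: deriv ('X * C)).
    by rewrite /T derivB -[1]polyC1 derivC sub0r -scalerAl derivZ.
  have h4 : eqX k.+1 (q *: (P * (T * S))) (q *: (P * deriv ('X * C))).
    move=> m mk; have := h3 m mk; rewrite ES dT.
    have -> : P * T * - (\sum_i E (x i) + q *: S) = P * - (\sum_i E (x i)) * T - q *: (P * (T * S)).
      rewrite mulrN mulrDr opprD; congr (_ + _); first by rewrite mulrN mulNr mulrAC.
      by rewrite -scalerAr mulrA.
    have -> : P * - (q *: deriv ('X * C)) = - (q *: (P * deriv ('X * C))) by rewrite mulrN scalerAr.
    by rewrite !coefD => /addrI; rewrite !coefN => /oppr_inj.
  by move=> m mk; have := h4 m mk; rewrite !coefZ => /(mulfI q0).
have CE m : (m < M)%N -> C`_m = ppc m by move=> mM; rewrite coef_poly mM.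
have SE m : (m < M)%N -> S`_m = dsum m.+1 by move=> mM; rewrite coef_poly mM.
have := eqX_cancel P0 key (ltnSn k).
rewrite coef_deriv coefXM /= CE // mulr_natl => <-.
rewrite /T mulrBl mul1r coefB SE //; congr (_ - _).
rewrite -mulrA -scalerAl coefZ; congr (_ * _).
move: {P Q W E P0 WC QE dP dQ ES T key} CE SE; move: (C : {poly K}) (S : {poly K}) => {}C {}S; rewrite /M.
case: k {M} => [|k] CE SE.
  by rewrite coefXM big_ord0.
rewrite coefXM /= coefM (reindex_inj rev_ord_inj) /=; apply: eq_bigr => m _.
have mk : (m <= k)%N by rewrite -ltnS.
rewrite CE ?SE; [|lia|lia].
by congr (_ * dsum _); lia.
Qed.

End PerelomovPopov.

(** * Lagrange inversion *)

Section LagrangeInversion.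
Variable K : fieldType.
Hypothesis charK : forall m, m.+1%:R != 0 :> K.
Implicit Types (p f g h xi eta u : {poly K}) (M b n k : nat).

Lemma deriv_expE p n : deriv (p ^+ n.+1) = n.+1%:R *: (p ^+ n * deriv p).
Proof.
by rewrite deriv_exp /= scaler_nat mulrC.
Qed.

(* formal residue of [d(y xi) / (y xi)^b] *)
Lemma residue_pow M b xi eta : eqX M (xi * eta) 1 -> (0 < b)%N -> (b <= M)%N ->
  (eta ^+ b * ('X * xi)^`())`_b.-1 = (b == 1%N)%:R.
Proof.
move=> xe; case: b => [//|[|b]] _ bM.
  rewrite /= expr1 derivM derivX mul1r mulrDr coefD [eta * xi]mulrC xe // coef1 /=.
  by rewrite mulrCA coefXM /= addr0.
rewrite /= derivM derivX mul1r mulrDr coefD.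
have h1 : eqX M (eta ^+ b.+2 * xi) (eta ^+ b.+1).
  rewrite exprSr -mulrA [eta * xi]mulrC -[X in eqX _ _ X]mulr1; exact: eqXMl.
rewrite h1 //.
have dxe : eqX M.-1 (xi^`() * eta) (- (xi * eta^`())).
  have : eqX M.-1 (xi * eta)^`() 1^`() by apply: eqX_deriv; rewrite prednK //; apply: leq_trans bM.
  rewrite derivM -[1]polyC1 derivC => h m mM; have := h m mM.
  by rewrite coefD coef0 coefN => /eqP; rewrite addr_eq0 => /eqP.
have h2 : eqX M.-1 (eta ^+ b.+2 * xi^`()) (- (eta ^+ b * eta^`())).
  have -> : eta ^+ b.+2 * xi^`() = eta ^+ b.+1 * (xi^`() * eta) by rewrite exprSr; ring.
  apply: (eqX_trans (q := eta ^+ b.+1 * - (xi * eta^`()))); first exact: eqXMl.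
  have -> : eta ^+ b.+1 * - (xi * eta^`()) = - ((xi * eta) * (eta ^+ b * eta^`())) by rewrite exprSr; ring.
  apply: eqXN; rewrite -[X in eqX _ _ X]mul1r; apply: eqXMr; apply: eqX_le xe; exact: leq_pred.
rewrite mulrCA coefXM /= h2; last by case: (M) bM.
rewrite coefN; apply/eqP; rewrite subr_eq0; apply/eqP.
apply: (mulfI (charK b)).
have := congr1 (fun p : {poly K} => p`_b) (deriv_expE eta b).
by rewrite /= coef_deriv coefZ !mulr_natl.
Qed.

(* change of variables [x = y xi] in a formal residue *)
Lemma residue_comp M n xi eta g : eqX M (xi * eta) 1 -> (n < M)%N ->
  (eta ^+ n.+1 * ((g \Po ('X * xi)) * ('X * xi)^`()))`_n = g`_n.
Proof.
move=> xe nM.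
have mono i : (eta ^+ n.+1 * (('X * xi) ^+ i * ('X * xi)^`()))`_n = (i == n)%:R.
  rewrite exprMn_comm; last exact: mulrC.
  have -> : eta ^+ n.+1 * ('X ^+ i * xi ^+ i * ('X * xi)^`()) =
    'X^i * (eta ^+ n.+1 * xi ^+ i * ('X * xi)^`()) by ring.
  rewrite coefXnM; case: ltnP => [ni|iN]; first by rewrite gtn_eqF.
  have h : eqX M (eta ^+ n.+1 * xi ^+ i * ('X * xi)^`()) (eta ^+ (n - i).+1 * ('X * xi)^`()).
    apply: eqXMr; rewrite -subSn // -{1}(subnK (leqW iN)) exprD -mulrA -exprMn_comm; last exact: mulrC.
    rewrite -[X in eqX _ _ X]mulr1; apply: eqXMl; rewrite -[X in eqX _ _ X](expr1n _ i).
    by apply: eqXX; rewrite mulrC.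
  rewrite h; last by apply: leq_ltn_trans nM; exact: leq_subr.
  have := @residue_pow M (n - i).+1 xi eta xe (ltn0Sn _) _; rewrite /= => -> //.
    by rewrite eqSS subn_eq0 eqn_leq iN.
  by apply: leq_ltn_trans nM; exact: leq_subr.
rewrite comp_polyE big_distrl /= big_distrr coef_sum /=.
under eq_bigr => i _ do rewrite -scalerAl -scalerAr coefZ mono.
case: (ltnP n (size g)) => ng; last first.
  rewrite nth_default // big1 // => i _; rewrite (_ : (i == n :> nat) = false) ?mulr0 //.
  by apply/negbTE; rewrite neq_ltn (leq_trans (ltn_ord i) ng).
rewrite (bigD1 (Ordinal ng)) //= eqxx mulr1 big1 ?addr0 // => i /eqP ne.
case: eqP => [ni|]; last by rewrite mulr0.
by case: ne; apply: val_inj.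
Qed.

Section Inversion.
Variables (M : nat) (h th : {poly K}).
Hypotheses (h0 : h`_0 = 1) (th0 : th`_0 = 1) (hth : eqX M (th * h) 1).

(** [th] stands for 1 / h. The series y / h has order one with leading coefficient 1, so its powers
    form a triangular basis. *)
Lemma expansion_ex k : (k <= M)%N -> exists d : nat -> K, eqX k h (\sum_(j < k) d j *: ('X * th) ^+ j).
Proof.
elim: k => [|k IH] kM; first by exists (fun=> 0).
have [d hd] := IH (ltnW kM).
pose c := (h - \sum_(j < k) d j *: ('X * th) ^+ j)`_k.
exists (fun j => if j == k then c else d j) => m; rewrite ltnS => mk.
rewrite big_ord_recr /= eqxx coefD coefZ.
have -> : \sum_(i < k) (if i == k :> nat then c else d i) *: ('X * th) ^+ i = \sum_(i < k) d i *: ('X * th) ^+ i.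
  by apply: eq_bigr => i _; rewrite ltn_eqF.
rewrite exprMn_comm; last exact: mulrC.
rewrite coefXnM; move: mk; rewrite leq_eqVlt => /orP[/eqP ->|mk]; last by rewrite mk mulr0 addr0 hd.
have -> : (th ^+ k)`_(k - k) = 1.
  rewrite subnn; elim: k {IH kM d hd c m} => [|k IH]; first by rewrite coef1.
  by rewrite exprS coefM big_ord_recl big_ord0 addr0 IH th0 mulr1.
by rewrite ltnn mulr1 /c coefB addrC subrK.
Qed.

Definition lag j : K := (h ^+ j.+1)`_j / j.+1%:R.

(** Write t = y / h. From h = sum d_j t^j follows y = sum d_j t^(j+1); differentiating and taking
    residues against h^(j+1) gives d_j = [lag j]. The claim is the expansion of h multiplied by
    h^k. *)
Lemma lagrange_expansion k : (k < M)%N -> eqX k (h ^+ k.+1) (\sum_(j < k) lag j *: ('X^j * h ^+ (k - j))).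
Proof.
move=> kM; have [d hd] := expansion_ex (ltnW kM).
have dE j : (j < k)%N -> d j = lag j.
  move=> jk; rewrite /lag; apply: (mulIf (charK j)); rewrite divfK ?charK //.
  have h2 : eqX k.+1 ('X : {poly K}) (\sum_(i < k) d i *: ('X * th) ^+ i.+1).
    have -> : \sum_(i < k) d i *: ('X * th) ^+ i.+1 = 'X * (th * \sum_(i < k) d i *: ('X * th) ^+ i).
      by rewrite mulrA big_distrr; apply: eq_bigr => i _ /=; rewrite -scalerAr exprS.
    rewrite -[X in eqX _ X _]mulr1; apply: eqX_mulX.
    apply: (eqX_trans (q := th * h)); last exact: eqXMl.
    by apply: eqX_sym; apply: eqX_le hth; exact: ltnW.
  have h3 : eqX k 1 (((\sum_(i < k) (d i * i.+1%:R) *: 'X^i) \Po ('X * th)) * ('X * th)^`()).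
    have := eqX_deriv h2; rewrite derivX raddf_sum /= => h3.
    apply: eqX_trans h3 _; rewrite linear_sum /= big_distrl /=; apply: eqX_sum => i _.
    rewrite derivZ deriv_expE comp_polyZ comp_Xn_poly -scalerAl scalerA.
    exact: eqX_refl.
  have := @residue_comp M j th h (\sum_(i < k) (d i * i.+1%:R) *: 'X^i) hth (ltn_trans jk kM).
  have -> : (\sum_(i < k) (d i * i.+1%:R) *: 'X^i : {poly K})`_j = d j * j.+1%:R.
    rewrite coef_sum (bigD1 (Ordinal jk)) //= coefZ coefXn eqxx mulr1 big1 ?addr0 // => i /eqP ne.
    rewrite coefZ coefXn; case: eqP => [ji|]; last by rewrite mulr0.
    by case: ne; apply: val_inj.
  by move=> <-; rewrite -(eqXMl (h ^+ j.+1) h3 jk) mulr1.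
apply: (eqX_trans (q := (\sum_(j < k) d j *: ('X * th) ^+ j) * h ^+ k)).
  by rewrite exprS; exact: eqXMr.
rewrite big_distrl /=; apply: eqX_sum => j _.
rewrite dE // -scalerAl; apply: eqXZ; rewrite exprMn_comm; last exact: mulrC.
have hk : h ^+ k = h ^+ j * h ^+ (k - j) by rewrite -exprD subnKC // ltnW.
rewrite -mulrA; apply: eqXMl; rewrite hk mulrA -exprMn_comm; last exact: mulrC.
rewrite -[X in eqX _ _ X]mul1r; apply: eqXMr; rewrite -[X in eqX _ _ X](expr1n _ j).
by apply: eqXX; apply: eqX_le hth; exact: ltnW.
Qed.

End Inversion.

(** Binomial expansion of (X psi' + 1)^(k+1), with (k+1) C(k, m) = (m+1) C(k+1, m+1) absorbing the
    denominators of [Mlim]. *)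
Lemma Mlim_closed (psi : {poly K}) k :
  k.+1%:R * Mlim psi k = ((1 + 'X) ^+ k * (1 + 'X * deriv psi) ^+ k.+1)`_k.
Proof.
have E (j : nat) : ((1 + 'X) ^+ k * ('X * deriv psi) ^+ j)`_k =
    if (k < j)%N then 0 else ((1 + 'X) ^+ k * deriv psi ^+ j)`_(k - j).
  rewrite exprMn_comm; last exact: mulrC.
  by rewrite mulrCA coefXnM.
rewrite /Mlim big_distrr /= [1 + 'X * _]addrC [('X * _ + 1) ^+ _]exprDn big_distrr coef_sum /=.
rewrite [RHS]big_ord_recl /= subn0 expr1n mulr1 bin0 mulr1n E ltnSn add0r.
apply: eq_bigr => m _; have mk : (m <= k)%N by rewrite -ltnS.
rewrite /bump /= add1n subSS expr1n mulr1 mulrnAr coefMn E.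
rewrite ltnNge leq_subr /= subKn //.
rewrite -(mulr_natl _ 'C(k.+1, m.+1)) !mulrA; congr (_ * _).
apply: (mulIf (charK m)); rewrite divfK ?charK // -!natrM; congr _%:R.
by have /= -> := mul_bin_diag k.+1 m; rewrite mulnC.
Qed.

(* [X] stands for [e_q - 1], [eta] for [y / (e_q y - 1)], [p] for [z |-> Psi'(1 + z)],
   and [h] for [1 + y F(y)]. *)
Section Recursion.
Variables (M : nat) (q : K) (xi eta p : {poly K}).
Local Notation X := ('X * xi).
Local Notation h := (eta * (1 + X) * (1 + X * (p \Po X))).
Hypotheses (eta0 : eta`_0 = 1).
Hypothesis xe : eqX M (xi * eta) 1.
Hypothesis ode : eqX M ((1 - q *: 'X) * deriv X) (1 + X).

(** The truncated inverse of 1 - q y. *)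
Let iq : {poly K} := \poly_(i < M) q ^+ i.

Lemma iqE : eqX M ((1 - q *: 'X) * iq) 1.
Proof.
move=> m mM; rewrite mulrBl mul1r coefB -scalerAl coefZ coefXM !coef_poly mM coef1.
by case: m mM => [|m] mM /=; rewrite ?mulr0 ?subr0 // (ltnW mM) exprS subrr.
Qed.

(** Change of variables x = e_q(y) - 1 in the residue. The differential equation gives dx = (1 + x)
    dy / (1 - q y), which supplies the missing factor 1 + x of h^(n+1). *)
Lemma Mseries (n : nat) : (n < M)%N ->
  ((1 + 'X) ^+ n * (1 + 'X * p) ^+ n.+1)`_n = (h ^+ n.+1 * iq)`_n.
Proof.
move=> nM; rewrite -(residue_comp _ xe nM).
set G := _ \Po X.
have GE : G = (1 + X) ^+ n * (1 + X * (p \Po X)) ^+ n.+1.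
  by rewrite /G comp_polyM !rmorphXn /= !rmorphD /= !rmorph1 rmorphM /= comp_polyX.
suff : eqX M (eta ^+ n.+1 * (G * deriv X)) (h ^+ n.+1 * iq) by move/(_ n nM).
rewrite GE.
apply: (@eqX_cancel _ M _ _ (1 - q *: 'X)).
  by rewrite coefB coef1 coefZ coefX mulr0 subr0 oner_neq0.
apply: (eqX_trans (q := h ^+ n.+1)).
  have -> : (1 - q *: 'X) * (eta ^+ n.+1 * ((1 + X) ^+ n * (1 + X * (p \Po X)) ^+ n.+1 * deriv X)) =
    eta ^+ n.+1 * (1 + X) ^+ n * (1 + X * (p \Po X)) ^+ n.+1 * ((1 - q *: 'X) * deriv X) by ring.
  have -> : h ^+ n.+1 = eta ^+ n.+1 * (1 + X) ^+ n * (1 + X * (p \Po X)) ^+ n.+1 * (1 + X).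
    by rewrite !exprMn [(1 + X) ^+ n.+1]exprSr; ring.
  exact: eqXMl.
have -> : (1 - q *: 'X) * (h ^+ n.+1 * iq) = h ^+ n.+1 * ((1 - q *: 'X) * iq) by ring.
by rewrite -[X in eqX _ X _]mulr1; apply: eqXMl; apply: eqX_sym iqE.
Qed.

(** Here m n = [y^n] h^(n+1) / (1 - q y). Splitting 1 / (1 - q y) = 1 + q y / (1 - q y) isolates
    (k+1) [lag k], and the Lagrange expansion of h^(k+1) in the other term produces the
    convolution. *)
Lemma lag_rec (m : nat -> K) k : (k < M)%N ->
  (forall n, (n < M)%N -> m n = ((1 + 'X) ^+ n * (1 + 'X * p) ^+ n.+1)`_n) ->
  k.+1%:R * lag h k = m k - q * \sum_(n < k) lag h (k - n.+1) * m n.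
Proof.
move=> kM hm.
have h0 : h`_0 = 1.
  by rewrite !coef0M !coefD !coef1 !coef0M !coefX !mul0r !addr0 eta0 !mulr1.
move: h0; set H := h => h0.
pose th := \sum_(i < M) (1 - H) ^+ i.
have hth : eqX M (th * H) 1.
  have -> : th * H = 1 - (1 - H) ^+ M.
    have -> : th * H = - (((1 - H) - 1) * th) by ring.
    by rewrite /th -subrX1 opprB.
  move=> i iM; rewrite coefB coef_exp_lt ?subr0 //.
  by rewrite coefB coef1 h0 subrr.
have th0 : th`_0 = 1.
  have := hth 0%N (leq_ltn_trans (leq0n k) kM).
  by rewrite coefM big_ord_recl big_ord0 addr0 subn0 h0 mulr1 coef1.
have lagE : k.+1%:R * lag H k = (H ^+ k.+1)`_k by rewrite /lag mulrC divfK ?charK.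
have iqX : eqX M iq (1 + q *: 'X * iq).
  move=> i iM; have := iqE iM; rewrite mulrBl mul1r coefB coefD => /eqP.
  by rewrite subr_eq => /eqP ->.
have mE n : (n < M)%N -> m n = (H ^+ n.+1 * iq)`_n by move=> nM; rewrite hm // Mseries.
rewrite lagE mE // (eqXMl _ iqX kM) mulrDr mulr1 coefD -addrA; apply/esym/eqP.
rewrite -subr_eq0 addrAC subrr add0r subr_eq0; apply/eqP.
rewrite mulrCA -scalerAl coefZ; congr (_ * _).
case: k kM {lagE} => [|k] kM; first by rewrite coefXM big_ord0.
rewrite coefXM /= mulrC.
rewrite (eqXMl iq (lagrange_expansion th0 hth kM) (ltnSn k)) big_distrr coef_sum /=.
rewrite [RHS](reindex_inj rev_ord_inj) /=; apply: eq_bigr => j _.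
have jk : (j <= k)%N by rewrite -ltnS.
have -> : (k.+1 - (k.+1 - j.+1).+1)%N = j by rewrite subSS subKn.
rewrite mE; last by apply: leq_ltn_trans kM; rewrite subSS ltnW // ltnS leq_subr.
rewrite -scalerAr coefZ; congr (_ * _).
have -> : iq * ('X^j * H ^+ (k.+1 - j)) = 'X^j * (H ^+ (k.+1 - j) * iq) by ring.
by rewrite coefXnM ltnNge jk /= subSS subSn.
Qed.

End Recursion.
End LagrangeInversion.

(** * Convergence in probability *)

Section InProbability.
Variables (R : realType) (T : nat -> eqType) (w : forall n, T n -> R).
Hypothesis w0 : forall n (l : T n), 0 <= w l.
Local Notation K := (CC R).

(* Probabilities are tested on finite sets of outcomes, so that no infinite sum is
   needed before the end. *)
Definition cip (X : forall n, T n -> K) (c : K) : Prop :=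
  forall e eta : R, 0 < e -> 0 < eta -> \forall n \near \oo, forall s : seq (T n),
  uniq s -> (forall l, l \in s -> e <= modC (X n l - c)) -> \sum_(l <- s) w l <= eta.

Lemma cip_ext X Y c : (forall n l, X n l = Y n l) -> cip X c -> cip Y c.
Proof.
move=> XY h e eta e0 eta0; apply: filterS (h e eta e0 eta0) => n hn s us hs.
by apply: hn => // l ls; rewrite XY; exact: hs.
Qed.

Lemma cip_det u c : cvgK u c -> cip (fun n _ => u n) c.
Proof.
move=> uc e eta e0 eta0; have [M hM] := uc e e0; exists M => // n /= Mn [|l s] us hs.
  by rewrite big_nil; exact: ltW.
by have := hs l (mem_head _ _); rewrite leNgt hM.
Qed.

Lemma cip_cst c : cip (fun _ _ => c) c.
Proof. by apply: cip_det => e e0; exists 0%N => n _; rewrite subrr modC0. Qed.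

(** Continuous mapping with a union bound: an outcome where F is far from its limit has X or Y far
    from theirs. *)
Lemma cip_cont2 X Y c d (F : K -> K -> K) : cip X c -> cip Y d ->
  (forall e : R, 0 < e -> exists2 de : R, 0 < de & forall x y,
     modC (x - c) < de -> modC (y - d) < de -> modC (F x y - F c d) < e) ->
  cip (fun n l => F (X n l) (Y n l)) (F c d).
Proof.
move=> hX hY hF e eta e0 eta0; have [de de0 h] := hF e e0.
have eta2 : 0 < eta / 2 by rewrite divr_gt0.
near=> n => s us hs.
rewrite (bigID (fun l => de <= modC (X n l - c))) /= (splitr eta).
apply: lerD; rewrite -big_filter.
  have : forall s : seq (T n), uniq s -> (forall l, l \in s -> de <= modC (X n l - c)) -> \sum_(l <- s) w l <= eta / 2.
    by near: n; exact: hX.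
  apply; first exact: filter_uniq.
  by move=> l; rewrite mem_filter => /andP[].
have : forall s : seq (T n), uniq s -> (forall l, l \in s -> de <= modC (Y n l - d)) -> \sum_(l <- s) w l <= eta / 2.
  by near: n; exact: hY.
apply; first exact: filter_uniq.
move=> l; rewrite mem_filter -ltNge => /andP[lX ls]; rewrite leNgt; apply/negP => lY.
by have := hs l ls; rewrite leNgt h.
Unshelve. all: by end_near. Qed.

Lemma cipD X Y c d : cip X c -> cip Y d -> cip (fun n l => X n l + Y n l) (c + d).
Proof.
move=> hX hY; apply: (cip_cont2 (F := fun x y => x + y) hX hY) => e e0.
exists (e / 2); first by rewrite divr_gt0.
move=> x y xc yd; rewrite opprD addrACA (splitr e).
by apply: le_lt_trans (modCD _ _) _; exact: ltrD.
Qed.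

Lemma cipM X Y c d : cip X c -> cip Y d -> cip (fun n l => X n l * Y n l) (c * d).
Proof.
move=> hX hY; apply: (cip_cont2 (F := fun x y => x * y) hX hY) => e e0.
have c0 := modC_ge0 c; have d0 := modC_ge0 d.
pose B := 1 + modC c + modC d.
have B0 : 0 < B by rewrite /B; lra.
exists (Num.min 1 (e / B)); first by rewrite lt_min ltr01 divr_gt0.
move=> x y; rewrite !lt_min => /andP[x1 xe] /andP[y1 ye].
have -> : x * y - c * d = (x - c) * (y - d) + c * (y - d) + (x - c) * d by ring.
apply: le_lt_trans (modCD _ _) _; apply: le_lt_trans (lerD (modCD _ _) (lexx _)) _.
rewrite !modCM; have X0 := modC_ge0 (x - c); have Y0 := modC_ge0 (y - d).
have h1 : modC (x - c) * modC (y - d) <= 1 * modC (y - d) by apply: ler_wpM2r => //; exact: ltW.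
have h2 : modC c * modC (y - d) <= modC c * (e / B) by apply: ler_wpM2l => //; exact: ltW.
have h3 : modC (x - c) * modC d <= e / B * modC d by apply: ler_wpM2r => //; exact: ltW.
have : e / B * B = e by rewrite divfK ?gt_eqF.
rewrite /B => hB; move: (e / _) hB ye h2 h3 => E; lra.
Qed.

Lemma cipZ X b c : cip X c -> cip (fun n l => b * X n l) (b * c).
Proof. by move=> h; apply: cipM => //; exact: cip_cst. Qed.

Lemma cipB X Y c d : cip X c -> cip Y d -> cip (fun n l => X n l - Y n l) (c - d).
Proof.
move=> hX /(cipZ (-1)) hY; rewrite -[- d]mulN1r.
by apply: cip_ext (cipD hX hY) => n l; rewrite mulN1r.
Qed.

Lemma cip_sum k (X : nat -> forall n, T n -> K) (c : nat -> K) :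
  (forall m, (m < k)%N -> cip (X m) (c m)) ->
  cip (fun n l => \sum_(m < k) X m n l) (\sum_(m < k) c m).
Proof.
elim: k => [|k IH] h.
  by rewrite big_ord0; apply: cip_ext (cip_cst 0) => n l; rewrite big_ord0.
rewrite big_ord_recr /=; apply: (@cip_ext (fun n l => \sum_(m < k) X m n l + X k n l)).
  by move=> n l; rewrite big_ord_recr.
by apply: cipD (h k (ltnSn k)); apply: IH => m mk; apply: h; exact: ltnW.
Qed.

Lemma chebyshev_cip X c :
  (forall e : R, 0 < e -> \forall n \near \oo, forall s : seq (T n), uniq s ->
     \sum_(l <- s) w l * modC (X n l - c) ^+ 2 <= e) -> cip X c.
Proof.
move=> h e eta e0 eta0; apply: filterS (h (eta * e ^+ 2) _); last by rewrite mulr_gt0 ?exprn_gt0.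
move=> n hn s us hs; rewrite -(@ler_pM2r _ (e ^+ 2)) ?exprn_gt0 //.
apply: le_trans (hn s us); rewrite big_distrl /= big_seq [leRHS]big_seq; apply: ler_sum => l ls.
by apply: ler_wpM2l => //; rewrite lerXn2r ?nnegrE ?modC_ge0 ?hs // ltW.
Qed.

End InProbability.

(** The extended sum is the supremum of its finite sub-sums, to which [cip] applies uniformly. The
    index N = n+1 skips the irrelevant value N = 0. *)
Lemma cip_cvg_in_prob (R : realType) (rho : forall N, signature N -> R)
  (X : forall N, signature N -> CC R) c : (forall N (l : signature N), 0 <= rho N l) ->
  cip (T := fun n => signature n.+1) (fun n l => rho n.+1 l) (fun n l => X n.+1 l) c ->
  cvg_in_prob rho X c.
Proof.
move=> rho0 h e e0; pose f (N : nat) := \esum_(l in [set l : signature N | ofR e < `|X N l - c|]) (rho N l)%:E.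
have f0 N : (0 <= f N)%E by apply: esum_ge0 => l _; rewrite lee_fin.
have hf (eta : R) : 0 < eta -> \forall N \near \oo, (f N <= eta%:E)%E.
  move=> eta0; have [M _ hM] := h e eta e0 eta0.
  exists M.+1 => // -[//|n] /= Mn; apply: ge_ereal_sup => _ [A [fA As] <-].
  rewrite fsbig_finite //= sumEFin lee_fin; apply: (hM n Mn); first exact: finmap.fset_uniq.
  move=> l; rewrite (in_fset_set fA) inE => lA.
  by have := As l lA; rewrite /= normE ltr_ofR; exact: ltW.
have fN : \forall N \near \oo, f N \is a fin_num.
  apply: filterS (hf 1 ltr01) => N fN; rewrite ge0_fin_numE //.
  by apply: le_lt_trans fN _; exact: ltry.
apply/fine_cvgP; split=> //; apply/cvgr0Pnorm_lt => eta eta0; rewrite -/f.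
have eta2 : 0 < eta / 2 by rewrite divr_gt0.
near=> N.
have fNfin : f N \is a fin_num by near: N.
have : (f N <= (eta / 2)%:E)%E by near: N; exact: hf.
rewrite -(fineK fNfin) lee_fin => h1.
rewrite /= -/(f N) ger0_norm ?fine_ge0 //; move: h1 (eta0 : 0 < eta); move: (fine _) => x; lra.
Unshelve. all: by end_near. Qed.

Lemma cvgK_invn (R : realType) : cvgK (fun n => (n.+1%:R)^-1 : CC R) 0.
Proof.
move=> e e0; exists (Num.bound e^-1) => n Nn.
rewrite subr0 modCV modC_nat invf_plt ?posrE ?ltr0n //.
apply: lt_le_trans (archi_boundP _) _; first by rewrite invr_ge0 ltW.
by rewrite ler_nat ltnW.
Qed.

(** * Perelomov-Popov moments in probability *)

Section PerelomovPopovMoments.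
Variables (R : realType) (rho : forall N, signature N -> R) (Mf : nat -> CC R) (q : CC R).
Local Notation K := (CC R).
Definition cips (X : forall n, signature n.+1 -> K) (c : K) : Prop :=
  cip (T := fun n => signature n.+1) (fun n l => rho l) X c.

Lemma cips_ext X Y c : (forall n (l : signature n.+1), X n l = Y n l) -> cips X c -> cips Y c.
Proof. exact: cip_ext. Qed.
Lemma cipsD X Y c d : cips X c -> cips Y d -> cips (fun n l => X n l + Y n l) (c + d).
Proof. exact: cipD. Qed.
Lemma cipsM X Y c d : cips X c -> cips Y d -> cips (fun n l => X n l * Y n l) (c * d).
Proof. exact: cipM. Qed.
Lemma cipsB X Y c d : cips X c -> cips Y d -> cips (fun n l => X n l - Y n l) (c - d).
Proof. exact: cipB. Qed.
Lemma cipsZ X b c : cips X c -> cips (fun n l => b * X n l) (b * c).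
Proof. exact: cipZ. Qed.
Lemma cips_sum k (X : nat -> forall n, signature n.+1 -> K) (c : nat -> K) :
  (forall m, (m < k)%N -> cips (X m) (c m)) ->
  cips (fun n l => \sum_(m < k) X m n l) (\sum_(m < k) c m).
Proof. exact: cip_sum. Qed.

Hypothesis facsum_cip : forall k, cips (fun n l => facsum R k l / n.+1%:R ^+ k.+1) (Mf k).

Definition xl n (l : signature n.+1) (j : 'I_n.+1) : K := (lexp l j)%:~R.

Lemma xl_inj n (l : signature n.+1) i j : i != j -> xl l i != xl l j.
Proof.
move=> ij; rewrite /xl eqr_int; have := sdec_lexp l; rewrite /sdec => h.
have [/h|/h|/val_inj e] := ltngtP i j; [lia|lia|by rewrite e eqxx in ij].
Qed.

(** Subtracting a multiple of the falling factorial lowers the degree, and lower degrees come with a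
    spare factor 1/N: only the leading coefficient survives. *)
Lemma polysum_cip m (f : {poly K}) : (size f <= m.+1)%N ->
  cips (fun n l => (\sum_j f.[xl l j]) / n.+1%:R ^+ m.+1) (f`_m * Mf m).
Proof.
elim: m f => [|m IH] f sf.
  rewrite (size1_polyC sf) coefC eqxx /=.
  apply: cips_ext (cipsZ f`_0 (facsum_cip 0)) => n l.
  rewrite mulrA /facsum big_distrr; congr (_ / _); apply: eq_bigr => j _.
  by rewrite hornerC /fallK big_ord0 /= mulr1.
have fE k : fallp (0 : K) k = \prod_(j < k) ('X - (j%:R)%:P).
  by apply: eq_bigr => j _; rewrite sub0r polyCN.
have sp : size (fallp (0 : K) m.+1) = m.+2.
  by rewrite fE size_prod_XsubC /index_enum -enumT size_enum_ord.
have lp : (fallp (0 : K) m.+1)`_m.+1 = 1.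
  have /monicP := monic_prod_XsubC (index_enum 'I_m.+1) xpredT (fun j => (j%:R : K)).
  by rewrite lead_coefE -fE sp.
pose g := f - f`_m.+1 *: fallp 0 m.+1.
have sg : (size g <= m.+1)%N.
  apply/leq_sizeP => j; rewrite leq_eqVlt => /orP[/eqP <-|mj]; rewrite coefB coefZ.
    by rewrite lp mulr1 subrr.
  by rewrite [f`_j]nth_default ?(leq_trans sf) // [(fallp _ _)`_j]nth_default ?sp // mulr0 subrr.
have -> : f`_m.+1 * Mf m.+1 = f`_m.+1 * Mf m.+1 + (g`_m * Mf m) * 0 by rewrite mulr0 addr0.
have h2 : cips (fun n _ => n.+1%:R^-1) 0 by apply: cip_det; exact: cvgK_invn.
apply: cips_ext (cipsD (cipsZ f`_m.+1 (facsum_cip m.+1)) (cipsM (IH g sg) h2)) => n l.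
have -> : f = f`_m.+1 *: fallp 0 m.+1 + g by rewrite addrC subrK.
under [in RHS]eq_bigr do rewrite hornerD hornerZ horner_fallp add0r.
rewrite big_split /= -big_distrr /= mulrDl -mulrA coefD coefZ lp mulr1 [g`_m.+1]nth_default // addr0.
by congr (_ + _); rewrite [_ ^+ m.+2]exprSr invfM !mulrA.
Qed.

Lemma dsum_cip k : cips (fun n l => dsum (xl l) q k.+1 / n.+1%:R ^+ k.+1) (k.+1%:R * Mf k).
Proof.
pose f : {poly K} := \poly_(a < k.+1) ('C(k.+1, a)%:R * q ^+ (k - a)).
have -> : k.+1%:R = f`_k by rewrite coef_poly ltnSn subnn expr0 mulr1 binSn.
apply: cips_ext (polysum_cip (size_poly _ _)) => n l; congr (_ / _); apply: eq_bigr => j _.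
by rewrite horner_poly.
Qed.

Lemma ppc_cip (C : nat -> K) :
  (forall k, k.+1%:R * C k = k.+1%:R * Mf k - q * \sum_(n < k) C (k - n.+1)%N * (n.+1%:R * Mf n)) ->
  forall k, cips (fun n l => ppc (xl l) q k / n.+1%:R ^+ k.+1) (C k).
Proof.
move=> hC k; elim/ltn_ind: k => k IH.
have -> : C k = (k.+1%:R)^-1 * (k.+1%:R * Mf k - q * \sum_(n < k) C (k - n.+1)%N * (n.+1%:R * Mf n)).
  by rewrite -hC mulKf ?charCC.
pose X m n (l : signature n.+1) : K := ppc (xl l) q (k - m.+1) / n.+1%:R ^+ (k - m.+1).+1 *
   (dsum (xl l) q m.+1 / n.+1%:R ^+ m.+1).
apply: (@cips_ext (fun n l => (k.+1%:R)^-1 *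
  (dsum (xl l) q k.+1 / n.+1%:R ^+ k.+1 - q * \sum_(m < k) X m n l))) => [n l|].
  have := ppc_rec (@charCC R) q (@xl_inj n l) k => h.
  have -> : \sum_(m < k) X m n l = (\sum_(m < k) ppc (xl l) q (k - m.+1) * dsum (xl l) q m.+1) / n.+1%:R ^+ k.+1.
    rewrite big_distrl; apply: eq_bigr => m _ /=; rewrite /X mulrACA -invfM -exprD; congr (_ / _ ^+ _).
    by have := ltn_ord m; lia.
  by rewrite [q * (_ / _)]mulrA -mulrBl -h mulrA mulKf ?charCC.
apply: cipsZ; apply: cipsB; first exact: dsum_cip.
apply: cipsZ.
apply: (@cips_sum k (fun m n l => X m n l) (fun m => C (k - m.+1)%N * (m.+1%:R * Mf m))) => m mk.
by apply: cipsM; [apply: IH; lia | exact: dsum_cip].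
Qed.

End PerelomovPopovMoments.

(** The weights depend on differences of the lambda_i - i only, and these are the l_i up to a common
    shift. The powers of N are one for the mean and k for the rescaled atoms. *)
Lemma pp_moment_ppc (R : realType) (q : R) k n (l : signature n.+1) :
  ofR (pp_moment q k l) = ppc (xl R l) (ofR q) k / n.+1%:R ^+ k.+1.
Proof.
have e j : ((sgv l j - j%:Z) = lexp l j - n%:Z).
  by rewrite /lexp; have := ltn_ord j; lia.
rewrite /pp_moment ofRM ofRV ofR_nat /ppc big_distrl ofR_sum big_distrr; apply: eq_bigr => i _ /=.
rewrite ofRM ofRX ofRM ofRV ofR_nat ofR_int -/(lexp l i) exprMn exprVn exprS invfM.
have -> : ofR (pp_weight q l i) = ppw (xl R l) (ofR q) i.
  rewrite /pp_weight ofR_prod; apply: eq_bigr => j _.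
  by rewrite !e opprB addrA subrK ofRM ofRV ofRB ofR_int rmorphB.
by rewrite /xl; ring.
Qed.

(** * The limiting moments *)

Section DeformedExponential.
Variables (R : realType) (q : R).
Local Notation K := (CC R).
Local Notation Q := (ofR q).

(* [e_q = exp o g] with [g u = sum_n q^n u^(n+1)/(n+1)], for [q = 0] as well *)
Definition eqlog (n : nat) : K := if n is m.+1 then Q ^+ m / m.+1%:R else 0.
Definition eqc : nat -> K := comps (@expc R) eqlog.

(** |q| <= 1 keeps q u in the disc of radius 1/4 where the principal logarithm is its Taylor
    series. *)
Lemma e_q_germ : -1 <= q <= 1 -> exists2 r : R, 0 < r & ps r eqc (e_q q).
Proof.
move=> /andP[q1 q2].
have [g [r [r0 hg hE]]] : exists g (r : R), [/\ 0 < r, ps r eqlog g &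
    forall u, modC u <= r -> e_q q u = cexp (g u)].
  have [q0|q0] := eqVneq q 0.
    exists id, 1; split=> // [|u _]; last by rewrite /e_q q0 eqxx.
    have E1 : eqlog 1 = 1 by rewrite /eqlog expr0 divr1.
    have E i : eqlog i.+2 = 0 by rewrite /eqlog q0 expr0n mul0r.
    split=> [|z _ e e0].
      exists 1 => -[|[|n]]; rewrite ?big_ord0 //.
        by rewrite big_ord_recl big_ord0 modC0 mul0r addr0.
      rewrite big_ord_recl big_ord_recl big1 => [|i _]; last by rewrite -[eqlog _]/(eqlog i.+2) E modC0 mul0r.
      by rewrite -[eqlog (bump _ _)]/(eqlog 1) E1 modC0 modC1 mul0r !expr1 mul1r add0r addr0.
    exists 2%N => -[|[|n]] // _; rewrite /pss big_ord_recl big_ord_recl big1 => [|i _].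
      by rewrite -[eqlog (bump _ _)]/(eqlog 1) E1 mul0r expr1 mul1r add0r addr0 subrr modC0.
    by rewrite -[eqlog _]/(eqlog i.+2) E mul0r.
  have r0 : (0 : R) < 1 / 4 by rewrite divr_gt0.
  have qu u : modC u <= 1 / 4 -> modC (Q * u) <= 1 / 4.
    move=> u4; rewrite modCM modC_ofR; apply: le_trans u4.
    by rewrite ler_piMl ?modC_ge0 // ler_norml q1.
  exists (fun u => - Q^-1 * @Lam R (Q * u)), (1 / 4); split=> // [|u /qu h].
    have r1 : (1 / 4 : R) < 1 by lra.
    have qr : modC Q * (1 / 4) <= 1 / 4.
      by rewrite modC_ofR ler_piMl ?(ltW r0) // ler_norml q1.
    apply: ps_ext (psZ (- Q^-1) (ps_scale qr (ltW r0) (ps_Lam (ltW r0) r1))) => // n.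
    rewrite /eqlog /logc; case: n => [|n]; first by rewrite invr0 oppr0 !mulr0.
    by rewrite exprS !mulrN mulNr opprK !mulrA mulVf ?mul1r // ofR_eq0.
  by rewrite /e_q (negbTE q0) LogC_1B.
exists r => //; have [[C hC] _] := hg.
have hc := ps_comp (ltW r0) (erefl : eqlog 0 = 0) hC (lexx C) (ps_cexp (psb_ge0 hC)) hg.
by apply: ps_ext hc => // z zr; rewrite hE.
Qed.

Lemma eqc0 : eqc 0 = 1.
Proof. by rewrite /eqc /comps big_ord_recl big_ord0 addr0 /expc /= invr1 mul1r. Qed.

(** The equation (1 - q u) e_q' = e_q, from the chain rule and g' = 1 / (1 - q u). *)
Lemma eqc_ode M : eqX M ((1 - Q *: 'X) * deriv (tr M.+1 eqc)) (tr M eqc).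
Proof.
have el0 : eqlog 0 = 0 by [].
have h1 := eqX_deriv (tr_comps (n := M.+1) (@expc R) el0).
rewrite deriv_comp in h1.
have dexp : eqX M (deriv (tr M.+1 (@expc R))) (tr M (@expc R)).
  move=> i iM; rewrite coef_deriv !coef_tr ?ltnS ?(ltnW iM) // -mulr_natl.
  by rewrite /expc factS natrM invfM mulrA mulfV ?mul1r ?charCC.
have dlog : eqX M ((1 - Q *: 'X) * deriv (tr M.+1 eqlog)) 1.
  apply: (eqX_trans (q := (1 - Q *: 'X) * tr M (fun n => Q ^+ n))).
    apply: eqXMl => i iM; rewrite coef_deriv !coef_tr ?ltnS ?(ltnW iM) // -mulr_natl.
    by rewrite /eqlog mulrC divfK ?charCC.
  move=> m mM; rewrite mulrBl mul1r coefB -scalerAl coefZ coefXM !coef_poly mM coef1.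
  by case: m mM => [|m] mM /=; rewrite ?mulr0 ?subr0 // (ltnW mM) exprS subrr.
apply: (eqX_trans (q := (1 - Q *: 'X) * (((deriv (tr M.+1 (@expc R))) \Po tr M.+1 eqlog) * deriv (tr M.+1 eqlog)))).
  by apply: eqXMl; exact: h1.
rewrite mulrCA -[X in eqX _ _ X]mulr1.
apply: eqXM dlog; apply: eqX_sym; refine (eqX_trans (tr_comps (n := M) (@expc R) el0) _).
apply: eqX_comp; rewrite ?coef_poly ?el0 //; try by case: ifP.
- exact: eqX_sym.
- by apply: eqX_sym; exact: eqX_tr.
Qed.
End DeformedExponential.

(** Binomial expansion of (1 + y F)^(k+1). Of its extreme terms, the power k+1 of y F has order
    above k, and the constant 1 has no coefficient at y^k because k > 0. *)
Lemma lag_pow (K : fieldType) (charK : forall m, m.+1%:R != 0 :> K) (F : {poly K}) k : (0 < k)%N ->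
  lag (1 + 'X * F) k = \sum_(m < k) k`!%:R / ((m.+1)`!%:R * (k - m)`!%:R) * (F ^+ (k - m))`_m.
Proof.
move=> k0; have f0 n : n`!%:R != 0 :> K by exact: factK_neq0.
rewrite /lag [1 + _]addrC exprDn coef_sum big_distrl /= big_ord_recl /= subn0 expr1n mulr1 bin0 mulr1n.
rewrite exprMn_comm; last exact: mulrC.
rewrite coefXnM ltnSn mul0r add0r.
rewrite big_ord_recr /= /bump add1n subnn expr0 mul1r expr1n coefMn coef1 (gtn_eqF k0) mul0rn mul0r addr0.
apply: eq_bigr => m _; have mk := ltn_ord m.
rewrite add1n subSS expr1n mulr1 exprMn_comm; last exact: mulrC.
rewrite coefMn coefXnM ltnNge leq_subr /= subKn ?(ltnW mk) // -(mulr_natl _ 'C(k.+1, m.+1)); move: (_`_m) => x.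
have D0 : (m.+1)`!%:R * (k - m)`!%:R != 0 :> K by rewrite mulf_neq0.
have -> : 'C(k.+1, m.+1)%:R = k.+1%:R * k`!%:R / ((m.+1)`!%:R * (k - m)`!%:R) :> K.
  apply: (mulIf D0); rewrite divfK // -!natrM -factS -[in RHS](bin_fact (ltnW mk : (m.+1 <= k.+1)%N)).
  by rewrite subSS.
rewrite mulrAC -[k.+1%:R * _ / _]mulrA; congr (_ * _).
by rewrite mulrC mulKf.
Qed.

(** * The announced moments as Lagrange coefficients *)

Section LimitMoments.
Variables (R : realType) (q : R) (Psi : CC R -> CC R) (a : nat -> CC R) (ra : R).
Local Notation K := (CC R).
Local Notation Q := (ofR q).
Hypothesis q1 : -1 <= q <= 1.
Hypothesis ra0 : 0 < ra.
Hypothesis ha : forall z, modC z < ra -> cvgK (pss a z) (Psi (1 + z)).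

Definition expm (n : nat) : K := eqc q n - delta0 K n.
Definition psi1 : nat -> K := comps (dseq a) expm.

Lemma expm0 : expm 0 = 0.
Proof. by rewrite /expm eqc0 subrr. Qed.

Lemma expm1 : expm 1 = 1.
Proof.
have := @eqc_ode R q 1 0%N isT; rewrite mulrBl mul1r coefB -scalerAl coefZ coefXM mulr0 subr0.
by rewrite coef_deriv !coef_tr // eqc0 mulr1n /expm /delta0 subr0.
Qed.

Lemma derive1_shift z : derive1 (fun z => Psi (1 + z)) z = derive1 Psi (1 + z).
Proof.
rewrite /derive1 (_ : (fun h => _) = (fun h => h^-1 *: (Psi (h + (1 + z)) - Psi (1 + z)))) //.
by apply/funext => h; rewrite addrCA.
Qed.

Lemma psi1_germ : exists2 r : R, 0 < r & ps r psi1 (fun u => derive1 Psi (e_q q u)).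
Proof.
have [rf rf0 hf] : exists2 rf : R, 0 < rf & ps rf a (fun z => Psi (1 + z)).
  have rf0 : 0 < ra / 2 by rewrite divr_gt0.
  by exists (ra / 2) => //; apply: (ps_of_analytic (ra := ra)) => //; lra.
have s0 : 0 < rf / 2 by rewrite divr_gt0.
have [f' [hf' f'E]] := ps_derive1 s0 (ltac:(lra) : rf / 2 < rf) hf.
have [r r0 he] := e_q_germ q1.
have [[C hC] _] := he.
have hX := psD (ltW r0) he (psZ (-1) (ps_delta0 (ltW r0))).
have {}hX : ps r expm (fun u => e_q q u - 1).
  by apply: ps_ext hX => [n|z _]; rewrite /expm mulN1r.
have [[D hD] _] := hX; have D0 := psb_ge0 hD.
(* Small enough that e_q - 1, which vanishes at 0, keeps its bound below [rf / 2], the radius on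
   which the derivative of Psi is available. *)
pose s := Num.min r (r / (D + 1) * (rf / 4)).
have s1 : 0 < s by rewrite lt_min r0 /= mulr_gt0 ?divr_gt0 //; lra.
have sr : s <= r by rewrite ge_min lexx.
have hs := psb_shrink expm0 (ltW s1) sr r0 hD.
have hb : s / r * D < rf / 2.
  have h : s <= r / (D + 1) * (rf / 4) by rewrite ge_min lexx orbT.
  have D1 : 0 < D + 1 by lra.
  apply: le_lt_trans (_ : r / (D + 1) * (rf / 4) / r * (D + 1) < _).
    by apply: ler_pM => //; [rewrite divr_ge0 // ltW|rewrite ler_pM2r ?invr_gt0|lra].
  have -> : r / (D + 1) * (rf / 4) / r * (D + 1) = rf / 4.
    by field; rewrite !gt_eqF.
  by lra.
exists s => //.
have hc := ps_comp (ltW s1) expm0 hs (ltW hb) hf' (ps_le (ltW s1) sr hX).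
apply: ps_ext hc => // z zs.
rewrite -f'E ?derive1_shift ?[1 + _]addrC ?subrK //.
apply: le_lt_trans hb.
exact: (ps_bound hs (ps_le (ltW s1) sr hX)).
Qed.

(* The convolution is the series of [eta e_q (1 + (e_q - 1) Psi'(e_q))] with
   [eta = u / (e_q u - 1)], that is, of [1 + u F(u)]. *)
Lemma Fq_germ : exists (eta : nat -> K), eta 0%N = 1 /\
  (forall n, conv (fun n => expm n.+1) eta n = delta0 K n) /\
  exists2 r : R, 0 < r & exists2 Fe,
    ps r (fun n => conv (conv eta (eqc q)) (fun n => delta0 K n + conv expm psi1 n) n.+1) Fe &
    forall u, u != 0 -> modC u <= r -> Fq q Psi u = Fe u.
Proof.
have [r1 r10 he1] := e_q_germ q1.
have [r2 r20 hp2] := psi1_germ.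
pose r := Num.min r1 r2.
have r0 : 0 < r by rewrite lt_min r10.
have he : ps r (eqc q) (e_q q) by apply: ps_le he1; [exact: ltW|rewrite ge_min lexx].
have hp : ps r psi1 (fun u => derive1 Psi (e_q q u)).
  by apply: ps_le hp2; [exact: ltW|rewrite ge_min lexx orbT].
have hX : ps r expm (fun u => e_q q u - 1).
  by apply: ps_ext (psD (ltW r0) he (psZ (-1) (ps_delta0 (ltW r0)))) => [n|z _]; rewrite /expm mulN1r.
have hxi := ps_divX r0 expm0 hX.
have [s [eta [s0 sr eta0 heta xin]]] := ps_inv r0 expm1 hxi.
exists eta; split=> //; split.
  apply: (ps_unique s0 _ (ps_delta0 (ltW s0))).
  apply: ps_ext (ps_conv (ltW s0) (ps_le (ltW s0) sr hxi) heta) => // z zs.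
  by rewrite mulfV // xin.
have S0 := ltW s0.
pose hfun u := ((if u == 0 then expm 1 else (e_q q u - 1) / u)^-1 * e_q q u) *
   (1 + (e_q q u - 1) * derive1 Psi (e_q q u)).
pose hc := conv (conv eta (eqc q)) (fun n => delta0 K n + conv expm psi1 n).
have hh : ps s hc hfun.
  apply: (ps_conv S0); first by apply: (ps_conv S0 heta); exact: ps_le he.
  apply: (psD S0); first exact: ps_delta0.
  by apply: (ps_conv S0); exact: ps_le (hX) || exact: ps_le (hp).
have hc0 : hc 0%N - delta0 K 0 = 0.
  rewrite /hc /conv !big_ord_recl !big_ord0 !subn0 !addr0 eta0 eqc0 expm0 mul0r addr0.
  by rewrite /delta0 eqxx !mulr1 subrr.
have hd : ps s (fun n => hc n - delta0 K n) (fun u => hfun u - 1).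
  by apply: ps_ext (psD S0 hh (psZ (-1) (ps_delta0 S0))) => [n|z _]; rewrite mulN1r.
have hF := ps_divX s0 hc0 hd.
exists s => //; exists (fun u => if u == 0 then hc 1%N - delta0 K 1 else (hfun u - 1) / u).
  by apply: ps_ext hF => // n; rewrite /delta0 subr0.
move=> u u0 us; have := xin u us; rewrite /hfun /Fq (negbTE u0).
move: (e_q q u) (derive1 Psi _) => e p h.
have e1 : e - 1 != 0 by apply: contraNneq h => ->; rewrite mul0r.
by field; rewrite u0.
Qed.

(** Off 0 the power of F is a power series, whose value at 0 is the limit defining [Fq_pow_ext]
    there; so the singularity is removable and the derivatives are read off the coefficients. *)
Lemma derive1n_Fq_pow j m (r : R) (c : nat -> K) (Fe : K -> K) : 0 < r -> ps r c Fe ->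
  (forall u, u != 0 -> modC u <= r -> Fq q Psi u = Fe u) ->
  derive1n m (Fq_pow_ext q Psi j) 0 = m`!%:R * pw c j m.
Proof.
move=> r0 hc hF; have r1 := ltW r0.
rewrite -(ps_derive1n m r0 (ps_pw j r1 hc)).
apply: (derive1n_near m r0); last by rewrite modC0.
move=> z zr; rewrite /Fq_pow_ext; case: eqP => [->|/eqP z0]; last by rewrite hF // ltW.
have [B B0 hB] := ps_cont0 r0 (ps_pw j r1 hc).
rewrite (ps0 r1 (ps_pw j r1 hc)); apply: dnbhsK_lim => e e0.
have B1 : 0 < B + 1 by lra.
exists (Num.min r (e / (B + 1))); first by rewrite lt_min r0 divr_gt0.
move=> u u0; rewrite lt_min => /andP[ur ue]; rewrite hF ?ltW //.
apply: le_lt_trans (hB u (ltW ur)) _.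
apply: le_lt_trans (_ : modC u * (B + 1) < _); first by rewrite ler_wpM2l ?modC_ge0 //; lra.
by rewrite -ltr_pdivlMr.
Qed.

Lemma limit_moment_rec : exists C : nat -> K,
  (forall k, (0 < k)%N -> limit_moment q Psi k = C k) /\
  let m n := n.+1%:R * Mlim (psiD (n + n + 2) a) n in
  forall k, k.+1%:R * C k = m k - Q * \sum_(n < k) C (k - n.+1)%N * m n.
Proof.
have [eta [eta0 [xe [r r0 [Fe hFe FE]]]]] := Fq_germ.
set H := conv (conv eta (eqc q)) (fun n => delta0 K n + conv expm psi1 n).
have H0 : H 0%N = 1.
  rewrite /H /conv !big_ord_recl !big_ord0 !subn0 !addr0 eta0 eqc0 expm0 mul0r addr0.
  by rewrite /delta0 eqxx !mulr1.
pose Fc n := H n.+1.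
(* This gives the value 1 at k = 0, needed by the recursion, whereas the sum in [limit_moment] is
   empty there; hence the restriction to positive k in the first clause. *)
exists (fun k => pw H k.+1 k / k.+1%:R).
have lagH P M k : (k < M)%N -> eqX M P (tr M H) -> lag P k = pw H k.+1 k / k.+1%:R.
  move=> kM PH; rewrite /lag; congr (_ / _).
  by rewrite (eqXX k.+1 PH kM) -(tr_pw H k.+1 kM) coef_tr.
split=> [k k0|m k].
  rewrite -(@lagH (1 + 'X * tr k.+1 Fc) k.+1 k (ltnSn k)) ?(lag_pow (@charCC R)) //; last first.
    move=> i ik; rewrite coefD coef1 coefXM [RHS]coef_tr //.
    case: i ik => [|i] ik; first by rewrite addr0 H0.
    by rewrite add0r /= coef_tr // ltnW.
  apply: eq_bigr => i _; have ik := ltn_ord i.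
  rewrite (derive1n_Fq_pow _ _ r0 hFe FE) -/Fc.
  have -> : (tr k.+1 Fc ^+ (k - i))`_i = pw Fc (k - i) i.
    by rewrite -(@tr_pw _ k.+1 Fc (k - i) i) ?coef_tr // ltnW.
  have f0 : (i`!%:R : K) != 0 by rewrite pnatr_eq0 -lt0n fact_gt0.
  rewrite mulrA; congr (_ * _); rewrite -mulrA -[i`!%:R * _ * _]mulrA; congr (_ * _).
  by rewrite [(i`!%:R * _)^-1]invfM mulrAC mulVf ?mul1r.
pose M := k.+1.
pose xi := tr M (fun n => expm n.+1); pose et := tr M eta; pose p := tr M (dseq a).
have Xxi : 'X * xi = tr M.+1 expm.
  apply/polyP => i; rewrite coefXM [RHS]coef_poly; case: i => [|i] /=; first by rewrite expm0.
  by rewrite coef_poly ltnS.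
have eqcE : tr M.+1 (eqc q) = 1 + 'X * xi.
  rewrite Xxi; apply/polyP => i; rewrite coefD !coef_poly coef1; case: ifP => iM.
    by rewrite /expm /delta0 addrC subrK.
  by case: i iM => // i; rewrite addr0.
have trX : eqX M ('X * xi) (tr M expm) by rewrite Xxi; exact: eqX_tr.
have trE : eqX M (1 + 'X * xi) (tr M (eqc q)) by rewrite -eqcE; exact: eqX_tr.
pose h := et * (1 + 'X * xi) * (1 + 'X * xi * (p \Po ('X * xi))).
have hH : eqX M h (tr M H).
  apply: eqX_sym; refine (eqX_trans (tr_conv _ _) _); apply: eqXM.
    refine (eqX_trans (tr_conv _ _) _); apply: eqXMl; exact: eqX_sym.
  have -> : tr M (fun n => delta0 K n + conv expm psi1 n) = tr M (delta0 K) + tr M (conv expm psi1).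
    by apply/polyP => i; rewrite coefD !coef_poly; case: ifP; rewrite ?addr0.
  apply: eqXD; first exact: tr_delta0.
  refine (eqX_trans (tr_conv _ _) _); apply: eqXM; first exact: eqX_sym.
  refine (eqX_trans (tr_comps _ expm0) _); apply: eqX_comp => //; last exact: eqX_sym.
    by rewrite coef_tr // expm0.
  by rewrite coefXM.
have ode : eqX M ((1 - Q *: 'X) * deriv ('X * xi)) (1 + 'X * xi).
  have -> : deriv ('X * xi) = deriv (tr M.+1 (eqc q)) by rewrite eqcE derivD -polyC1 derivC add0r.
  by refine (eqX_trans (@eqc_ode R q M) (eqX_sym _)).
have xieta : eqX M (xi * et) 1.
  move=> i iM; rewrite -(tr_conv _ _ iM) coef_tr // xe coef1 /delta0 //.
have et0 : et`_0 = 1 by rewrite coef_tr.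
have hm n : (n < M)%N -> m n = ((1 + 'X) ^+ n * (1 + 'X * p) ^+ n.+1)`_n.
  move=> nM; rewrite /m (Mlim_closed (@charCC R)).
  have E : eqX n.+1 (deriv (psiD (n + n + 2) a)) p.
    move=> i iN; rewrite coef_deriv coef_poly coef_tr ?(leq_trans iN) //.
    by rewrite ifT /dseq ?mulr_natl //; lia.
  apply: (eqXMl (n := n.+1)) => //; apply: eqXX; apply: eqXD; first exact: eqX_refl.
  exact: eqXMl.
have rec := lag_rec (@charCC R) et0 xieta ode (ltnSn k) hm.
rewrite -(lagH h M) // rec; congr (_ - _ * _); apply: eq_bigr => n _; congr (_ * _).
by apply: (lagH h M) => //; rewrite /M; lia.
Qed.

End LimitMoments.

Theorem theorem16 (R : realType) (q : R) (rho : forall N : nat, signature N -> R)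
    (Psi : CC R -> CC R) :
  -1 <= q <= 1 ->
  (forall N, is_prob (rho N)) ->
  (forall N, sgf_unif_near_one (rho N)) ->
  analytic_at Psi 1 ->
  log_sgf_limit rho Psi ->
  forall k : nat, (0 < k)%N ->
    cvg_in_prob rho (fun N l => ofR (pp_moment q k l)) (limit_moment q Psi k).
Proof.
move=> q1 rhoP unif [ra [ra0 [a ha]]] loglim k k0.
have rho0 N (l : signature N) : 0 <= rho N l := (rhoP N).1 l.
have ha' z : modC z < ra -> cvgK (pss a z) (Psi (1 + z)).
  move=> zr; apply/cvgKP; have z1 : 1 + z - 1 = z by rewrite addrC addKr.
  by have := ha (1 + z); rewrite z1; exact.
have [C [hC recC]] := limit_moment_rec q1 ra0 ha'.
rewrite hC //; apply: (cip_cvg_in_prob rho0).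
have facsum_lim j : cips rho (fun n l => facsum R j l / n.+1%:R ^+ j.+1) (Mlim (psiD (j + j + 2) a) j).
  have h := @facsum_variance R rho Psi rho0 unif loglim j a ra ra0 ha'.
  by apply: chebyshev_cip => [n l|e e0]; [exact: rho0 | exact: (h e e0)].
have h := ppc_cip facsum_lim recC k.
suff : cips rho (fun n l => ofR (pp_moment q k l)) (C k) by [].
by apply: cips_ext h => n l; rewrite pp_moment_ppc.
Qed.
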